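(* Let $(X_t)_{t\ge 0}$ be a regular jump Lévy process in $\mathbf{R}^d$, with transition densities $p(t,x)$, and let $V$ be a confining $X$-Kato class potential with Feynman--Kac semigroup $\{T_t: t\ge0\}$ (all terms as defined in the context). Suppose in addition that there are constants $C_{17}=C_{17}(X)$ and $C_{18}=C_{18}(X)$ such that for every $t>0$ there is $R=R(t)>0$ with $$|\log\nu(x)|\asymp C_{17}\,|\log p(t,x)|\quad\text{and}\quad|\log\nu(x)|\asymp C_{18}\,|\log\mathbf{P}^x(X_t\in B(0,1))|,\qquad |x|>R.$$ (1) If $\{T_t\}$ is GSD (or IUC), then for every $t>0$ and every $\varepsilon\in(0,1]$ $$\lim_{|x|\to\infty}\frac{\sup_{y\in B(x,\varepsilon)}V(y)}{|\log\mathbf{P}^x(X_t\in B(0,1))|}=\lim_{|x|\to\infty}\frac{\sup_{y\in B(x,\varepsilon)}V(y)}{|\log p(t,x)|}=\infty.$$ When in addition there exist $R_0>1$ and a constant $C_{14}=C_{14}(V)$ such that for every $|x|>R_0$, $V(y)\le C_{14}V(x)$ for all $y\in B(x,1)$, then $\sup_{y\in B(x,\varepsilon)}V(y)$ may be replaced by $V(x)$. (2) If there is $t>0$ such that $$\lim_{|x|\to\infty}\frac{V(x)}{|\log\mathbf{P}^x(X_t\in B(0,1))|}=\infty\quad\text{or}\quad\lim_{|x|\to\infty}\frac{V(x)}{|\log p(t,x)|}=\infty,$$ then $\{T_t\}$ is GSD. If, moreover, $p(t,\cdot)$ is bounded for all $t>0$, then either of these two conditions also implies IUC.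
   Context: Conventions. $(X_t)_{t\ge0}$ is a Lévy process in $\mathbf{R}^d$, $d\ge1$; $\mathbf{P}^x,\mathbf{E}^x$ refer to the process started at $x$. $B(x,r)$ is the open ball; $\mathbf{1}$ is the function identically $1$. $C, C_i$ denote positive constants; $C(X,a,\dots)$ depends only on the process (and the dimension $d$) and on the listed parameters. $f\asymp Cg$ means $C^{-1}g\le f\le Cg$. Regular jump Lévy process: a Lévy process satisfying (A1)--(A3). (A1) $(X_t)$ is symmetric, its Lévy measure is absolutely continuous with a strictly positive density $\nu$, and: (1) for every $0<r\le 1/2$ there is $C_1=C_1(X,r)\ge1$ with $\nu(x)\asymp C_1\nu(y)$ for $r\le|y|\le|x|\le|y|+1$; (2) there is $C_2=C_2(X)\ge1$ with $\nu(x)\le C_2\nu(y)$ for $1/2\le|y|\le|x|$; (3) there is $C_3=C_3(X)\ge1$ with $\int_{|z-x|>1/2,\,|z-y|>1/2}\nu(x-z)\nu(z-y)\,dz\le C_3\nu(x-y)$ for $|y-x|\ge1$. (A2) $(X_t)$ is strong Feller, equivalently it has transition densities $p(t,x,y)=p(t,y-x)$ for $t>0$; moreover there are $t_b>0$ and a constant $C(X,t_b)$ with $0<p(t_b,x)\le C(X,t_b)$ for all $x\in\mathbf{R}^d$. (A3) For all $0<p<q<R\le1$, $\sup_{x\in B(0,p)}\sup_{y\in B(0,q)^c}G_{B(0,R)}(x,y)<\infty$, where for a bounded open set $D$, $G_D(x,y)=\int_0^\infty p_D(t,x,y)\,dt$ for $x,y\in D$ (and $0$ otherwise), and $p_D$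 is the transition density of the process killed upon exiting $D$. Potentials. A Borel function $V:\mathbf{R}^d\to\mathbf{R}$ belongs to $\mathcal{K}^X$ if $\lim_{t\to0}\sup_x\mathbf{E}^x[\int_0^t|V(X_s)|ds]=0$, and to $\mathcal{K}^X_{\mathrm{loc}}$ if $V\mathbf{1}_B\in\mathcal{K}^X$ for every ball $B$. $V$ is an $X$-Kato class potential if $V_-\in\mathcal{K}^X$ and $V_+\in\mathcal{K}^X_{\mathrm{loc}}$. It is confining if also $V(x)\to\infty$ as $|x|\to\infty$. Feynman--Kac semigroup: $T_tf(x)=\mathbf{E}^x[e^{-\int_0^tV(X_s)ds}f(X_t)]$, $t>0$. Whenever $(X_t)$ is a regular jump Lévy process and $V$ is a confining $X$-Kato class potential, $\{T_t\}$ is a strongly continuous semigroup of symmetric compact operators on $L^2(\mathbf{R}^d)$; there is an orthonormal basis $\{\varphi_n\}_{n\ge0}$ of $L^2(\mathbf{R}^d)$ with $T_t\varphi_n=e^{-\lambda_nt}\varphi_n$, where $\lambda_0<\lambda_1\le\lambda_2\le\cdots\to\infty$; each $\varphi_n$ is bounded and continuous, and the ground state $\varphi_0$ is chosen strictly positive. With $\widetilde T_tf=\frac{e^{\lambda_0t}}{\varphi_0}T_t(\varphi_0f)$, $\{T_t\}$ is IUC if $\widetilde T_t$ is bounded from $L^2(\mathbf{R}^d,\varphi_0^2dx)$ to $L^\infty(\mathbf{R}^d)$ for every $t>0$. $\{T_t\}$ is GSD if for every $t>0$ there is $C_{12}=C_{12}(X,V,t)$ with $T_t\mathbf{1}(x)\le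 C_{12}\varphi_0(x)$ for all $x\in\mathbf{R}^d$. *)

(* Defs.v *)
From HB Require Import structures.
From mathcomp Require Import all_boot all_order all_algebra.
From mathcomp Require Import all_classical all_reals all_analysis.
From mathcomp Require Import measurable_realfun.

Set Implicit Arguments.
Unset Strict Implicit.
Unset Printing Implicit Defensive.

Import Order.TTheory GRing.Theory Num.Theory.
Import numFieldNormedType.Exports.

Local Open Scope classical_set_scope.
Local Open Scope ring_scope.

(* R^d is 'rV[R]_d.  Its sigma-algebra is generated by the coordinates (as the
   library does for tuples); it is the Borel one, see measurable_rV_borel. *)
Definition measure_rV_display : measure_display. Proof. exact: default_measure_display. Qed.

Section measurable_rV.
Context {R : realType} {n : nat}.

Let coors : 'I_n -> 'rV[R]_n -> R := fun i x => x ord0 i.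

Let rV_set0 : g_sigma_preimage coors set0.
Proof. exact: sigma_algebra0. Qed.

Let rV_setC A : g_sigma_preimage coors A -> g_sigma_preimage coors (~` A).
Proof. exact: sigma_algebraC. Qed.

Let rV_bigcup (F : _^nat) : (forall i, g_sigma_preimage coors (F i)) ->
  g_sigma_preimage coors (\bigcup_i (F i)).
Proof. exact: sigma_algebra_bigcup. Qed.

HB.instance Definition _ := @isMeasurable.Build measure_rV_display
  'rV[R]_n (g_sigma_preimage coors) rV_set0 rV_setC rV_bigcup.

End measurable_rV.

Lemma measurable_coord (R : realType) n (i : 'I_n) :
  measurable_fun [set: 'rV[R]_n] (fun x => x ord0 i).
Proof.
move=> _ Y mY; rewrite setTI; apply: sub_sigma_algebra => /=.
rewrite -bigcup_seq/=; exists i => /=; first by rewrite mem_index_enum.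
by exists Y => //; rewrite setTI.
Qed.

Lemma measurable_fun_rVP d (T : measurableType d) (R : realType) n
    (f : T -> 'rV[R]_n) :
  (forall i, measurable_fun [set: T] (fun x => f x ord0 i)) ->
  measurable_fun [set: T] f.
Proof.
move=> mf _ A mA; rewrite setTI.
suff : g_sigma_preimage (fun i (x : 'rV[R]_n) => x ord0 i) `<=`
    [set B | measurable (f @^-1` B)] by apply.
apply: smallest_sub.
  split => /=.
  - by rewrite preimage_set0.
  - by move=> B mB; rewrite setTD preimage_setC; exact: measurableC.
  - by move=> F mF; rewrite preimage_bigcup; exact: bigcup_measurable.
elim/big_ind : _ => [|B C sB sC|i _]; first exact: sub0set.
- by rewrite subUset; split.
- by move=> _ [B mB <-] /=; rewrite setTI -[X in measurable X]setTI; exact: mf.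
Qed.

Lemma measurable_rV_borel (R : realType) n :
  (@measurable _ 'rV[R]_n) = <<s @open 'rV[R]_n >>.
Proof.
apply/seteqP; split; last first.
  apply: smallest_sub; first exact: sigma_algebra_measurable.
  move=> U oU.
  pose box (q : 'rV[rat]_n) (k : nat) : set 'rV[R]_n :=
    [set y | forall i, `|ratr (q ord0 i) - y ord0 i| < k.+1%:R^-1].
  have mbox q k : measurable (box q k).
    rewrite (_ : box q k = \bigcap_(i in [set: 'I_n])
        ((fun x : 'rV[R]_n => x ord0 i) @^-1`
           (ball (ratr (q ord0 i) : R) k.+1%:R^-1))); last first.
      apply/seteqP; split => y /=; first by move=> yb i _; exact: yb.
      by move=> yb i; exact: yb.
    apply: fin_bigcap_measurable; first exact: finite_finset.
    move=> i _; rewrite -[X in measurable X]setTI; apply: measurable_coord => //.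
    by rewrite ball_itv; exact: measurable_itv.
  rewrite (_ : U = \bigcup_(z in [set z : 'rV[rat]_n * nat |
      box z.1 z.2 `<=` U]) box z.1 z.2); last first.
    apply/seteqP; split => [x Ux|x [z /= zU]]; last exact: zU.
    have /nbhs_ballP[e /= e0 eU] : nbhs x U by rewrite nbhsE; exists U.
    have [k ke] : exists k : nat, k.+1%:R^-1 < e / 2.
      have e20 : 0 < e / 2 by rewrite divr_gt0.
      exists (Num.truncn (e / 2)^-1).
      rewrite invf_plt ?posrE//.
      by rewrite truncnS_gt.
    have qP i : exists q : rat, `|ratr q - x ord0 i| < k.+1%:R^-1.
      have xk : x ord0 i < x ord0 i + k.+1%:R^-1 by rewrite ltrDl invr_gt0.
      have [q] := rat_in_itvoo xk.
      rewrite in_itv/= => /andP[q1 q2]; exists q.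
      by rewrite ger0_norm ?subr_ge0 1?ltW// ltrBlDl.
    pose q : 'rV[rat]_n := \row_i projT1 (cid (qP i)).
    have xq : box q k x by move=> i; rewrite /q mxE; case: cid.
    exists (q, k) => //= y qy; apply: eU; split => // i j.
    rewrite ord1 /ball/=.
    rewrite -(subrKA (ratr (q ord0 j))) (le_lt_trans (ler_normD _ _))//.
    rewrite [ltRHS]splitr ltrD// (lt_trans _ ke)//.
    by rewrite distrC; exact: xq.
  rewrite bigcup_mkcond; apply: countable_bigcupT_measurable => // z.
  by case: ifPn.
apply: smallest_sub; first exact: smallest_sigma_algebra.
elim/big_ind : _ => [|B C sB sC|i _]; first exact: sub0set.
- by rewrite subUset; split.
move=> _ [B mB <-]; rewrite setTI.
have : measurable_fun [set: g_sigma_algebraType (@open 'rV[R]_n)]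
    (fun x : 'rV[R]_n => x ord0 i).
  apply: (measurability _ (RGenOpens.measurableE R)) => _ [_ [a [b ->]] <-].
  rewrite setTI; apply: sub_sigma_algebra; apply: open_comp.
    by move=> x _; exact: coord_continuous.
  exact: (@interval_open R (BRight a) (BLeft b)).
by move=> /(_ measurableT _ mB); rewrite setTI.
Qed.

Section cons_rV.
Context {R : realType} {n : nat}.

Definition cons_rV (z : R * 'rV[R]_n) : 'rV[R]_n.+1 :=
  row_mx (z.1%:M : 'rV_1) z.2.

Definition uncons_rV (x : 'rV[R]_n.+1) : R * 'rV[R]_n :=
  (x ord0 ord0, \row_i x ord0 (lift ord0 i)).

Lemma cons_rVK : cancel cons_rV uncons_rV.
Proof.
move=> [a v]; rewrite /uncons_rV /cons_rV /=; congr pair.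
  rewrite mxE; case: splitP => // j _.
  by rewrite !mxE !ord1.
apply/rowP => i; rewrite mxE mxE; case: splitP => [j|k].
  by rewrite lift0 => /= ji; have := ltn_ord j; rewrite -ji.
by rewrite lift0 add1n => -[] /val_inj ->.
Qed.

Lemma measurable_cons_rV : measurable_fun [set: R * 'rV[R]_n] cons_rV.
Proof.
apply: measurable_fun_rVP => i; case: (split_ordP (i : 'I_(1 + n))) => j ->.
  rewrite (_ : (fun z => _) = fst); first exact: measurable_fst.
  by apply/funext => z; rewrite /cons_rV (row_mxEl _ _ _ j) !mxE !ord1.
rewrite (_ : (fun z => _) = (fun x : 'rV[R]_n => x ord0 j) \o snd).
  exact: (measurableT_comp (measurable_coord j) measurable_snd).
by apply/funext => z; exact: row_mxEr.
Qed.

Lemma measurable_uncons_rV : measurable_fun [set: 'rV[R]_n.+1] uncons_rV.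
Proof.
apply: measurable_fun_pair; first exact: measurable_coord.
apply: measurable_fun_rVP => i; under eq_fun do rewrite mxE.
exact: measurable_coord.
Qed.

Variable mu : {sigma_finite_measure set 'rV[R]_n -> \bar R}.

Definition lebesgue_rVS : set 'rV[R]_n.+1 -> \bar R :=
  pushforward ((@lebesgue_measure R \x mu)%E) cons_rV.

Let lebesgue_rVS0 : lebesgue_rVS set0 = 0%E.
Proof. by rewrite /lebesgue_rVS /pushforward preimage_set0 measure0. Qed.

Let lebesgue_rVS_ge0 A : (0 <= lebesgue_rVS A)%E.
Proof. by rewrite /lebesgue_rVS /pushforward measure_ge0. Qed.

Let lebesgue_rVS_sigma_additive : semi_sigma_additive lebesgue_rVS.
Proof.
move=> F mF tF mUF; rewrite /lebesgue_rVS /pushforward preimage_bigcup.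
apply: measure_semi_sigma_additive.
- by move=> k; rewrite -[X in measurable X]setTI; exact: measurable_cons_rV.
- apply/trivIsetP => /= i j _ _ ij; rewrite -preimage_setI.
  by move/trivIsetP : tF => /(_ _ _ _ _ ij) ->//; rewrite preimage_set0.
- by rewrite -preimage_bigcup -[X in measurable X]setTI;
    exact: measurable_cons_rV.
Qed.

HB.instance Definition _ := isMeasure.Build _ _ _ lebesgue_rVS
  lebesgue_rVS0 lebesgue_rVS_ge0 lebesgue_rVS_sigma_additive.

Let sigma_finite_lebesgue_rVS : sigma_finite setT lebesgue_rVS.
Proof.
have /sigma_finiteP[F [TF ndF Foo]] := sigma_finiteT (@lebesgue_measure R).
have /sigma_finiteP[G [TG ndG Goo]] := sigma_finiteT mu.
exists (fun k => uncons_rV @^-1` (F k `*` G k)).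
  apply/esym/seteqP; split => // x _.
  have [[k _ Fk] [l _ Gl]] : (\bigcup_k F k) (uncons_rV x).1 /\
      (\bigcup_k G k) (uncons_rV x).2 by rewrite -TF -TG.
  exists (maxn k l) => //; split => /=.
  - by move: Fk; exact/subsetPset/ndF/leq_maxl.
  - by move: Gl; exact/subsetPset/ndG/leq_maxr.
move=> k; have [mF Fk] := Foo k; have [mG Gk] := Goo k; split.
  rewrite -[X in measurable X]setTI; apply: measurable_uncons_rV => //.
  exact: measurableX.
rewrite /lebesgue_rVS /pushforward -comp_preimage.
rewrite (_ : uncons_rV \o cons_rV = id); last first.
  by apply/funext => z /=; rewrite cons_rVK.
by rewrite preimage_id product_measure1E// lte_mul_pinfty// ge0_fin_numE.
Qed.

HB.instance Definition _ := Measure_isSigmaFinite.Build _ _ _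
  lebesgue_rVS sigma_finite_lebesgue_rVS.

End cons_rV.

Fixpoint lebesgue_rV (R : realType) (n : nat) :
    {sigma_finite_measure set 'rV[R]_n -> \bar R} :=
  match n with
  | 0 => @dirac _ _ (0 : 'rV[R]_0) R
  | m.+1 => lebesgue_rVS (lebesgue_rV R m)
  end.

Lemma lebesgue_rV_box (R : realType) (n : nat) (A : 'I_n -> set R) :
  (forall i, measurable (A i)) ->
  lebesgue_rV R n [set x | forall i, A i (x ord0 i)] =
  (\prod_(i < n) lebesgue_measure (A i))%E.
Proof.
elim: n A => [|n ih] A mA /=.
  by rewrite big_ord0 diracE mem_set// => -[].
rewrite big_ord_recl -ih; last by move=> i; exact: mA.
have mB : measurable
    [set x : 'rV[R]_n | forall i, A (lift ord0 i) (x ord0 i)].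
  rewrite (_ : [set _ | _] = \bigcap_(i in [set: 'I_n])
      ((fun x : 'rV[R]_n => x ord0 i) @^-1` A (lift ord0 i))); last first.
    by apply/seteqP; split => [x xA i _|x xA i]; exact: xA.
  apply: fin_bigcap_measurable; first exact: finite_finset.
  by move=> i _; rewrite -[X in measurable X]setTI; exact: measurable_coord.
rewrite /lebesgue_rVS /pushforward -product_measure1E; [|exact: mA|exact: mB].
congr (_ _); apply/seteqP; split => [[a v]|[a v]].
  move=> /= H; split => [|i] /=.
    by have /(congr1 fst) /= <- := cons_rVK (a, v); exact: H.
  have /(congr1 (fun z : R * 'rV[R]_n => z.2 ord0 i)) := cons_rVK (a, v).
  by rewrite /= mxE => <-; exact: H.
move=> /= [H1 H2] i; have [j ->|->] := unliftP ord0 i; last first.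
  by have /(congr1 fst) /= -> := cons_rVK (a, v).
have /(congr1 (fun z : R * 'rV[R]_n => z.2 ord0 j)) := cons_rVK (a, v).
by rewrite /= mxE => ->; exact: H2.
Qed.

Section euclid.
Context {R : realType} {d : nat}.
Implicit Types x y a : 'rV[R]_d.

Definition dot x y : R := \sum_(i < d) x ord0 i * y ord0 i.

(* The library's norm and balls on 'rV[R]_d are those of the sup norm. *)
Definition enorm x : R := Num.sqrt (dot x x).

Definition eball a (r : R) : set 'rV[R]_d := [set y | enorm (y - a) < r].

(* The filter of |x| --> oo. *)
Definition infty_rV : set_system 'rV[R]_d :=
  [set A | exists r : R, forall x, r < enorm x -> A x].

Global Instance infty_rV_filter : Filter infty_rV.
Proof.
split.
- by exists 0.
- move=> A B [r Ar] [s Bs]; exists (Num.max r s) => x.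
  by rewrite gt_max => /andP[rx sx]; split; [exact: Ar|exact: Bs].
- by move=> A B AB [r Ar]; exists r => x /Ar /AB.
Qed.

End euclid.

Section levy.
Local Open Scope ereal_scope.
Context {R : realType} {d : nat} {dO : measure_display}
  {Omega : measurableType dO} (P : probability Omega R)
  (X : R -> Omega -> 'rV[R]_d).

Record levy_process : Prop := LevyProcess {
  levy_measurable : forall t, (0 <= t)%R -> measurable_fun setT (X t) ;
  levy_start : P [set w | X 0%R w = 0%R] = 1 ;
  levy_indep : forall (n : nat) (t : nat -> R) (A : nat -> set 'rV[R]_d),
    (0 <= t 0%N)%R -> (forall i, (t i <= t i.+1)%R) ->
    (forall i, measurable (A i)) ->
    P [set w | forall i, (i < n)%N -> A i (X (t i.+1) w - X (t i) w)%R] =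
    \prod_(i < n) P [set w | A i (X (t i.+1) w - X (t i) w)%R] ;
  levy_stationary : forall (s t : R) (A : set 'rV[R]_d),
    (0 <= s)%R -> (0 <= t)%R -> measurable A ->
    P [set w | A (X (s + t)%R w - X s w)%R] = P [set w | A (X t w)] ;
  levy_rcont : forall w t, (0 <= t)%R -> X s w @[s --> t^'+] --> X t w ;
  levy_llim : forall w t, (0 < t)%R ->
    exists l : 'rV[R]_d, X s w @[s --> t^'-] --> l }.

Definition symmetric_process : Prop := forall (t : R) (A : set 'rV[R]_d),
  (0 <= t)%R -> measurable A ->
  P [set w | A (X t w)] = P [set w | A (- X t w)%R].

(* Real and imaginary parts of the Levy-Khintchine exponent
   i <b, xi> - <xi, S xi> / 2
     + \int (e^{i <xi, z>} - 1 - i <xi, z> 1_{|z| < 1}) m(dz). *)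
Definition levy_exponent_re (S : 'M[R]_d)
    (m : {measure set 'rV[R]_d -> \bar R}) (xi : 'rV[R]_d) : R :=
  (\int[m]_z (cos (dot xi z) - 1) - dot xi (xi *m S) / 2)%R.

Definition levy_exponent_im (b : 'rV[R]_d)
    (m : {measure set 'rV[R]_d -> \bar R}) (xi : 'rV[R]_d) : R :=
  (dot b xi +
    \int[m]_z (sin (dot xi z) - dot xi z * \1_(eball 0 1) z))%R.

(* m is the Levy measure of X: the jump part of its Levy-Khintchine triplet.
   The last clause is E[e^{i <xi, X_t>}] = e^{t (re + i im)}. *)
Definition is_levy_measure (m : {measure set 'rV[R]_d -> \bar R}) : Prop :=
  exists (b : 'rV[R]_d) (S : 'M[R]_d),
  [/\ S^T%R = S /\ (forall xi : 'rV[R]_d, (0 <= dot xi (xi *m S))%R),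
      m [set 0%R] = 0,
      \int[m]_z (Num.min 1 (enorm z ^+ 2)%R)%:E < +oo
    & forall (t : R) (xi : 'rV[R]_d), (0 <= t)%R ->
      let re := levy_exponent_re S m xi in
      let im := levy_exponent_im b m xi in
      (\int[P]_w cos (dot xi (X t w)) = expR (t * re) * cos (t * im))%R /\
      (\int[P]_w sin (dot xi (X t w)) = expR (t * re) * sin (t * im))%R].

(* Under P^x the process is x + X. *)
Definition law_from (x : 'rV[R]_d) (t : R) (A : set 'rV[R]_d) : \bar R :=
  P [set w | A (x + X t w)%R].

(* The values are extended reals because a transition density may be infinite
   at some points (e.g. p(t,0) for small t). *)
Definition is_transition_density (p : R -> 'rV[R]_d -> \bar R) : Prop :=
  forall t, (0 < t)%R ->
  [/\ measurable_fun setT (p t), forall x, 0 <= p t x &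
      forall x (A : set 'rV[R]_d), measurable A ->
      law_from x t A = \int[lebesgue_rV R d]_(y in A) p t (y - x)%R].

Definition exit_time (D : set 'rV[R]_d) (x : 'rV[R]_d) (w : Omega) : \bar R :=
  ereal_inf [set s%:E | s in [set s : R | (0 <= s)%R /\ ~ D (x + X s w)%R]].

(* P^x(X_t \in A, t < tau_D), as the integral of an indicator: {t < tau_D} is
   in general only measurable for the completion of P, and the integral is
   then still its probability. *)
Definition killed_law (D : set 'rV[R]_d) (x : 'rV[R]_d) (t : R)
    (A : set 'rV[R]_d) : \bar R :=
  \int[P]_w (\1_[set v | A (x + X t v)%R /\ (t%:E < exit_time D x v)%E] w)%:E.

(* Symmetry and the Chapman-Kolmogorov identity at all points single out one
   version of the density, so that pointwise suprema are meaningful. *)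
Record is_killed_density (D : set 'rV[R]_d)
    (pD : R -> 'rV[R]_d -> 'rV[R]_d -> \bar R) : Prop := KilledDensity {
  killed_measurable :
    measurable_fun
      [set z : R * ('rV[R]_d * 'rV[R]_d) |
        [/\ (0 < z.1)%R, D z.2.1 & D z.2.2]]
      (fun z => pD z.1 z.2.1 z.2.2) ;
  killed_ge0 : forall t x y, (0 < t)%R -> D x -> D y -> 0 <= pD t x y ;
  killed_lawE : forall t x (A : set 'rV[R]_d), (0 < t)%R -> D x ->
    measurable A -> A `<=` D ->
    killed_law D x t A = \int[lebesgue_rV R d]_(y in A) pD t x y ;
  killed_sym : forall t x y, (0 < t)%R -> D x -> D y -> pD t x y = pD t y x ;
  killed_CK : forall s t x y, (0 < s)%R -> (0 < t)%R -> D x -> D y ->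
    pD (s + t)%R x y =
    \int[lebesgue_rV R d]_(z in D) (pD s x z * pD t z y) }.

Definition green (D : set 'rV[R]_d)
    (pD : R -> 'rV[R]_d -> 'rV[R]_d -> \bar R) (x y : 'rV[R]_d) : \bar R :=
  if `[< D x /\ D y >]
  then \int[lebesgue_measure]_(t in `]0%R, +oo[%classic) pD t x y else 0.

Record assumption_A1 (nu : 'rV[R]_d -> R) : Prop := AssumptionA1 {
  A1_symmetric : symmetric_process ;
  A1_pos : forall x, x != 0%R -> (0 < nu x)%R ;
  A1_measurable : measurable_fun setT nu ;
  A1_density : exists2 m : {measure set 'rV[R]_d -> \bar R},
    is_levy_measure m &
    forall A, measurable A -> m A = \int[lebesgue_rV R d]_(x in A) (nu x)%:E ;
  A1_local : forall r, (0 < r <= 2^-1)%R ->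
    exists2 C1 : R, (1 <= C1)%R & forall x y,
      (r <= enorm y <= enorm x)%R -> (enorm x <= enorm y + 1)%R ->
      (C1^-1 * nu y <= nu x <= C1 * nu y)%R ;
  A1_decay : exists2 C2 : R, (1 <= C2)%R & forall x y,
    (2^-1 <= enorm y <= enorm x)%R -> (nu x <= C2 * nu y)%R ;
  A1_convolution : exists2 C3 : R, (1 <= C3)%R & forall x y,
    (1 <= enorm (y - x))%R ->
    \int[lebesgue_rV R d]_(z in
       [set z | (2^-1 < enorm (z - x))%R /\ (2^-1 < enorm (z - y))%R])
       (nu (x - z) * nu (z - y))%:E <= (C3 * nu (x - y))%:E }.

Definition assumption_A2 (p : R -> 'rV[R]_d -> \bar R) : Prop :=
  is_transition_density p /\
  exists tb C : R, (0 < tb)%R /\ forall x, 0 < p tb x <= C%:E.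

Definition assumption_A3 : Prop := forall r1 r2 r3 : R,
  (0 < r1)%R -> (r1 < r2)%R -> (r2 < r3)%R -> (r3 <= 1)%R ->
  exists2 pD, is_killed_density (eball 0 r3) pD &
  ereal_sup [set green (eball 0 r3) pD xy.1 xy.2 |
             xy in eball 0 r1 `*` ~` eball 0 r2] < +oo.

(* nu is the density of the Levy measure, p the transition density. *)
Record regular_jump_levy (nu : 'rV[R]_d -> R) (p : R -> 'rV[R]_d -> \bar R)
    : Prop := RegularJumpLevy {
  regular_levy : levy_process ;
  regular_A1 : assumption_A1 nu ;
  regular_A2 : assumption_A2 p ;
  regular_A3 : assumption_A3 }.

Definition kato (V : 'rV[R]_d -> R) : Prop :=
  measurable_fun setT V /\
  ereal_sup (range (fun x : 'rV[R]_d =>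
    \int[P]_w \int[lebesgue_measure]_(s in `[0%R, t]%classic)
      `|V (x + X s w)%R|%:E)) @[t --> 0%R^'+] --> 0.

Definition kato_loc (V : 'rV[R]_d -> R) : Prop :=
  measurable_fun setT V /\
  forall (a : 'rV[R]_d) (r : R), (0 < r)%R ->
    kato (fun x => V x * \1_(eball a r) x)%R.

Definition kato_potential (V : 'rV[R]_d -> R) : Prop :=
  [/\ measurable_fun setT V, kato (V^\-)%R & kato_loc (V^\+)%R].

Definition confining_kato_potential (V : 'rV[R]_d -> R) : Prop :=
  kato_potential V /\ (V x @[x --> infty_rV] --> +oo%R).

(* T_t f(x); the inner integral is finite almost surely when V is an X-Kato
   class potential. *)
Definition feynman_kac (V : 'rV[R]_d -> R) (t : R) (f : 'rV[R]_d -> R)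
    (x : 'rV[R]_d) : \bar R :=
  \int[P]_w
    (expeR (- \int[lebesgue_measure]_(s in `[0%R, t]%classic)
                (V (x + X s w)%R)%:E)
     * (f (x + X t w)%R)%:E).

(* lam and phi are the eigenvalues and the eigenfunctions of the semigroup,
   phi 0 being its ground state. *)
Record feynman_kac_eigenbasis (V : 'rV[R]_d -> R)
    (lam : nat -> R) (phi : nat -> 'rV[R]_d -> R) : Prop :=
    FeynmanKacEigenbasis {
  eigen_continuous : forall n, continuous (phi n) ;
  eigen_bounded : forall n, exists M : R, forall x, (`|phi n x| <= M)%R ;
  eigen_orthonormal : forall m n,
    \int[lebesgue_rV R d]_x (phi m x * phi n x)%:E = (m == n)%:R%:E ;
  eigen_complete : forall f : 'rV[R]_d -> R, measurable_fun setT f ->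
    \int[lebesgue_rV R d]_x ((f x) ^+ 2)%:E < +oo ->
    \int[lebesgue_rV R d]_x ((f x - \sum_(0 <= k < n)
      (\int[lebesgue_rV R d]_y (f y * phi k y)) * phi k x) ^+ 2)%:E
      @[n --> \oo] --> 0 ;
  eigen_eq : forall n t, (0 < t)%R ->
    {ae lebesgue_rV R d, forall x,
      feynman_kac V t (phi n) x = (expR (- lam n * t) * phi n x)%:E} ;
  eigen_gap : (lam 0 < lam 1)%R ;
  eigen_nondecreasing : forall n, (lam n <= lam n.+1)%R ;
  eigen_cvg : lam n @[n --> \oo] --> +oo%R ;
  ground_state_gt0 : forall x, (0 < phi 0%N x)%R }.

Definition intrinsic_semigroup (V : 'rV[R]_d -> R) (lam0 : R)
    (phi0 : 'rV[R]_d -> R) (t : R) (f : 'rV[R]_d -> R) (x : 'rV[R]_d)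
    : \bar R :=
  (expR (lam0 * t) / phi0 x)%:E *
  feynman_kac V t (fun y => phi0 y * f y)%R x.

Definition IUC (V : 'rV[R]_d -> R) (lam0 : R) (phi0 : 'rV[R]_d -> R) : Prop :=
  forall t, (0 < t)%R -> exists C : R, forall f : 'rV[R]_d -> R,
    measurable_fun setT f ->
    \int[lebesgue_rV R d]_x (f x ^+ 2 * phi0 x ^+ 2)%:E < +oo ->
    'N[lebesgue_rV R d]_+oo[intrinsic_semigroup V lam0 phi0 t f] <=
    C%:E * (\int[lebesgue_rV R d]_x (f x ^+ 2 * phi0 x ^+ 2)%:E) `^ 2^-1.

Definition GSD (V : 'rV[R]_d -> R) (phi0 : 'rV[R]_d -> R) : Prop :=
  forall t, (0 < t)%R -> exists2 C : R, (0 < C)%R &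
    forall x, feynman_kac V t (cst 1%R) x <= (C * phi0 x)%:E.

End levy.

(* C^-1 g <= f <= C g. *)
Definition asymp_by {R : realType} (C : R) (f g : \bar R) : Prop :=
  ((C^-1)%:E * g <= f <= C%:E * g)%E.

(* lne is the logarithm with log 0 = -oo (the real-valued ln has ln 0 = 0). *)
Definition abs_log {R : realType} (y : \bar R) : \bar R := (`|lne y|)%E.

Definition sup_ball {R : realType} {d : nat} (V : 'rV[R]_d -> R) (eps : R)
    (x : 'rV[R]_d) : \bar R :=
  ereal_sup [set (V y)%:E | y in eball x eps].

(* Main.v *)
(* Write kappa = nu outside the unit ball and kappa = 1 inside, and Q_t for the
   free semigroup. The convolution bound (A1)(3) gives kappa * kappa <= C kappa. A
   smooth bump chi at the origin satisfies Dynkin's formula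
   Q_t chi = chi + \int_0^t Q_s F with |F| <= C kappa and F >= c kappa away from the
   origin: this is immediate for trigonometric polynomials from the
   Levy-Khintchine exponent, and passes to chi by approximation. Convolving with
   kappa yields Q_t kappa comparable to kappa, uniformly on bounded time intervals.

   A potential-theoretic domination principle transfers this to the Feynman-Kac
   semigroup: if u is nearly invariant and bounded below on {W > 0}, then
   \int_0^t T_s W ds <= C u as soon as the left-hand side is bounded.

   (1) Since V >= M - W with W supported in a ball, iterating the eigen equation
   gives phi_0 <= C kappa. On the other hand T_t 1_B >= e^(- t sup_B V) / 2 near the
   centre of a ball B, for t small, because the paths stay in B with probability
   at least 1/2. Hence GSD or IUC forces t sup_B V >= |log nu| - C_t for every t.

   (2) If V / |log nu| tends to infinity, Jensen's inequality along the path gives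
   T_s 1 <= C kappa for every s > 0, and therefore T_(2s) 1 <= C T_u kappa for
   0 <= u <= s. Dynkin's formula for the bump, killed at rate V_+, gives
   \int_0^s T_u kappa du <= C phi_0 by domination with u = phi_0. This is GSD; if
   the densities are bounded, Cauchy-Schwarz bounds T_s from L^2 to L^infinity,
   so that |T_(t + s) h| <= C |h|_2 T_t 1 <= C' |h|_2 phi_0, which is IUC. *)

Require Import Defs.
From HB Require Import structures.
From mathcomp Require Import all_boot all_order all_algebra.
From mathcomp Require Import all_classical all_reals all_analysis.
From mathcomp Require Import measurable_realfun ring lra.

Set Implicit Arguments.
Unset Strict Implicit.
Unset Printing Implicit Defensive.

Import Order.TTheory GRing.Theory Num.Theory.
Import numFieldNormedType.Exports.

Local Open Scope classical_set_scope.
Local Open Scope ring_scope.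

(** * Time integrals and their exponentials *)

(** The semigroups are kept nonnegative: in [fk a b] the killing rate a and the gain rate b sit in
    separate exponential factors, so its values in [0, +oo] obey Tonelli's theorem and no
    integrability has to be carried along.

    Two obstacles shape the proof. The weights depend on whole paths, whereas a Levy process is
    given by finitely many increments at a time; hence a space of paths observed at dyadic times,
    where the Markov property is inherited from cylinders. And the Levy-Khintchine formula yields
    Dynkin's formula for the waves cos(<xi, x> + th) only. To reach a compactly supported bump,
    polynomials are applied to the trigonometric sum 4 L^2 sum_i sin^2(x_i / (2 L)), which tends to
    |x|^2. Along each limit the second differences stay below a fixed multiple of min(1, |z|^2),
    which is what the Levy measure integrates.

    All estimates compare V with |log nu|; the ratios of the statement are translated to and from
    this at the very end. Since GSD and IUC are conditions for every t, the time in part (1) may be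
    chosen small in terms of the growth rate to be proved. *)

Section time_integrals.
Local Open Scope ereal_scope.
Context {R : realType}.
Notation mu := (@lebesgue_measure R).
Implicit Types (f : R -> \bar R) (r s t : R).

(** Translation invariance: the image of Lebesgue measure under the shift agrees with it on
    half-open intervals, hence everywhere, and the claim is an integral against a push-forward. *)
Lemma ge0_integral_shift (A : set R) f r : measurable A ->
  measurable_fun setT f -> (forall u, 0 <= f u) ->
  \int[mu]_(u in A) f u = \int[mu]_(u in [set u | A (r + u)%R]) f (r + u)%R.
Proof.
move=> mA mf f0.
pose T (u : measurableTypeR R) : measurableTypeR R := (r + u)%R.
have mT : measurable_fun [set: measurableTypeR R] T by exact: measurable_funD.
have E B : measurable B -> pushforward mu T B = mu B.
  move=> mB; apply/esym/lebesgue_measure_unique => //= _ [[a b]] _ <-.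
  rewrite /pushforward (_ : T @^-1` _ = `](a - r)%R, (b - r)%R]%classic); last first.
    by apply/seteqP; split => u; rewrite /T /= !in_itv/= lerBrDl ltrBlDl.
  rewrite !lebesgue_measure_itv/= !lte_fin ltrD2r; case: ifPn => // _.
  by rewrite -!EFinB; congr EFin; ring.
rewrite (_ : [set u | _] = T @^-1` A)//.
rewrite -(@ge0_integral_pushforward _ _ _ _ R T mT mu A f)//; last first.
  exact: measurable_funS mf.
by apply: eq_measure_integral => B mB BA; exact/esym/E.
Qed.

Lemma ge0_integral_itvD f r s : (0 <= r)%R -> (0 <= s)%R ->
  measurable_fun setT f -> (forall u, 0 <= f u) ->
  \int[mu]_(u in `[0%R, (r + s)%R]) f u =
  \int[mu]_(u in `[0%R, r]) f u + \int[mu]_(u in `[0%R, s]) f (r + u)%R.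
Proof.
move=> r0 s0 mf f0.
have -> : `[0%R, (r + s)%R]%classic = `[0%R, r]%classic `|` `]r, (r + s)%R]%classic.
  apply/seteqP; split => u /=; rewrite !in_itv/=.
    move=> /andP[u0 us]; case: (lerP u r) => ur; [left|right]; apply/andP => //.
  by move=> [/andP[u0 ur]|/andP[ur us]]; apply/andP; split => //; lra.
rewrite ge0_integral_setU//.
- congr (_ + _); rewrite integral_itv_obnd_cbnd; last exact: measurable_funS mf.
  rewrite (ge0_integral_shift r)//; congr integral; apply/seteqP; split => u;
    rewrite /= !in_itv/= => /andP[? ?]; apply/andP; split; lra.
- exact: measurable_funS mf.
- rewrite disj_set2E; apply/eqP/seteqP; split => u //=; rewrite !in_itv/=.
  by move=> [/andP[? ?] /andP[? ?]]; lra.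
Qed.

Lemma measurable_itv_fun d (Z : measurableType d) (h : Z * R -> \bar R) :
  measurable_fun setT h ->
  measurable_fun setT (fun z : (R * Z) * R =>
    (if (0 <= z.2 <= z.1.1)%R then h (z.1.2, z.2) else 0)).
Proof.
move=> mh; apply: measurable_fun_if => //.
- apply: measurable_and.
    by apply: measurable_fun_ler => //; exact: measurable_snd.
  apply: measurable_fun_ler; first exact: measurable_snd.
  by apply: measurableT_comp => //; exact: measurable_fst.
- apply: measurable_funTS; apply: measurableT_comp => //.
  apply: measurable_fun_pair => //.
  by apply: measurableT_comp => //; exact: measurable_snd.
Qed.

Lemma integral_itvE f t : \int[mu]_(u in `[0%R, t]) f u =
  \int[mu]_u (if (0 <= u <= t)%R then f u else 0).
Proof.
rewrite integral_mkcond; apply: eq_integral => u _.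
rewrite /patch; case: ifPn => [|].
  by rewrite inE/= in_itv/= => ->.
by rewrite notin_setE/= in_itv/=; case: ifP.
Qed.

(** The variable interval is absorbed into the integrand, so that measurability in the end point and
    the parameter together is Tonelli's theorem over the whole line. *)
Lemma measurable_integral_itv d (Z : measurableType d) (h : Z * R -> \bar R) :
  measurable_fun setT h -> (forall z, 0 <= h z) ->
  measurable_fun setT (fun z : R * Z =>
    \int[mu]_(u in `[0%R, z.1]) h (z.2, u)).
Proof.
move=> mh h0.
under eq_fun do rewrite integral_itvE.
apply: (@measurable_fun_fubini_tonelli_F _ _ _ _ _ mu
  (fun z : (R * Z) * R => if (0 <= z.2 <= z.1.1)%R then h (z.1.2, z.2) else 0)).
  exact: measurable_itv_fun.
by move=> z; case: ifP.
Qed.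

(** Tonelli's theorem on the triangle 0 <= r <= s <= t, followed by the substitution s = r + q.
    Integrated over time, a Duhamel formula thereby becomes a restart at r with remaining time t -
    r. *)
Lemma ge0_integral_triangle (h : R * R -> \bar R) t :
  measurable_fun setT h -> (forall z, 0 <= h z) ->
  \int[mu]_(s in `[0%R, t]) \int[mu]_(r in `[0%R, s]) h (r, s) =
  \int[mu]_(r in `[0%R, t]) \int[mu]_(q in `[0%R, (t - r)%R]) h (r, (r + q)%R).
Proof.
move=> mh h0.
pose k (z : R * R) := if ((0 <= z.1) && (z.1 <= z.2) && (z.2 <= t))%R then h z else 0.
have mk : measurable_fun setT k.
  apply: measurable_fun_if => //.
    apply: measurable_and; [apply: measurable_and|]; apply: measurable_fun_ler => //.
  exact: measurable_funTS.
transitivity (\int[mu]_s \int[mu]_r k (r, s)).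
  rewrite integral_itvE; apply: eq_integral => s _; case: ifPn => [/andP[s0 st]|sN].
    by rewrite integral_itvE; apply: eq_integral => r _; rewrite /k/= st andbT.
  rewrite integral0_eq// => r _; rewrite /k/=; case: ifP => // /andP[/andP[r0 rs] st].
  by move: sN; rewrite st (le_trans r0 rs).
transitivity (\int[mu]_r \int[mu]_s k (r, s)).
  apply/esym/(@fubini_tonelli _ _ _ _ _ mu mu k) => //.
  by move=> z; rewrite /k; case: ifP.
rewrite [RHS]integral_itvE; apply: eq_integral => r _; case: ifPn => [/andP[r0 rt]|rN].
  rewrite (@ge0_integral_shift setT _ r)//; last first.
  - by move=> u; rewrite /k; case: ifP.
  - exact: (measurableT_comp mk (pair1_measurable r)).
  rewrite integral_itvE (_ : [set _ | _] = setT); last by apply/seteqP.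
  apply: eq_integral => q _; rewrite /k/= r0/=.
  by rewrite lerDl lerBrDl.
rewrite integral0_eq// => s _; rewrite /k/=; case: ifP => // /andP[/andP[r0 rs] st].
by move: rN; rewrite r0 (le_trans rs st).
Qed.

End time_integrals.

Section exponential_functional.
Local Open Scope ereal_scope.
Context {R : realType}.
Notation mu := (@lebesgue_measure R).

Lemma integral_itv_cst (c t : R) : (0 <= t)%R ->
  \int[mu]_(u in `[0%R, t]) c%:E = (c * t)%:E.
Proof.
move=> t0; rewrite (@integral_cst _ _ _ mu _ (measurable_itv _) c%:E)/=.
rewrite lebesgue_measure_itv/= lte_fin.
case: ltP => t0'; first by rewrite oppr0 adde0.
by rewrite (_ : t = 0%R) ?mulr0 ?mule0//; apply/le_anti/andP.
Qed.

Lemma measurable_expeR : measurable_fun [set: \bar R] (@expeR R).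
Proof.
rewrite (_ : expeR = fun x => if x == -oo then 0 else if x == +oo then +oo
    else (expR (fine x))%:E); last by apply/funext => -[].
have me (c : \bar R) : measurable_fun [set: \bar R] (fun x => x == c).
  by apply: measurable_fun_eqe => //.
apply: measurable_fun_if => //; apply: measurable_funTS.
apply: measurable_fun_if => //; apply: measurable_funTS.
apply/measurable_EFinP; by apply: measurableT_comp.
Qed.

Lemma cvg_expeR (u : (\bar R)^nat) l : u n @[n --> \oo] --> l ->
  expeR (u n) @[n --> \oo] --> expeR l.
Proof.
case: l => [l| |] /=.
- move/fine_cvgP => [ufin ul].
  apply: cvg_trans (_ : (expR (fine (u n)))%:E @[n --> \oo] --> _).
    apply: near_eq_cvg; near=> n.
    by have /fineK <- : u n \is a fin_num by near: n.
  apply: cvg_EFin; first exact: nearW.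
  exact: (cvg_comp _ _ ul (@continuous_expR R l)).
- move/cvgeyPge => h; apply/cvgeyPge => A; have := h A; apply: filterS => n.
  by move=> An; apply: le_trans (expeR_ge1Dx _); rewrite (le_trans An)// leeDr.
- move/cvgeNyPle => h; apply/fine_cvgP; split.
    have := h 0%R; apply: filterS => n un; rewrite ge0_fin_numE ?expeR_ge0//.
    by apply: (@le_lt_trans _ _ (expeR 0%:E)); rewrite ?lee_expeR// expeR0 ltry.
  apply/cvgrPdist_le => e e0; have := h (ln e); apply: filterS => n un.
  rewrite sub0r normrN ger0_norm; last by rewrite fine_ge0// expeR_ge0.
  have := un; rewrite -lee_expeR/= lnK ?posrE//.
  by have := expeR_ge0 (u n); case: (expeR (u n)) => //= r _; rewrite lee_fin.
Unshelve. all: by end_near. Qed.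

(** Cutting [0, t] into n + 1 equal pieces telescopes the total increment into a sum of at most K
    t^2 / (n + 1). *)
Lemma eq_of_quadratic_increments (D : R -> R) (K t : R) : (0 <= t)%R ->
  (forall r s, 0 <= r -> r <= s -> s <= t -> `|D s - D r| <= K * (s - r) ^+ 2)%R ->
  D t = D 0%R.
Proof.
move=> t0 H; apply/eqP; rewrite -subr_eq0 -normr_le0.
suff H1 n : (`|D t - D 0| <= K * t ^+ 2 / n.+1%:R)%R.
  apply/ler_addgt0Pl => e e0; rewrite addr0.
  have K1 : (0 < `|K * t ^+ 2| + 1)%R by rewrite ltr_wpDl.
  pose n := Num.truncn ((`|K * t ^+ 2| + 1) / e)%R.
  have := truncnS_gt ((`|K * t ^+ 2| + 1) / e)%R; rewrite -/n => h.
  apply: (le_trans (H1 n)); rewrite ler_pdivrMr//.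
  apply: (le_trans (ler_norm _)); move: h; rewrite ltr_pdivrMr// => /ltW.
  by move: (`|_|)%R (n.+1%:R)%R => x y; lra.
pose g (i : nat) : R := (t * i%:R / n.+1%:R)%R.
have gS i : (g i.+1 - g i = t / n.+1%:R)%R.
  by rewrite /g -mulrBl -mulrBr -natrB// subSnn mulr1.
have -> : (D t - D 0 = \sum_(0 <= i < n.+1) (D (g i.+1) - D (g i)))%R.
  rewrite telescope_sumr// /g; congr (D _ - D _)%R; last by rewrite mulr0 mul0r.
  by rewrite mulfK.
apply: (le_trans (ler_norm_sum _ _ _)).
apply: (@le_trans _ _ (\sum_(0 <= i < n.+1) (K * (t / n.+1%:R) ^+ 2))%R).
  rewrite big_nat_cond [leRHS]big_nat_cond; apply: ler_sum => i /andP[/andP[_ i_n] _].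
  rewrite -(gS i); apply: H.
  - by rewrite /g divr_ge0// mulr_ge0.
  - by rewrite -subr_ge0 gS divr_ge0.
  - by rewrite /g ler_pdivrMr// ler_wpM2l// ler_nat.
rewrite sumr_const_nat subn0 -[leLHS]mulr_natr.
have n0 : (n.+1%:R != 0 :> R)%R by rewrite pnatr_eq0.
by rewrite le_eqVlt; apply/orP; left; apply/eqP; move: (n.+1%:R : R)%R n0 => x x0; field.
Qed.

(** Both I and e^(-x) - e^(-y) lie between e^(-y) (y - x) and e^(-x) (y - x), and these differ by at
    most (y - x)^2. *)
Lemma expRN_increment (x y I : R) : (0 <= x <= y)%R ->
  (expR (- y) * (y - x) <= I <= expR (- x) * (y - x))%R ->
  (`|I - (expR (- x) - expR (- y))| <= (y - x) ^+ 2)%R.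
Proof.
move=> /andP[x0 xy] /andP[I1 I2].
have ex : (expR (- x) = expR (y - x) * expR (- y))%R by rewrite -expRD; congr expR; ring.
have ey : (expR (- y) = expR (x - y) * expR (- x))%R by rewrite -expRD; congr expR; ring.
have hx := expR_gt0 (- x)%R; have hy := expR_gt0 (- y)%R.
have x1 : (expR (- x) <= 1)%R by rewrite -expR0 ler_expR oppr_le0.
have e1 : (expR (- y) * (y - x) <= expR (- x) - expR (- y))%R.
  rewrite ex -[X in (_ <= _ - X)%R]mul1r -mulrBl mulrC ler_wpM2r ?(ltW hy)//.
  by have := expR_ge1Dx (y - x)%R; lra.
have e2 : (expR (- x) - expR (- y) <= expR (- x) * (y - x))%R.
  rewrite [X in (_ - X <= _)%R]ey -[X in (X - _ <= _)%R]mul1r -mulrBl mulrC ler_wpM2l ?(ltW hx)//.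
  by have := expR_ge1Dx (x - y)%R; lra.
have e3 : ((expR (- x) - expR (- y)) * (y - x) <= (y - x) ^+ 2)%R.
  by rewrite expr2 ler_wpM2r ?subr_ge0//; move: e2 x1 hx xy; move: (expR _) (expR _) => p q; nra.
rewrite ler_norml; move: e1 e2 e3 I1 I2.
by move: (expR _) (expR _) ((y - x) ^+ 2)%R => p q z; nra.
Qed.

(* Both sides have the same increments up to O((s - r)^2), so a uniform partition
   shows that they agree; no differentiation theorem for A is needed. *)
Lemma integral_expRN_bounded (a : R -> R) (N t : R) : (0 <= t)%R ->
  measurable_fun setT a -> (forall u, 0 <= a u <= N)%R ->
  \int[mu]_(s in `[0%R, t])
     ((a s)%:E * expeR (- \int[mu]_(u in `[0%R, s]) (a u)%:E)) =
  1 - expeR (- \int[mu]_(u in `[0%R, t]) (a u)%:E).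
Proof.
move=> t0 ma aN.
have N0 : (0 <= N)%R by have /andP[] := aN 0%R; exact: le_trans.
have a0 u : 0 <= (a u)%:E by rewrite lee_fin; case/andP: (aN u).
have mea : measurable_fun setT (EFin \o a) by exact/measurable_EFinP.
pose A s := \int[mu]_(u in `[0%R, s]) (a u)%:E.
have AN r s : (0 <= r)%R -> (0 <= s)%R ->
    0 <= \int[mu]_(u in `[0%R, s]) (a (r + u))%:E <= (N * s)%:E.
  move=> r0 s0; apply/andP; split; first exact: integral_ge0.
  apply: (@le_trans _ _ (\int[mu]_(u in `[0%R, s]) cst N%:E u)).
    apply: ge0_le_integral => //.
    - by apply: measurable_funTS; apply: (measurableT_comp mea); exact: (@measurable_funD _ _ _ _ (cst r) id).
    - by move=> u _; rewrite lee_fin; case/andP: (aN (r + u)%R).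
  by rewrite integral_itv_cst.
have AD r s : (0 <= r)%R -> (0 <= s)%R ->
    A (r + s)%R = A r + \int[mu]_(u in `[0%R, s]) (a (r + u))%:E.
  by move=> r0 s0; rewrite /A ge0_integral_itvD.
have Afin s : (0 <= s)%R -> A s \is a fin_num.
  move=> s0; rewrite ge0_fin_numE; last exact: integral_ge0.
  have /andP[_] := AN 0%R s (lexx _) s0.
  by under eq_integral do rewrite add0r; move=> /le_lt_trans; apply; rewrite ltry.
have [B AB] : exists B : R -> R, forall s : R, (0 <= s)%R -> A s = (B s)%:E.
  by exists (fine \o A) => s s0; rewrite fineK// Afin.
pose f s := (a s)%:E * expeR (- A s).
have f0 s : 0 <= f s by rewrite mule_ge0// expeR_ge0.
have mA : measurable_fun setT A.
  have := @measurable_integral_itv R _ unit (fun z => (a z.2)%:E).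
  move=> /(_ _ (fun=> a0 _)) h.
  have /h {}h : measurable_fun setT (fun z : unit * R => (a z.2)%:E).
    by apply/measurable_EFinP; exact: measurableT_comp.
  by apply: (measurableT_comp h (pair2_measurable tt)).
have mf : measurable_fun setT f.
  by apply: emeasurable_funM => //; apply: (measurableT_comp measurable_expeR); apply: measurableT_comp.
have mshift (g : R -> \bar R) r : measurable_fun setT g ->
    measurable_fun [set: R] (fun u : R => g (r + u)%R).
  by move=> mg; apply: (measurableT_comp mg); exact: (@measurable_funD _ _ _ _ (cst r) id).
pose L s := \int[mu]_(u in `[0%R, s]) f u.
have fE s : (0 <= s)%R -> f s = (a s * expR (- B s))%:E.
  by move=> s0; rewrite /f AB// EFinM.
have BD r h : (0 <= r)%R -> (0 <= h)%R ->
    \int[mu]_(u in `[0%R, h]) (a (r + u))%:E = (B (r + h) - B r)%:E.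
  by move=> r0 h0; rewrite EFinB -!AB ?addr_ge0// AD// addeAC subee ?Afin// add0e.
have Bhomo r h : (0 <= r)%R -> (0 <= h)%R -> (B r <= B (r + h))%R.
  by move=> r0 h0; rewrite -subr_ge0 -lee_fin -BD//; exact: integral_ge0.
have Bmono (x y : R) : (0 <= x)%R -> (x <= y)%R -> (B x <= B y)%R.
  by move=> x0 xy; rewrite -(subrKC x y) Bhomo// subr_ge0.
have LD r h : (0 <= r)%R -> (0 <= h)%R ->
    L (r + h)%R = L r + \int[mu]_(u in `[0%R, h]) f (r + u)%R.
  by move=> r0 h0; rewrite /L ge0_integral_itvD.
have Lbnd r h : (0 <= r)%R -> (0 <= h)%R ->
    (expR (- B (r + h)) * (B (r + h) - B r))%:E <=
    \int[mu]_(u in `[0%R, h]) f (r + u)%R <= (expR (- B r) * (B (r + h) - B r))%:E.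
  move=> r0 h0.
  have mar : measurable_fun `[0%R, h] (fun u : R => (a (r + u))%:E).
    by apply: measurable_funTS; exact: (mshift _ r mea).
  have mfr : measurable_fun `[0%R, h] (fun u : R => f (r + u)%R).
    by apply: measurable_funTS; exact: (mshift _ r mf).
  have mz c : measurable_fun `[0%R, h] (fun u : R => c%:E * (a (r + u))%:E).
    exact: emeasurable_funM.
  have ZE c : (0 <= c)%R -> (c * (B (r + h) - B r))%:E =
      \int[mu]_(u in `[0%R, h]) (c%:E * (a (r + u))%:E).
    by move=> c0; rewrite ge0_integralZl_EFin// BD.
  rewrite (ZE _ (expR_ge0 (- B (r + h)%R))) (ZE _ (expR_ge0 (- B r))).
  apply/andP; split; apply: ge0_le_integral => //.
  - by move=> u _; rewrite mule_ge0// lee_fin expR_ge0.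
  - exact: mz.
  - move=> u; rewrite /= in_itv/= => /andP[u0 uh]; rewrite fE ?addr_ge0// -EFinM lee_fin mulrC.
    rewrite ler_wpM2l//; first by case/andP: (aN (r + u)%R).
    by rewrite ler_expR lerN2 Bmono ?addr_ge0 ?lerD2l.
  - exact: mz.
  - move=> u; rewrite /= in_itv/= => /andP[u0 uh]; rewrite fE ?addr_ge0// -EFinM lee_fin [leRHS]mulrC.
    rewrite ler_wpM2l//; first by case/andP: (aN (r + u)%R).
    by rewrite ler_expR lerN2 Bmono ?lerDl.
have L0 s : 0 <= L s by exact: integral_ge0.
have B0 : B 0%R = 0%R.
  by apply: EFin_inj; rewrite -AB// /A set_itv1 integral_set1.
have Lfin s : (0 <= s)%R -> L s \is a fin_num.
  move=> s0; rewrite ge0_fin_numE//.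
  have /andP[_] := Lbnd 0%R s (lexx _) s0.
  under eq_integral do rewrite add0r.
  by move=> /le_lt_trans; apply; rewrite ltry.
have [M LM] : exists M : R -> R, forall s : R, (0 <= s)%R -> L s = (M s)%:E.
  by exists (fine \o L) => s s0; rewrite fineK// Lfin.
pose D s := (M s + expR (- B s))%R.
have Dt : D t = D 0%R.
  (* The primitive [B] of a grows by at most N (s - r) on [r, s], whence the constant N^2. *)
  apply: (@eq_of_quadratic_increments _ (N ^+ 2) t) => // r s r0 rs st.
  have h0 : (0 <= s - r)%R by rewrite subr_ge0.
  have srs : (r + (s - r) = s)%R by ring.
  have := Lbnd r (s - r)%R r0 h0; have := LD r (s - r)%R r0 h0; rewrite srs.
  have s0 : (0 <= s)%R by exact: le_trans rs.
  have If : \int[mu]_(u in `[0%R, (s - r)%R]) f (r + u)%R \is a fin_num.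
    rewrite ge0_fin_numE; last exact: integral_ge0.
    have /andP[_] := Lbnd r (s - r)%R r0 h0.
    by move=> /le_lt_trans; apply; rewrite ltry.
  rewrite -(fineK If) !LM//; move: (fine _) => I [LE]; rewrite !lee_fin => hI.
  have -> : (D s - D r = I - (expR (- B r) - expR (- B s)))%R by rewrite /D LE; ring.
  have Br0 : (0 <= B r)%R by rewrite -B0 Bmono.
  have Brs : (B r <= B s)%R by rewrite Bmono.
  have BN : (B s - B r <= N * (s - r))%R.
    by rewrite -lee_fin -{1}srs -BD//; case/andP: (AN r (s - r)%R r0 h0).
  rewrite (le_trans (expRN_increment _ hI)) ?Br0// -exprMn ler_pXn2r ?nnegrE ?subr_ge0//.
  by rewrite mulr_ge0.
rewrite -/(A t) AB// -/(L t) LM// -EFinB; congr EFin.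
have M0 : M 0%R = 0%R.
  by apply: EFin_inj; rewrite -LM// /L set_itv1 integral_set1.
by move: Dt; rewrite /D B0 M0 oppr0 expR0 => Dt; apply/eqP; rewrite eq_sym subr_eq Dt add0r.
Qed.

(** Truncate a at height n; a itself dominates. Finiteness is essential: if a is not integrable near
    0, the exponential vanishes at once and the left side is 0 whereas the right side is 1. *)
Lemma integral_expRN (a : R -> R) (t : R) : (0 <= t)%R ->
  measurable_fun setT a -> (forall u, 0 <= a u)%R ->
  \int[mu]_(u in `[0%R, t]) (a u)%:E < +oo ->
  \int[mu]_(s in `[0%R, t])
     ((a s)%:E * expeR (- \int[mu]_(u in `[0%R, s]) (a u)%:E)) =
  1 - expeR (- \int[mu]_(u in `[0%R, t]) (a u)%:E).
Proof.
move=> t0 ma a0 At.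
pose an n u := Num.min (a u) n%:R.
have man n : measurable_fun setT (an n) by exact: measurable_minr.
have an0 n u : (0 <= an n u <= n%:R)%R by rewrite le_min a0 ler0n ge_min lexx orbT.
have an_a n u : (an n u <= a u)%R by rewrite ge_min lexx.
have ancvg u : (an n u)%:E @[n --> \oo] --> (a u)%:E.
  apply: cvg_near_cst; exists (Num.truncn (a u)).+1 => // n /= h.
  congr EFin; apply/min_idPl/ltW/(lt_le_trans (truncnS_gt _)).
  by rewrite ler_nat.
have Afin s : (s <= t)%R -> \int[mu]_(u in `[0%R, s]) (a u)%:E < +oo.
  move=> st; apply: le_lt_trans At; apply: ge0_subset_integral => //.
  - by apply: measurable_funTS; exact/measurable_EFinP.
  - by move=> u _; rewrite lee_fin.
  - by move=> u; rewrite /= !in_itv/= => /andP[-> /le_trans]; apply.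
have Acvg s : (s <= t)%R -> \int[mu]_(u in `[0%R, s]) (an n u)%:E @[n --> \oo] -->
    \int[mu]_(u in `[0%R, s]) (a u)%:E.
  move=> st; apply: (@dominated_cvg _ _ _ mu _ _ _ _ (EFin \o a)) => //.
  - by move=> n; apply: measurable_funTS; apply/measurable_EFinP; exact: man.
  - apply/integrableP; split; first by apply: measurable_funTS; exact/measurable_EFinP.
    by under eq_integral => u _ do rewrite /= ger0_norm//; exact: Afin.
  - move=> n u _; rewrite /= lee_fin ger0_norm ?an_a//; by case/andP: (an0 n u).
have ecvg s : (s <= t)%R -> expeR (- \int[mu]_(u in `[0%R, s]) (an n u)%:E) @[n --> \oo] -->
    expeR (- \int[mu]_(u in `[0%R, s]) (a u)%:E).
  by move=> st; apply: cvg_expeR; apply: cvgeN; exact: Acvg.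
have h n := integral_expRN_bounded t0 (man n) (an0 n).
have mAn (b : R -> R) : measurable_fun setT b -> (forall u, 0 <= b u)%R ->
    measurable_fun setT (fun s : R => \int[mu]_(u in `[0%R, s]) (b u)%:E).
  move=> mb b0.
  have := @measurable_integral_itv R _ unit (fun z => (b z.2)%:E).
  move=> /(_ _ (fun=> _)) k.
  have /k {}k : measurable_fun setT (fun z : unit * R => (b z.2)%:E).
    by apply/measurable_EFinP; exact: measurableT_comp.
  by apply: (measurableT_comp (k _) (pair2_measurable tt)) => z; rewrite lee_fin.
have mF (b : R -> R) : measurable_fun setT b -> (forall u, 0 <= b u)%R ->
    measurable_fun setT (fun s => (b s)%:E * expeR (- \int[mu]_(u in `[0%R, s]) (b u)%:E)).
  move=> mb b0; apply: emeasurable_funM; first exact/measurable_EFinP.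
  by apply: (measurableT_comp measurable_expeR); apply: measurableT_comp => //; exact: mAn.
have an0' n u : (0 <= an n u)%R by case/andP: (an0 n u).
have expfin s : expeR (- \int[mu]_(u in `[0%R, s]) (a u)%:E) \is a fin_num.
  rewrite ge0_fin_numE ?expeR_ge0//; apply: (@le_lt_trans _ _ (expeR 0)).
    by rewrite lee_expeR oppe_le0 integral_ge0// => v _; rewrite lee_fin.
  by rewrite expeR0 ltry.
have l1 : \int[mu]_(s in `[0%R, t])
     ((an n s)%:E * expeR (- \int[mu]_(u in `[0%R, s]) (an n u)%:E)) @[n --> \oo] -->
   \int[mu]_(s in `[0%R, t])
     ((a s)%:E * expeR (- \int[mu]_(u in `[0%R, s]) (a u)%:E)).
  apply: (@dominated_cvg _ _ _ mu _ _ _ _ (EFin \o a)) => //.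
  - by move=> n; apply: measurable_funTS; apply: mF.
  - move=> u; rewrite /= in_itv/= => /andP[u0 ut]; apply: cvgeM.
    + by apply: mule_def_fin => //; apply: expfin.
    + exact: ancvg.
    + exact: ecvg.
  - apply/integrableP; split; first by apply: measurable_funTS; exact/measurable_EFinP.
    by under eq_integral => u _ do rewrite /= ger0_norm//.
  - move=> n u _; rewrite gee0_abs ?mule_ge0 ?expeR_ge0 ?lee_fin//.
    rewrite -[leRHS]mule1; apply: lee_pmul; rewrite ?expeR_ge0 ?lee_fin//.
    by rewrite -expeR0 lee_expeR oppe_le0 integral_ge0// => v _; rewrite lee_fin.
have l2 : 1 - expeR (- \int[mu]_(u in `[0%R, t]) (an n u)%:E) @[n --> \oo] -->
    1 - expeR (- \int[mu]_(u in `[0%R, t]) (a u)%:E).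
  by apply: cvgeB; [rewrite fin_num_adde_defr|exact: cvg_cst|exact: ecvg].
by move: l1; rewrite (funext h) => l1; exact: (cvg_unique _ l1 l2).
Qed.

End exponential_functional.

Section rV_measurability.
Context {R : realType} {d : nat} {dT : measure_display} {T : measurableType dT}.
Implicit Types f g : T -> 'rV[R]_d.

Lemma measurable_funD_rV f g : measurable_fun setT f -> measurable_fun setT g ->
  measurable_fun setT (fun x => f x + g x).
Proof.
move=> mf mg; apply: measurable_fun_rVP => i; under eq_fun do rewrite mxE.
by apply: measurable_funD; [apply: (measurableT_comp (measurable_coord i) mf)
  |apply: (measurableT_comp (measurable_coord i) mg)].
Qed.

Lemma measurable_funB_rV f g : measurable_fun setT f -> measurable_fun setT g ->
  measurable_fun setT (fun x => f x - g x).
Proof.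
move=> mf mg; apply: measurable_fun_rVP => i; under eq_fun do rewrite !mxE.
by apply: measurable_funB; [apply: (measurableT_comp (measurable_coord i) mf)
  |apply: (measurableT_comp (measurable_coord i) mg)].
Qed.

End rV_measurability.

Lemma eq_law_integral (R : realType) d1 d2 d3 (T1 : measurableType d1)
    (T2 : measurableType d2) (T3 : measurableType d3)
    (m1 : {measure set T1 -> \bar R}) (m2 : {measure set T2 -> \bar R})
    (f1 : T1 -> T3) (f2 : T2 -> T3) (h : T3 -> \bar R) :
  measurable_fun setT f1 -> measurable_fun setT f2 -> measurable_fun setT h ->
  (forall x, 0 <= h x)%E ->
  (forall A, measurable A -> m1 (f1 @^-1` A) = m2 (f2 @^-1` A)) ->
  (\int[m1]_x h (f1 x) = \int[m2]_x h (f2 x))%E.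
Proof.
move=> mf1 mf2 mh h0 E.
pose F1 : {mfun T1 >-> T3} := HB.pack f1 (isMeasurableFun.Build _ _ _ _ _ mf1).
pose F2 : {mfun T2 >-> T3} := HB.pack f2 (isMeasurableFun.Build _ _ _ _ _ mf2).
transitivity (\int[pushforward m1 F1]_y h y)%E.
  by rewrite ge0_integral_pushforward//= preimage_setT.
transitivity (\int[pushforward m2 F2]_y h y)%E.
  by apply: eq_measure_integral => A mA _; exact: E.
by rewrite ge0_integral_pushforward//= preimage_setT.
Qed.

Lemma integral_probability_cst (R : realType) dT (T : measurableType dT)
  (P : probability T R) (c : \bar R) : (\int[P]_w c = c)%E.
Proof.
transitivity (c * P setT)%E; first exact: (integral_cst P measurableT c).
by rewrite probability_setT mule1.
Qed.

(** * The Markov property on path space *)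

Section independence.
Local Open Scope ereal_scope.
Context {R : realType} {dO dT : measure_display} {Omega : measurableType dO}
  {T : measurableType dT}.
Variables (P : probability Omega R) (G : set (set Omega)) (Y : Omega -> T).
Hypotheses (Gm : G `<=` measurable) (setIG : setI_closed G) (GT : G setT)
  (mY : measurable_fun setT Y).
Hypothesis indepG : forall C B, G C -> measurable B ->
  P (C `&` Y @^-1` B) = P C * P (Y @^-1` B).

Let mYB B : measurable B -> measurable (Y @^-1` B).
Proof. by move=> mB; rewrite -[X in measurable X]setTI; exact: mY. Qed.

Lemma sigma_measurable C : <<s G >> C -> measurable C.
Proof.
by apply: smallest_sub => //; exact: sigma_algebra_measurable.
Qed.

(** For fixed B both sides are finite measures in C that agree on the pi-system [G]. *)
Lemma indep_sigma C B : <<s G >> C -> measurable B ->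
  P (C `&` Y @^-1` B) = P C * P (Y @^-1` B).
Proof.
move=> sC mB; have mYB' := mYB mB.
have k0 : (0 <= fine (P (Y @^-1` B)))%R by exact: fine_ge0.
pose k := NngNum k0.
have -> : P C * P (Y @^-1` B) = mscale k P C.
  by rewrite /mscale/= fineK ?fin_num_measure// muleC.
apply: (@g_sigma_algebra_measure_unique _ _ _ G Gm (fun=> setT) (fun=> GT) _
  (mrestr P mYB') (mscale k P) setIG _ _ C sC).
- by rewrite bigcup_const//; exists 0%N.
- move=> A GA; rewrite /mrestr /= /mscale/= fineK ?fin_num_measure//.
  by rewrite muleC; exact: indepG.
- move=> _; change (P (setT `&` Y @^-1` B) < +oo).
  by rewrite setTI (le_lt_trans (probability_le1 _ _))// ltry.
Qed.

(** The identity of Omega is viewed as a random element [I] of the coarser space generated by [G].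
    Its joint law with [Y] is the product law, and Tonelli's theorem concludes. *)
Lemma indep_integral (K : g_sigma_algebraType G * T -> \bar R) :
  measurable_fun setT K -> (forall z, 0 <= K z) ->
  \int[P]_w K (w, Y w) = \int[P]_w \int[P]_w' K (w, Y w').
Proof.
move=> mK K0.
pose I (w : Omega) : g_sigma_algebraType G := w.
have mI : measurable_fun setT I.
  by move=> _ A mA; rewrite setTI; exact: sigma_measurable.
pose J (w : Omega) : g_sigma_algebraType G * T := (I w, Y w).
have mJ : measurable_fun setT J by exact: measurable_fun_pair.
pose I' : {mfun Omega >-> g_sigma_algebraType G} :=
  HB.pack I (isMeasurableFun.Build _ _ _ _ _ mI).
pose Y' : {mfun Omega >-> T} := HB.pack Y (isMeasurableFun.Build _ _ _ _ _ mY).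
pose J' : {mfun Omega >-> (g_sigma_algebraType G * T)%type} :=
  HB.pack J (isMeasurableFun.Build _ _ _ _ _ mJ).
have E : forall A, measurable A ->
    (distribution P I' \x distribution P Y') A = distribution P J' A.
  apply: product_measure_unique => A B mA mB.
  exact: indep_sigma.
transitivity (\int[distribution P J']_z K z).
  by rewrite ge0_integral_pushforward//= preimage_setT.
transitivity (\int[distribution P I' \x distribution P Y']_z K z).
  by apply: eq_measure_integral => A mA _; exact/esym/E.
rewrite fubini_tonelli1// ge0_integral_pushforward//=; last first.
- by move=> x _; apply: integral_ge0.
- exact: measurable_fun_fubini_tonelli_F.
rewrite preimage_setT; apply: eq_integral => w _ /=.
rewrite /fubini_F ge0_integral_pushforward ?preimage_setT//=.
exact: (measurableT_comp mK (pair1_measurable _)).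
Qed.

End independence.

Section finite_dimensional_laws.
Local Open Scope ereal_scope.
Context {R : realType} {d : nat} {dO : measure_display}
  {Omega : measurableType dO}.
Variables (P : probability Omega R) (X : R -> Omega -> 'rV[R]_d).
Hypothesis HX : levy_process P X.

Lemma measurable_X t : (0 <= t)%R -> measurable_fun setT (X t).
Proof. exact: (levy_measurable HX). Qed.

Lemma X0_ae : {ae P, forall w, X 0%R w = 0%R}.
Proof.
have mA : measurable [set w | X 0%R w = 0%R].
  have -> : [set w | X 0%R w = 0%R] =
      \bigcap_(i in [set: 'I_d]) ((fun w => X 0%R w ord0 i) @^-1` [set 0%R]).
    apply/seteqP; split => w /=; first by move=> w0 i _; rewrite /= w0 mxE.
    by move=> h; apply/rowP => i; rewrite mxE; exact: h.
  apply: fin_bigcap_measurable; first exact: finite_finset.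
  move=> i _; rewrite -[X in measurable X]setTI.
  by apply: (measurableT_comp (measurable_coord i) (measurable_X (lexx _))).
exists (~` [set w | X 0%R w = 0%R]); split => //; first exact: measurableC.
by rewrite probability_setC// (levy_start HX) subee.
Qed.

Lemma stationary_integral s t (f : 'rV[R]_d -> \bar R) : (0 <= s)%R -> (0 <= t)%R ->
  measurable_fun setT f -> (forall y, 0 <= f y) ->
  \int[P]_w f (X (s + t)%R w - X s w)%R = \int[P]_w f (X t w).
Proof.
move=> s0 t0 mf f0.
have mD : measurable_fun setT (fun w => X (s + t)%R w - X s w)%R.
  by apply: measurable_funB_rV; apply: measurable_X => //; exact: addr_ge0.
apply: (@eq_law_integral _ _ _ _ _ _ _ P P _ (X t) f) => //; first exact: measurable_X.
by move=> A mA; exact: (levy_stationary HX).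
Qed.

Let step := (R * ('rV[R]_d -> \bar R))%type.
Definition ok_step (x : step) :=
  [/\ (0 <= x.1)%R, measurable_fun setT x.2 & forall y, 0 <= x.2 y].
Definition step0 : step := (0%R, cst 0).
Definition ok_steps (l : seq step) := forall k, ok_step (nth step0 l k).
Definition duration (l : seq step) : R := (\sum_(x <- l) x.1)%R.

Lemma ok_step0 : ok_step step0.
Proof. by split => //=; exact: measurable_cst. Qed.

Lemma ok_steps_cons x l : ok_steps (x :: l) <-> ok_step x /\ ok_steps l.
Proof.
split=> [h|[h1 h2] [|k]] //=; first by split => [|k]; [exact: (h 0%N)|exact: (h k.+1)].
Qed.

Lemma ok_steps_rcons x l : ok_steps (rcons l x) -> ok_step x /\ ok_steps l.
Proof.
move=> h; split; first by have := h (size l); rewrite nth_rcons ltnn eqxx.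
move=> k; have := h k; rewrite nth_rcons; case: ltnP => // lk.
by move=> _; rewrite nth_default//; exact: ok_step0.
Qed.

Lemma ok_steps_cat l1 l2 : ok_steps l1 -> ok_steps l2 -> ok_steps (l1 ++ l2).
Proof. by move=> h1 h2 k; rewrite nth_cat; case: ifP. Qed.

Lemma duration_ge0 l : ok_steps l -> (0 <= duration l)%R.
Proof.
elim: l => [|x l ih]; first by rewrite /duration big_nil.
move=> /ok_steps_cons[[x0 _ _] hl]; rewrite /duration big_cons addr_ge0//; exact: ih.
Qed.

Lemma duration_cons x l : (duration (x :: l) = x.1 + duration l)%R.
Proof. by rewrite /duration big_cons. Qed.

Lemma duration_rcons l x : (duration (rcons l x) = duration l + x.1)%R.
Proof. by rewrite /duration -cats1 big_cat/= big_seq1. Qed.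

(* The first components of [l] are waiting times between successive evaluations. *)
Fixpoint path_prod (l : seq step) (s : R) (y : 'rV[R]_d) (w : Omega) : \bar R :=
  if l is x :: l' then
    x.2 (y + (X (s + x.1)%R w - X 0%R w))%R * path_prod l' (s + x.1)%R y w
  else 1.

(** The Markov counterpart of [path_prod]: a fresh expectation for each waiting time. On the path
    side positions are counted from [X 0], which vanishes only almost surely. *)
Fixpoint iter_op (l : seq step) (b : 'rV[R]_d -> \bar R) (y : 'rV[R]_d) : \bar R :=
  if l is x :: l' then
    \int[P]_w (x.2 (y + X x.1 w)%R * iter_op l' b (y + X x.1 w)%R)
  else b y.

Lemma iter_op_cat l1 l2 b y : iter_op (l1 ++ l2) b y = iter_op l1 (iter_op l2 b) y.
Proof. by elim: l1 y => [//|x l ih] y /=; apply: eq_integral => w _; rewrite ih. Qed.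

Lemma measurable_shift_X (f : 'rV[R]_d -> \bar R) t : (0 <= t)%R ->
  measurable_fun setT f ->
  measurable_fun setT (fun z : 'rV[R]_d * Omega => f (z.1 + X t z.2)%R).
Proof.
move=> t0 mf; apply: (measurableT_comp mf); apply: measurable_funD_rV => //.
by apply: (measurableT_comp (measurable_X t0)).
Qed.

Lemma iter_op_ge0 l b y : ok_steps l -> (forall y, 0 <= b y) -> 0 <= iter_op l b y.
Proof.
move=> + b0; elim: l y => [//|x l ih] y /ok_steps_cons[[x0 mx xge0] hl] /=.
by apply: integral_ge0 => w _; rewrite mule_ge0// ih.
Qed.

Lemma measurable_iter_op l b : ok_steps l -> measurable_fun setT b ->
  (forall y, 0 <= b y) -> measurable_fun setT (iter_op l b).
Proof.
move=> + mb b0; elim: l => [//|x l ih] /ok_steps_cons[[x0 mx xge0] hl] /=.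
apply: (@measurable_fun_fubini_tonelli_F _ _ _ _ _ P
  (fun z : 'rV[R]_d * Omega => x.2 (z.1 + X x.1 z.2)%R * iter_op l b (z.1 + X x.1 z.2)%R)).
  by apply: emeasurable_funM; apply: measurable_shift_X => //; exact: ih.
by move=> z; rewrite mule_ge0// iter_op_ge0.
Qed.

Lemma path_prod_ge0 l s y w : ok_steps l -> 0 <= path_prod l s y w.
Proof.
elim: l s => [//|x l ih] s /ok_steps_cons[[x0 mx xge0] hl] /=.
by rewrite mule_ge0// ih.
Qed.

Lemma path_prod_rcons l x s y w : path_prod (rcons l x) s y w =
  path_prod l s y w *
  x.2 (y + (X (s + duration (rcons l x))%R w - X 0%R w))%R.
Proof.
elim: l s => [|z l ih] s /=; first by rewrite /duration big_seq1 mule1 mul1e.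
by rewrite ih muleA duration_cons [(s + (_ + _))%R]addrA.
Qed.

Lemma measurable_path_prod dT (T : measurableType dT) (I : T -> Omega) l s y :
  ok_steps l ->
  (forall k, measurable_fun setT
     (fun z : T => X (s + duration (take k.+1 l))%R (I z) - X 0%R (I z))%R) ->
  measurable_fun setT (fun z : T => path_prod l s y (I z)).
Proof.
elim: l s => [|x l ih] s /= hl h; first exact: measurable_cst.
move/ok_steps_cons : hl => [[x0 mx xge0] hl].
apply: emeasurable_funM.
  apply: (measurableT_comp mx); apply: measurable_funD_rV => //.
  by have := h 0%N; rewrite take0 /duration big_seq1.
apply: ih => // k.
case: (ltnP k.+1 (size l).+1) => kl.
  by have := h k.+1; rewrite /= duration_cons addrA.
rewrite take_oversize; last by rewrite ltnW.
by have := h (size l); rewrite take_size duration_cons addrA.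
Qed.

Section one_step.
Variable (t : nat -> R) (m : nat).
Hypotheses (t0 : t 0%N = 0%R) (tle : forall i, (t i <= t i.+1)%R).

(** A pi-system for the information available at time [t m]. Cylinders in increments, rather than in
    positions, let the independence of increments apply directly. *)
Definition past : set (set Omega) :=
  [set C | exists A : nat -> set 'rV[R]_d, (forall k, measurable (A k)) /\
    C = [set w | forall k, (k < m)%N -> A k (X (t k.+1) w - X (t k) w)%R]].

Let tge0 k : (0 <= t k)%R.
Proof. by elim: k => [|k ih]; [rewrite t0|exact: le_trans ih _]. Qed.

Let mdX k : measurable_fun setT (fun w => X (t k.+1) w - X (t k) w)%R.
Proof. by apply: measurable_funB_rV; exact: measurable_X. Qed.

Lemma past_measurable : past `<=` measurable.
Proof.
move=> C [A [mA ->]].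
rewrite (_ : [set _ | _] = \bigcap_(k in [set k | (k < m)%N])
    ((fun w => X (t k.+1) w - X (t k) w)%R @^-1` A k)); last by apply/seteqP; split.
apply: bigcap_measurableType => k _; rewrite -[X in measurable X]setTI.
exact: mdX.
Qed.

Lemma past_setI : setI_closed past.
Proof.
move=> C D [A [mA ->]] [B [mB ->]]; exists (fun k => A k `&` B k).
split; first by move=> k; exact: measurableI.
apply/seteqP; split => w /=; first by move=> [h1 h2] k km; split; [exact: h1|exact: h2].
by move=> h; split => k km; have [] := h k km.
Qed.

Lemma past_setT : past setT.
Proof. by exists (fun=> setT); split => //; apply/seteqP. Qed.

Lemma past_indep C B : past C -> measurable B ->
  P (C `&` (fun w => X (t m.+1) w - X (t m) w)%R @^-1` B) =
  P C * P ((fun w => X (t m.+1) w - X (t m) w)%R @^-1` B).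
Proof.
move=> [A [mA ->]] mB.
have tt0 : (0 <= t 0%N)%R by rewrite t0.
rewrite (levy_indep HX)//.
have := @levy_indep _ _ _ _ _ _ HX m.+1 t (fun k => if k == m then B else A k) tt0 tle.
rewrite big_ord_recr/= eqxx => h.
transitivity (P [set w | forall i : nat, (i < m.+1)%N ->
    (if i == m then B else A i) (X (t i.+1) w - X (t i) w)%R]).
  congr (P _); apply/seteqP; split => w /=.
    move=> [h1 h2] i; rewrite ltnS leq_eqVlt; case: eqP => [->//|_ /= im]; exact: h1.
  move=> h1; split; last by have := h1 m (ltnSn m); rewrite eqxx.
  by move=> k km; have := h1 k (ltnW km); rewrite ltn_eqF.
rewrite h; last by move=> i; case: ifP.
by congr (_ * _); apply: eq_bigr => i _; rewrite ltn_eqF.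
Qed.

Lemma past_increment k : (k <= m)%N ->
  measurable_fun setT (fun w : g_sigma_algebraType past => X (t k) w - X 0%R w)%R.
Proof.
elim: k => [_|k ih km].
  by rewrite t0; under eq_fun do rewrite subrr; exact: measurable_cst.
under eq_fun => w do rewrite -(subrKA (X (t k) w)).
apply: measurable_funD_rV; last exact: (ih (ltnW km)).
move=> _ B mB; rewrite setTI; apply: sub_sigma_algebra.
exists (fun j => if j == k then B else setT); split; first by move=> j; case: ifP.
apply/seteqP; split => w /=; first by move=> h j jm; case: eqP => // ->.
by move=> /(_ k km); rewrite eqxx.
Qed.

End one_step.

(** Induction on the last step. Its increment is independent of the earlier ones and distributed
    like X at its waiting time; integrating it out leaves the shorter list with a new terminal
    function. *)
Lemma fddE l b y : ok_steps l -> measurable_fun setT b -> (forall y, 0 <= b y) ->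
  \int[P]_w (path_prod l 0%R y w * b (y + (X (duration l) w - X 0%R w))%R) =
  iter_op l b y.
Proof.
elim/last_ind: l b => [|l x ih] b hl mb b0.
  rewrite /duration big_nil; under eq_integral do rewrite subrr addr0/= mul1e.
  exact: integral_probability_cst.
have /ok_steps_rcons[[x0 mx xge0] hl'] := hl.
pose c y := x.2 y * b y.
have mc : measurable_fun setT c by exact: emeasurable_funM.
have c0 y' : 0 <= c y' by rewrite mule_ge0.
pose t k := duration (take k (rcons l x)).
have t0 : t 0%N = 0%R by rewrite /t take0 /duration big_nil.
have tle i : (t i <= t i.+1)%R.
  rewrite /t; case: (ltnP i (size (rcons l x))) => il.
    by rewrite (take_nth step0 il) duration_rcons lerDl; case: (hl i).
  by rewrite !take_oversize// ltnW.
have tm : t (size l) = duration l.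
  by rewrite /t -cats1 take_cat ltnn subnn take0 cats0.
have tm1 : (t (size l).+1 = duration l + x.1)%R.
  by rewrite /t take_oversize ?size_rcons// duration_rcons.
pose G := past t (size l).
pose K (z : g_sigma_algebraType G * 'rV[R]_d) : \bar R :=
  path_prod l 0%R y z.1 * c (y + (X (duration l) z.1 - X 0%R z.1) + z.2)%R.
have mfst : measurable_fun setT (fun z : g_sigma_algebraType G * 'rV[R]_d => z.1).
  exact: measurable_fst.
have mXl : measurable_fun setT (fun z : g_sigma_algebraType G * 'rV[R]_d =>
    X (duration l) z.1 - X 0%R z.1)%R.
  have := past_increment t0 (leqnn (size l)); rewrite tm => h.
  exact: (measurableT_comp h mfst).
have mK : measurable_fun setT K.
  apply: emeasurable_funM.
    apply: (@measurable_path_prod _ _ (fun z : g_sigma_algebraType G * 'rV[R]_d => z.1)) => // k.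
    rewrite add0r.
    have [j jl ->] : exists2 j, (j <= size l)%N & duration (take k.+1 l) = t j.
      case: (ltnP k (size l)) => kl.
        by exists k.+1 => //; rewrite /t -cats1 takel_cat.
      by exists (size l) => //; rewrite take_oversize ?tm// ltnW.
    exact: (measurableT_comp (past_increment t0 jl) mfst).
  apply: (measurableT_comp mc); apply: measurable_funD_rV; last exact: measurable_snd.
  exact: measurable_funD_rV.
have K0 z : 0 <= K z by rewrite mule_ge0// path_prod_ge0.
transitivity (\int[P]_w K (w, X (t (size l).+1) w - X (t (size l)) w)%R).
  apply: eq_integral => w _; rewrite path_prod_rcons add0r /K/= -muleA.
  rewrite tm1 tm duration_rcons -/(c _); congr (_ * c _); rewrite -addrA; congr (_ + _)%R.
  by rewrite [RHS]addrC subrKA.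
have tge0 k : (0 <= t k)%R.
  by elim: k => [|k h]; [rewrite t0|exact: le_trans h (tle _)].
rewrite (@indep_integral _ _ _ _ _ P G _ (past_measurable t0 tle) (@past_setI t (size l))
  (@past_setT t (size l)) _ (@past_indep t (size l) t0 tle) K mK K0); last first.
  by apply: measurable_funB_rV; apply: measurable_X.
rewrite -cats1 iter_op_cat -ih//; last 2 first.
- by apply: measurable_iter_op => //; apply/ok_steps_cons; split => // k; rewrite nth_nil; exact: ok_step0.
- by move=> z; apply: iter_op_ge0 => //; apply/ok_steps_cons; split => // k; rewrite nth_nil; exact: ok_step0.
apply: eq_integral => w _; rewrite /K/=.
have mcw (f : Omega -> 'rV[R]_d) z : measurable_fun setT f ->
    measurable_fun setT (fun w => c (z + f w)%R).
  by move=> mf; apply: (measurableT_comp mc); exact: measurable_funD_rV.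
have pp := path_prod_ge0 0%R y w hl'.
rewrite ge0_integralZl//; last first.
  by apply: mcw; apply: measurable_funB_rV; apply: measurable_X.
congr (_ * _); rewrite tm1 tm.
rewrite (@stationary_integral _ _ (fun z => c (y + (X (duration l) w - X 0%R w) + z)%R))//.
- exact: duration_ge0.
- by apply: (measurableT_comp mc); exact: measurable_funD_rV.
Qed.

End finite_dimensional_laws.

(** * Paths observed at dyadic times, and their concatenation *)

Section path_space.
Context {R : realType} {d : nat}.

(* Paths carry the sigma-algebra generated by the finitely many positions at
   the times k / 2^n; [regularize] reads the other positions as right limits. *)
Definition grid_cylinders : set (set (R -> 'rV[R]_d)) :=
  [set C | exists (n m : nat) (A : nat -> set 'rV[R]_d),
    (forall k, measurable (A k)) /\
    C = [set xi | forall k, (k < m)%N -> A k (xi (k%:R / 2 ^+ n))]].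

Definition paths := g_sigma_algebraType grid_cylinders.

(** On the grid twice as fine the odd times are left free. Two cylinders can thus be written on a
    common grid, which makes cylinders stable under intersection. *)
Lemma grid_cylinder_refine n m (A : nat -> set 'rV[R]_d) p :
  (forall k, measurable (A k)) -> exists m' A', (forall k, measurable (A' k)) /\
  [set xi : R -> 'rV[R]_d | forall k, (k < m)%N -> A k (xi (k%:R / 2 ^+ n))] =
  [set xi | forall k, (k < m')%N -> A' k (xi (k%:R / 2 ^+ (n + p)))].
Proof.
elim: p n m A => [|p ih] n m A mA; first by exists m, A; rewrite addn0.
rewrite addnS -addSn.
rewrite (_ : [set _ | _] = [set xi : R -> 'rV[R]_d | forall k, (k < m.*2)%N ->
    (if odd k then setT else A k./2) (xi (k%:R / 2 ^+ n.+1))]).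
  by apply: (ih n.+1 m.*2 (fun k => if odd k then setT else A k./2)) => k; case: ifP.
have e k : (k.*2%:R / 2 ^+ n.+1 = k%:R / 2 ^+ n :> R).
  by rewrite -muln2 natrM exprS invfM mulrA -(mulrA _ 2) mulfV// mulr1.
apply/seteqP; split => xi /= h k km.
  case: ifPn => // ok; rewrite -(even_halfK ok) e doubleK; apply: h.
  by rewrite -ltn_double even_halfK.
by have := h k.*2; rewrite ltn_double odd_double doubleK e; apply.
Qed.

Lemma grid_cylinders_setI : setI_closed grid_cylinders.
Proof.
move=> C D [n [m [A [mA ->]]]] [n' [m' [A' [mA' ->]]]].
have [p [B [mB ->]]] := @grid_cylinder_refine n m A n' mA.
have [p' [B' [mB' ->]]] := @grid_cylinder_refine n' m' A' n mA'.
exists (n + n')%N, (p + p')%N, (fun k => (if (k < p)%N then B k else setT) `&`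
  (if (k < p')%N then B' k else setT)); split.
  by move=> k; apply: measurableI; case: ifP.
rewrite (addnC n' n); apply/seteqP; split => xi /=.
  by move=> [h1 h2] k _; split; case: ifPn => // ?; [exact: h1|exact: h2].
move=> h; split => k kp.
  by have := h k (ltn_addr _ kp); rewrite kp => -[].
by have := h k (ltn_addl _ kp); rewrite kp => -[].
Qed.

Lemma grid_cylinders_setT : grid_cylinders setT.
Proof. by exists 0%N, 0%N, (fun=> setT); split => //; apply/seteqP. Qed.

(** The successor puts the grid point strictly above u even when u is dyadic: only limits from the
    right are available. *)
Definition grid_above (n : nat) (u : R) : R :=
  (Num.truncn (2 ^+ n * u)).+1%:R / 2 ^+ n.

(** An upper limit in each coordinate exists, and is measurable, for every element of [paths], right
    continuous or not. *)
Definition regularize (xi : paths) (u : R) : 'rV[R]_d :=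
  \row_i fine (limn_esup (fun n => (xi (grid_above n u) ord0 i)%:E)).

Lemma measurable_truncn_eq k : measurable [set u : R | Num.truncn u = k].
Proof.
have ml q : measurable [set u : R | (Num.truncn u <= q)%N].
  rewrite (_ : [set _ | _] = `]-oo, q.+1%:R[%classic); first exact: measurable_itv.
  by apply/seteqP; split => u; rewrite /= in_itv/= truncn_le_nat.
case: k => [|k].
  by rewrite (_ : [set _ | _] = [set u | (Num.truncn u <= 0)%N])//;
    apply/seteqP; split => u /=; rewrite leqn0 => /eqP.
rewrite (_ : [set _ | _] = [set u | (Num.truncn u <= k.+1)%N] `\` [set u | (Num.truncn u <= k)%N]).
  exact: measurableD.
apply/seteqP; split => u /=; first by move=> ->; rewrite ltnn.
by move=> [h1 h2]; apply/eqP; rewrite eqn_leq h1/= ltnNge; apply/negP.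
Qed.

Lemma measurable_position (k n : nat) :
  measurable_fun [set: paths] (fun xi : paths => xi (k%:R / 2 ^+ n)).
Proof.
move=> _ B mB; rewrite setTI; apply: sub_sigma_algebra.
exists n, k.+1, (fun j => if j == k then B else setT).
split; first by move=> j; case: ifP.
apply/seteqP; split => xi /=; first by move=> h j _; case: eqP => // ->.
by move=> /(_ k (ltnSn k)); rewrite eqxx.
Qed.

Lemma measurable_grid_position n :
  measurable_fun setT (fun z : R * paths => z.2 (grid_above n z.1)).
Proof.
move=> _ B mB; rewrite setTI.
rewrite (_ : _ @^-1` _ = \bigcup_k
   (((fun u : R => 2 ^+ n * u) @^-1` [set u | Num.truncn u = k]) `*`
    ((fun xi : paths => xi (k.+1%:R / 2 ^+ n)) @^-1` B))).
  apply: bigcupT_measurable => k; apply: measurableX.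
    rewrite -[X in measurable X]setTI; apply: measurable_funM => //.
    exact: measurable_truncn_eq.
  by rewrite -[X in measurable X]setTI; exact: measurable_position.
apply/seteqP; split => [[u xi] /= h|[u xi] [k _ /= [h1 h2]]].
  by exists (Num.truncn (2 ^+ n * u)).
by rewrite /grid_above h1.
Qed.

Lemma measurable_regularize :
  measurable_fun setT (fun z : R * paths => regularize z.2 z.1).
Proof.
apply: measurable_fun_rVP => i.
rewrite (_ : (fun x : R * paths => _) = fun z : R * paths =>
    fine (limn_esup (fun n => (z.2 (grid_above n z.1) ord0 i)%:E))); last first.
  by apply/funext => z; rewrite mxE.
apply: measurableT_comp; first exact: fine_measurable.
apply: measurable_fun_limn_esup => n; apply/measurable_EFinP.
exact: (measurableT_comp (measurable_coord i) (measurable_grid_position n)).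
Qed.

Definition right_cont (xi : R -> 'rV[R]_d) := forall (u : R) (v : nat -> R),
  0 <= u -> (forall n, u < v n) -> v n @[n --> \oo] --> u ->
  xi (v n) @[n --> \oo] --> xi u.

Lemma right_contP (xi : R -> 'rV[R]_d) :
  (forall u, 0 <= u -> xi s @[s --> u^'+] --> xi u) -> right_cont xi.
Proof.
move=> h u v u0 uv vu; apply: (cvg_comp _ _ _ (h u u0)).
move=> A [e /= e0 hA]; have /cvgrPdist_lt/(_ _ e0) := vu.
by apply: filterS => n; move=> vn; apply: hA.
Qed.

Lemma regularizeE (xi : R -> 'rV[R]_d) u : right_cont xi -> 0 <= u ->
  regularize xi u = xi u.
Proof.
move=> rc u0; have p2 n : 0 < (2 ^+ n : R) by rewrite exprn_gt0.
have gu n : u < grid_above n u.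
  by rewrite /grid_above ltr_pdivlMr// mulrC; exact: truncnS_gt.
have gle n : grid_above n u <= u + (2 ^+ n)^-1.
  rewrite /grid_above ler_pdivrMr// mulrDl mulVf ?gt_eqF// -natr1 lerD2r mulrC.
  by case/andP: (truncn_itv (mulr_ge0 (ltW (p2 n)) u0)); rewrite mulrC.
have cg : grid_above n u @[n --> \oo] --> u.
  apply: (@squeeze_cvgr _ _ _ _ (cst u) (fun n => u + (2 ^+ n)^-1)).
  - by apply: nearW => n; rewrite (ltW (gu n)) gle.
  - exact: cvg_cst.
  - rewrite -[X in _ --> X]addr0; apply: cvgD; first exact: cvg_cst.
    by under eq_fun do rewrite -exprVn; apply: cvg_expr; rewrite ger0_norm ?invf_lt1 ?ltr1n.
have := rc u _ u0 gu cg => h; apply/rowP => i; rewrite mxE.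
have hi : (xi (grid_above n u) ord0 i)%:E @[n --> \oo] --> (xi u ord0 i)%:E.
  apply: cvg_EFin; first exact: nearW.
  exact: (cvg_comp _ _ h (@coord_continuous _ _ _ ord0 i (xi u))).
rewrite is_cvg_limn_esupE; last by apply/cvg_ex; exists (xi u ord0 i)%:E.
by rewrite (cvg_lim _ hi).
Qed.

(** Only the increments of the second path enter, so the two pieces fit together at time r whatever
    its starting point. *)
Definition concat (r : R) (xi xi' : R -> 'rV[R]_d) (t : R) : 'rV[R]_d :=
  if t < r then xi t else xi r + (xi' (t - r) - xi' 0).

Lemma right_cont_concat r xi xi' : 0 <= r -> right_cont xi -> right_cont xi' ->
  right_cont (concat r xi xi').
Proof.
move=> r0 c c' u v u0 uv vu; rewrite {2}/concat; case: ifPn => ur.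
  apply: cvg_trans (c u v u0 uv vu); apply: near_eq_cvg.
  have e0 : 0 < r - u by rewrite subr_gt0.
  have /cvgrPdist_lt/(_ _ e0) := vu; apply: filterS => n.
  rewrite /concat distrC ger0_norm ?subr_ge0 ?(ltW (uv n))//.
  by rewrite ltrD2r => ->.
rewrite -leNgt in ur.
rewrite (_ : (fun n => _) = fun n => xi r + (xi' (v n - r) - xi' 0)); last first.
  by apply/funext => n; rewrite /concat ltNge (le_trans ur)// ltW.
apply: cvgD; first exact: cvg_cst.
apply: cvgB; last exact: cvg_cst.
apply: c'; [by rewrite subr_ge0|by move=> n; rewrite ltrD2r|].
by apply: cvgB => //; exact: cvg_cst.
Qed.

Lemma measurable_to_path dT (T : measurableType dT) (Y : T -> paths) :
  (forall t, 0 <= t -> measurable_fun setT (fun w => Y w t)) ->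
  measurable_fun setT Y.
Proof.
move=> mY _ B mB; rewrite setTI.
suff : <<s grid_cylinders >> `<=` [set B | measurable (Y @^-1` B)] by apply.
apply: smallest_sub.
  split => /=.
  - by rewrite preimage_set0.
  - by move=> D mD; rewrite setTD preimage_setC; exact: measurableC.
  - by move=> F mF; rewrite preimage_bigcup; exact: bigcup_measurable.
move=> _ [n [m [A [mA ->]]]] /=.
rewrite (_ : _ @^-1` _ = \bigcap_(k in [set k | (k < m)%N])
    ((fun w => Y w (k%:R / 2 ^+ n)) @^-1` A k)); last by apply/seteqP; split.
apply: bigcap_measurableType => k _; rewrite -[X in measurable X]setTI.
by apply: mY => //; rewrite divr_ge0.
Qed.

End path_space.
Arguments paths : clear implicits.

Section markov.
Local Open Scope ereal_scope.
Context {R : realType} {d : nat} {dO : measure_display}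
  {Omega : measurableType dO}.
Variables (P : probability Omega R) (X : R -> Omega -> 'rV[R]_d).
Hypothesis HX : levy_process P X.

Definition sample (w : Omega) : paths R d := fun t => X t w.

Lemma right_cont_sample w : right_cont (sample w).
Proof. by apply: right_contP => u u0; exact: (levy_rcont HX). Qed.

Lemma measurable_sample : measurable_fun setT sample.
Proof. by apply: measurable_to_path => t t0; exact: (measurable_X HX). Qed.

Lemma measurable_concat r : (0 <= r)%R -> measurable_fun setT
  (fun z : Omega * Omega => concat r (sample z.1) (sample z.2) : paths R d).
Proof.
move=> r0; apply: measurable_to_path => t t0; rewrite /concat /sample.
case: ltP => tr; first by apply: (measurableT_comp (measurable_X HX t0)).
apply: measurable_funD_rV; first by apply: (measurableT_comp (measurable_X HX r0)).
by apply: measurable_funB_rV;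
  apply: measurableT_comp => //; apply: (measurable_X HX); rewrite ?subr_ge0.
Qed.

Variables (n m : nat) (A : nat -> set 'rV[R]_d).
Hypothesis mA : forall k, measurable (A k).
Let h : R := (2 ^+ n)^-1%R.

(** The first waiting time is a separate argument because the grid is resumed after a splitting time
    that need not lie on it. *)
Fixpoint grid_steps (dl : R) (k p : nat) : seq (R * ('rV[R]_d -> \bar R)) :=
  if p is p'.+1 then (dl, fun y => (\1_(A k) y)%:E) :: grid_steps h k.+1 p' else [::].

Lemma ok_grid_steps dl k p : ((0 < p)%N -> (0 <= dl)%R) -> ok_steps (grid_steps dl k p).
Proof.
elim: p dl k => [|p ih] dl k hd /=; first by move=> i; rewrite nth_nil; exact: ok_step0.
apply/ok_steps_cons; split; last by apply: ih => _; rewrite invr_ge0 exprn_ge0.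
split => /=; first exact: hd.
- by apply/measurable_EFinP; exact: measurable_indic.
- by move=> y; rewrite lee_fin.
Qed.

Lemma path_prod_grid dl k p s y w : path_prod X (grid_steps dl k p) s y w =
  (`[< forall i, (i < p)%N ->
       A (k + i) (y + (X (s + dl + i%:R * h) w - X 0 w))%R >])%:R%:E.
Proof.
elim: p dl k s => [|p ih] dl k s /=; first by rewrite asboolT.
rewrite ih indicE -EFinM -natrM mulnb; congr ((nat_of_bool _)%:R%:E).
have e i : (s + dl + i.+1%:R * h = s + dl + h + i%:R * h)%R by rewrite -natr1; ring.
apply/idP/asboolP => [/andP[/set_mem h1 /asboolP h2] [|i] ip|H].
- by rewrite addn0 mul0r addr0.
- by have := h2 i ip; rewrite addnS addSn e.
apply/andP; split; first by apply/mem_set; have := H 0%N isT; rewrite addn0 mul0r addr0.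
by apply/asboolP => i ip; have := H i.+1 ip; rewrite addnS addSn e.
Qed.

Lemma path_prod_cat l1 l2 s y w : path_prod X (l1 ++ l2) s y w =
  path_prod X l1 s y w * path_prod X l2 (s + duration l1)%R y w.
Proof.
elim: l1 s => [|x l ih] s /=; first by rewrite mul1e /duration big_nil addr0.
by rewrite ih muleA duration_cons [(s + (_ + _))%R]addrA.
Qed.

Lemma duration_grid p : duration (grid_steps 0 0 p) = (p.-1%:R * h)%R.
Proof.
case: p => [|p] /=; first by rewrite /duration big_nil mul0r.
rewrite duration_cons /= add0r; move: (1%N); elim: p => [|p ih] k /=.
  by rewrite /duration big_nil mul0r.
by rewrite duration_cons ih /= -natr1 mulrDl mul1r addrC.
Qed.

Lemma grid_split r : (0 <= r)%R -> exists j, [/\ (j <= m)%N,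
  forall k, (k < j)%N -> (k%:R * h < r)%R &
  forall k, (j <= k < m)%N -> (r <= k%:R * h)%R].
Proof.
move=> r0; elim: m => [|q [j [jq h1 h2]]]; first by exists 0%N.
case: (ltP (q%:R * h)%R r) => qr.
  exists q.+1; split => //.
  - move=> k; rewrite ltnS => kq; apply: le_lt_trans qr.
    by rewrite ler_wpM2r ?invr_ge0 ?exprn_ge0// ler_nat.
  - by move=> k /andP[/leq_ltn_trans H /H]; rewrite ltnn.
exists j; split => //; first exact: leqW.
move=> k /andP[jk]; rewrite ltnS leq_eqVlt => /predU1P[->//|kq].
by apply: h2; rewrite jk.
Qed.

(** The Markov property at time r, tested on cylinders. A dummy step with the constant function 1 is
    inserted at time r; it cuts the nested expectations of [iter_op] into the j grid times before r
    and those after it. *)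
Lemma sample_concat_cylinder r : (0 <= r)%R ->
  P (sample @^-1` [set xi | forall k, (k < m)%N -> A k (xi (k%:R / 2 ^+ n)%R)]) =
  (P \x P) ((fun z => concat r (sample z.1) (sample z.2)) @^-1`
    [set xi | forall k, (k < m)%N -> A k (xi (k%:R / 2 ^+ n)%R)]).
Proof.
move=> r0; set C := [set xi | _].
have mC : measurable (C : set (paths R d)).
  by apply: sub_sigma_algebra; exists n, m, A.
have [j [jm j1 j2]] := grid_split r0.
pose L1 := grid_steps 0 0 j.
pose L2 := grid_steps (j%:R * h - r) j (m - j).
have dL1 : (duration L1 <= r)%R.
  rewrite duration_grid; case: j {L1 L2 jm j2} j1 => [|j] j1 /=; first by rewrite mul0r.
  exact/ltW/j1.
pose dl := (r - duration L1)%R.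
pose L12 := L1 ++ (dl, cst 1) :: L2.
have ok1 : ok_steps L1 by apply: ok_grid_steps.
have ok2 : ok_steps L2.
  by apply: ok_grid_steps; rewrite subn_gt0 => jm'; rewrite subr_ge0 j2// leqnn.
have oks : ok_step (dl, cst 1 : 'rV[R]_d -> \bar R).
  by split => //=; rewrite subr_ge0.
have ok12 : ok_steps L12 by apply: ok_steps_cat => //; apply/ok_steps_cons.
have m1 : measurable_fun [set: 'rV[R]_d] (cst (1 : \bar R)) by exact: measurable_cst.
have h0 : (0 <= h)%R by rewrite invr_ge0 exprn_ge0.
have mS : measurable (sample @^-1` C).
  by rewrite -[X in measurable X]setTI; exact: measurable_sample.
pose Cr := (fun z => concat r (sample z.1) (sample z.2) : paths R d) @^-1` C.
have mCr : measurable Cr.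
  by rewrite -[X in measurable X]setTI; exact: measurable_concat.
have ae0 := X0_ae HX.
have mX0 : measurable [set w | X 0 w = 0%R].
  have -> : [set w | X 0%R w = 0%R] =
      \bigcap_(i in [set: 'I_d]) ((fun w => X 0%R w ord0 i) @^-1` [set 0%R]).
    apply/seteqP; split => w /=; first by move=> w0 i _; rewrite /= w0 mxE.
    by move=> H; apply/rowP => i; rewrite mxE; exact: H.
  apply: fin_bigcap_measurable; first exact: finite_finset.
  move=> i _; rewrite -[X in measurable X]setTI.
  by apply: (measurableT_comp (measurable_coord i) (measurable_X HX (lexx _))).
have mpp l y : ok_steps l -> measurable_fun setT (fun w => path_prod X l 0%R y w).
  move=> okl; apply: (@measurable_path_prod _ _ _ _ X _ _ id) => // k.
  apply: measurable_funB_rV; apply: (measurable_X HX) => //.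
  rewrite add0r duration_ge0// => i; case: (ltnP i k.+1) => ik.
    by rewrite nth_take.
  by rewrite nth_default ?size_take_min ?geq_min ?ik//; exact: ok_step0.
have durE : (duration L1 + dl = r)%R by rewrite /dl addrC subrK.
have tE i : (r + (j%:R * h - r) + i%:R * h = (j + i)%:R * h)%R.
  by rewrite natrD; ring.
have E1 : P (sample @^-1` C) = iter_op P X L12 (cst 1) 0%R.
  rewrite -(@fddE _ _ _ _ _ _ HX)//; under [RHS]eq_integral do rewrite mule1.
  transitivity (\int[P]_w (\1_(sample @^-1` C) w)%:E); first by rewrite integral_indic// setIT.
  apply: ge0_ae_eq_integral => //.
  - by apply/measurable_EFinP; exact: measurable_indic.
  - exact: mpp.
  - by move=> w _; exact: path_prod_ge0.
  apply: filterS ae0 => w w0 _.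
  rewrite indicE path_prod_cat/= add0r mul1e !path_prod_grid -EFinM -natrM mulnb.
  congr ((nat_of_bool _)%:R%:E).
  apply/idP/andP => [/set_mem H|[/asboolP H1 /asboolP H2]].
    split; apply/asboolP => i ij.
      by rewrite w0 subr0 !add0r; apply: H; exact: leq_trans jm.
    by rewrite durE tE w0 subr0 add0r; apply: H; rewrite -ltn_subRL.
  apply/mem_set => k km; case: (ltnP k j) => kj.
    by have := H1 k kj; rewrite w0 subr0 !add0r.
  have := H2 (k - j)%N; rewrite durE tE w0 subr0 add0r subnKC//; apply.
  by rewrite ltn_sub2r// (leq_ltn_trans kj).
rewrite E1; transitivity (\int[P \x P]_z (\1_Cr z)%:E); last by rewrite integral_indic// setIT.
rewrite fubini_tonelli1//; last by apply/measurable_EFinP; exact: measurable_indic.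
transitivity (\int[P]_w (path_prod X L1 0%R 0%R w *
    iter_op P X L2 (cst 1) (0 + (X r w - X 0 w))%R)).
  rewrite /L12 iter_op_cat.
  have mb : measurable_fun setT (iter_op P X L2 (cst 1)) by exact: measurable_iter_op.
  have b0 y : 0 <= iter_op P X L2 (cst 1) y by exact: iter_op_ge0.
  transitivity (iter_op P X (L1 ++ [:: (dl, cst 1)]) (iter_op P X L2 (cst 1)) 0%R).
    by rewrite iter_op_cat.
  rewrite -(@fddE _ _ _ _ _ _ HX)//; last first.
    by apply: ok_steps_cat => //; apply/ok_steps_cons; split => // i; rewrite nth_nil; exact: ok_step0.
  apply: eq_integral => w _; rewrite path_prod_cat/= !mule1.
  by rewrite (_ : duration (L1 ++ _) = r)// cats1 duration_rcons.
apply/esym; apply: ge0_ae_eq_integral => //.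
- apply: (@measurable_fun_fubini_tonelli_F _ _ _ _ _ P (fun z => (\1_Cr z)%:E)) => //.
  by apply/measurable_EFinP; exact: measurable_indic.
- apply: emeasurable_funM; first exact: mpp.
  apply: measurableT_comp; first exact: measurable_iter_op.
  by apply: measurable_funD_rV => //; apply: measurable_funB_rV; exact: (measurable_X HX).
- by move=> w _; apply: integral_ge0.
- by move=> w _; rewrite mule_ge0 ?path_prod_ge0 ?iter_op_ge0.
apply: filterS ae0 => w w0 _.
rewrite -(@fddE _ _ _ _ _ _ HX)//; under [in RHS]eq_integral do rewrite mule1.
rewrite -ge0_integralZl//; last 3 first.
- exact: mpp.
- by move=> w' _; exact: path_prod_ge0.
- exact: path_prod_ge0.
apply: eq_integral => w' _; rewrite indicE !path_prod_grid -EFinM -natrM mulnb.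
congr ((nat_of_bool _)%:R%:E); rewrite w0 subr0 !add0r.
have cE k : (k < m)%N -> (j <= k)%N -> concat r (sample w) (sample w') (k%:R * h)%R =
    (X r w + (X (j%:R * h - r + (k - j)%:R * h) w' - X 0 w'))%R.
  move=> km jk; rewrite /concat ltNge j2 ?jk//= /sample.
  by congr (_ + (X _ _ - _))%R; rewrite natrB//; ring.
apply/idP/andP => [/set_mem H|[/asboolP H1 /asboolP H2]].
  split; apply/asboolP => i ij.
    have := H i (leq_trans ij jm); rewrite /concat /= -/h j1//.
    by rewrite subr0 !add0r.
  have jim : (j + i < m)%N by rewrite -ltn_subRL.
  have := H (j + i)%N jim; rewrite /= -/h cE ?leq_addr//.
  by rewrite addKn.
apply/mem_set => k km; case: (ltnP k j) => kj /=.
  by have := H1 k kj; rewrite subr0 !add0r /concat -/h j1.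
have := H2 (k - j)%N; rewrite -/h cE// subnKC//; apply.
by rewrite ltn_sub2r// (leq_ltn_trans kj).
Qed.

End markov.

Section markov_integral.
Local Open Scope ereal_scope.
Context {R : realType} {d : nat} {dO : measure_display}
  {Omega : measurableType dO}.
Variables (P : probability Omega R) (X : R -> Omega -> 'rV[R]_d).
Hypothesis HX : levy_process P X.
Notation sample := (sample X).

(** The path, and the concatenation at r of two independent copies, have laws that agree on the
    pi-system of cylinders, hence everywhere; the product measure is then split by Tonelli's
    theorem. *)
Lemma markov_path (r : R) (G : paths R d -> \bar R) : (0 <= r)%R ->
  measurable_fun setT G -> (forall xi, 0 <= G xi) ->
  \int[P]_w G (sample w) =
  \int[P]_w \int[P]_w' G (concat r (sample w) (sample w')).
Proof.
move=> r0 mG G0.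
pose c (z : Omega * Omega) : paths R d := concat r (sample z.1) (sample z.2).
have mc : measurable_fun setT c by exact: (measurable_concat HX).
have ms := measurable_sample HX.
pose S' : {mfun Omega >-> paths R d} := HB.pack sample (isMeasurableFun.Build _ _ _ _ _ ms).
pose c' : {mfun (Omega * Omega)%type >-> paths R d} := HB.pack c (isMeasurableFun.Build _ _ _ _ _ mc).
rewrite (@eq_law_integral _ _ _ _ _ _ _ P (P \x P) sample c)//; last first.
  move=> B mB.
  apply: (@g_sigma_algebra_measure_unique _ _ (paths R d) grid_cylinders _ (fun=> setT)
    (fun=> grid_cylinders_setT) _ (pushforward P S') (pushforward (P \x P) c')) => //.
  - by move=> C HC; exact: sub_sigma_algebra.
  - by rewrite bigcup_const//; exists 0%N.
  - exact: grid_cylinders_setI.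
  - by move=> C [n [m [A [mA ->]]]]; exact: (sample_concat_cylinder HX).
  - by move=> _; change (P setT < +oo); rewrite probability_setT ltry.
by rewrite fubini_tonelli1//; exact: measurableT_comp.
Qed.

Lemma sample0_integral (G : paths R d -> \bar R) :
  measurable_fun setT G -> (forall xi, 0 <= G xi) ->
  \int[P]_w G (fun t => X t w - X 0 w)%R = \int[P]_w G (sample w).
Proof.
move=> mG G0; apply: ge0_ae_eq_integral => //.
- apply: (measurableT_comp mG); apply: measurable_to_path => t t0.
  by apply: measurable_funB_rV; exact: (measurable_X HX).
- by apply: (measurableT_comp mG); exact: (measurable_sample HX).
apply: filterS (X0_ae HX) => w w0 _; congr G.
by apply/funext => t; rewrite w0 subr0.
Qed.

End markov_integral.

(** * Feynman-Kac kernels *)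

Section feynman_kac_kernel.
Local Open Scope ereal_scope.
Context {R : realType} {d : nat}.
Notation mu := (@lebesgue_measure R).
Notation rV := 'rV[R]_d.

(** Two factors instead of the exponential of a difference: the weight is meaningful for all
    measurable a, b >= 0, the product being 0 when both integrals are infinite. *)
Definition fk_weight (a b : rV -> R) (x : rV) (t : R) (xi : R -> rV) : \bar R :=
  expeR (- \int[mu]_(u in `[0%R, t]) (a (x + xi u)%R)%:E) *
  expeR (\int[mu]_(u in `[0%R, t]) (b (x + xi u)%R)%:E).

Lemma fk_weight_ge0 a b x t xi : 0 <= fk_weight a b x t xi.
Proof. by rewrite mule_ge0// expeR_ge0. Qed.

Definition potential (a : rV -> R) := measurable_fun setT a /\ forall x, (0 <= a x)%R.

Lemma measurable_path_integral (a : rV -> R) dT (T : measurableType dT)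
    (x : T -> rV) (t : T -> R) (v : T * R -> rV) :
  potential a -> measurable_fun setT x -> measurable_fun setT t ->
  measurable_fun setT v ->
  measurable_fun setT (fun z : T =>
    \int[mu]_(u in `[0%R, t z]) (a (x z + v (z, u))%R)%:E).
Proof.
move=> [ma a0] mx mt mv.
have H := @measurable_integral_itv R _ T (fun z => (a (x z.1 + v z)%R)%:E).
have mh : measurable_fun setT (fun z : T * R => (a (x z.1 + v z)%R)%:E).
  apply/measurable_EFinP; apply: (measurableT_comp ma).
  by apply: measurable_funD_rV => //; apply: measurableT_comp.
have {}H := H mh (fun=> a0 _).
have := measurableT_comp H (measurable_fun_pair mt (@measurable_id _ T setT)).
by apply: eq_measurable_fun => z _ /=; apply: eq_integral.
Qed.

Lemma measurable_fk_weight (a b : rV -> R) dT (T : measurableType dT)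
    (x : T -> rV) (t : T -> R) (v : T * R -> rV) :
  potential a -> potential b -> measurable_fun setT x -> measurable_fun setT t ->
  measurable_fun setT v ->
  measurable_fun setT (fun z : T => fk_weight a b (x z) (t z) (fun u => v (z, u))).
Proof.
move=> pa pb mx mt mv; apply: emeasurable_funM.
  apply: (measurableT_comp measurable_expeR).
  by apply: measurableT_comp => //; exact: (@measurable_path_integral a _ T x t v).
by apply: (measurableT_comp measurable_expeR); exact: (@measurable_path_integral b _ T x t v).
Qed.

Lemma expeRD_ACA (x y z t : \bar R) :
  expeR (x + y) * expeR (z + t) = expeR x * expeR z * (expeR y * expeR t).
Proof. by rewrite !expeRD muleACA. Qed.

Lemma eq_fk_weight a b x y t xi xi' : (0 <= t)%R ->
  (forall u, (0 <= u <= t)%R -> (x + xi u = y + xi' u)%R) ->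
  fk_weight a b x t xi = fk_weight a b y t xi'.
Proof.
move=> t0 H; rewrite /fk_weight; congr (expeR (- _) * expeR _);
  apply: eq_integral => u; rewrite inE/= in_itv/= => ut; by rewrite H.
Qed.

Lemma potentialD a b : potential a -> potential b -> potential (a \+ b)%R.
Proof.
move=> [ma a0] [mb b0]; split; first exact: measurable_funD.
by move=> x; rewrite addr_ge0.
Qed.

Lemma potential0 : potential (cst 0%R).
Proof. by split => //; exact: measurable_cst. Qed.

Context {dO : measure_display} {Omega : measurableType dO}.
Variables (P : probability Omega R) (X : R -> Omega -> 'rV[R]_d).
Hypothesis HX : levy_process P X.

Definition path_of (w : Omega) (u : R) : rV := X u w.

(** With a = b = 0 this is the free semigroup; with a = V_+ and b = V_- it is the Feynman-Kac
    semigroup. *)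
Definition fk (a b : rV -> R) (f : rV -> \bar R) (t : R) (x : rV) : \bar R :=
  \int[P]_w (fk_weight a b x t (path_of w) * f (x + X t w)%R).

(* Sample paths are only right continuous on [0, +oo[, so joint measurability in
   (w, t) is obtained for this extension to negative times. *)
Let Xr (z : Omega * R) : rV := regularize (sample X z.1) z.2.

Lemma measurable_Xr : measurable_fun setT Xr.
Proof.
have ms := measurable_sample HX.
have m1 : measurable_fun setT (fun z : Omega * R => (z.2, sample X z.1 : paths R d)).
  apply: measurable_fun_pair => //.
  by apply: (measurableT_comp ms).
exact: (measurableT_comp measurable_regularize m1).
Qed.

Lemma XrE w u : (0 <= u)%R -> Xr (w, u) = X u w.
Proof. by move=> u0; rewrite /Xr/= regularizeE//; exact: (right_cont_sample HX). Qed.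

Lemma fk_weightXr a b x t w : fk_weight a b x t (path_of w) =
  fk_weight a b x t (fun u => Xr (w, u)).
Proof.
rewrite /fk_weight; congr (expeR (- _) * expeR _);
  apply: eq_integral => u; rewrite inE/= in_itv/= => /andP[u0 _]; by rewrite XrE.
Qed.

Section measurability.
Context {dT : measure_display} {T : measurableType dT}.
Variables (x : T -> rV) (t : T -> R) (w : T -> Omega).
Hypotheses (mx : measurable_fun setT x) (mt : measurable_fun setT t)
  (mw : measurable_fun setT w).

Lemma measurable_fk_weight_path a b : potential a -> potential b ->
  measurable_fun setT (fun z => fk_weight a b (x z) (t z) (path_of (w z))).
Proof.
move=> pa pb; under eq_fun do rewrite fk_weightXr.
apply: (@measurable_fk_weight a b _ T x t (fun z : T * R => Xr (w z.1, z.2))) => //.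
apply: (measurableT_comp measurable_Xr); apply: measurable_fun_pair => //.
by apply: (measurableT_comp mw).
Qed.

Lemma measurable_position_path dS (S : measurableType dS) (f : rV -> S) :
  measurable_fun setT f -> (forall z, 0 <= t z)%R ->
  measurable_fun setT (fun z => f (x z + X (t z) (w z))%R).
Proof.
move=> mf t0; under eq_fun do rewrite -XrE//.
apply: (measurableT_comp mf); apply: measurable_funD_rV => //.
by apply: (measurableT_comp measurable_Xr); exact: measurable_fun_pair.
Qed.

End measurability.

Lemma measurable_fk_integrand a b f dT (T : measurableType dT)
    (x : T -> rV) (t : T -> R) (w : T -> Omega) :
  potential a -> potential b -> measurable_fun setT f ->
  measurable_fun setT x -> measurable_fun setT t -> measurable_fun setT w ->
  (forall z, 0 <= t z)%R ->
  measurable_fun setT (fun z => fk_weight a b (x z) (t z) (path_of (w z)) *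
    f (x z + X (t z) (w z))%R).
Proof.
move=> pa pb mf mx mt mw t0; apply: emeasurable_funM.
  exact: measurable_fk_weight_path.
exact: measurable_position_path.
Qed.

Lemma measurable_fk a b f dT (T : measurableType dT) (x : T -> rV) (t : T -> R) :
  potential a -> potential b -> measurable_fun setT f -> (forall y, 0 <= f y) ->
  measurable_fun setT x -> measurable_fun setT t -> (forall z, 0 <= t z)%R ->
  measurable_fun setT (fun z => fk a b f (t z) (x z)).
Proof.
move=> pa pb mf f0 mx mt t0.
apply: (@measurable_fun_fubini_tonelli_F _ _ _ _ _ P (fun z : T * Omega =>
  fk_weight a b (x z.1) (t z.1) (path_of z.2) * f (x z.1 + X (t z.1) z.2)%R)).
  apply: (@measurable_fk_integrand a b f _ _ (fun z => x z.1) (fun z => t z.1) snd) => //;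
  by [apply: (measurableT_comp mx)|apply: (measurableT_comp mt)].
by move=> z; rewrite mule_ge0// fk_weight_ge0.
Qed.

Lemma fk_ge0 a b f t x : (forall y, 0 <= f y) -> 0 <= fk a b f t x.
Proof.
by move=> f0; apply: integral_ge0 => w _; rewrite mule_ge0// fk_weight_ge0.
Qed.

(** The two periods may carry different potentials because Duhamel's formula mixes two semigroups.
    All functionals are rewritten through [regularize], which makes them measurable on [paths] and
    leaves them unchanged on sample paths. *)
Lemma markov_fk a1 b1 a2 b2 (F f : rV -> \bar R) (r s : R) x :
  potential a1 -> potential b1 -> potential a2 -> potential b2 ->
  measurable_fun setT F -> measurable_fun setT f ->
  (forall y, 0 <= F y) -> (forall y, 0 <= f y) -> (0 <= r)%R -> (0 <= s)%R ->
  \int[P]_w (fk_weight a1 b1 x r (path_of w) * F (x + X r w)%R *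
    (fk_weight a2 b2 x s (fun u => X (r + u)%R w) * f (x + X (r + s) w)%R)) =
  fk a1 b1 (fun y => F y * fk a2 b2 f s y) r x.
Proof.
move=> pa1 pb1 pa2 pb2 mF mf F0 f0 r0 s0.
pose S y (xi : paths R d) : \bar R := fk_weight a2 b2 y s (fun u => regularize xi u) *
  f (y + regularize xi s)%R.
pose G (xi : paths R d) : \bar R :=
  fk_weight a1 b1 x r (fun u => regularize xi u) * F (x + regularize xi r)%R *
  (fk_weight a2 b2 x s (fun u => regularize xi (r + u)%R) * f (x + regularize xi (r + s))%R).
have mreg (c : R) : measurable_fun setT (fun xi : paths R d => regularize xi c).
  exact: (measurableT_comp measurable_regularize (pair1_measurable c)).
have mrego : measurable_fun setT (fun z : paths R d * R => regularize z.1 z.2).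
  apply: (measurableT_comp measurable_regularize (_ : measurable_fun setT (fun z : paths R d * R => (z.2, z.1)))).
  exact: measurable_fun_pair.
have mregr : measurable_fun setT (fun z : paths R d * R => regularize z.1 (r + z.2)%R).
  apply: (measurableT_comp mrego (_ : measurable_fun setT (fun z : paths R d * R => (z.1, r + z.2)%R))).
  by apply: measurable_fun_pair => //; exact: measurable_funD.
have mS y : measurable_fun setT (S y).
  apply: emeasurable_funM.
    exact: (@measurable_fk_weight a2 b2 _ (paths R d) (cst y) (cst s) (fun z => regularize z.1 z.2)).
  by apply: (measurableT_comp mf); exact: measurable_funD_rV.
have S0 y xi : 0 <= S y xi by rewrite mule_ge0// fk_weight_ge0.
have mG : measurable_fun setT G.
  apply: emeasurable_funM; apply: emeasurable_funM.
  - exact: (@measurable_fk_weight a1 b1 _ (paths R d) (cst x) (cst r) (fun z => regularize z.1 z.2)).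
  - by apply: (measurableT_comp mF); exact: measurable_funD_rV.
  - exact: (@measurable_fk_weight a2 b2 _ (paths R d) (cst x) (cst s) (fun z => regularize z.1 (r + z.2)%R)).
  - by apply: (measurableT_comp mf); exact: measurable_funD_rV.
have G0 xi : 0 <= G xi.
  by apply: mule_ge0; apply: mule_ge0 => //; exact: fk_weight_ge0.
have rcs w : right_cont (sample X w) by exact: (right_cont_sample HX).
transitivity (\int[P]_w G (sample X w)).
  apply: eq_integral => w _.
  have rE u : (0 <= u)%R -> regularize (sample X w) u = X u w by exact: regularizeE.
  rewrite /G (rE r r0) (rE _ (addr_ge0 r0 s0)).
  congr (_ * _ * (_ * _)); apply: eq_fk_weight => // u /andP[u0 _].
    by rewrite (rE _ u0).
  by rewrite (rE _ (addr_ge0 r0 u0)).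
rewrite (markov_path HX r0 mG G0); apply: eq_integral => w _.
pose c w' := concat r (sample X w) (sample X w').
have rcc w' : right_cont (c w') by exact: right_cont_concat.
have fk_eq y : fk a2 b2 f s y = \int[P]_w' S y (fun t => X t w' - X 0 w')%R.
  rewrite (sample0_integral HX (mS y) (S0 y)); apply: eq_integral => w' _.
  rewrite /S regularizeE//; congr (_ * _); apply: eq_fk_weight => // u /andP[u0 _].
  by rewrite regularizeE.
have rc0 w' : right_cont (fun t => X t w' - X 0 w')%R.
  by move=> u v u0 uv vu; apply: cvgB; [exact: (rcs w')|exact: cvg_cst].
rewrite fk_eq.
transitivity (\int[P]_w' (fk_weight a1 b1 x r (path_of w) * F (x + X r w)%R *
    S (x + X r w)%R (fun t => X t w' - X 0 w')%R)).
  apply: eq_integral => w' _; rewrite -/(c w').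
  have rE u : (0 <= u)%R -> regularize (c w') u = c w' u by exact: regularizeE.
  have rE' u : (0 <= u)%R -> regularize (fun t => X t w' - X 0 w')%R u = (X u w' - X 0 w')%R.
    exact: regularizeE.
  rewrite /G (rE r r0) (rE _ (addr_ge0 r0 s0)).
  have cle u : (0 <= u <= r)%R -> c w' u = X u w.
    move=> /andP[u0]; rewrite le_eqVlt /c /concat => /predU1P[->|->]//.
    by rewrite ltxx subrr subrr addr0.
  have cge u : (0 <= u)%R -> c w' (r + u)%R = (X r w + (X u w' - X 0 w'))%R.
    move=> u0; rewrite /c /concat ltNge lerDl u0/=.
    by rewrite /sample (addrC r) addrK.
  rewrite cle ?r0 ?lexx// cge// addrA; congr (_ * _ * _).
    by apply: eq_fk_weight => // u ur; have /andP[u0 _] := ur; rewrite (rE _ u0) cle.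
  have -> : S (x + X r w)%R (fun t => X t w' - X 0 w')%R =
      fk_weight a2 b2 (x + X r w)%R s (fun u => regularize (fun t => X t w' - X 0 w')%R u) *
      f (x + X r w + (X s w' - X 0 w'))%R by rewrite /S (rE' _ s0).
  apply: (congr2 mule _ (erefl _)).
  apply: eq_fk_weight => // u /andP[u0 _]; rewrite (rE' _ u0) (rE _ (addr_ge0 r0 u0)).
  by rewrite cge// addrA.
rewrite ge0_integralZl//.
- by rewrite muleA.
- apply: (measurableT_comp (mS _)); apply: measurable_to_path => t t0.
  by apply: measurable_funB_rV; exact: (measurable_X HX).
- by rewrite mule_ge0// fk_weight_ge0.
Qed.

Lemma fk_weightD a b x r s w : potential a -> potential b -> (0 <= r)%R -> (0 <= s)%R ->
  fk_weight a b x (r + s)%R (path_of w) =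
  fk_weight a b x r (path_of w) * fk_weight a b x s (fun u => X (r + u)%R w).
Proof.
move=> [ma a0] [mb b0] r0 s0; rewrite !fk_weightXr.
have -> : fk_weight a b x s (fun u => X (r + u)%R w) =
    fk_weight a b x s (fun u => Xr (w, (r + u)%R)).
  by apply: eq_fk_weight => // u /andP[u0 _]; rewrite XrE// addr_ge0.
have mXw : measurable_fun setT (fun u => Xr (w, u)).
  exact: (measurableT_comp measurable_Xr (pair1_measurable w)).
have H (h : rV -> R) : measurable_fun setT h -> (forall y, 0 <= h y)%R ->
    \int[mu]_(u in `[0%R, (r + s)%R]) (h (x + Xr (w, u))%R)%:E =
    \int[mu]_(u in `[0%R, r]) (h (x + Xr (w, u))%R)%:E +
    \int[mu]_(u in `[0%R, s]) (h (x + Xr (w, (r + u)%R))%R)%:E.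
  move=> mh h0; rewrite ge0_integral_itvD//.
  - by apply/measurable_EFinP; apply: (measurableT_comp mh); exact: measurable_funD_rV.
  - by move=> u; rewrite lee_fin.
rewrite /fk_weight !H//.
rewrite oppeD; last first.
  by rewrite ge0_adde_def// inE; apply: integral_ge0 => u _; rewrite lee_fin.
exact: expeRD_ACA.
Qed.

Lemma fk_semigroup a b f r s x : potential a -> potential b ->
  measurable_fun setT f -> (forall y, 0 <= f y) -> (0 <= r)%R -> (0 <= s)%R ->
  fk a b f (r + s) x = fk a b (fk a b f s) r x.
Proof.
move=> pa pb mf f0 r0 s0.
have := @markov_fk a b a b (cst 1) f r s x pa pb pa pb (measurable_cst _) mf.
move=> /(_ (fun=> lee01) f0 r0 s0).
rewrite (_ : (fun y => cst 1 y * _) = fk a b f s); last by apply/funext => y; rewrite mul1e.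
move=> h; apply: etrans h; apply: eq_integral => w _.
rewrite fk_weightD// /cst mule1.
exact: (esym (muleA _ _ _)).
Qed.

Lemma fk_le a b (f g : rV -> \bar R) t x : potential a -> potential b -> (0 <= t)%R ->
  measurable_fun setT f -> measurable_fun setT g ->
  (forall y, 0 <= f y) -> (forall y, f y <= g y) ->
  fk a b f t x <= fk a b g t x.
Proof.
move=> pa pb t0 mf mg f0 fg; apply: ge0_le_integral => //.
- by move=> w _; rewrite mule_ge0// fk_weight_ge0.
- exact: (@measurable_fk_integrand a b f _ _ (cst x) (cst t) id).
- exact: (@measurable_fk_integrand a b g _ _ (cst x) (cst t) id).
- by move=> w _; apply: lee_wpmul2l => //; exact: fk_weight_ge0.
Qed.

Lemma fkZl a b (f : rV -> \bar R) t x (c : R) : potential a -> potential b ->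
  (0 <= t)%R -> measurable_fun setT f -> (forall y, 0 <= f y) -> (0 <= c)%R ->
  fk a b (fun y => c%:E * f y) t x = c%:E * fk a b f t x.
Proof.
move=> pa pb t0 mf f0 c0; rewrite -ge0_integralZl_EFin//.
- by apply: eq_integral => w _; rewrite muleCA.
- by move=> w _; rewrite mule_ge0// fk_weight_ge0.
- exact: (@measurable_fk_integrand a b f _ _ (cst x) (cst t) id).
Qed.

Lemma fkD a b (f g : rV -> \bar R) t x : potential a -> potential b ->
  (0 <= t)%R -> measurable_fun setT f -> measurable_fun setT g ->
  (forall y, 0 <= f y) -> (forall y, 0 <= g y) ->
  fk a b (fun y => f y + g y) t x = fk a b f t x + fk a b g t x.
Proof.
move=> pa pb t0 mf mg f0 g0; rewrite -ge0_integralD//.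
- by apply: eq_integral => w _; rewrite ge0_muleDr.
- by move=> w _; rewrite mule_ge0// fk_weight_ge0.
- exact: (@measurable_fk_integrand a b f _ _ (cst x) (cst t) id).
- by move=> w _; rewrite mule_ge0// fk_weight_ge0.
- exact: (@measurable_fk_integrand a b g _ _ (cst x) (cst t) id).
Qed.

Lemma fk_time_integral a b (f : R -> rV -> \bar R) t x : potential a -> potential b ->
  measurable_fun setT (fun z : R * rV => f z.1 z.2) -> (forall s y, 0 <= f s y) ->
  \int[mu]_(s in `[0%R, t]) fk a b (f s) s x =
  \int[P]_w \int[mu]_(s in `[0%R, t])
     (fk_weight a b x s (path_of w) * f s (x + X s w)%R).
Proof.
move=> pa pb mf f0.
(* Negative times are replaced by 0, since joint measurability of the position is available for
   nonnegative times. *)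
pose h (z : R * Omega) : \bar R := if (0 <= z.1 <= t)%R then
  fk_weight a b x (Num.max z.1 0%R) (path_of z.2) * f (Num.max z.1 0%R) (x + X (Num.max z.1 0%R) z.2)%R else 0.
have mmax : measurable_fun setT (fun z : R * Omega => Num.max z.1 0%R).
  by apply: measurable_maxr.
have mh : measurable_fun setT h.
  apply: measurable_fun_if => //.
    by apply: measurable_and; apply: measurable_fun_ler.
  apply: measurable_funTS; apply: emeasurable_funM.
    exact: (@measurable_fk_weight_path _ _ (cst x) (fun z : R * Omega => Num.max z.1 0%R) snd).
  apply: (measurableT_comp mf (_ : measurable_fun setT (fun z : R * Omega => (Num.max z.1 0%R, x + X (Num.max z.1 0%R) z.2)%R))).
  apply: measurable_fun_pair => //.
  apply: (@measurable_position_path _ _ (cst x) (fun z : R * Omega => Num.max z.1 0%R) snd _ _ _ _ _ id) => //.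
  by move=> z; rewrite le_max lexx orbT.
transitivity (\int[mu]_s \int[P]_w h (s, w)).
  rewrite integral_itvE; apply: eq_integral => s _; rewrite /h/=; case: ifPn => [/andP[s0 st]|_].
    by apply: eq_integral => w _; rewrite max_l.
  by rewrite integral0.
rewrite (@fubini_tonelli _ _ _ _ _ mu P h mh); last first.
  by move=> z; rewrite /h; case: ifP => // _; rewrite mule_ge0// fk_weight_ge0.
apply: eq_integral => w _; rewrite [RHS]integral_itvE; apply: eq_integral => s _.
by rewrite /h/=; case: ifPn => // /andP[s0 _]; rewrite max_l.
Qed.

End feynman_kac_kernel.

(** * Duhamel's formula *)

Section duhamel.
Local Open Scope ereal_scope.
Context {R : realType} {d : nat}.
Notation mu := (@lebesgue_measure R).
Notation rV := 'rV[R]_d.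
Context {dO : measure_display} {Omega : measurableType dO}.
Variables (P : probability Omega R) (X : R -> Omega -> 'rV[R]_d).
Hypothesis HX : levy_process P X.
Notation fk := (fk P X).
Notation path_of := (path_of X).

Lemma mule_AC5 (p q v k z : \bar R) : p * q * v * (k * z) = p * z * k * (q * v).
Proof. by rewrite -!muleA; congr (p * _); rewrite muleA muleC (muleC k) -muleA. Qed.

Lemma fubini_itv dT (T : measurableType dT) (m : {sigma_finite_measure set T -> \bar R})
    (h : R * T -> \bar R) t :
  measurable_fun setT h -> (forall z, 0 <= h z) ->
  \int[m]_w \int[mu]_(r in `[0%R, t]) h (r, w) =
  \int[mu]_(r in `[0%R, t]) \int[m]_w h (r, w).
Proof.
move=> mh h0.
pose k (z : R * T) : \bar R := if (0 <= z.1 <= t)%R then h z else 0.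
have mk : measurable_fun setT k.
  apply: measurable_fun_if => //; last exact: measurable_funTS.
  by apply: measurable_and; apply: measurable_fun_ler.
transitivity (\int[m]_w \int[mu]_r k (r, w)).
  by apply: eq_integral => w _; rewrite integral_itvE; apply: eq_integral.
rewrite -(@fubini_tonelli _ _ _ _ _ mu m k mk); last by move=> z; rewrite /k; case: ifP.
rewrite [RHS]integral_itvE; apply: eq_integral => r _; rewrite /k/=.
by case: ifPn => // _; rewrite integral0.
Qed.

(** Forces a time into [0, t], so that measurability lemmas asking for nonnegative times everywhere
    apply to integrands that matter only on this interval. *)
Definition clamp (t r : R) : R := Num.min (Num.max r 0%R) t.

Lemma clampE t r : (0 <= r <= t)%R -> clamp t r = r.
Proof. by move=> /andP[r0 rt]; rewrite /clamp max_l// min_l. Qed.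

Lemma clamp_itv t r : (0 <= t)%R -> (0 <= clamp t r <= t)%R.
Proof. by move=> t0; rewrite /clamp le_min ge_min lexx orbT t0 le_max lexx orbT. Qed.

Lemma measurable_clamp t dT (T : measurableType dT) (r : T -> R) :
  measurable_fun setT r -> measurable_fun setT (fun z => clamp t (r z)).
Proof.
move=> mr; apply: measurable_minr => //; exact: measurable_maxr.
Qed.

(** The path integrand before conditioning at time r: the first pair of potentials acts up to r, the
    second one from r to t. *)
Definition duhamel_integrand (a1 b1 a2 b2 : rV -> R) (F f : rV -> \bar R) t x r w :=
  fk_weight a1 b1 x r (path_of w) * F (x + X r w)%R *
  (fk_weight a2 b2 x (t - r) (fun u => X (r + u)%R w) * f (x + X t w)%R).

Lemma measurable_duhamel_integrand a1 b1 a2 b2 F f t x :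
  potential a1 -> potential b1 -> potential a2 -> potential b2 ->
  measurable_fun setT F -> measurable_fun setT f -> (0 <= t)%R ->
  measurable_fun setT (fun z : R * Omega =>
    duhamel_integrand a1 b1 a2 b2 F f t x (clamp t z.1) z.2).
Proof.
move=> pa1 pb1 pa2 pb2 mF mf t0.
have mc : measurable_fun setT (fun z : R * Omega => clamp t z.1) by exact: measurable_clamp.
have cl0 (z : R * Omega) : (0 <= clamp t z.1)%R by case/andP: (clamp_itv z.1 t0).
have clt (z : R * Omega) : (0 <= t - clamp t z.1)%R.
  by rewrite subr_ge0; case/andP: (clamp_itv z.1 t0).
apply: emeasurable_funM.
  exact: (@measurable_fk_integrand _ _ _ _ _ _ HX a1 b1 F _ _ (cst x) _ snd).
apply: emeasurable_funM; last first.
  exact: (@measurable_position_path _ _ _ _ _ _ HX _ _ (cst x) (cst t) snd).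
pose v (q : (R * Omega) * R) : rV :=
  regularize (sample X q.1.2) (clamp t q.1.1 + Num.max q.2 0)%R.
have mv : measurable_fun setT v.
  apply: (measurableT_comp measurable_regularize (_ : measurable_fun setT
    (fun q : (R * Omega) * R => ((clamp t q.1.1 + Num.max q.2 0)%R, sample X q.1.2 : paths R d)))).
  apply: measurable_fun_pair.
    apply: measurable_funD; last by apply: measurable_maxr => //; exact: measurable_snd.
    by apply: measurable_clamp; apply: measurableT_comp => //; exact: measurable_fst.
  by apply: (measurableT_comp (measurable_sample HX)); apply: measurableT_comp => //; exact: measurable_fst.
have := @measurable_fk_weight _ _ a2 b2 _ (R * Omega)%type (cst x) (fun z => t - clamp t z.1)%R v pa2 pb2.
move=> /(_ (measurable_cst _) _ mv) H.
have {}H := H (measurable_funB (measurable_cst _) mc).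
apply: eq_measurable_fun H => z _; apply: eq_fk_weight => // u /andP[u0 _].
by rewrite /v/= max_l// regularizeE ?addr_ge0//; exact: (right_cont_sample HX).
Qed.

Lemma duhamel_integrand_ge0 a1 b1 a2 b2 F f t x r w : (forall y, 0 <= F y) ->
  (forall y, 0 <= f y) -> 0 <= duhamel_integrand a1 b1 a2 b2 F f t x r w.
Proof.
by move=> F0 f0; apply: mule_ge0; apply: mule_ge0 => //; exact: fk_weight_ge0.
Qed.

Lemma integral_duhamel a1 b1 a2 b2 F f t x :
  potential a1 -> potential b1 -> potential a2 -> potential b2 ->
  measurable_fun setT F -> measurable_fun setT f ->
  (forall y, 0 <= F y) -> (forall y, 0 <= f y) -> (0 <= t)%R ->
  \int[P]_w \int[mu]_(r in `[0%R, t]) duhamel_integrand a1 b1 a2 b2 F f t x r w =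
  \int[mu]_(r in `[0%R, t]) fk a1 b1 (fun y => F y * fk a2 b2 f (t - r)%R y) r x.
Proof.
move=> pa1 pb1 pa2 pb2 mF mf F0 f0 t0.
transitivity (\int[P]_w \int[mu]_(r in `[0%R, t])
    duhamel_integrand a1 b1 a2 b2 F f t x (clamp t r) w).
  apply: eq_integral => w _; apply: eq_integral => r; rewrite inE/= in_itv/= => rt.
  by rewrite clampE.
rewrite (@fubini_itv _ _ P (fun z => duhamel_integrand a1 b1 a2 b2 F f t x (clamp t z.1) z.2)).
- apply: eq_integral => r; rewrite inE/= in_itv/= => rt; rewrite clampE//.
  have /andP[r0 rt'] := rt; have tr0 : (0 <= t - r)%R by rewrite subr_ge0.
  apply: etrans (@markov_fk _ _ _ _ _ _ HX a1 b1 a2 b2 F f r (t - r)%R x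
    pa1 pb1 pa2 pb2 mF mf F0 f0 r0 tr0).
  by apply: eq_integral => w _; rewrite /duhamel_integrand subrKC.
- exact: measurable_duhamel_integrand.
- by move=> z; exact: duhamel_integrand_ge0.
Qed.

Lemma fk_weight_addl (a b c : rV -> R) x r w : potential a -> potential c ->
  fk_weight (a \+ c)%R b x r (path_of w) =
  fk_weight a b x r (path_of w) *
    expeR (- \int[mu]_(u in `[0%R, r]) (c (x + X u w)%R)%:E).
Proof.
move=> [ma a0] [mc c0].
have mX : measurable_fun setT (fun u => regularize (sample X w) u).
  exact: (measurableT_comp measurable_regularize (pair2_measurable (sample X w : paths R d))).
have E (h : rV -> R) : \int[mu]_(u in `[0%R, r]) (h (x + X u w)%R)%:E =
    \int[mu]_(u in `[0%R, r]) (h (x + regularize (sample X w) u)%R)%:E.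
  apply: eq_integral => u; rewrite inE/= in_itv/= => /andP[u0 _].
  by rewrite regularizeE//; exact: (right_cont_sample HX).
have mh (h : rV -> R) : measurable_fun setT h ->
    measurable_fun `[0%R, r] (fun u => (h (x + regularize (sample X w) u)%R)%:E).
  move=> mh; apply: measurable_funTS; apply/measurable_EFinP.
  by apply: (measurableT_comp mh); exact: measurable_funD_rV.
rewrite /fk_weight /path_of !E; under eq_integral do rewrite EFinD.
rewrite ge0_integralD//; last 4 first.
- by move=> u _; rewrite lee_fin.
- exact: mh.
- by move=> u _; rewrite lee_fin.
- exact: mh.
rewrite oppeD ?expeRD; last first.
  by rewrite ge0_adde_def// inE; apply: integral_ge0 => u _; rewrite lee_fin.
by rewrite muleAC.
Qed.

(** Along a path with finite integral of c, 1 = exp(- int_0^t c) + int_0^t c(X_r) exp(- int_0^r c)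
    dr by [integral_expRN]. Multiplied by the weight of (a, b) and conditioned at time r, this is
    the formula. *)
Lemma duhamel (a b c : rV -> R) (f : rV -> \bar R) t x :
  potential a -> potential b -> potential c ->
  measurable_fun setT f -> (forall y, 0 <= f y) -> (0 <= t)%R ->
  {ae P, forall w, \int[mu]_(u in `[0%R, t]) (c (x + X u w)%R)%:E < +oo} ->
  fk a b f t x = fk (a \+ c)%R b f t x +
  \int[mu]_(r in `[0%R, t])
    fk (a \+ c)%R b (fun y => (c y)%:E * fk a b f (t - r)%R y) r x.
Proof.
move=> pa pb pc mf f0 t0 cfin; have [mc c0] := pc.
have pac := potentialD pa pc.
have mEc : measurable_fun setT (EFin \o c) by exact/measurable_EFinP.
have Ec0 y : 0 <= (EFin \o c) y by rewrite lee_fin.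
rewrite -(@integral_duhamel (a \+ c)%R b a b (EFin \o c) f t x)//.
have mI : measurable_fun setT (fun w =>
    \int[mu]_(r in `[0%R, t]) duhamel_integrand (a \+ c)%R b a b (EFin \o c) f t x r w).
  have := @measurable_integral_itv R _ Omega (fun z =>
    duhamel_integrand (a \+ c)%R b a b (EFin \o c) f t x (clamp t z.2) z.1).
  have m1 : measurable_fun setT (fun z : Omega * R =>
      duhamel_integrand (a \+ c)%R b a b (EFin \o c) f t x (clamp t z.2) z.1).
    have := @measurable_duhamel_integrand (a \+ c)%R b a b (EFin \o c) f t x pac pb pa pb mEc mf t0.
    move=> /measurableT_comp/(_ (_ : measurable_fun setT (fun z : Omega * R => (z.2, z.1)))); apply.
    exact: measurable_fun_pair.
  move=> /(_ m1 (fun=> duhamel_integrand_ge0 _ _ _ _ _ _ _ _ Ec0 f0)) H.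
  have := measurableT_comp H (pair1_measurable t : measurable_fun setT (fun w : Omega => (t, w))).
  apply: eq_measurable_fun => w _ /=; apply: eq_integral => r; rewrite inE/= in_itv/= => rt.
  by rewrite clampE.
have I0 w : 0 <= \int[mu]_(r in `[0%R, t]) duhamel_integrand (a \+ c)%R b a b (EFin \o c) f t x r w.
  by apply: integral_ge0 => r _; exact: duhamel_integrand_ge0.
have mfkc := @measurable_fk_integrand _ _ _ _ _ _ HX (a \+ c)%R b f _ Omega (cst x) (cst t) id
  pac pb mf (measurable_cst _) (measurable_cst _) (@measurable_id _ _ _) (fun=> t0).
have mfk := @measurable_fk_integrand _ _ _ _ _ _ HX a b f _ Omega (cst x) (cst t) id
  pa pb mf (measurable_cst _) (measurable_cst _) (@measurable_id _ _ _) (fun=> t0).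
have fkc0 w : 0 <= fk_weight (a \+ c)%R b x t (path_of w) * f (x + X t w)%R.
  by rewrite mule_ge0// fk_weight_ge0.
rewrite -ge0_integralD//; apply: ge0_ae_eq_integral => //.
- exact: emeasurable_funD.
- by move=> w _; rewrite mule_ge0// fk_weight_ge0.
- by move=> w _; rewrite adde_ge0.
apply: filterS cfin => w cw _.
have mX : measurable_fun setT (fun u => regularize (sample X w) u).
  exact: (measurableT_comp measurable_regularize (pair2_measurable (sample X w : paths R d))).
have XE u : (0 <= u)%R -> regularize (sample X w) u = X u w.
  by move=> u0; apply: regularizeE => //; exact: (right_cont_sample HX).
pose cX u := c (x + regularize (sample X w) u)%R.
have mcX : measurable_fun setT cX by apply: (measurableT_comp mc); exact: measurable_funD_rV.
have cXE r : \int[mu]_(u in `[0%R, r]) (c (x + X u w)%R)%:E = \int[mu]_(u in `[0%R, r]) (cX u)%:E.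
  by apply: eq_integral => u; rewrite inE/= in_itv/= => /andP[u0 _]; rewrite /cX XE.
have ID := @integral_expRN R cX t t0 mcX (fun=> c0 _).
rewrite -cXE in ID; have {}ID := ID cw.
set EC := expeR (- _) in ID.
have ECfin : EC \is a fin_num.
  rewrite ge0_fin_numE ?expeR_ge0//; apply: (@le_lt_trans _ _ (expeR 0)).
    by rewrite lee_expeR oppe_le0 integral_ge0// => v _; rewrite lee_fin.
  by rewrite expeR0 ltry.
pose J := \int[mu]_(r in `[0%R, t]) ((cX r)%:E * expeR (- \int[mu]_(u in `[0%R, r]) (cX u)%:E)).
have g0 r : 0 <= (cX r)%:E * expeR (- \int[mu]_(u in `[0%R, r]) (cX u)%:E).
  by apply: mule_ge0; [rewrite lee_fin; exact: c0|exact: expeR_ge0].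
have J0 : 0 <= J by exact: integral_ge0.
have one : 1 = EC + J by rewrite /J ID addeC subeK.
rewrite fk_weight_addl// -/EC.
pose e := fk_weight a b x t (path_of w) * f (x + X t w)%R.
have e0 : 0 <= e by rewrite mule_ge0// fk_weight_ge0.
transitivity (e * EC + e * J).
  by rewrite -ge0_muleDr ?expeR_ge0// -one mule1.
rewrite (muleAC _ EC) -/e; congr (_ + _).
have mint : measurable_fun `[0%R, t] (fun r => (cX r)%:E * expeR (- \int[mu]_(u in `[0%R, r]) (cX u)%:E)).
  apply: measurable_funTS; apply: emeasurable_funM; first exact/measurable_EFinP.
  apply: (measurableT_comp measurable_expeR); apply: measurableT_comp => //.
  have := @measurable_integral_itv R _ unit (fun z => (cX z.2)%:E).
  move=> k; have /k {}k : measurable_fun setT (fun z : unit * R => (cX z.2)%:E).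
    by apply/measurable_EFinP; exact: measurableT_comp.
  by apply: (measurableT_comp (k _) (pair2_measurable tt)) => z; rewrite lee_fin; exact: c0.
rewrite /J -ge0_integralZl//.
apply: eq_integral => r; rewrite inE/= in_itv/= => /andP[r0 rt].
have tr0 : (0 <= t - r)%R by rewrite subr_ge0.
rewrite /duhamel_integrand fk_weight_addl// -cXE /e.
rewrite -{1}(subrKC r t) (@fk_weightD _ _ _ _ _ _ HX)//.
rewrite /cX XE//; exact: mule_AC5.
Qed.

End duhamel.

Lemma mct_cvg d (T : measurableType d) (R : realType) (m : {measure set T -> \bar R})
    (D : set T) (f_ : (T -> \bar R)^nat) (f : T -> \bar R) :
  measurable D -> (forall n, measurable_fun D (f_ n)) ->
  (forall n x, D x -> (0 <= f_ n x)%E) ->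
  (forall x, D x -> {homo f_^~ x : n k / (n <= k)%N >-> (n <= k)%E}) ->
  (forall x, D x -> f_ n x @[n --> \oo] --> f x) ->
  (\int[m]_(x in D) f_ n x @[n --> \oo] --> \int[m]_(x in D) f x)%E.
Proof.
move=> mD mf f0 nd cf.
rewrite (_ : (\int[m]_(x in D) f x = \int[m]_(x in D) limn (f_^~ x))%E).
  exact: cvg_monotone_convergence.
by apply: eq_integral => x /set_mem Dx; apply/esym/cvg_lim => //; exact: cf.
Qed.

Lemma lee_of_cvg (R : realType) (u : (\bar R)^nat) (l c : \bar R) :
  u n @[n --> \oo] --> l -> (forall n, (u n <= c)%E) -> (l <= c)%E.
Proof.
move=> ul uc; have <- : limn u = l by apply/cvg_lim.
by apply: lime_le; [apply/cvg_ex; exists l|exact: nearW].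
Qed.

Lemma gee_of_cvg (R : realType) (u : (\bar R)^nat) (l c : \bar R) :
  u n @[n --> \oo] --> l -> (forall n, (c <= u n)%E) -> (c <= l)%E.
Proof.
move=> ul uc; have <- : limn u = l by apply/cvg_lim.
by apply: lime_ge; [apply/cvg_ex; exists l|exact: nearW].
Qed.

(** * Khasminskii's lemma and the domination principle *)

Section khasminskii.
Local Open Scope ereal_scope.
Context {R : realType} {d : nat}.
Notation mu := (@lebesgue_measure R).
Notation rV := 'rV[R]_d.
Context {dO : measure_display} {Omega : measurableType dO}.
Variables (P : probability Omega R) (X : R -> Omega -> 'rV[R]_d).
Hypothesis HX : levy_process P X.
Local Opaque fk fk_weight.
Notation fk := (fk P X).
Notation path_of := (path_of X).

Lemma fkE a b f t x :
  fk a b f t x = \int[P]_w (fk_weight a b x t (path_of w) * f (x + X t w)%R).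
Proof. by []. Qed.

Lemma fk_weightE (a b : rV -> R) x t xi : fk_weight a b x t xi =
  expeR (- \int[mu]_(u in `[0%R, t]) (a (x + xi u)%R)%:E) *
  expeR (\int[mu]_(u in `[0%R, t]) (b (x + xi u)%R)%:E).
Proof. by []. Qed.

Lemma measurable_potential (W : rV -> R) : potential W ->
  measurable_fun setT (EFin \o W).
Proof. by move=> [mW _]; exact/measurable_EFinP. Qed.

Lemma potential_ge0 (W : rV -> R) y : potential W -> 0 <= (EFin \o W) y.
Proof. by move=> [_ W0]; rewrite lee_fin. Qed.


Lemma measurable_fkx a b f t : potential a -> potential b -> measurable_fun setT f ->
  (forall y, 0 <= f y) -> (0 <= t)%R -> measurable_fun setT (fk a b f t).
Proof.
move=> pa pb mf f0 t0.
exact: (@measurable_fk _ _ _ _ _ _ HX a b f _ _ id (cst t)).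
Qed.

Lemma measurable_fks a b f x : potential a -> potential b -> measurable_fun setT f ->
  (forall y, 0 <= f y) ->
  measurable_fun setT (fun s : R => fk a b f (Num.max s 0)%R x).
Proof.
move=> pa pb mf f0.
apply: (@measurable_fk _ _ _ _ _ _ HX a b f _ R (cst x) (fun s => Num.max s 0)%R) => //.
- by apply: measurable_maxr.
- by move=> s; rewrite le_max lexx orbT.
Qed.

Lemma measurable_fks_itv (a b : rV -> R) (f : rV -> \bar R) (x : rV) (t : R) :
  potential a -> potential b -> measurable_fun setT f ->
  (forall y, 0 <= f y) ->
  measurable_fun `[0%R, t] (fun s : R => fk a b f s x).
Proof.
move=> pa pb mf f0.
have := measurable_fks x pa pb mf f0.
move=> /(measurable_funTS (D := `[0%R, t]%classic)); apply: eq_measurable_fun => s.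
by rewrite inE/= in_itv/= => /andP[s0 _]; rewrite max_l.
Qed.

Lemma fk_cst_le a b (c : R) f t x : potential a -> potential b -> (0 <= t)%R ->
  measurable_fun setT f -> (forall y, 0 <= f y) -> (0 <= c)%R ->
  (forall y, f y <= c%:E) -> fk a b f t x <= c%:E * fk a b (cst 1) t x.
Proof.
move=> pa pb t0 mf f0 c0 fc.
rewrite -(@fkZl _ _ _ _ _ _ HX a b (cst 1) t x c pa pb t0 (measurable_cst _) (fun=> lee01) c0).
apply: (@fk_le _ _ _ _ _ _ HX a b _ _ _ _ pa pb t0 mf _ f0).
  by rewrite (_ : (fun y : rV => _) = cst c%:E)//; apply/funext => y; rewrite /= mule1.
by move=> y; rewrite mule1.
Qed.

Lemma eq_fk a b f g t x : (forall y, f y = g y) -> fk a b f t x = fk a b g t x.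
Proof. by move=> fg; rewrite !fkE; apply: eq_integral => w _; rewrite fg. Qed.

Lemma eq_potential_path (W : rV -> R) x w t :
  \int[mu]_(u in `[0%R, t]) (W (x + X u w)%R)%:E =
  \int[mu]_(u in `[0%R, t]) (W (x + regularize (sample X w) u)%R)%:E.
Proof.
apply: eq_integral => u; rewrite inE/= in_itv/= => /andP[u0 _].
by rewrite regularizeE//; exact: (right_cont_sample HX).
Qed.

Lemma measurable_potential_path (W : rV -> R) x w :
  measurable_fun setT W ->
  measurable_fun setT (fun u => W (x + regularize (sample X w) u)%R).
Proof.
move=> mW; apply: (measurableT_comp mW); apply: measurable_funD_rV => //.
exact: (measurableT_comp measurable_regularize (pair2_measurable (sample X w : paths R d))).
Qed.

Lemma path_integral_le (W W' : rV -> R) x w t :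
  potential W -> potential W' -> (forall y, W y <= W' y)%R ->
  \int[mu]_(u in `[0%R, t]) (W (x + X u w)%R)%:E <=
  \int[mu]_(u in `[0%R, t]) (W' (x + X u w)%R)%:E.
Proof.
move=> [mW W0] [mW' W'0] WW'; rewrite !eq_potential_path; apply: ge0_le_integral => //.
- by move=> u _; rewrite lee_fin.
- by apply: measurable_funTS; apply/measurable_EFinP; exact: measurable_potential_path.
- by apply: measurable_funTS; apply/measurable_EFinP; exact: measurable_potential_path.
- by move=> u _; rewrite lee_fin.
Qed.

Lemma path_integral_bounded (W : rV -> R) (N : R) x w t :
  potential W -> (forall y, W y <= N)%R -> (0 <= t)%R ->
  \int[mu]_(u in `[0%R, t]) (W (x + X u w)%R)%:E <= (N * t)%:E.
Proof.
move=> pW WN t0; have N0 : (0 <= N)%R by apply: le_trans (WN 0%R); case: pW.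
rewrite -(integral_itv_cst N t0); apply: (@path_integral_le W (cst N)) => //.
Qed.

Lemma path_integral_ge0 (W : rV -> R) x w t : potential W ->
  0 <= \int[mu]_(u in `[0%R, t]) (W (x + X u w)%R)%:E.
Proof. by move=> [mW W0]; apply: integral_ge0 => u _; rewrite lee_fin. Qed.

Lemma fk_weight_le a b a' b' x t w : potential a -> potential b -> potential a' ->
  potential b' -> (forall y, a' y <= a y)%R -> (forall y, b y <= b' y)%R ->
  fk_weight a b x t (path_of w) <= fk_weight a' b' x t (path_of w).
Proof.
move=> pa pb pa' pb' aa bb; rewrite !fk_weightE; apply: lee_pmul; rewrite ?expeR_ge0//.
  by rewrite lee_expeR leeN2; exact: path_integral_le.
by rewrite lee_expeR; exact: path_integral_le.
Qed.

Lemma fk_weight00 x t w : fk_weight (cst 0%R) (cst 0%R) x t (path_of w) = 1.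
Proof.
by rewrite fk_weightE !integral0// oppe0 expeR0 mule1.
Qed.

Lemma fk00 f t x : fk (cst 0%R) (cst 0%R) f t x = \int[P]_w f (x + X t w)%R.
Proof. by rewrite fkE; apply: eq_integral => w _; rewrite fk_weight00 mul1e. Qed.

Definition occupation (W : rV -> R) (t : R) (x : rV) : \bar R :=
  \int[mu]_(s in `[0%R, t]) fk (cst 0%R) (cst 0%R) (EFin \o W) s x.

Lemma occupationE W t x : potential W -> occupation W t x =
  \int[P]_w \int[mu]_(s in `[0%R, t]) (W (x + X s w)%R)%:E.
Proof.
move=> pW; have [mW W0] := pW.
have m2 : measurable_fun setT (fun z : R * rV => (EFin \o W) z.2).
  by apply/measurable_EFinP; exact: measurableT_comp.
rewrite /occupation (@fk_time_integral _ _ _ _ _ _ HX _ _ (fun=> EFin \o W) t x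
  potential0 potential0 m2 (fun _ y => potential_ge0 y pW)).
by apply: eq_integral => w _; apply: eq_integral => s _; rewrite fk_weight00 mul1e.
Qed.

(** The number 1/2 is the ratio of the geometric series in Khasminskii's argument. *)
Definition small_occupation (W : rV -> R) :=
  exists2 t0 : R, (0 < t0)%R & forall x, occupation W t0 x <= (2^-1)%:E.

Lemma kato_small W : potential W -> kato P X W -> small_occupation W.
Proof.
move=> pW [_]; have [_ W0] := pW.
move=> /fine_cvgP[fin /cvgrPdist_lt/(_ (2^-1)%R)]; rewrite invr_gt0 ltr0n => /(_ isT) h.
pose S (t : R) := ereal_sup (range (fun x : rV =>
  \int[P]_w \int[mu]_(s in `[0%R, t]) `|W (x + X s w)%R|%:E)).
near ((0:R)%R^'+) => t; exists t; first by near: t; exact: nbhs_right_gt.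
have tf : S t \is a fin_num by near: t.
have h0 : (`|0 - fine (S t)| < 2^-1)%R by near: t.
rewrite sub0r normrN in h0 => x; rewrite occupationE//.
apply: (@le_trans _ _ (S t)).
  apply: ereal_sup_ubound; exists x => //.
  by apply: eq_integral => w _; apply: eq_integral => s _; rewrite ger0_norm.
rewrite -(fineK tf) lee_fin; apply: ltW; apply: le_lt_trans h0.
exact: ler_norm.
Unshelve. all: by end_near. Qed.

Lemma occupation_le W W' t x : potential W -> potential W' ->
  (forall y, W y <= W' y)%R -> occupation W t x <= occupation W' t x.
Proof.
move=> pW pW' WW'.
have mI V : potential V -> measurable_fun `[0%R, t] (fun s : R => fk (cst 0%R) (cst 0%R) (EFin \o V) s x).
  move=> pV; apply: measurable_fks_itv; [exact: potential0|exact: potential0|exact: measurable_potential|].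
  by move=> y; exact: potential_ge0.
apply: ge0_le_integral; [exact: measurable_itv| |exact: mI|exact: mI|].
- by move=> s _; apply: fk_ge0 => y; exact: potential_ge0.
- move=> s; rewrite /= in_itv/= => /andP[s0 _].
  apply: (@fk_le _ _ _ _ _ _ HX _ _ _ _ _ _ potential0 potential0 s0);
    [exact: measurable_potential|exact: measurable_potential|by move=> y; exact: potential_ge0|].
  by move=> y; rewrite lee_fin.
Qed.

(** Killing at rate W cancels the gain W, so the extra semigroup in [duhamel] is the free one. The
    bound on W keeps the two exponents finite, without which they would not cancel. *)
Lemma duhamel_gain (W : rV -> R) (N : R) f t x : potential W ->
  (forall y, W y <= N)%R -> measurable_fun setT f -> (forall y, 0 <= f y) -> (0 <= t)%R ->
  fk (cst 0%R) W f t x = fk (cst 0%R) (cst 0%R) f t x +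
  \int[mu]_(r in `[0%R, t]) fk (cst 0%R) (cst 0%R)
     (fun y => (W y)%:E * fk (cst 0%R) W f (t - r)%R y) r x.
Proof.
move=> pW WN mf f0 t0.
have cfin : {ae P, forall w, \int[mu]_(u in `[0%R, t]) (W (x + X u w)%R)%:E < +oo}.
  by apply: nearW => w; apply: le_lt_trans (ltry (N * t)); exact: path_integral_bounded.
rewrite (@duhamel _ _ _ _ _ _ HX (cst 0%R) W W f t x potential0 pW pW mf f0 t0 cfin).
have E r g : (0 <= r)%R -> fk (cst 0%R \+ W)%R W g r x = fk (cst 0%R) (cst 0%R) g r x.
  move=> r0; rewrite fk00 fkE; apply: eq_integral => w _.
  rewrite (@fk_weight_addl _ _ _ _ _ _ HX _ _ _ _ _ _ potential0 pW).
  rewrite fk_weightE integral0 oppe0 expeR0 mul1e -expeRD subee ?expeR0 ?mul1e//.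
  rewrite ge0_fin_numE ?path_integral_ge0//.
  by apply: le_lt_trans (ltry (N * r)); exact: path_integral_bounded.
rewrite (E t f t0); apply: (congr2 adde (erefl _)).
by apply: eq_integral => r; rewrite inE/= in_itv/= => /andP[r0 _]; exact: E.
Qed.

Lemma measurable_fk_param a b dZ (Z : measurableType dZ) (f : Z * rV -> \bar R)
    (r : Z -> R) x : potential a -> potential b -> measurable_fun setT f ->
  (forall z, 0 <= f z) -> measurable_fun setT r -> (forall z, 0 <= r z)%R ->
  measurable_fun setT (fun z => fk a b (fun y => f (z, y)) (r z) x).
Proof.
move=> pa pb mf f0 mr r0.
have mr1 : measurable_fun setT (fun z : Z * Omega => r z.1).
  exact: (measurableT_comp mr measurable_fst).
have m1 := @measurable_fk_weight_path _ _ _ _ _ _ HX _ (Z * Omega)%type (cst x) _ snd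
  (measurable_cst _) mr1 measurable_snd a b pa pb.
have m2 := @measurable_position_path _ _ _ _ _ _ HX _ (Z * Omega)%type (cst x) _ snd
  (measurable_cst _) mr1 measurable_snd _ _ id (@measurable_id _ _ _) (fun z => r0 z.1).
have m3 : measurable_fun setT (fun z : Z * Omega =>
    fk_weight a b x (r z.1) (path_of z.2) * f (z.1, (x + X (r z.1) z.2)%R)).
  apply: emeasurable_funM; first exact: m1.
  apply: (measurableT_comp mf); apply: measurable_fun_pair; first exact: measurable_fst.
  exact: m2.
have := @measurable_fun_fubini_tonelli_F _ _ _ _ _ P _ m3.
apply; move=> z; apply: mule_ge0; [exact: fk_weight_ge0|exact: f0].
Qed.

Lemma measurable_fk_mid (a1 b1 a2 b2 : rV -> R) (F f : rV -> \bar R) (x : rV) :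
  potential a1 -> potential b1 -> potential a2 -> potential b2 ->
  measurable_fun setT F -> measurable_fun setT f ->
  (forall y, 0 <= F y) -> (forall y, 0 <= f y) ->
  measurable_fun setT (fun z : R * R =>
    fk a1 b1 (fun y => F y * fk a2 b2 f (Num.max z.2 0)%R y) (Num.max z.1 0)%R x).
Proof.
move=> pa1 pb1 pa2 pb2 mF mf F0 f0.
have mm (g : R * R -> R) : measurable_fun setT g ->
    measurable_fun setT (fun z => Num.max (g z) 0)%R.
  by move=> mg; exact: measurable_maxr.
apply: (@measurable_fk_param a1 b1 _ (R * R)%type
  (fun z => F z.2 * fk a2 b2 f (Num.max z.1.2 0)%R z.2)) => //.
- apply: emeasurable_funM; first exact: (measurableT_comp mF measurable_snd).
  apply: (@measurable_fk _ _ _ _ _ _ HX a2 b2 f _ ((R * R) * rV)%type snd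
    (fun z => Num.max z.1.2 0)%R) => //.
    apply: (measurable_maxr (measurableT_comp measurable_snd measurable_fst)).
    exact: measurable_cst.
  by move=> z; rewrite le_max lexx orbT.
- by move=> z; apply: mule_ge0 => //; exact: fk_ge0.
- exact: (mm fst measurable_fst).
- by move=> z; rewrite le_max lexx orbT.
Qed.

Lemma measurable_fk_mid_itv (a1 b1 a2 b2 : rV -> R) (F f : rV -> \bar R) (t : R) (x : rV) :
  potential a1 -> potential b1 -> potential a2 -> potential b2 ->
  measurable_fun setT F -> measurable_fun setT f ->
  (forall y, 0 <= F y) -> (forall y, 0 <= f y) ->
  measurable_fun `[0%R, t] (fun r =>
    fk a1 b1 (fun y => F y * fk a2 b2 f (t - r)%R y) r x).
Proof.
move=> pa1 pb1 pa2 pb2 mF mf F0 f0.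
have m := @measurable_fk_mid a1 b1 a2 b2 F f x pa1 pb1 pa2 pb2 mF mf F0 f0.
have m2 : measurable_fun setT (fun r : R => (r, (t - r)%R)).
  by apply: measurable_fun_pair => //; exact: measurable_funB.
have := measurableT_comp m m2.
move=> /(measurable_funTS (D := `[0%R, t]%classic)); apply: eq_measurable_fun => r.
rewrite inE/= in_itv/= => /andP[r0 rt] /=.
by rewrite (max_l r0) max_l// subr_ge0.
Qed.

(** By Duhamel's formula a uniform bound c improves to 1 + c / 2, a map with fixed point 2. The
    bound N of W provides the starting value e^(N t0); it disappears in the limit, so the result is
    uniform over truncations. *)
Lemma fk_exp_bounded (W : rV -> R) (N : R) t0 : potential W ->
  (forall y, W y <= N)%R -> (0 <= t0)%R ->
  (forall x, occupation W t0 x <= (2^-1)%:E) ->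
  forall s x, (0 <= s <= t0)%R -> fk (cst 0%R) W (cst 1) s x <= 2%:E.
Proof.
move=> pW WN t00 hocc.
have N0 : (0 <= N)%R by apply: le_trans (WN 0%R); case: pW.
have m1 : measurable_fun [set: rV] (cst (1 : \bar R)) by exact: measurable_cst.
pose c k : R := (2 + expR (N * t0) / 2 ^+ k)%R.
have c0 k : (0 <= c k)%R by rewrite addr_ge0// divr_ge0 ?expR_ge0 ?exprn_ge0.
suff H k s x : (0 <= s <= t0)%R -> fk (cst 0%R) W (cst 1) s x <= (c k)%:E.
  move=> s x st; apply: (@gee_of_cvg _ (fun k => (c k)%:E)); last by move=> k; exact: H.
  apply: cvg_EFin; first exact: nearW.
  rewrite -[X in _ --> X]addr0; apply: cvgD; first exact: cvg_cst.
  rewrite -(mulr0 (expR (N * t0))); apply: cvgM; first exact: cvg_cst.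
  by under eq_fun do rewrite -exprVn; apply: cvg_expr; rewrite ger0_norm ?invf_lt1 ?ltr1n.
elim: k s x => [|k ih] s x /andP[s0 st].
  apply: (@le_trans _ _ (expR (N * t0))%:E); last first.
    by rewrite lee_fin /c expr0 divr1 lerDr.
  rewrite -[leRHS](integral_probability_cst P) fkE; apply: ge0_le_integral => //.
  - by move=> w _; rewrite mule1 fk_weight_ge0.
  - exact: (@measurable_fk_integrand _ _ _ _ _ _ HX (cst 0%R) W _ _ _ (cst x) (cst s) id).
  - move=> w _; rewrite mule1 fk_weightE integral0 oppe0 expeR0 mul1e.
    rewrite -[leRHS]/(expeR (N * t0)%:E) lee_expeR.
    apply: (le_trans (path_integral_bounded x w pW WN s0)).
    by rewrite lee_fin ler_wpM2l.
rewrite (duhamel_gain x pW WN m1 (fun=> lee01) s0) fk00 integral_probability_cst.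
apply: (@le_trans _ _ (1 + (c k)%:E * (2^-1)%:E)); last first.
  rewrite -EFinM -EFinD lee_fin /c exprS invfM; move: (expR _) (2 ^+ k)^-1%R => p q; nra.
rewrite leeD2l//.
apply: (@le_trans _ _ ((c k)%:E * occupation W s x)).
  rewrite /occupation -ge0_integralZl_EFin//; last 2 first.
  - by move=> r _; apply: fk_ge0 => y; exact: potential_ge0.
  - by apply: measurable_fks_itv; [exact: potential0|exact: potential0|exact: measurable_potential|move=> y; exact: potential_ge0].
  apply: ge0_le_integral; [exact: measurable_itv| | | |].
  - move=> r _; apply: fk_ge0 => y; apply: mule_ge0; first by rewrite lee_fin; case: pW.
    by apply: fk_ge0 => z; exact: lee01.
  - apply: (@measurable_fk_mid_itv _ _ (cst 0%R) W (EFin \o W) (cst 1) s x) => //.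
    + exact: measurable_potential.
    + by move=> y; exact: potential_ge0.
  - apply: emeasurable_funM; first exact: measurable_cst.
    by apply: measurable_fks_itv; [exact: potential0|exact: potential0|exact: measurable_potential|move=> y; exact: potential_ge0].
  - move=> r; rewrite /= in_itv/= => /andP[r0 rs].
    have sr0 : (0 <= s - r)%R by rewrite subr_ge0.
    rewrite -(@fkZl _ _ _ _ _ _ HX (cst 0%R) (cst 0%R) (EFin \o W) r x (c k) potential0 potential0 r0
      (measurable_potential pW) (fun y => potential_ge0 y pW) (c0 k)).
    apply: (@fk_le _ _ _ _ _ _ HX _ _ _ _ _ _ potential0 potential0 r0).
    + apply: emeasurable_funM; first exact: measurable_potential.
      exact: measurable_fkx potential0 pW m1 (fun=> lee01) sr0.
    + by apply: emeasurable_funM; [exact: measurable_cst|exact: measurable_potential].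
    + move=> y; apply: mule_ge0; first exact: potential_ge0.
      by apply: fk_ge0 => z; exact: lee01.
    + move=> y; rewrite muleC; apply: lee_wpmul2r; first exact: potential_ge0.
      by apply: ih; rewrite sr0/=; apply: le_trans st; rewrite gerBl.
apply: lee_wpmul2l; rewrite ?lee_fin//; apply: le_trans (hocc x).
apply: ge0_subset_integral => //.
- by apply: measurable_fks_itv; [exact: potential0|exact: potential0|exact: measurable_potential|move=> y; exact: potential_ge0].
- by move=> r _; apply: fk_ge0 => y; exact: potential_ge0.
- by move=> u; rewrite /= !in_itv/= => /andP[-> /le_trans]; apply.
Qed.

End khasminskii.

Lemma cvg_mule_nondecreasing (R : realType) (c l : \bar R) (u : (\bar R)^nat) :
  (0 <= c)%E -> (forall n, 0 <= u n)%E -> (forall n, u n <= l)%E ->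
  u n @[n --> \oo] --> l -> (c * u n)%E @[n --> \oo] --> (c * l)%E.
Proof.
move=> c0 u0 ul cu; case: c c0 => [r| |//] r0; first exact: cvgeZl.
have l0 : (0 <= l)%E by apply: le_trans (u0 0%N) (ul 0%N).
have [l00|ln0] := eqVneq l 0%E.
  have E n : u n = 0%E by apply/eqP; rewrite eq_le u0 andbT -l00.
  by rewrite l00; under eq_fun do rewrite E; exact: cvg_cst.
have lp : (0 < l)%E by rewrite lt_neqAle eq_sym ln0.
rewrite gt0_mulye//; apply: cvg_near_cst.
have : nbhs l [set y : \bar R | (0 < y)%E].
  by apply: open_nbhs_nbhs; split => //; exact: open_ereal_gt_ereal.
by move=> /cu h; near=> n; rewrite gt0_mulye//; near: n; exact: h.
Unshelve. all: by end_near.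
Qed.

Section domination.
Local Open Scope ereal_scope.
Context {R : realType} {d : nat}.
Notation mu := (@lebesgue_measure R).
Notation rV := 'rV[R]_d.
Context {dO : measure_display} {Omega : measurableType dO}.
Variables (P : probability Omega R) (X : R -> Omega -> 'rV[R]_d).
Hypothesis HX : levy_process P X.
Local Opaque fk fk_weight.
Notation fk := (fk P X).
Notation path_of := (path_of X).

Definition truncation (W : rV -> R) (n : nat) (y : rV) : R := Num.min (W y) n%:R.

Lemma potential_truncation W n : potential W -> potential (truncation W n).
Proof.
move=> [mW W0]; split; first by apply: measurable_minr.
by move=> y; rewrite le_min W0 ler0n.
Qed.

Lemma truncation_le W n y : (truncation W n y <= W y)%R.
Proof. by rewrite ge_min lexx. Qed.

Lemma truncation_bound W n y : (truncation W n y <= n%:R)%R.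
Proof. by rewrite ge_min lexx orbT. Qed.

Lemma truncation_homo W y : {homo truncation W ^~ y : n k / (n <= k)%N >-> (n <= k)%R}.
Proof. by move=> n k nk; rewrite /truncation le_min ge_min lexx ge_min ler_nat nk orbT. Qed.

Lemma cvg_truncation W y : (truncation W n y)%:E @[n --> \oo] --> (W y)%:E.
Proof.
apply: cvg_near_cst; exists (Num.truncn (W y)).+1 => // n /= Wn.
congr (_%:E); apply: min_l; apply: le_trans (ltW (truncnS_gt (W y))) _.
by rewrite ler_nat.
Qed.

Lemma cvg_fk_truncation_potential W f t x : potential W ->
  measurable_fun setT f -> (forall y, 0 <= f y) -> (0 <= t)%R ->
  fk (cst 0%R) (truncation W n) f t x @[n --> \oo] --> fk (cst 0%R) W f t x.
Proof.
move=> pW mf f0 t0; have pT n := potential_truncation n pW.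
under eq_fun do rewrite fkE; rewrite fkE.
apply: mct_cvg => //.
- move=> n; exact: (@measurable_fk_integrand _ _ _ _ _ _ HX (cst 0%R) (truncation W n) f _ _ (cst x) (cst t) id potential0 (pT n) mf).
- by move=> n w _; rewrite mule_ge0// fk_weight_ge0.
- move=> w _ n k nk; apply: lee_wpmul2r => //.
  by apply: (fk_weight_le HX x t w potential0 (pT n) potential0 (pT k)) => // y; exact: truncation_homo.
- move=> w _; rewrite muleC; under eq_fun do rewrite muleC.
  apply: cvg_mule_nondecreasing => //.
  + by move=> n; exact: fk_weight_ge0.
  + by move=> n; apply: (fk_weight_le HX x t w potential0 (pT n) potential0 pW) => // y; exact: truncation_le.
  rewrite fk_weightE; under eq_fun do rewrite fk_weightE.
  apply: cvg_mule_nondecreasing.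
  + exact: expeR_ge0.
  + by move=> n; exact: expeR_ge0.
  + by move=> n; rewrite lee_expeR; apply: (path_integral_le HX) => // y; exact: truncation_le.
  apply: cvg_expeR; rewrite (eq_potential_path HX).
  under eq_fun do rewrite (eq_potential_path HX).
  apply: mct_cvg => //.
  + move=> n; apply: measurable_funTS; apply/measurable_EFinP; apply: measurable_potential_path.
    by case: (pT n).
  + by move=> n u _; rewrite lee_fin; case: (pT n).
  + by move=> u _ n k nk; rewrite lee_fin; exact: truncation_homo.
  + by move=> u _; exact: cvg_truncation.
Qed.

Lemma cvg_fk_truncation a b W t x : potential a -> potential b -> potential W -> (0 <= t)%R ->
  fk a b (EFin \o truncation W n) t x @[n --> \oo] --> fk a b (EFin \o W) t x.
Proof.
move=> pa pb pW t0; have pT n := potential_truncation n pW.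
under eq_fun do rewrite fkE; rewrite fkE.
apply: mct_cvg => //.
- move=> n; exact: (@measurable_fk_integrand _ _ _ _ _ _ HX a b _ _ _ (cst x) (cst t) id pa pb (measurable_potential (pT n))).
- by move=> n w _; rewrite mule_ge0 ?fk_weight_ge0//; exact: potential_ge0.
- move=> w _ n k nk; apply: lee_wpmul2l; first exact: fk_weight_ge0.
  by rewrite lee_fin; exact: truncation_homo.
- move=> w _; apply: cvg_mule_nondecreasing.
  + exact: fk_weight_ge0.
  + by move=> n; exact: potential_ge0.
  + by move=> n; rewrite lee_fin; exact: truncation_le.
  + exact: cvg_truncation.
Qed.

(** Monotone convergence carries the bound 2 on [0, t0] from the truncations to W, and the semigroup
    property doubles it with each further step of length t0. *)
Lemma khasminskii W t : potential W -> small_occupation P X W -> (0 <= t)%R ->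
  exists2 C : R, (1 <= C)%R & forall s x, (0 <= s <= t)%R -> fk (cst 0%R) W (cst 1) s x <= C%:E.
Proof.
move=> pW [t0 t00 hocc] tge0.
have m1 : measurable_fun [set: rV] (cst (1 : \bar R)) by exact: measurable_cst.
have H s x : (0 <= s <= t0)%R -> fk (cst 0%R) W (cst 1) s x <= 2%:E.
  move=> st; have /andP[s0 _] := st.
  have cv := @cvg_fk_truncation_potential W _ s x pW m1 (fun=> lee01) s0.
  apply: (lee_of_cvg cv) => n.
  have hn y : occupation P X (truncation W n) t0 y <= (2^-1)%:E.
    apply: le_trans (hocc y); apply: (occupation_le HX) => //.
      exact: potential_truncation.
    by move=> z; exact: truncation_le.
  exact: (@fk_exp_bounded _ _ _ _ _ _ HX (truncation W n) n%:R t0 (potential_truncation n pW)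
    (truncation_bound W n) (ltW t00) hn s x st).
have K k s x : (0 <= s <= k%:R * t0)%R -> fk (cst 0%R) W (cst 1) s x <= (2 ^+ k.+1)%:E.
  elim: k s x => [|k ih] s x.
    rewrite mul0r => /andP[s0 s0']; rewrite expr1; apply: H.
    by rewrite s0 (le_trans s0' (ltW t00)).
  move=> /andP[s0 st].
  have [st0|st0] := leP s t0.
    apply: le_trans (H s x _) _; first by rewrite s0.
    by rewrite lee_fin exprS ler_peMr// exprn_ege1// ler1n.
  have s1 : (0 <= s - t0 <= k%:R * t0)%R.
    by rewrite subr_ge0 (ltW st0)/= lerBlDr -[X in (_ + X)%R]mul1r -mulrDl natr1.
  have /andP[s10 _] := s1.
  rewrite -(subrKC t0 s) (@fk_semigroup _ _ _ _ _ _ HX _ _ _ _ _ _ potential0 pW m1 (fun=> lee01) (ltW t00) s10).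
  apply: (@le_trans _ _ ((2 ^+ k.+1)%:E * fk (cst 0%R) W (cst 1) t0 x)).
    have f0 y : 0 <= fk (cst 0%R) W (cst 1) (s - t0)%R y by apply: fk_ge0 => z; exact: lee01.
    have c0 : (0 <= 2 ^+ k.+1 :> R)%R by rewrite exprn_ge0.
    exact: (@fk_cst_le _ _ _ _ _ _ HX _ _ _ _ _ x potential0 pW (ltW t00)
      (@measurable_fkx _ _ _ _ _ _ HX _ _ _ _ potential0 pW m1 (fun=> lee01) s10) f0 c0
      (fun y => ih _ y s1)).
  rewrite (exprSr _ k.+1) EFinM; apply: lee_wpmul2l; first by rewrite lee_fin exprn_ge0.
  by apply: H; rewrite lexx ltW.
exists (2 ^+ (Num.truncn (t / t0)).+2)%R; first by rewrite exprn_ege1// ler1n.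
move=> s x /andP[s0 st]; apply: K; rewrite s0/= (le_trans st)//.
by rewrite -ler_pdivrMr// ltW// truncnS_gt.
Qed.

Lemma fk_integral a b (g : R * rV -> \bar R) T r x : potential a -> potential b ->
  measurable_fun setT g -> (forall z, 0 <= g z) -> (0 <= r)%R ->
  fk a b (fun y => \int[mu]_(q in `[0%R, T]) g (q, y)) r x =
  \int[mu]_(q in `[0%R, T]) fk a b (fun y => g (q, y)) r x.
Proof.
move=> pa pb mg g0 r0; rewrite fkE.
pose h (z : R * Omega) := fk_weight a b x r (path_of z.2) * g (z.1, (x + X r z.2)%R).
have mw : measurable_fun setT (fun w => fk_weight a b x r (path_of w)).
  exact: (@measurable_fk_weight_path _ _ _ _ _ _ HX _ Omega (cst x) (cst r) id).
have mX : measurable_fun setT (fun w => x + X r w)%R.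
  exact: (@measurable_position_path _ _ _ _ _ _ HX _ Omega (cst x) (cst r) id
    (measurable_cst _) (measurable_cst _) (@measurable_id _ _ _) _ _ id (@measurable_id _ _ _) (fun=> r0)).
have mh : measurable_fun setT h.
  apply: emeasurable_funM; first exact: (measurableT_comp mw measurable_snd).
  apply: (measurableT_comp mg); apply: measurable_fun_pair; first exact: measurable_fst.
  exact: (measurableT_comp mX measurable_snd).
have h0 z : 0 <= h z by rewrite mule_ge0// fk_weight_ge0.
transitivity (\int[P]_w \int[mu]_(q in `[0%R, T]) h (q, w)).
  apply: eq_integral => w _; rewrite -ge0_integralZl//; last exact: fk_weight_ge0.
  apply: measurable_funTS.
  exact: (measurableT_comp mg (pair2_measurable (x + X r w)%R : measurable_fun setT (fun q : R => (q, (x + X r w)%R)))).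
rewrite (fubini_itv P T mh h0); apply: eq_integral => q _; by rewrite fkE.
Qed.

Definition positivity (W : rV -> R) (n : nat) (y : rV) : R :=
  if (0 < W y)%R then n%:R else 0%R.

Lemma potential_positivity W n : potential W -> potential (positivity W n).
Proof.
move=> [mW W0]; split; last by move=> y; rewrite /positivity; case: ifP.
apply: measurable_fun_ifT => //; exact: measurable_fun_ltr.
Qed.

Lemma positivity_bound W n y : (positivity W n y <= n%:R)%R.
Proof. by rewrite /positivity; case: ifP. Qed.

(* Killing at rate n on {W > 0} and expanding [fk a b u] by Duhamel's formula
   bounds the expected killing weighted by u >= c; as n tends to infinity this
   controls the probability of ever reaching {W > 0}, after which the time
   integral of W contributes at most B. *)
Section bounded_domination.
Variables (a b W u : rV -> R) (al be c B t : R).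
Hypotheses (pa : potential a) (pb : potential b) (pW : potential W) (pu : potential u)
  (al0 : (0 < al)%R) (c0 : (0 < c)%R) (t0 : (0 <= t)%R)
  (ulow : forall s y, (0 <= s <= t)%R -> (al * u y)%:E <= fk a b (EFin \o u) s y)
  (uup : forall y, fk a b (EFin \o u) t y <= (be * u y)%:E)
  (uW : forall y, (0 < W y)%R -> (c <= u y)%R)
  (WB : forall y, \int[mu]_(s in `[0%R, t]) fk a b (EFin \o W) s y <= B%:E).

Let C n := positivity W n.
Let pC n : potential (C n) := potential_positivity n pW.
Let J n x := \int[mu]_(r in `[0%R, t]) fk (a \+ C n)%R b (EFin \o C n) r x.

Let Cfin n x s : (0 <= s)%R ->
  {ae P, forall w, \int[mu]_(v in `[0%R, s]) (C n (x + X v w)%R)%:E < +oo}.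
Proof.
move=> s0; apply: nearW => w; apply: le_lt_trans (ltry (n%:R * s)).
apply: (path_integral_bounded HX _ _ (pC n)) => //; exact: positivity_bound.
Qed.

Let mfks a1 b1 f x : potential a1 -> potential b1 -> potential f ->
  measurable_fun `[0%R, t] (fun s : R => fk a1 b1 (EFin \o f) s x).
Proof.
move=> p1 p2 pf; apply: (measurable_fks_itv HX) => //.
  exact: measurable_potential.
by move=> y; exact: potential_ge0.
Qed.

Let J_le n x : (al * c)%:E * J n x <= (be * u x)%:E.
Proof.
apply: le_trans (uup x).
have pac := potentialD pa (pC n).
have mu' := measurable_potential pu.
rewrite (@duhamel _ _ _ _ _ _ HX a b (C n) (EFin \o u) t x pa pb (pC n) mu'
  (fun y => potential_ge0 y pu) t0 (Cfin n x t0)).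
apply: le_trans (leeDr _ (fk_ge0 P X _ _ _ _ (fun y => potential_ge0 y pu))).
have alc : (0 <= al * c)%R by rewrite mulr_ge0// ltW.
rewrite -ge0_integralZl_EFin//; last 2 first.
- by move=> s _; apply: fk_ge0 => y; exact: potential_ge0.
- exact: mfks.
apply: ge0_le_integral; [exact: measurable_itv| | | |].
- move=> s _; apply: mule_ge0 => //; apply: fk_ge0 => y; exact: potential_ge0.
- by apply: emeasurable_funM; [exact: measurable_cst|exact: mfks].
- apply: (measurable_fk_mid_itv HX) => //.
  + by apply/measurable_EFinP; case: (pC n).
  + by move=> y; rewrite lee_fin; case: (pC n).
  + by move=> y; exact: potential_ge0.
- move=> r; rewrite /= in_itv/= => /andP[r0 rt].
  have tr : (0 <= t - r <= t)%R by rewrite subr_ge0 rt gerBl.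
  have /andP[tr0 _] := tr.
  rewrite -(@fkZl _ _ _ _ _ _ HX _ _ _ _ x (al * c)%R pac pb r0
    (measurable_potential (pC n)) (fun y => potential_ge0 y (pC n)) alc).
  apply: (@fk_le _ _ _ _ _ _ HX _ _ _ _ _ _ pac pb r0).
  + by apply: emeasurable_funM; [exact: measurable_cst|exact: measurable_potential].
  + apply: emeasurable_funM; first by apply/measurable_EFinP; case: (pC n).
    exact: (@measurable_fkx _ _ _ _ _ _ HX _ _ _ _ pa pb mu' (fun y => potential_ge0 y pu) tr0).
  + by move=> y; rewrite mule_ge0//; exact: potential_ge0.
  (* Where killing can occur, u is at least c, and the remaining evolution loses at most the factor
     al. *)
  + move=> y; rewrite muleC; rewrite /C /= /positivity.
    case: ifPn => [Wy|_]; last by rewrite !mul0e.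
    apply: lee_wpmul2l => //; apply: le_trans (ulow y tr).
    by rewrite lee_fin ler_wpM2l ?(ltW al0)// uW.
Qed.

Let I_le k n x : (0 < n)%N -> (forall y, W y <= k)%R ->
  \int[mu]_(s in `[0%R, t]) fk a b (EFin \o W) s x <= (B + k / n%:R)%:E * J n x.
Proof.
move=> n0 Wk; have pac := potentialD pa (pC n).
have mW := measurable_potential pW; have mC := measurable_potential (pC n).
have W0 y := potential_ge0 y pW; have C0 y := potential_ge0 y (pC n).
have n0' : (0 < n%:R :> R)%R by rewrite ltr0n.
have k0 : (0 <= k)%R by apply: le_trans (Wk 0%R); case: pW.
have B0 : (0 <= B)%R.
  rewrite -lee_fin; apply: le_trans (WB 0%R); apply: integral_ge0 => s _; exact: fk_ge0.
have J0 : 0 <= J n x by apply: integral_ge0 => s _; exact: fk_ge0.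
pose h (z : R * R) := fk (a \+ C n)%R b (fun y => (C n y)%:E * fk a b (EFin \o W) (Num.max z.2 0)%R y) (Num.max z.1 0)%R x.
have mh : measurable_fun setT h.
  exact: (@measurable_fk_mid _ _ _ _ _ _ HX _ _ _ _ (EFin \o C n) (EFin \o W)).
have h0 z : 0 <= h z by apply: fk_ge0 => y; rewrite mule_ge0//; [exact: C0|exact: fk_ge0].
have mh' : measurable_fun setT (fun z : R * R => h (z.1, (z.2 - z.1)%R)).
  apply: (measurableT_comp mh); apply: measurable_fun_pair => //.
  by apply: measurable_funB; [exact: measurable_snd|exact: measurable_fst].
have E s : (0 <= s <= t)%R -> fk a b (EFin \o W) s x =
    fk (a \+ C n)%R b (EFin \o W) s x + \int[mu]_(r in `[0%R, s]) h (r, (s - r)%R).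
  move=> /andP[s0 st].
  rewrite (@duhamel _ _ _ _ _ _ HX a b (C n) (EFin \o W) s x pa pb (pC n) mW W0 s0 (Cfin n x s0)).
  apply: (congr2 adde (erefl _)); apply: eq_integral => r; rewrite inE/= in_itv/= => /andP[r0 rs].
  by rewrite /h/= (max_l r0) max_l// subr_ge0.
have -> : \int[mu]_(s in `[0%R, t]) fk a b (EFin \o W) s x =
    \int[mu]_(s in `[0%R, t]) (fk (a \+ C n)%R b (EFin \o W) s x +
      \int[mu]_(r in `[0%R, s]) h (r, (s - r)%R)).
  by apply: eq_integral => s; rewrite inE/= in_itv/=; exact: E.
have mI : measurable_fun `[0%R, t] (fun s : R => \int[mu]_(r in `[0%R, s]) h (r, (s - r)%R)).
  apply: measurable_funTS.
  have mk : measurable_fun setT (fun z : R * R => h (z.2, (z.1 - z.2)%R)).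
    apply: (measurableT_comp mh); apply: measurable_fun_pair => //.
    by apply: measurable_funB; [exact: measurable_fst|exact: measurable_snd].
  have H := @measurable_integral_itv R _ R _ mk (fun=> h0 _).
  have md : measurable_fun setT (fun s : R => (s, s)) by exact: measurable_fun_pair.
  exact: (measurableT_comp H md).
have fac0 s : 0 <= fk (a \+ C n)%R b (EFin \o W) s x by exact: fk_ge0.
have I0 s : 0 <= \int[mu]_(r in `[0%R, s]) h (r, (s - r)%R) by apply: integral_ge0 => r _; exact: h0.
rewrite (ge0_integralD mu (measurable_itv `[0%R, t]) (fun s _ => fac0 s) (mfks x pac pb pW) (fun s _ => I0 s) mI).
rewrite (@ge0_integral_triangle R (fun z => h (z.1, (z.2 - z.1)%R)) t mh' (fun=> h0 _)) /=.
(* Two contributions: up to the killing time, W <= (k / n) [C n]; after it, the restarted time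
   integral is at most B. *)
rewrite addrC EFinD ge0_muleDl ?lee_fin ?divr_ge0//; apply: leeD; last first.
  rewrite -ge0_integralZl_EFin//; last 3 first.
  - by move=> s _; exact: fk_ge0.
  - exact: mfks.
  - by rewrite divr_ge0.
  apply: ge0_le_integral; [exact: measurable_itv| | | |].
  - by move=> s _; exact: fk_ge0.
  - exact: mfks.
  - by apply: emeasurable_funM; [exact: measurable_cst|exact: mfks].
  - move=> s; rewrite /= in_itv/= => /andP[s0 st].
    have kn : (0 <= k / n%:R)%R by rewrite divr_ge0.
    rewrite -(@fkZl _ _ _ _ _ _ HX _ _ _ _ x (k / n%:R)%R pac pb s0 mC C0 kn).
    apply: (@fk_le _ _ _ _ _ _ HX _ _ _ _ _ _ pac pb s0) => //.
      by apply: emeasurable_funM; [exact: measurable_cst|].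
    move=> y; rewrite -EFinM lee_fin /C /positivity; case: ifPn => [_|].
      by rewrite divfK ?gt_eqF.
    by rewrite -leNgt mulr0.
rewrite -ge0_integralZl_EFin//; last 2 first.
- by move=> s _; exact: fk_ge0.
- exact: mfks.
apply: ge0_le_integral; [exact: measurable_itv| | | |].
- by move=> r _; apply: integral_ge0 => q _; exact: h0.
- apply: measurable_funTS.
  have mk : measurable_fun setT (fun z : R * R => h (z.1, (z.1 + z.2 - z.1)%R)).
    apply: (measurableT_comp mh); apply: measurable_fun_pair => //.
    by apply: measurable_funB; [apply: measurable_funD|exact: measurable_fst].
  have := @measurable_integral_itv R _ R _ mk (fun=> h0 _).
  move=> /measurableT_comp/(_ (_ : measurable_fun setT (fun r : R => ((t - r)%R, r)))); apply.
  by apply: measurable_fun_pair => //; exact: measurable_funB.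
- by apply: emeasurable_funM; [exact: measurable_cst|exact: mfks].
- move=> r; rewrite /= in_itv/= => /andP[r0 rt].
  pose g (z : R * rV) := (C n z.2)%:E * fk a b (EFin \o W) (Num.max z.1 0)%R z.2.
  have mg : measurable_fun setT g.
    apply: emeasurable_funM; first exact: (measurableT_comp mC measurable_snd).
    apply: (@measurable_fk _ _ _ _ _ _ HX a b _ _ (R * rV)%type snd (fun z => Num.max z.1 0)%R) => //.
      by apply: measurable_maxr; [exact: measurable_fst|exact: measurable_cst].
    by move=> z; rewrite le_max lexx orbT.
  have g0 z : 0 <= g z by rewrite mule_ge0//; [exact: C0|exact: fk_ge0].
  have -> : \int[mu]_(q in `[0%R, (t - r)%R]) h (r, (r + q - r)%R) =
      \int[mu]_(q in `[0%R, (t - r)%R]) fk (a \+ C n)%R b (fun y => g (q, y)) r x.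
    by apply: eq_integral => q _; rewrite /h/= (max_l r0) addrAC subrr add0r.
  rewrite -(@fk_integral _ _ _ _ _ _ pac pb mg g0 r0).
  rewrite -(@fkZl _ _ _ _ _ _ HX _ _ _ _ x B pac pb r0 mC C0 B0).
  apply: (@fk_le _ _ _ _ _ _ HX _ _ _ _ _ _ pac pb r0).
  + have := @measurable_integral_itv R _ rV (fun z => g (z.2, z.1)).
    have ms : measurable_fun setT (fun z : rV * R => (z.2, z.1)) by exact: measurable_fun_pair.
    move=> /(_ (measurableT_comp mg ms) (fun=> g0 _)) H.
    exact: (measurableT_comp H (pair1_measurable (t - r)%R : measurable_fun setT (fun y : rV => ((t - r)%R, y)))).
  + by apply: emeasurable_funM; [exact: measurable_cst|].
  + by move=> y; apply: integral_ge0 => q _; exact: g0.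
  + move=> y; rewrite /g/= ge0_integralZl_EFin//; last 3 first.
    * by move=> q _; exact: fk_ge0.
    * apply: measurable_funTS.
      exact: (measurable_fks HX).
    * by case: (pC n).
    rewrite muleC; apply: lee_wpmul2r; first exact: C0.
    apply: le_trans (WB y).
    have -> : \int[mu]_(q in `[0%R, (t - r)%R]) fk a b (EFin \o W) (Num.max q 0)%R y =
        \int[mu]_(q in `[0%R, (t - r)%R]) fk a b (EFin \o W) q y.
      by apply: eq_integral => q; rewrite inE/= in_itv/= => /andP[q0 _]; rewrite max_l.
    apply: ge0_subset_integral => //.
    * exact: mfks.
    * by move=> q _; exact: fk_ge0.
    * move=> q; rewrite /= !in_itv/= => /andP[-> qt]; apply: le_trans qt _.
      by rewrite gerBl.
Qed.

Lemma bounded_domination k x : (forall y, W y <= k)%R ->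
  \int[mu]_(s in `[0%R, t]) fk a b (EFin \o W) s x <= (B * be / (al * c) * u x)%:E.
Proof.
move=> Wk; have alc : (0 < al * c)%R by rewrite mulr_gt0.
have Jn n : J n x <= (be / (al * c) * u x)%:E.
  rewrite (_ : be / (al * c) * u x = (al * c)^-1 * (be * u x))%R; last by ring.
  by rewrite EFinM lee_pdivlMl.
pose D := (be / (al * c) * u x)%R.
have nd n : (0 <= B + k / n.+1%:R)%R.
  rewrite addr_ge0//; last by rewrite divr_ge0//; apply: le_trans (Wk 0%R); case: pW.
  rewrite -lee_fin; apply: le_trans (WB 0%R); apply: integral_ge0 => s _.
  by apply: fk_ge0 => y; exact: potential_ge0.
have cv : ((B + k / n.+1%:R) * D)%:E @[n --> \oo] --> (B * be / (al * c) * u x)%:E.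
  apply: cvg_EFin; first exact: nearW.
  rewrite (_ : B * be / (al * c) * u x = (B + k * 0) * D)%R; last by rewrite /D mulr0 addr0 !mulrA.
  apply: cvgM; last exact: cvg_cst.
  apply: cvgD; first exact: cvg_cst.
  by apply: cvgM; [exact: cvg_cst|exact: cvg_harmonic].
apply: (gee_of_cvg cv) => n; rewrite EFinM; apply: le_trans (I_le x (ltn0Sn n) Wk) _.
by apply: lee_wpmul2l; [rewrite lee_fin|exact: Jn].
Qed.
End bounded_domination.

(** The constant in [bounded_domination] is free of the bound on W, so truncations pass to the
    limit. *)
Lemma domination (a b W u : rV -> R) (al be c B t : R) x :
  potential a -> potential b -> potential W -> potential u ->
  (0 < al)%R -> (0 < c)%R -> (0 <= t)%R ->
  (forall s y, (0 <= s <= t)%R -> (al * u y)%:E <= fk a b (EFin \o u) s y) ->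
  (forall y, fk a b (EFin \o u) t y <= (be * u y)%:E) ->
  (forall y, (0 < W y)%R -> (c <= u y)%R) ->
  (forall y, \int[mu]_(s in `[0%R, t]) fk a b (EFin \o W) s y <= B%:E) ->
  \int[mu]_(s in `[0%R, t]) fk a b (EFin \o W) s x <= (B * be / (al * c) * u x)%:E.
Proof.
move=> pa pb pW pu al0 c0 t0 ulow uup uW WB.
have pT n := potential_truncation n pW.
have mI V y : potential V -> measurable_fun `[0%R, t] (fun s : R => fk a b (EFin \o V) s y).
  move=> pV; apply: (measurable_fks_itv HX) => //; first exact: measurable_potential.
  by move=> z; exact: potential_ge0.
have I0 V s y : potential V -> 0 <= fk a b (EFin \o V) s y.
  by move=> pV; apply: fk_ge0 => z; exact: potential_ge0.
have mono V V' s y : potential V -> potential V' -> (forall z, V z <= V' z)%R -> (0 <= s)%R ->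
    fk a b (EFin \o V) s y <= fk a b (EFin \o V') s y.
  move=> pV pV' VV' s0; apply: (@fk_le _ _ _ _ _ _ HX _ _ _ _ _ _ pa pb s0) => //;
    by [exact: measurable_potential|move=> z; exact: potential_ge0].
have cv : \int[mu]_(s in `[0%R, t]) fk a b (EFin \o truncation W n) s x @[n --> \oo] -->
    \int[mu]_(s in `[0%R, t]) fk a b (EFin \o W) s x.
  apply: mct_cvg.
  - exact: measurable_itv.
  - by move=> n; exact: mI.
  - by move=> n s _; exact: I0.
  - move=> s; rewrite /= in_itv/= => /andP[s0 _] n k nk; apply: mono => // z.
    exact: truncation_homo.
  - by move=> s; rewrite /= in_itv/= => /andP[s0 _]; exact: cvg_fk_truncation.
apply: (lee_of_cvg cv) => n.
apply: (@bounded_domination a b (truncation W n) u al be c B t pa pb (pT n) pu al0 c0 t0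
  ulow uup _ _ n%:R x (truncation_bound W n)) => y.
  by rewrite lt_min => /andP[Wy _]; exact: uW.
apply: le_trans (WB y); apply: ge0_le_integral; [exact: measurable_itv| | | |].
- by move=> s _; exact: I0.
- exact: mI.
- exact: mI.
- move=> s; rewrite /= in_itv/= => /andP[s0 _]; apply: mono => // z; exact: truncation_le.
Qed.

End domination.

(** * Dynkin's formula for a bump function *)

Section dot_product.
Context {R : realType} {d : nat}.
Implicit Types x y : 'rV[R]_d.

Lemma dotC x y : dot x y = dot y x.
Proof. by apply: eq_bigr => i _; rewrite mulrC. Qed.

Lemma dotDl x y (z : 'rV[R]_d) : dot (x + y) z = dot x z + dot y z.
Proof. by rewrite -big_split/=; apply: eq_bigr => i _; rewrite mxE mulrDl. Qed.

Lemma dotZl (a : R) x (z : 'rV[R]_d) : dot (a *: x) z = a * dot x z.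
Proof. by rewrite mulr_sumr; apply: eq_bigr => i _; rewrite mxE mulrA. Qed.

Lemma dotNl x (z : 'rV[R]_d) : dot (- x) z = - dot x z.
Proof. by rewrite -scaleN1r dotZl mulN1r. Qed.

Lemma dotDr x y (z : 'rV[R]_d) : dot z (x + y) = dot z x + dot z y.
Proof. by rewrite dotC dotDl !(dotC z). Qed.

Lemma dotZr (a : R) x (z : 'rV[R]_d) : dot z (a *: x) = a * dot z x.
Proof. by rewrite dotC dotZl (dotC z). Qed.

Lemma dotNr x (z : 'rV[R]_d) : dot z (- x) = - dot z x.
Proof. by rewrite dotC dotNl (dotC z). Qed.

Lemma dot0l x : dot 0 x = 0.
Proof. by rewrite -(scale0r 0) dotZl mul0r. Qed.

Lemma dotxx_ge0 x : 0 <= dot x x.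
Proof. by apply: sumr_ge0 => i _; rewrite -expr2 sqr_ge0. Qed.

Lemma enorm_ge0 x : 0 <= enorm x.
Proof. exact: sqrtr_ge0. Qed.

Lemma sqr_enorm x : enorm x ^+ 2 = dot x x.
Proof. by rewrite sqr_sqrtr// dotxx_ge0. Qed.

Lemma coord_le_enorm x i : `|x ord0 i| <= enorm x.
Proof.
rewrite -sqrtr_sqr ler_sqrt ?dotxx_ge0// /dot (bigD1 i)//= expr2 lerDl.
by apply: sumr_ge0 => j _; rewrite -expr2 sqr_ge0.
Qed.

Lemma cauchy_schwarz x y : `|dot x y| <= enorm x * enorm y.
Proof.
have [y0|y0] := eqVneq (dot y y) 0.
  have y00 : y = 0.
    apply/rowP => i; rewrite mxE; apply/eqP; rewrite -normr_le0.
    by apply: le_trans (coord_le_enorm y i) _; rewrite /enorm y0 sqrtr0.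
  by rewrite y00 dotC dot0l normr0 mulr_ge0// enorm_ge0.
have yp : 0 < dot y y by rewrite lt_neqAle eq_sym y0 dotxx_ge0.
rewrite -ler_sqr ?nnegrE ?mulr_ge0 ?enorm_ge0// real_normK ?num_real// exprMn !sqr_enorm.
have := dotxx_ge0 (dot y y *: x - dot x y *: y).
rewrite dotDl !dotDr !dotNl !dotNr !dotZl !dotZr (dotC y x).
set a := dot x x; set b := dot y y; set c := dot x y => H.
have : 0 <= b * (a * b - c ^+ 2) by nra.
by rewrite pmulr_rge0// subr_ge0.
Qed.

Lemma enormD x y : enorm (x + y) <= enorm x + enorm y.
Proof.
rewrite -ler_sqr ?nnegrE ?addr_ge0 ?enorm_ge0// sqr_enorm sqrrD !sqr_enorm.
rewrite dotDl !dotDr (dotC y x).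
have := le_trans (ler_norm _) (cauchy_schwarz x y); lra.
Qed.

Lemma enormN x : enorm (- x) = enorm x.
Proof. by rewrite /enorm dotNl dotNr opprK. Qed.

Lemma enormB x y : enorm (x - y) = enorm (y - x).
Proof. by rewrite -enormN opprB. Qed.

Lemma enorm_le_sum x : enorm x <= \sum_i `|x ord0 i|.
Proof.
have h0 : 0 <= \sum_i `|x ord0 i| by apply: sumr_ge0.
rewrite -ler_sqr ?nnegrE ?enorm_ge0// sqr_enorm expr2 mulr_suml; apply: ler_sum => i _.
apply: le_trans (ler_norm _) _; rewrite normrM ler_wpM2l// (bigD1 i)//= lerDl.
by apply: sumr_ge0.
Qed.

Lemma measurable_dot dT (T : measurableType dT) (f g : T -> 'rV[R]_d) :
  measurable_fun setT f -> measurable_fun setT g ->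
  measurable_fun setT (fun z => dot (f z) (g z)).
Proof.
move=> mf mg; apply: measurable_sum => i; apply: measurable_funM.
  exact: (measurableT_comp (measurable_coord i) mf).
exact: (measurableT_comp (measurable_coord i) mg).
Qed.

Lemma measurable_enorm : measurable_fun setT (@enorm R d).
Proof.
apply: (measurableT_comp (f := @Num.sqrt R)); last exact: measurable_dot.
by apply: continuous_measurable_fun; exact: sqrt_continuous.
Qed.

End dot_product.

(** * The algebra of trigonometric sums *)

Section trigonometric_sums.
Context {R : realType} {d : nat}.
Notation rV := 'rV[R]_d.
Variable S : 'M[R]_d.
Hypothesis Ssym : S^T = S.

Definition sdot (x y : rV) := dot x (y *m S).

Lemma sdotC x y : sdot x y = sdot y x.
Proof.
rewrite /sdot /dot; under eq_bigr do rewrite mxE mulr_sumr.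
under [RHS]eq_bigr do rewrite mxE mulr_sumr.
rewrite exchange_big/=; apply: eq_bigr => i _; apply: eq_bigr => j _.
by rewrite -[in LHS]Ssym mxE mulrCA mulrA.
Qed.

Lemma sdotDl x y z : sdot (x + y) z = sdot x z + sdot y z.
Proof. exact: dotDl. Qed.
Lemma sdotZl a x z : sdot (a *: x) z = a * sdot x z.
Proof. exact: dotZl. Qed.
Lemma sdotNl x z : sdot (- x) z = - sdot x z.
Proof. exact: dotNl. Qed.
Lemma sdotDr x y z : sdot z (x + y) = sdot z x + sdot z y.
Proof. by rewrite sdotC sdotDl !(sdotC z). Qed.
Lemma sdotZr a x z : sdot z (a *: x) = a * sdot z x.
Proof. by rewrite sdotC sdotZl (sdotC z). Qed.
Lemma sdotNr x z : sdot z (- x) = - sdot z x.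
Proof. by rewrite sdotC sdotNl (sdotC z). Qed.
Lemma sdot0l z : sdot 0 z = 0.
Proof. exact: dot0l. Qed.
Lemma sdot_suml I (r : seq I) (F : I -> rV) z :
  sdot (\sum_(i <- r) F i) z = \sum_(i <- r) sdot (F i) z.
Proof.
by elim: r => [|i r ih]; rewrite ?big_nil ?sdot0l// !big_cons sdotDl ih.
Qed.
Lemma sdot_sumr I (r : seq I) (F : I -> rV) z :
  sdot z (\sum_(i <- r) F i) = \sum_(i <- r) sdot z (F i).
Proof. by rewrite sdotC sdot_suml; apply: eq_bigr => i _; rewrite sdotC. Qed.

(* A wave [(c, xi, th)] stands for [c cos(<xi, x> + th)]. *)
Definition wave := (R * rV * R)%type.
Implicit Types (s t : seq wave) (k l : wave).

Definition phase k x := dot k.1.2 x + k.2.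

Definition wval s x := \sum_(k <- s) k.1.1 * cos (phase k x).
(* minus the gradient *)
Definition wgrad s x := \sum_(k <- s) (k.1.1 * sin (phase k x)) *: k.1.2.
(** The operator sum_ij S_ij d_i d_j applied to the sum: twice the Gaussian part of the
    generator. *)
Definition whess s x := - \sum_(k <- s) k.1.1 * cos (phase k x) * sdot k.1.2 k.1.2.

Definition wadd k l : wave := (k.1.1 * l.1.1 / 2, k.1.2 + l.1.2, k.2 + l.2).
Definition wsub k l : wave := (k.1.1 * l.1.1 / 2, k.1.2 - l.1.2, k.2 - l.2).

(** The product-to-sum formula for cosines keeps products among trigonometric sums. *)
Definition wmul s t : seq wave :=
  [seq wadd k l | k <- s, l <- t] ++ [seq wsub k l | k <- s, l <- t].

Lemma phaseD k l x : phase (wadd k l) x = phase k x + phase l x.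
Proof. by rewrite /phase/= dotDl addrACA. Qed.

Lemma phaseB k l x : phase (wsub k l) x = phase k x - phase l x.
Proof. by rewrite /phase/= dotDl dotNl opprD addrACA. Qed.

Lemma big_wmul (V : zmodType) (F : wave -> V) s t : \sum_(k <- wmul s t) F k =
  \sum_(k <- s) \sum_(l <- t) (F (wadd k l) + F (wsub k l)).
Proof.
rewrite big_cat/= !big_allpairs_dep/= -big_split/=; apply: eq_bigr => k _.
by rewrite -big_split.
Qed.

Lemma wval_wmul s t x : wval (wmul s t) x = wval s x * wval t x.
Proof.
rewrite /wval big_wmul mulr_suml; apply: eq_bigr => k _; rewrite mulr_sumr.
apply: eq_bigr => l _; rewrite phaseD phaseB cosD cosB/=; by field.
Qed.

Lemma wgrad_wmul s t x :
  wgrad (wmul s t) x = wval t x *: wgrad s x + wval s x *: wgrad t x.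
Proof.
rewrite /wval /wgrad big_wmul scaler_sumr scaler_suml -big_split/=; apply: eq_bigr => k _.
rewrite scaler_suml scaler_sumr -big_split/=; apply: eq_bigr => l _.
rewrite phaseD phaseB sinD sinB/= !scalerA !scalerDr !scalerN addrACA -scalerDl -scalerBl.
by congr (_ *: _ + _ *: _); field.
Qed.

Lemma whess_wmul s t x : whess (wmul s t) x =
  wval t x * whess s x + wval s x * whess t x + 2 * sdot (wgrad s x) (wgrad t x).
Proof.
pose cs k := cos (phase k x); pose sn k := sin (phase k x).
have -> : wval t x * whess s x =
    \sum_(k <- s) \sum_(l <- t) - (k.1.1 * l.1.1 * (cs k * cs l) * sdot k.1.2 k.1.2).
  rewrite /wval /whess mulrN mulr_sumr -sumrN; apply: eq_bigr => k _.
  by rewrite mulr_suml -sumrN; apply: eq_bigr => l _; rewrite /cs; ring.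
have -> : wval s x * whess t x =
    \sum_(k <- s) \sum_(l <- t) - (k.1.1 * l.1.1 * (cs k * cs l) * sdot l.1.2 l.1.2).
  rewrite /wval /whess mulrN mulr_suml -sumrN; apply: eq_bigr => k _.
  by rewrite mulr_sumr -sumrN; apply: eq_bigr => l _; rewrite /cs; ring.
have -> : 2 * sdot (wgrad s x) (wgrad t x) =
    \sum_(k <- s) \sum_(l <- t) 2 * (k.1.1 * l.1.1 * (sn k * sn l) * sdot k.1.2 l.1.2).
  rewrite /wgrad sdot_suml mulr_sumr; apply: eq_bigr => k _.
  rewrite sdot_sumr mulr_sumr; apply: eq_bigr => l _.
  by rewrite sdotZl sdotZr /sn; ring.
rewrite -!big_split/= /whess big_wmul -sumrN; apply: eq_bigr => k _.
rewrite -!big_split/= -sumrN; apply: eq_bigr => l _.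
rewrite phaseD phaseB cosD cosB/= !sdotDl !sdotDr !sdotNl !sdotNr (sdotC l.1.2 k.1.2).
by rewrite /cs /sn; field.
Qed.

Definition wcst (c : R) : seq wave := [:: (c, 0, 0)].

Lemma wval_wcst c x : wval (wcst c) x = c.
Proof. by rewrite /wval big_seq1 /phase/= dot0l addr0 cos0 mulr1. Qed.

Lemma wgrad_wcst c x : wgrad (wcst c) x = 0.
Proof. by rewrite /wgrad big_seq1 /phase/= scaler0. Qed.

Lemma whess_wcst c x : whess (wcst c) x = 0.
Proof. by rewrite /whess big_seq1 /= sdot0l mulr0 oppr0. Qed.

(** Trigonometric sums form an algebra, so polynomials of one are again such sums; the induction
    follows Horner's scheme and carries the chain rule for the first two derivatives. *)
Lemma wpoly_ex u (q : {poly R}) : exists s, forall x,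
  [/\ wval s x = q.[wval u x], wgrad s x = (deriv q).[wval u x] *: wgrad u x &
      whess s x = (deriv (deriv q)).[wval u x] * sdot (wgrad u x) (wgrad u x) +
                  (deriv q).[wval u x] * whess u x].
Proof.
elim/poly_ind: q => [|q c [s hs]].
  exists [::] => x; rewrite !deriv0 !horner0 !(mul0r, scale0r) /wval /wgrad /whess !big_nil.
  by rewrite oppr0 addr0.
exists (wmul s u ++ wcst c) => x; have [h1 h2 h3] := hs x.
have vD a b : wval (a ++ b) x = wval a x + wval b x by exact: big_cat.
have gD a b : wgrad (a ++ b) x = wgrad a x + wgrad b x by exact: big_cat.
have hD a b : whess (a ++ b) x = whess a x + whess b x by rewrite /whess big_cat/= opprD.
rewrite vD gD hD wval_wmul wgrad_wmul whess_wmul wval_wcst wgrad_wcst whess_wcst h1 h2 h3.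
rewrite !(derivD, derivM, derivX, derivC, addr0, mulr1) !hornerE; split => //.
- by rewrite scalerA -scalerDl; congr (_ *: _); ring.
- rewrite sdotZl; move: (sdot _ _) (whess _ _) => p r; ring.
Qed.

End trigonometric_sums.

Section sine_bounds.
Context {R : realType}.
Implicit Types u v : R.

Lemma abs_sin_le u : `|sin u| <= `|u|.
Proof.
suff pos v : 0 <= v -> `|sin v| <= v.
  have [u0|u0] := leP 0 u; first by rewrite (ger0_norm u0) pos.
  by rewrite -(normrN (sin u)) -sinN (ltr0_norm u0) pos// oppr_ge0 ltW.
move=> v0.
have ds x : x \in `]0, v[ -> is_derive x 1 (@sin R) (cos x) by move=> _; exact: is_derive_sin.
have cs : {within `[0, v], continuous (@sin R)}.
  by apply: continuous_subspaceT => x; exact: continuous_sin.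
have [c _] := MVT_segment v0 ds cs; rewrite sin0 !subr0 => ->.
by rewrite normrM (ger0_norm v0) ler_piMl// cos_max.
Qed.

Lemma cos_quadratic u : 0 <= 1 - cos u <= u ^+ 2 / 2.
Proof.
rewrite subr_ge0 cos_le1/=.
have -> : 1 - cos u = 2 * sin (u / 2) ^+ 2.
  have h2 : (u / 2) *+ 2 = u by rewrite mulr2n -splitr.
  have -> : cos u = cos (u / 2) ^+ 2 *+ 2 - 1 by rewrite -cos_mulr2n h2.
  by have := cos2Dsin2 (u / 2); rewrite -mulr_natr; nra.
have := abs_sin_le (u / 2); rewrite -ler_sqr ?nnegrE// !real_normK ?num_real//.
rewrite expr_div_n; lra.
Qed.

Lemma sin_cubic u : `|sin u - u| <= `|u| ^+ 3.
Proof.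
suff pos v : 0 <= v -> `|sin v - v| <= v ^+ 3.
  have [u0|u0] := leP 0 u; first by rewrite (ger0_norm u0) pos.
  by rewrite -(normrN (_ - _)) opprD -sinN (ltr0_norm u0) pos// oppr_ge0 ltW.
move=> v0.
have ds x : x \in `]0, v[ -> is_derive x 1 (@sin R) (cos x) by move=> _; exact: is_derive_sin.
have cs : {within `[0, v], continuous (@sin R)}.
  by apply: continuous_subspaceT => x; exact: continuous_sin.
have [c] := MVT_segment v0 ds cs; rewrite in_itv/= sin0 !subr0 => /andP[c0 cv] ->.
have /andP[h1 h2] := cos_quadratic c.
have -> : cos c * v - v = - ((1 - cos c) * v) by ring.
rewrite normrN normrM (ger0_norm h1) (ger0_norm v0) exprSr ler_wpM2r//.
apply: (le_trans h2); have : c ^+ 2 <= v ^+ 2 by rewrite ler_sqr ?nnegrE.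
have := sqr_ge0 v; lra.
Qed.
End sine_bounds.

(** * Dynkin's formula for trigonometric sums *)

Section generator_identity.
Local Open Scope ereal_scope.
Context {R : realType} {d : nat}.
Notation mu := (@lebesgue_measure R).
Notation rV := 'rV[R]_d.
Context {dO : measure_display} {Omega : measurableType dO}.
Variables (P : probability Omega R) (X : R -> Omega -> 'rV[R]_d).
Hypothesis HX : levy_process P X.
Local Opaque fk fk_weight.
Notation fk := (fk P X).

Notation wv := (@wave R d).
Implicit Types (f g F G : rV -> R) (s t c N : R) (x y : rV).

Definition bounded_mf (f : rV -> R) :=
  measurable_fun setT f /\ exists N : R, forall x, (`|f x| <= N)%R.

Definition ex (f : rV -> R) (s : R) (x : rV) : \bar R := \int[P]_w (f (x + X s w)%R)%:E.

(* [F] plays the part of the generator applied to [f]. *)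
Definition dyn (f F : rV -> R) := [/\ bounded_mf f, bounded_mf F &
  forall t x, (0 <= t)%R -> ex f t x = (f x)%:E + \int[mu]_(s in `[0%R, t]) ex F s x].

Lemma measurable_fX f s x : measurable_fun setT f -> (0 <= s)%R ->
  measurable_fun setT (fun w => f (x + X s w)%R).
Proof.
move=> mf s0.
exact: (@measurable_position_path _ _ _ _ _ _ HX _ Omega (cst x) (cst s) id
    (measurable_cst _) (measurable_cst _) (@measurable_id _ _ _) _ _ f mf (fun=> s0)).
Qed.

Lemma integrable_fX f s x : bounded_mf f -> (0 <= s)%R ->
  P.-integrable setT (fun w => (f (x + X s w)%R)%:E).
Proof.
move=> [mf [N fN]] s0; apply: (measurable_bounded_integrable (f := fun w => f (x + X s w)%R)) => //.
- by rewrite -ge0_fin_numE// fin_num_measure.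
- exact: measurable_fX.
- exists N; split; first exact: num_real.
  by move=> M NM w _; apply: le_trans (fN _) (ltW NM).
Qed.

Lemma ex_fin f s x : bounded_mf f -> (0 <= s)%R -> ex f s x \is a fin_num.
Proof. by move=> bf s0; apply: integrable_fin_num => //; exact: integrable_fX. Qed.

Lemma exD f g s x : bounded_mf f -> bounded_mf g -> (0 <= s)%R ->
  ex (f \+ g)%R s x = ex f s x + ex g s x.
Proof.
move=> bf bg s0; rewrite /ex -integralD//; by [exact: integrable_fX|apply: eq_integral].
Qed.

Lemma exZ (c : R) f s x : bounded_mf f -> (0 <= s)%R ->
  ex (fun y => c * f y)%R s x = c%:E * ex f s x.
Proof.
by move=> bf s0; rewrite /ex -integralZl//; exact: integrable_fX.
Qed.

Lemma ex_cst (c : R) s x : ex (cst c) s x = c%:E.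
Proof. by rewrite /ex /= integral_probability_cst. Qed.

Lemma bounded_mf_cst c : bounded_mf (cst c).
Proof. by split => //; exists `|c|%R. Qed.

Lemma bounded_mfD f g : bounded_mf f -> bounded_mf g -> bounded_mf (f \+ g)%R.
Proof.
move=> [mf [N fN]] [mg [M gM]]; split; first exact: measurable_funD.
by exists (N + M)%R => x; apply: le_trans (ler_normD _ _) _; exact: lerD.
Qed.

Lemma bounded_mfZ c f : bounded_mf f -> bounded_mf (fun y => c * f y)%R.
Proof.
move=> [mf [N fN]]; split; first by apply: measurable_funM.
by exists (`|c| * N)%R => x; rewrite normrM ler_wpM2l.
Qed.

Lemma exN f N s x : bounded_mf f -> (0 <= s)%R ->
  fk (cst 0%R) (cst 0%R) (fun y => (f y + N)%:E) s x = ex f s x + N%:E.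
Proof.
move=> bf s0; rewrite fk00 -(ex_cst N s x) -(exD _ bf (bounded_mf_cst N) s0).
by [].
Qed.

Lemma measurable_ex f t x : bounded_mf f -> measurable_fun `[0%R, t] (fun s => ex f s x).
Proof.
move=> bf; have [mf [N fN]] := bf.
have h : measurable_fun `[0%R, t] (fun s : R => fk (cst 0%R) (cst 0%R) (fun y => (f y + N)%:E) s x - N%:E).
  apply: emeasurable_funB => //.
  apply: (measurable_fks_itv HX); [exact: potential0|exact: potential0| |].
    by apply/measurable_EFinP; exact: measurable_funD.
  by move=> y; rewrite lee_fin; have := fN y; rewrite ler_norml => /andP[]; lra.
apply: eq_measurable_fun h => s; rewrite inE/= in_itv/= => /andP[s0 _].
by rewrite exN// addeK.
Qed.

Lemma ex_abse_le f N s x : measurable_fun setT f -> (forall x, (`|f x| <= N)%R) -> (0 <= s)%R ->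
  `|ex f s x| <= N%:E.
Proof.
move=> mf fN s0; apply: (le_trans (le_abse_integral _ _ _)) => //.
  by apply/measurable_EFinP; exact: measurable_fX.
rewrite -[leRHS](integral_probability_cst P); apply: ge0_le_integral => //.
- by apply: measurableT_comp => //; apply/measurable_EFinP; exact: measurable_fX.
- by move=> w _; rewrite lee_fin.
Qed.

Lemma integrable_ex f t x : bounded_mf f -> (0 <= t)%R ->
  mu.-integrable `[0%R, t] (fun s => ex f s x).
Proof.
move=> bf t0; have [mf [N fN]] := bf.
have N0 : (0 <= N)%R by apply: le_trans (fN 0%R).
apply: (@le_integrable _ _ _ mu _ _ _ (cst N%:E)) => //.
- exact: measurable_ex.
- move=> s; rewrite /= in_itv/= => /andP[s0 _]; rewrite ger0_norm//.
  exact: ex_abse_le.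
- apply/integrableP; split => //.
  under eq_integral do rewrite /= ger0_norm//.
  by rewrite (integral_itv_cst _ t0) ltry.
Qed.

Lemma dynD f F g G : dyn f F -> dyn g G -> dyn (f \+ g)%R (F \+ G)%R.
Proof.
move=> [bf bF hf] [bg bG hg]; split; [exact: bounded_mfD|exact: bounded_mfD|].
move=> t x t0; rewrite exD// hf// hg// addeACA -EFinD; congr (_ + _).
rewrite -integralD//; [|exact: integrable_ex|exact: integrable_ex].
by apply: eq_integral => s; rewrite inE/= in_itv/= => /andP[s0 _]; rewrite exD.
Qed.

(** Dominated convergence, under the expectation and then in time; no relation between f and F other
    than the formula itself is used. *)
Lemma dyn_lim (f_ F_ : nat -> rV -> R) f F N :
  (forall n, dyn (f_ n) (F_ n)) ->
  (forall n x, (`|f_ n x| <= N)%R) -> (forall n x, (`|F_ n x| <= N)%R) ->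
  (forall x, f_ n x @[n --> \oo] --> f x) -> (forall x, F_ n x @[n --> \oo] --> F x) ->
  dyn f F.
Proof.
move=> D fN FN cf cF.
have lim_bound (g_ : nat -> rV -> R) g : (forall n x, (`|g_ n x| <= N)%R) ->
    (forall x, g_ n x @[n --> \oo] --> g x) -> forall x, (`|g x| <= N)%R.
  move=> gN cg x; rewrite -lee_fin.
  apply: (@lee_of_cvg _ (fun n => (`|g_ n x|)%:E)); last by move=> n; rewrite lee_fin.
  by apply: cvg_EFin; [exact: nearW|apply: cvg_norm; exact: cg].
have bm (g_ : nat -> rV -> R) g : (forall n, measurable_fun setT (g_ n)) ->
    (forall n x, (`|g_ n x| <= N)%R) ->
    (forall x, g_ n x @[n --> \oo] --> g x) -> bounded_mf g.
  move=> mg gN cg; split; last by exists N; exact: lim_bound cg.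
  by apply: (measurable_fun_cvg (h := g_)) => // x _; exact: cg.
have cex (g_ : nat -> rV -> R) g s x : (forall n, measurable_fun setT (g_ n)) ->
    (forall n x, (`|g_ n x| <= N)%R) -> (0 <= s)%R ->
    (forall x, g_ n x @[n --> \oo] --> g x) -> ex (g_ n) s x @[n --> \oo] --> ex g s x.
  move=> mg gN s0 cg; apply: (@dominated_cvg _ _ _ _ _ _ _ _ (cst N%:E)) => //.
  - by move=> n; apply/measurable_EFinP; exact: measurable_fX.
  - by move=> w _; apply: cvg_EFin; [exact: nearW|exact: cg].
  - apply/integrableP; split => //.
    by rewrite /= integral_probability_cst ltry.
  - by move=> n w _; rewrite lee_fin; exact: gN.
have mf n : measurable_fun setT (f_ n) by case: (D n) => -[].
have mF n : measurable_fun setT (F_ n) by case: (D n) => _ [].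
have bf := bm f_ f mf fN cf; have bF := bm F_ F mF FN cF.
split => // t x t0.
have N0 : (0 <= N)%R by apply: le_trans (fN 0%N 0%R).
have c1 := cex f_ f t x mf fN t0 cf.
have c2 : \int[mu]_(s in `[0%R, t]) ex (F_ n) s x @[n --> \oo] -->
    \int[mu]_(s in `[0%R, t]) ex F s x.
  apply: (@dominated_cvg _ _ _ _ _ _ _ _ (cst N%:E)) => //.
  - by move=> n; apply: measurable_ex; case: (D n).
  - by move=> s; rewrite /= in_itv/= => /andP[s0 _]; exact: cex.
  - apply/integrableP; split => //.
    under eq_integral do rewrite /= ger0_norm//.
    by rewrite (integral_itv_cst _ t0) ltry.
  - by move=> n s; rewrite /= in_itv/= => /andP[s0 _]; exact: ex_abse_le.
have c3 : ex (f_ n) t x @[n --> \oo] --> (f x)%:E + \int[mu]_(s in `[0%R, t]) ex F s x.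
  have -> : (fun n => ex (f_ n) t x) = (fun n => (f_ n x)%:E + \int[mu]_(s in `[0%R, t]) ex (F_ n) s x).
    by apply/funext => n; case: (D n) => _ _; exact.
  apply: cvgeD => //; last by apply: cvg_EFin; [exact: nearW|exact: cf].
exact: (cvg_unique _ c1 c3).
Qed.

Variables (b : rV) (S : 'M[R]_d) (m : {measure set rV -> \bar R}).
Hypotheses (Xsym : symmetric_process P X) (Ssym : S^T%R = S)
  (Spos : forall xi : rV, (0 <= dot xi (xi *m S))%R)
  (mfin : \int[m]_z (Num.min 1 (enorm z ^+ 2)%R)%:E < +oo)
  (charE : forall t (xi : rV), (0 <= t)%R ->
      let re := levy_exponent_re S m xi in
      let im := levy_exponent_im b m xi in
      (\int[P]_w cos (dot xi (X t w)) = expR (t * re) * cos (t * im))%R /\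
      (\int[P]_w sin (dot xi (X t w)) = expR (t * re) * sin (t * im))%R).

Let cosxi (xi y : rV) : R := cos (dot xi y).
Let sinxi (xi y : rV) : R := sin (dot xi y).

Let measurable_dotl xi : measurable_fun setT (@dot R d xi).
Proof. by apply: measurable_dot. Qed.

Lemma bounded_mf_cos (xi : rV) (th : R) : bounded_mf (fun y => cos (dot xi y + th))%R.
Proof.
split; last by exists 1%R => x; exact: cos_max.
apply: measurableT_comp; first by apply: continuous_measurable_fun => y; exact: continuous_cos.
by apply: measurable_funD.
Qed.

Let bcos xi : bounded_mf (cosxi xi).
Proof.
have := bounded_mf_cos xi 0; congr bounded_mf.
by apply/funext => y; rewrite addr0.
Qed.

Let bsin xi : bounded_mf (sinxi xi).
Proof.
split; last by exists 1%R => x; exact: sin_max.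
apply: measurableT_comp; first by apply: continuous_measurable_fun => y; exact: continuous_sin.
exact: measurable_dotl.
Qed.

Let ex_sin xi s : (0 <= s)%R -> ex (sinxi xi) s 0%R = 0.
Proof.
(* Equality in law is available for integrals of nonnegative functions, hence the shift of the sine
   by 1. *)
move=> s0; have b1 := bounded_mfD (bounded_mf_cst 1) (bsin xi).
have E : ex (cst 1 \+ sinxi xi)%R s 0%R = ex (cst 1 \+ (fun y => -1 * sinxi xi y))%R s 0%R.
  rewrite /ex.
  transitivity (\int[P]_w (1 + sinxi xi (X s w))%:E); first by apply: eq_integral => w _; rewrite add0r.
  transitivity (\int[P]_w (1 + sinxi xi (- X s w))%:E); last first.
    by apply: eq_integral => w _; rewrite add0r /= /sinxi dotNr sinN mulN1r.
  have mN : measurable_fun setT (fun w => - X s w)%R.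
    have := measurable_funB_rV (measurable_cst (0%R : rV)) (measurable_X HX s0).
    by apply: eq_measurable_fun => w _; rewrite /= sub0r.
  apply: (@eq_law_integral _ _ _ _ _ _ _ P P (X s) (fun w => - X s w)%R (fun y => (1 + sinxi xi y)%:E)) => //.
  - exact: (measurable_X HX).
  - by apply/measurable_EFinP; case: b1.
  - by move=> y; rewrite lee_fin -lerBlDl sub0r sin_geN1.
  - by move=> A mA; exact: Xsym.
have bs := ex_fin 0%R (bsin xi) s0.
move: E; rewrite exD ?exD ?exZ//; try exact: bounded_mf_cst; last exact: bounded_mfZ.
rewrite ex_cst -(fineK bs) -EFinM -!EFinD => -[E].
by congr EFin; move: E; lra.
Qed.

Let re xi := levy_exponent_re S m xi.

(** By symmetry sin(t im) = 0 for all t >= 0; a nonzero im would give 1 or -1 at t = pi / (2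
    |im|). *)
Let im0 xi : levy_exponent_im b m xi = 0%R.
Proof.
set im := levy_exponent_im b m xi.
have H t : (0 <= t)%R -> (sin (t * im) = 0)%R.
  move=> t0; have [_ h] := charE xi t0.
  have : (\int[P]_w sin (dot xi (X t w)) = 0)%R.
    rewrite /Rintegral -[RHS]/(fine 0) -(ex_sin xi t0); congr fine.
    by apply: eq_integral => w _; rewrite add0r.
  by rewrite h => /eqP; rewrite mulf_eq0 gt_eqF ?expR_gt0//= => /eqP.
have [//|i0] := eqVneq im 0%R.
have ip : (0 < `|im|)%R by rewrite normr_gt0.
have h := H (pi / 2 / `|im|)%R; have hp : (0 <= pi / 2 / `|im|)%R.
  by rewrite divr_ge0// divr_ge0// pi_ge0.
have := h hp; have [i1|i1] := leP 0%R im.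
  by rewrite (ger0_norm i1) divfK// sin_pihalf => /eqP; rewrite oner_eq0.
by rewrite (ltr0_norm i1) invrN mulrN mulNr divfK// sinN sin_pihalf => /eqP; rewrite oppr_eq0 oner_eq0.
Qed.

Let ex_cos xi s : (0 <= s)%R -> ex (cosxi xi) s 0%R = (expR (s * re xi))%:E.
Proof.
move=> s0; have [h _] := charE xi s0; move: h.
rewrite /= im0 mulr0 cos0 mulr1 -/(re xi) => <-.
rewrite /Rintegral fineK.
  by apply: eq_integral => w _; rewrite add0r.
have := ex_fin 0%R (bcos xi) s0; congr (_ \is a fin_num).
by apply: eq_integral => w _; rewrite add0r.
Qed.

Lemma integrable_small (g : rV -> R) C : measurable_fun setT g ->
  (forall z, `|g z| <= C * Num.min 1 (enorm z ^+ 2))%R -> m.-integrable setT (EFin \o g).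
Proof.
move=> mg gC.
have mmin : measurable_fun setT (fun z : rV => Num.min 1 (enorm z ^+ 2))%R.
  by apply: measurable_minr => //; apply: measurable_funX; exact: measurable_enorm.
have i1 : m.-integrable setT (fun z => (Num.min 1 (enorm z ^+ 2)%R)%:E).
  apply/integrableP; split; first exact/measurable_EFinP.
  under eq_integral.
    move=> z _; rewrite /= ger0_norm; last by rewrite le_min ler01 sqr_ge0.
    over.
  exact: mfin.
apply: (le_integrable _ _ _ (integrableZl _ C i1)) => //; first exact/measurable_EFinP.
by move=> z _; rewrite -EFinM /= lee_fin (le_trans (gC z))// ler_norm.
Qed.

Lemma cos_small (xi z : rV) : (`|cos (dot xi z) - 1| <= (2 + enorm xi ^+ 2) * Num.min 1 (enorm z ^+ 2))%R.
Proof.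
rewrite distrC; have /andP[h1 h2] := cos_quadratic (dot xi z).
rewrite ger0_norm//; have [z1|z1] := leP 1%R (enorm z ^+ 2)%R.
  rewrite mulr1; have := cos_geN1 (dot xi z); have := sqr_ge0 (enorm xi); lra.
apply: (le_trans h2).
have := cauchy_schwarz xi z; rewrite -ler_sqr ?nnegrE ?mulr_ge0 ?enorm_ge0//.
rewrite real_normK ?num_real// exprMn; have := sqr_ge0 (enorm z).
have := sqr_ge0 (dot xi z); move: (enorm xi ^+ 2)%R (enorm z ^+ 2)%R (dot xi z ^+ 2)%R => p q r; lra.
Qed.

Let mcos xi : m.-integrable setT (fun z => (cos (dot xi z) - 1)%:E).
Proof.
apply: (integrable_small (g := fun z => cos (dot xi z) - 1)%R); last exact: cos_small.
by apply: measurable_funB => //; case: (bcos xi).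
Qed.

Let re_le0 xi : (re xi <= 0)%R.
Proof.
rewrite /re /levy_exponent_re; have := Spos xi.
have : (\int[m]_z (cos (dot xi z) - 1) <= 0)%R.
  have E := RintegralZl (-1)%R measurableT (mcos xi).
  have : (0 <= \int[m]_z (-1 * (cos (dot xi z) - 1)))%R.
    by apply: Rintegral_ge0 => z _; rewrite mulN1r opprB; case/andP: (cos_quadratic (dot xi z)).
  by rewrite E mulN1r oppr_ge0.
lra.
Qed.

Definition wgen (s : seq wv) x : R :=
  (\sum_(k <- s) k.1.1 * re k.1.2 * cos (phase k x))%R.

(** The exponent being real, each wave is an eigenfunction of the free semigroup with eigenvalue
    e^(s re). The time integral of this exponential is [integral_expRN_bounded] for the constant
    rate - re >= 0. *)
Let dyn_wave (k : wv) :
  dyn (fun x => k.1.1 * cos (phase k x))%R (fun x => k.1.1 * re k.1.2 * cos (phase k x))%R.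
Proof.
case: k => -[c xi] th /=; pose k : wv := (c, xi, th).
have bk := bounded_mf_cos xi th.
have E s x : (0 <= s)%R -> ex (fun y => cos (phase k y)) s x = (expR (s * re xi) * cos (phase k x))%:E.
  move=> s0.
  have -> : ex (fun y => cos (phase k y)) s x = ex ((fun y => cos (phase k x) * cosxi xi y) \+
      (fun y => - sin (phase k x) * sinxi xi y))%R s 0%R.
    apply: eq_integral => w _; rewrite add0r; congr EFin.
    have -> : (phase k (x + X s w) = phase k x + dot xi (X s w))%R.
      by rewrite /phase/= dotDr addrAC.
    by rewrite cosD /cosxi /sinxi/= mulNr.
  rewrite exD//; [|exact: bounded_mfZ|exact: bounded_mfZ].
  by rewrite !exZ// ex_cos// ex_sin// mule0 adde0 -EFinM mulrC.
split; [exact: bounded_mfZ|exact: bounded_mfZ|] => t x t0.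
rewrite exZ// E//.
have a0 : (0 <= - re xi)%R by rewrite oppr_ge0.
have I := @integral_expRN_bounded R (cst (- re xi)%R) (- re xi)%R t t0 (measurable_cst _) (fun=> _).
have {}I := I (fun=> introT andP (conj a0 (lexx _))).
have I2 : \int[mu]_(s in `[0%R, t]) ((- re xi)%R%:E * (expR (s * re xi))%:E) = 1 - (expR (t * re xi))%:E.
  rewrite -[X in expR X]opprK -mulrN mulrC -[(expR _)%:E]/(expeR (- ((- re xi) * t)%R%:E)).
  rewrite -(integral_itv_cst _ t0) -I; apply: eq_integral => s; rewrite inE/= in_itv/= => /andP[s0 _].
  by rewrite integral_itv_cst// -[expeR _]/(expR _)%:E mulNr opprK mulrC.
have -> : \int[mu]_(s in `[0%R, t]) ex (fun y => c * re xi * cos (phase k y))%R s x =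
    \int[mu]_(s in `[0%R, t]) ((- (c * cos (phase k x)))%R%:E * ((- re xi)%R%:E * (expR (s * re xi))%:E)).
  apply: eq_integral => s; rewrite inE/= in_itv/= => /andP[s0 _].
  by rewrite exZ// E// -!EFinM; congr EFin; ring.
rewrite (integralZl _ (_ : mu.-integrable `[0%R, t] (fun s => (- re xi)%R%:E * (expR (s * re xi))%:E)))//; last first.
  have : mu.-integrable `[0%R, t] (fun s => (- re xi)%R%:E * ex (cosxi xi) s 0%R).
    by apply: integrableZl => //; exact: integrable_ex.
  apply: eq_integrable => // s; rewrite inE/= in_itv/= => /andP[s0 _].
  by rewrite ex_cos.
by rewrite I2 -[1]/(1%R%:E) -EFinB -!EFinM -EFinD; congr EFin; ring.
Qed.

Lemma dyn_wval (s : seq wv) : dyn (wval s) (wgen s).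
Proof.
elim: s => [|k s ih].
  have -> : wval (d := d) (R := R) [::] = cst 0%R by apply/funext => x; rewrite /wval big_nil.
  have -> : wgen [::] = cst 0%R by apply/funext => x; rewrite /wgen big_nil.
  split; [exact: bounded_mf_cst|exact: bounded_mf_cst|] => t x t0.
  rewrite ex_cst integral0_eq ?adde0// => s _; exact: ex_cst.
have := dynD (dyn_wave k) ih; congr dyn; apply/funext => x.
  by rewrite /wval big_cons.
by rewrite /wgen big_cons.
Qed.

(** Symmetrised second differences take the place of compensated first differences: for a wave they
    equal its value times cos(<xi, z>) - 1, with no drift term left. *)
Definition jump f x : R := (\int[m]_z (2^-1 * (f (x + z) + f (x - z)) - f x))%R.

Lemma wgenE (s : seq wv) x : (wgen s x = jump (wval s) x + 2^-1 * whess S s x)%R.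
Proof.
have E z : (2^-1 * (wval s (x + z) + wval s (x - z)) - wval s x =
    \sum_(k <- s) k.1.1 * cos (phase k x) * (cos (dot k.1.2 z) - 1))%R.
  rewrite /wval -big_split/= mulr_sumr -sumrB; apply: eq_bigr => k _.
  have -> : (phase k (x + z) = phase k x + dot k.1.2 z)%R by rewrite /phase dotDr addrAC.
  have -> : (phase k (x - z) = phase k x - dot k.1.2 z)%R by rewrite /phase dotDr dotNr addrAC.
  by rewrite cosD cosB; field.
have J : (jump (wval s) x = \sum_(k <- s) k.1.1 * cos (phase k x) * \int[m]_z (cos (dot k.1.2 z) - 1))%R.
  rewrite /jump; under eq_Rintegral do rewrite E.
  elim: s {E} => [|k s ih].
    by rewrite big_nil; under eq_Rintegral do rewrite big_nil; rewrite /Rintegral integral0_eq.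
  rewrite [RHS]big_cons -ih -(RintegralZl (k.1.1 * cos (phase k x))%R measurableT (mcos k.1.2)).
  have i1 : m.-integrable setT (EFin \o (fun z => k.1.1 * cos (phase k x) * (cos (dot k.1.2 z) - 1)))%R.
    by have := integrableZl measurableT (k.1.1 * cos (phase k x))%R (mcos k.1.2).
  have i2 : m.-integrable setT (EFin \o (fun z => \sum_(j <- s) j.1.1 * cos (phase j x) * (cos (dot j.1.2 z) - 1)))%R.
    have := @integrable_sum _ _ _ m setT measurableT _ s xpredT
      (fun j z => (j.1.1 * cos (phase j x))%:E * (cos (dot j.1.2 z) - 1)%:E)
      (fun j _ => integrableZl measurableT _ (mcos j.1.2)).
    apply: eq_integrable => // z _; rewrite /= -sumEFin; apply: eq_bigr => j _; exact: EFinM.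
  rewrite -(RintegralD measurableT i1 i2).
  by apply: eq_Rintegral => z _; rewrite big_cons.
rewrite J /wgen /whess mulrN mulr_sumr -sumrN -big_split/=; apply: eq_bigr => k _.
by rewrite /re /levy_exponent_re /sdot; field.
Qed.

End generator_identity.

(** * Polynomial approximation of a cutoff with two derivatives *)

Section polynomial_cutoffs.
Context {R : realType}.
Notation mu := (@lebesgue_measure R).
Implicit Types (p q : {poly R}) (u v : R).

Lemma poly_primitive p c : exists q, deriv q = p /\ q.[0] = c.
Proof.
exists (c%:P + \poly_(i < (size p).+1) (p`_i.-1 / i%:R *+ (0 < i)%N)); split.
  apply/polyP => i; rewrite derivD derivC add0r coef_deriv coef_poly ltnS.
  case: ltnP => [ip|ip]; last by rewrite mul0rn nth_default.
  by rewrite /= mulr1n -[X in X *+ _]mulr1 -mulrnAl -mulr_natr mulr1 divfK// pnatr_eq0.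
by rewrite hornerD hornerC horner_coef0 coef_poly/= mulr0n addr0.
Qed.

Lemma poly_FTC p v : 0 <= v ->
  (\int[mu]_(s in `[0%R, v]) ((deriv p).[s])%:E = (p.[v] - p.[0])%:E)%E.
Proof.
rewrite le_eqVlt => /predU1P[<-|v0].
  by rewrite set_itv1 integral_set1 subrr.
rewrite EFinB; apply: continuous_FTC2 => //.
- by apply: continuous_subspaceT => x; exact: continuous_horner.
- split.
  + by move=> x _; exact: derivable_horner.
  + by apply: cvg_at_right_filter; exact: continuous_horner.
  + by apply: cvg_at_left_filter; exact: continuous_horner.
- by move=> x _; rewrite -derivE.
Qed.

Lemma poly_MVT p u v : exists2 c, (Num.min u v <= c <= Num.max u v) &
  p.[v] - p.[u] = (deriv p).[c] * (v - u).
Proof.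
have H x y : x <= y -> exists2 c, x <= c <= y & p.[y] - p.[x] = (deriv p).[c] * (y - x).
  move=> xy; have cp : {within `[x, y], continuous (horner p)}.
    by apply: continuous_subspaceT => z; exact: continuous_horner.
  have [c] := MVT_segment xy (fun z _ => is_derive_poly p z) cp.
  by rewrite in_itv/= => cxy E; exists c.
have [uv|vu] := leP u v; first exact: H.
by have [c h1 h2] := H v u (ltW vu); exists c => //; rewrite -opprB h2 -mulrN opprB.
Qed.

Lemma poly_lipschitz p M B : (forall v, 0 <= v <= M -> `|(deriv p).[v]| <= B) ->
  forall u v, 0 <= u <= M -> 0 <= v <= M -> `|p.[v] - p.[u]| <= B * `|v - u|.
Proof.
move=> pB u v /andP[u0 uM] /andP[v0 vM]; have [c /andP[c1 c2] ->] := poly_MVT p u v.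
rewrite normrM ler_wpM2r// pB//; apply/andP; split.
  by apply: le_trans c1; rewrite le_min u0.
by apply: (le_trans c2); rewrite ge_max uM.
Qed.

Lemma poly_taylor p M B : (forall v, 0 <= v <= M -> `|(deriv (deriv p)).[v]| <= B) ->
  forall u v, 0 <= u <= M -> 0 <= v <= M ->
  `|p.[v] - p.[u] - (deriv p).[u] * (v - u)| <= B * (v - u) ^+ 2.
Proof.
move=> pB u v uM vM; have [c c12 ->] := poly_MVT p u v.
have cM : 0 <= c <= M.
  case/andP: uM => u0 uM; case/andP: vM => v0 vM; case/andP: c12 => c1 c2; apply/andP; split.
    by apply: le_trans c1; rewrite le_min u0.
  by apply: (le_trans c2); rewrite ge_max uM.
rewrite -mulrBl normrM -(real_normK (num_real (v - u))) expr2 mulrA ler_wpM2r//.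
have B0 : 0 <= B by apply: le_trans (pB u uM).
apply: le_trans (poly_lipschitz pB uM cM) _; rewrite ler_wpM2l//.
case/andP: c12; have [uv|vu] := leP u v => c1 c2.
  by rewrite !ger0_norm ?subr_ge0// lerB.
by rewrite !ler0_norm ?subr_le0// ?(ltW vu)// !opprB lerB.
Qed.

Lemma bernoulli (x : R) n : 0 <= x -> 1 + n%:R * x <= (1 + x) ^+ n.
Proof.
move=> x0; elim: n => [|n ih]; first by rewrite mul0r addr0 expr0.
rewrite exprS; apply: (@le_trans _ _ ((1 + x) * (1 + n%:R * x))).
  rewrite -natr1; have : 0 <= n%:R * x * x by rewrite !mulr_ge0.
  by move: (n%:R) => m; nra.
by rewrite ler_wpM2l// addr_ge0.
Qed.

Lemma bernoulliB (x : R) n : 0 <= x <= 1 -> 1 - n%:R * x <= (1 - x) ^+ n.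
Proof.
move=> /andP[x0 x1]; elim: n => [|n ih]; first by rewrite mul0r subr0 expr0.
rewrite exprS; apply: (@le_trans _ _ ((1 - x) * (1 - n%:R * x))).
  rewrite -natr1; have : 0 <= n%:R * x * x by rewrite !mulr_ge0.
  by move: (n%:R) => m; nra.
by rewrite ler_wpM2l// subr_ge0.
Qed.

(* Stone's polynomials (1 - x^n)^(k^n) decrease from 1 to 0 around x = 1/k. *)
Definition step_poly (M : R) (k n : nat) : {poly R} :=
  (1 - (M^-1 *: 'X) ^+ n) ^+ (k ^ n).

Variables (rho : R) (k : nat).
Hypotheses (rho0 : 0 < rho) (k1 : (1 < k)%N).
Let M := rho * k%:R.

Let M0 : 0 < M. Proof. by rewrite mulr_gt0// ltr0n (leq_trans _ k1). Qed.

Lemma step_polyE n v : (step_poly M k n).[v] = (1 - (v / M) ^+ n) ^+ (k ^ n).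
Proof. by rewrite /step_poly !hornerE mulrC. Qed.

Lemma step_poly_bound n v : 0 <= v <= M -> 0 <= (step_poly M k n).[v] <= 1.
Proof.
move=> /andP[v0 vM]; rewrite step_polyE.
have x0 : 0 <= v / M by rewrite divr_ge0// ltW.
have x1 : v / M <= 1 by rewrite ler_pdivrMr// mul1r.
have h0 : 0 <= (v / M) ^+ n by rewrite exprn_ge0.
have h1 : (v / M) ^+ n <= 1 by rewrite exprn_ile1.
by rewrite exprn_ge0 ?subr_ge0//= exprn_ile1// ?subr_ge0// gerBl.
Qed.

(** With x = v / M, Bernoulli's inequality gives the lower bound 1 - (k x)^n, and k x = v / rho <
    1. *)
Lemma cvg_step_poly_left v : 0 <= v < rho ->
  (step_poly M k n).[v] @[n --> \oo] --> (1 : R).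
Proof.
move=> /andP[v0 vr].
have r1 : `|v / rho| < 1 by rewrite ger0_norm ?divr_ge0 ?(ltW rho0)// ltr_pdivrMr// mul1r.
have vM : 0 <= v <= M.
  rewrite v0 /= ltW// (lt_le_trans vr)// ler_peMr ?ler1n ?(ltW rho0)//; exact: ltnW.
apply: (@squeeze_cvgr _ _ _ _ (fun n => 1 - (v / rho) ^+ n) (cst 1)).
- apply: nearW => n; rewrite /= andbC; have /andP[_ ->] := step_poly_bound n vM.
  rewrite step_polyE; have /andP[v0' vM'] := vM.
  have x0 : 0 <= v / M by rewrite divr_ge0// ltW.
  have x1 : v / M <= 1 by rewrite ler_pdivrMr// mul1r.
  have hx : 0 <= (v / M) ^+ n <= 1 by rewrite exprn_ge0//= exprn_ile1.
  apply: le_trans (bernoulliB (k ^ n) hx); rewrite natrX -exprMn.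
  have -> : k%:R * (v / M) = v / rho.
    rewrite /M invfM mulrA mulrCA !mulrA; field.
    by rewrite pnatr_eq0 -lt0n (ltnW k1) gt_eqF.
  by [].
- rewrite -[X in _ --> X]subr0; apply: cvgB; first exact: cvg_cst.
  exact: cvg_expr.
- exact: cvg_cst.
Qed.

(** With x = (v / M)^n, the value is at most (1 + x)^(- k^n) <= 1 / (k^n x), and this last quantity
    equals (rho / v)^n. *)
Lemma cvg_step_poly_right v : rho < v <= M ->
  (step_poly M k n).[v] @[n --> \oo] --> (0 : R).
Proof.
move=> /andP[rv vM]; have v0 := lt_trans rho0 rv.
have r1 : `|rho / v| < 1 by rewrite ger0_norm ?divr_ge0 ?(ltW rho0) ?(ltW v0)// ltr_pdivrMr// mul1r.
apply: (@squeeze_cvgr _ _ _ _ (cst 0) (fun n => (rho / v) ^+ n)).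
- apply: nearW => n; have h : 0 <= v <= M by rewrite ltW.
  have /andP[-> _] /= := step_poly_bound n h.
  rewrite step_polyE; set x := (v / M) ^+ n.
  have x0 : 0 < x by rewrite exprn_gt0// divr_gt0.
  have x1 : x <= 1 by rewrite exprn_ile1 ?divr_ge0 ?(ltW v0) ?(ltW M0)// ler_pdivrMr// mul1r.
  apply: (@le_trans _ _ ((1 + x) ^- (k ^ n))).
    rewrite -exprVn ler_pXn2r ?expn_gt0 ?(ltnW k1)// ?nnegrE ?subr_ge0 ?invr_ge0 ?addr_ge0 ?(ltW x0)//.
    rewrite -div1r ler_pdivlMr ?addr_gt0//; nra.
  have -> : (rho / v) ^+ n = ((k ^ n)%:R * x)^-1.
    rewrite natrX /x -exprMn -exprVn; congr (_ ^+ _).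
    rewrite /M; field; rewrite pnatr_eq0 -lt0n (ltnW k1) !gt_eqF//.
  rewrite lef_pV2 ?posrE ?exprn_gt0 ?addr_gt0 ?mulr_gt0 ?ltr0n ?expn_gt0 ?(ltnW k1)//.
  by apply: le_trans (bernoulli _ (ltW x0)); rewrite lerDr.
- exact: cvg_cst.
- exact: cvg_expr.
Qed.

(** The third power is the smallest for which the positive part of rho - v has two continuous
    derivatives; [cut1] and [cut2] are those derivatives. *)
Definition cut0 v : R := (Num.max (rho - v) 0) ^+ 3 / 6.
Definition cut1 v : R := - ((Num.max (rho - v) 0) ^+ 2 / 2).
Definition cut2 v : R := Num.max (rho - v) 0.

Let weight_int (g : {poly R}) v : 0 <= v <= M ->
  (\int[mu]_(s in `[0%R, v]) (g.[s] * ((rho - s) * (step_poly M k n).[s]))%:E @[n --> \oo] -->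
   \int[mu]_(s in `[0%R, Num.min v rho]) (g.[s] * (rho - s))%:E)%E.
Proof.
move=> /andP[v0 vM].
have mg (p : {poly R}) D : measurable_fun D (fun s => p.[s]).
  by apply: measurable_funTS; apply: continuous_measurable_fun => x; exact: continuous_horner.
have -> : (\int[mu]_(s in `[0%R, Num.min v rho]) (g.[s] * (rho - s))%:E =
    \int[mu]_(s in `[0%R, v]) (if s <= rho then g.[s] * (rho - s) else 0)%:E)%E.
  rewrite !integral_itvE; apply: eq_integral => s _; rewrite le_min.
  by case: (0 <= s) => //=; case: (s <= v) => //=; case: (s <= rho).
have [N gN] : exists N, forall s, 0 <= s <= M -> `|g.[s]| <= N.
  have [/= c _ cN] := @EVT_max R (fun s => `|g.[s]|) 0 M (ltW M0)
    (continuous_subspaceT (fun z => continuous_comp (@continuous_horner _ g z) (@norm_continuous _ _ _))).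
  by exists `|g.[c]| => s sM; apply: cN; rewrite in_itv.
have N0 : 0 <= N by apply: le_trans (gN 0 _) => //; rewrite lexx ltW.
apply: (@dominated_cvg _ _ _ _ _ _ _ _ (cst (N * M)%:E)) => //.
- move=> n; apply/measurable_EFinP.
  have := mg (g * ((rho%:P - 'X) * step_poly M k n)) `[0, v]%classic.
  by apply: eq_measurable_fun => s _; rewrite !hornerE.
- move=> s; rewrite /= in_itv/= => /andP[s0 sv].
  apply: cvg_EFin; first exact: nearW.
  have sM := le_trans sv vM.
  have [sr|rs|->] := ltgtP s rho.
  + rewrite -[X in _ --> X]mulr1 -!mulrA; apply: cvgM; first exact: cvg_cst.
    by apply: cvgM; [exact: cvg_cst|apply: cvg_step_poly_left; rewrite s0].
  + rewrite -[X in _ --> X](mulr0 (g.[s] * (rho - s))).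
    under eq_fun do rewrite mulrA.
    by apply: cvgM; [exact: cvg_cst|apply: cvg_step_poly_right; rewrite rs].
  + rewrite subrr mulr0; under eq_fun do rewrite mul0r mulr0; exact: cvg_cst.
- apply/integrableP; split => //.
  have -> : (fun x : R => `|cst (N * M)%:E x|)%E = cst (N * M)%:E.
    by apply/funext => s; rewrite /= ger0_norm// mulr_ge0// ltW.
  by rewrite (integral_itv_cst _ v0) ltry.
- move=> n s; rewrite /= in_itv/= => /andP[s0 sv]; rewrite lee_fin.
  have sM : 0 <= s <= M by rewrite s0 (le_trans sv).
  have /andP[p0 p1] := step_poly_bound n sM.
  rewrite !normrM; apply: ler_pM => //; first exact: gN.
  rewrite (ger0_norm p0) -[leRHS]mulr1; apply: ler_pM => //.
  case/andP: sM => _ sM; rewrite ler_norml; apply/andP; split.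
    by rewrite lerNl opprB (le_trans _ sM)// gerBl ltW.
  have rM : rho <= M by rewrite ler_peMr ?ler1n ?(ltW rho0)//; exact: ltnW.
  by rewrite (le_trans _ rM)// gerBl.
Qed.

(** By the fundamental theorem of calculus, [weight_int] is a statement on values of primitives. The
    step polynomials switch the integrand off beyond rho, which is why the limit stops at min(v,
    rho). *)
Let cvg_weight (g G : {poly R}) (Q : nat -> {poly R}) v : 0 <= v <= M ->
  (forall s, (deriv G).[s] = g.[s] * (rho - s)) ->
  (forall n s, (deriv (Q n)).[s] = g.[s] * ((rho - s) * (step_poly M k n).[s])) ->
  (Q n).[v] - (Q n).[0] @[n --> \oo] --> G.[Num.min v rho] - G.[0].
Proof.
move=> vM hG hQ; have /andP[v0 _] := vM.
have w0 : 0 <= Num.min v rho by rewrite le_min v0 ltW.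
have := @weight_int g v vM.
have -> : (fun n => \int[mu]_(s in `[0%R, v]) (g.[s] * ((rho - s) * (step_poly M k n).[s]))%:E)%E =
    (fun n => ((Q n).[v] - (Q n).[0])%:E).
  by apply/funext => n; rewrite -(poly_FTC (Q n) v0); apply: eq_integral => s _; rewrite hQ.
have -> : (\int[mu]_(s in `[0%R, Num.min v rho]) (g.[s] * (rho - s))%:E)%E =
    (G.[Num.min v rho] - G.[0])%:E.
  by rewrite -(poly_FTC G w0); apply: eq_integral => s _; rewrite hG.
exact: fine_cvg.
Qed.

(* [q n] is the second primitive of rho - v times a Stone step polynomial, so its
   first two derivatives converge boundedly along with it. *)
Lemma cutoff_polynomials : exists (q : nat -> {poly R}) (N : R), forall v, 0 <= v <= M ->
  [/\ (forall n, [/\ `|(q n).[v]| <= N, `|(deriv (q n)).[v]| <= N & `|(deriv (deriv (q n))).[v]| <= N]),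
      (q n).[v] @[n --> \oo] --> cut0 v, (deriv (q n)).[v] @[n --> \oo] --> cut1 v &
      (deriv (deriv (q n))).[v] @[n --> \oo] --> cut2 v].
Proof.
have /all_sig[q1 hq1] n : {q : {poly R} | deriv q = (rho%:P - 'X) * step_poly M k n /\ q.[0] = - (rho ^+ 2 / 2)}.
  by apply/cid; exact: poly_primitive.
have /all_sig[q hq] n : {q : {poly R} | deriv q = q1 n /\ q.[0] = rho ^+ 3 / 6}.
  by apply/cid; exact: poly_primitive.
have rM : rho <= M by rewrite ler_peMr ?ler1n ?(ltW rho0)//; exact: ltnW.
have b2 n v : 0 <= v <= M -> `|(deriv (deriv (q n))).[v]| <= M.
  move=> vM; have [-> _] := hq n; have [-> _] := hq1 n; rewrite hornerM normrM.
  have /andP[p0 p1] := step_poly_bound n vM; rewrite (ger0_norm p0) -[leRHS]mulr1; apply: ler_pM => //.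
  rewrite !hornerE.
  case/andP: vM => v0 vM; rewrite ler_norml; apply/andP; split.
    by rewrite lerNl opprB (le_trans _ vM)// gerBl ltW.
  by rewrite (le_trans _ rM)// gerBl.
have z0 : 0 <= (0 : R) <= M by rewrite lexx ltW.
have b1 n v : 0 <= v <= M -> `|(deriv (q n)).[v]| <= rho ^+ 2 / 2 + M * M.
  move=> vM; have := poly_lipschitz (b2 n) z0 vM; have [E _] := hq n; rewrite E.
  have [_ E0] := hq1 n; rewrite E0 subr0 opprK => h.
  have h2 : `|(q1 n).[v]| <= `|(q1 n).[v] + rho ^+ 2 / 2| + `|rho ^+ 2 / 2|.
    by rewrite -{1}[(q1 n).[v]](addrK (rho ^+ 2 / 2)) ler_normB.
  apply: (le_trans h2); rewrite addrC lerD//; first by rewrite ger0_norm// divr_ge0// sqr_ge0.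
  apply: (le_trans h); rewrite ler_wpM2l ?(ltW M0)//; case/andP: vM => v0 vM.
  by rewrite ger0_norm.
pose N1 := rho ^+ 2 / 2 + M * M.
have N10 : 0 <= N1 by rewrite /N1 addr_ge0 ?divr_ge0 ?sqr_ge0 ?mulr_ge0 ?(ltW M0).
have b0 n v : 0 <= v <= M -> `|(q n).[v]| <= rho ^+ 3 / 6 + N1 * M.
  move=> vM; have := poly_lipschitz (b1 n) z0 vM; have [_ E] := hq n; rewrite E subr0 => h.
  have h2 : `|(q n).[v]| <= `|(q n).[v] - rho ^+ 3 / 6| + `|rho ^+ 3 / 6|.
    by rewrite -{1}[(q n).[v]](subrK (rho ^+ 3 / 6)) ler_normD.
  apply: (le_trans h2); rewrite addrC lerD//.
    by rewrite ger0_norm// divr_ge0// exprn_ge0// ltW.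
  apply: (le_trans h); rewrite ler_wpM2l//; case/andP: vM => v0 vM.
  by rewrite ger0_norm.
exists q, (M + N1 + (rho ^+ 3 / 6 + N1 * M)) => v vM.
have p0 : 0 <= rho ^+ 3 / 6 + N1 * M.
  by rewrite addr_ge0 ?divr_ge0 ?mulr_ge0 ?exprn_ge0 ?(ltW M0) ?(ltW rho0).
have /andP[v0 vM'] := vM.
split.
- move=> n; split.
  + by apply: (le_trans (b0 n v vM)); rewrite lerDr addr_ge0// ltW.
  + by apply: (le_trans (b1 n v vM)); rewrite -/N1; have := ltW M0; lra.
  + by apply: (le_trans (b2 n v vM)); lra.
- (* Taylor's formula with integral remainder *)
  pose G : {poly R} := (v * rho)%:P * 'X - ((v + rho) / 2)%:P * ('X * 'X) + 3^-1%:P * ('X * 'X * 'X).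
  have := @cvg_weight (v%:P - 'X) G (fun n => (v%:P - 'X) * q1 n + q n) v vM.
  have dG s : (deriv G).[s] = (v%:P - 'X).[s] * (rho - s).
    by rewrite /G !(derivD, derivN, derivM, derivX, derivC) !(hornerD, hornerM, hornerN, hornerC, hornerX); field.
  have dQ n s : (deriv ((v%:P - 'X) * q1 n + q n)).[s] =
      (v%:P - 'X).[s] * ((rho - s) * (step_poly M k n).[s]).
    rewrite !(derivD, derivN, derivM, derivX, derivC) (hq n).1 (hq1 n).1.
    by rewrite !(hornerD, hornerM, hornerN, hornerC, hornerX); ring.
  move=> /(_ dG dQ) h.
  have -> : (fun n => (q n).[v]) = (fun n => ((v%:P - 'X) * q1 n + q n).[v] -
      ((v%:P - 'X) * q1 n + q n).[0] + (v * - (rho ^+ 2 / 2) + rho ^+ 3 / 6)).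
    apply/funext => n; rewrite !(hornerD, hornerM, hornerN, hornerC, hornerX).
    by rewrite (hq n).2 (hq1 n).2; ring.
  have -> : cut0 v = G.[Num.min v rho] - G.[0] + (v * - (rho ^+ 2 / 2) + rho ^+ 3 / 6).
    rewrite /G /cut0 !(hornerD, hornerM, hornerN, hornerC, hornerX); have [vr|vr] := leP v rho.
      by rewrite max_l ?subr_ge0//; field.
    by rewrite max_r ?subr_le0 ?(ltW vr)//; field.
  by apply: cvgD => //; exact: cvg_cst.
- pose G : {poly R} := rho%:P * 'X - 2^-1%:P * ('X * 'X).
  have := @cvg_weight 1 G q1 v vM.
  have dG s : (deriv G).[s] = (1 : {poly R}).[s] * (rho - s).
    by rewrite /G !(derivD, derivN, derivM, derivX, derivC) !(hornerD, hornerM, hornerN, hornerC, hornerX); field.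
  have dQ n s : (deriv (q1 n)).[s] = (1 : {poly R}).[s] * ((rho - s) * (step_poly M k n).[s]).
    by rewrite (hq1 n).1 !(hornerD, hornerM, hornerN, hornerC, hornerX); ring.
  move=> /(_ dG dQ) h.
  have -> : (fun n => (deriv (q n)).[v]) = (fun n => (q1 n).[v] - (q1 n).[0] - rho ^+ 2 / 2).
    by apply/funext => n; rewrite (hq n).1 (hq1 n).2 opprK addrK.
  have -> : cut1 v = G.[Num.min v rho] - G.[0] - rho ^+ 2 / 2.
    rewrite /G /cut1 !(hornerD, hornerM, hornerN, hornerC, hornerX); have [vr|vr] := leP v rho.
      by rewrite max_l ?subr_ge0//; field.
    by rewrite max_r ?subr_le0 ?(ltW vr)//; field.
  by apply: cvgB => //; exact: cvg_cst.
- have -> : (fun n => (deriv (deriv (q n))).[v]) = (fun n => (rho - v) * (step_poly M k n).[v]).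
    by apply/funext => n; rewrite (hq n).1 (hq1 n).1 hornerM !hornerE.
  rewrite /cut2; have [vr|rv|->] := ltgtP v rho.
  + rewrite max_l ?subr_ge0 ?ltW// -[X in _ --> X]mulr1.
    by apply: cvgM; [exact: cvg_cst|apply: cvg_step_poly_left; rewrite v0].
  + rewrite max_r ?subr_le0 ?ltW// -(mulr0 (rho - v)).
    by apply: cvgM; [exact: cvg_cst|apply: cvg_step_poly_right; rewrite rv].
  + by rewrite subrr maxxx; under eq_fun do rewrite mul0r; exact: cvg_cst.
Qed.

(** The second derivative [cut2] is at most rho on [0, +oo[. The estimate serves for the limit L ->
    +oo, where the polynomials are already gone; the cases are the positions of u and v relative to
    the kink rho. *)
Lemma cut_taylor u v : 0 <= u -> 0 <= v ->
  `|cut0 v - cut0 u - cut1 u * (v - u)| <= rho * (v - u) ^+ 2.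
Proof.
move=> u0 v0; rewrite /cut0 /cut1.
have [vr|vr] := leP v rho; have [ur|ur] := leP u rho.
- rewrite !max_l ?subr_ge0//.
  have -> : (rho - v) ^+ 3 / 6 - (rho - u) ^+ 3 / 6 - - ((rho - u) ^+ 2 / 2) * (v - u) =
    (v - u) ^+ 2 * ((rho - v) + 2 * (rho - u)) / 6 by field.
  rewrite ger0_norm; last first.
    by rewrite divr_ge0// mulr_ge0 ?sqr_ge0// addr_ge0 ?mulr_ge0// subr_ge0.
  have := sqr_ge0 (v - u); move: ((v - u) ^+ 2) => D D0; nra.
- rewrite (max_l (x := rho - v)) ?subr_ge0// (max_r (x := rho - u)) ?subr_le0 ?(ltW ur)//.
  rewrite !expr0n/= !mul0r subr0 oppr0 mul0r subr0.
  rewrite ger0_norm ?divr_ge0 ?exprn_ge0 ?subr_ge0//.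
  have h : (rho - v) ^+ 2 <= (v - u) ^+ 2.
    have h0 : 0 <= rho - v by rewrite subr_ge0.
    have h1 : 0 <= u - v by lra.
    by rewrite -[leRHS]sqrrN opprB ler_sqr ?nnegrE//; lra.
  have h0 : 0 <= rho - v by rewrite subr_ge0.
  have h1 : rho - v <= rho by rewrite gerBl.
  have : (rho - v) ^+ 2 * (rho - v) <= (v - u) ^+ 2 * rho by rewrite ler_pM ?sqr_ge0.
  have : 0 <= (v - u) ^+ 2 * rho by rewrite mulr_ge0 ?sqr_ge0// ltW.
  by rewrite (exprSr _ 2) (mulrC rho); lra.
- rewrite (max_r (x := rho - v)) ?subr_le0 ?(ltW vr)// (max_l (x := rho - u)) ?subr_ge0//.
  rewrite expr0n/= mul0r sub0r; have c0 : 0 <= rho - u by rewrite subr_ge0.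
  have cd : rho - u <= v - u by lra.
  have cr : rho - u <= rho by lra.
  move: c0 cd cr; move: (rho - u) (v - u) => C D C0 CD Cr.
  have h1 : 0 <= C ^+ 2 * D - C ^+ 3 / 3.
    by rewrite (exprSr _ 2) -mulrA -mulrBr mulr_ge0 ?sqr_ge0//; lra.
  have C30 : 0 <= C ^+ 3 by rewrite exprn_ge0.
  have -> : - (C ^+ 3 / 6) - - (C ^+ 2 / 2) * D = (C ^+ 2 * D - C ^+ 3 / 3) / 2 by field.
  rewrite ger0_norm ?divr_ge0//.
  have h2 : C ^+ 2 * D <= rho * D ^+ 2.
    rewrite !expr2 -mulrA; apply: ler_pM => //; first by rewrite mulr_ge0//; lra.
    by rewrite ler_wpM2r//; lra.
  have : 0 <= rho * D ^+ 2 by rewrite mulr_ge0 ?sqr_ge0// ltW.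
  lra.
- rewrite !max_r ?subr_le0 ?(ltW ur) ?(ltW vr)// !expr0n/= !mul0r subrr oppr0 mul0r subr0 normr0.
  by rewrite mulr_ge0 ?sqr_ge0// ltW.
Qed.

End polynomial_cutoffs.

(** * A periodic substitute for the squared norm *)

Section periodic_square.
Context {R : realType} {d : nat}.
Notation rV := 'rV[R]_d.
Implicit Types (x y z : rV) (L : R).
Variable S : 'M[R]_d.

Lemma enorm_le_coord x y : (forall i, `|x ord0 i| <= `|y ord0 i|) -> enorm x <= enorm y.
Proof.
move=> xy; rewrite ler_sqrt ?dotxx_ge0//; apply: ler_sum => i _.
by rewrite -!expr2 -(real_normK (num_real (x _ _))) -(real_normK (num_real (y _ _))) ler_sqr ?nnegrE.
Qed.

Lemma sin_lipschitz (a b : R) : `|sin a - sin b| <= `|a - b|.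
Proof.
have -> : sin a - sin b = 2 * sin ((a - b) / 2) * cos ((a + b) / 2).
  have h : sin a = sin ((a + b) / 2 + (a - b) / 2) by congr sin; field.
  have h' : sin b = sin ((a + b) / 2 - (a - b) / 2) by congr sin; field.
  by rewrite h h' sinD sinB; ring.
rewrite !normrM (ger0_norm (ler0n _ 2)).
have h1 := abs_sin_le ((a - b) / 2); have h2 := cos_max ((a + b) / 2).
apply: (@le_trans _ _ (2 * `|(a - b) / 2| * 1)).
  by rewrite ler_pM ?mulr_ge0// ler_wpM2l.
by rewrite normrM (ger0_norm (x := 2^-1)) ?invr_ge0// mulr1 mulrCA mulfV ?mulr1.
Qed.

(** A periodic substitute for x, close to it for large L, whose squared length [usq] is a
    trigonometric sum. Then [gr] is minus the gradient of [usq], and [hs] is sum_i S_ii d_i d_i of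
    it, the mixed derivatives being zero. *)
Definition rs L x : rV := \row_i (2 * L * sin (x ord0 i / (2 * L))).
Definition gr L x : rV := \row_i (- (2 * L * sin (x ord0 i / L))).
Definition usq L x := dot (rs L x) (rs L x).
Definition hs L x := \sum_i 2 * cos (x ord0 i / L) * S i i.

Definition uwave L : seq (@wave R d) := wcst (\sum_(i < d) (2 * L ^+ 2)) ++
  [seq (- (2 * L ^+ 2), L^-1 *: delta_mx ord0 i, 0) | i <- index_enum 'I_d].

Lemma dot_delta (a : R) i x : dot (a *: delta_mx ord0 i) x = a * x ord0 i.
Proof.
rewrite dotZl; congr (_ * _); rewrite /dot (bigD1 i)//= mxE !eqxx mul1r big1 ?addr0//.
by move=> j /negPf ji; rewrite mxE eqxx/= ji mul0r.
Qed.

Lemma sq_sin_half L v : L != 0 ->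
  (2 * L * sin (v / (2 * L))) * (2 * L * sin (v / (2 * L))) = 2 * L ^+ 2 * (1 - cos (v / L)).
Proof.
move=> L0; set w := v / (2 * L).
have -> : v / L = w *+ 2 by rewrite /w mulr2n; field.
rewrite cos_mulr2n; have := cos2Dsin2 w; rewrite mulr2n.
move: (cos w) (sin w) => c s h; rewrite (_ : c ^+ 2 = 1 - s ^+ 2); last by lra.
by ring.
Qed.

Lemma usqE L x : L != 0 -> usq L x = \sum_i 2 * L ^+ 2 * (1 - cos (x ord0 i / L)).
Proof. by move=> L0; apply: eq_bigr => i _; rewrite !mxE sq_sin_half. Qed.

Lemma wval_uwave L x : L != 0 -> wval (uwave L) x = usq L x.
Proof.
move=> L0; rewrite usqE// /wval /uwave big_cat/= -/(wval _ _) wval_wcst big_map -big_split/=.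
by apply: eq_bigr => i _; rewrite /phase/= dot_delta addr0 (mulrC L^-1) mulrBr mulr1 mulNr.
Qed.

Lemma wgrad_uwave L x : L != 0 -> wgrad (uwave L) x = gr L x.
Proof.
move=> L0; rewrite /wgrad /uwave big_cat/= -/(wgrad _ _) wgrad_wcst add0r big_map.
apply/rowP => j; rewrite summxE mxE (bigD1 j)//= !mxE !eqxx /phase/= dot_delta addr0.
rewrite big1 ?addr0; first by rewrite (mulrC L^-1); field.
by move=> i /negPf ij; rewrite !mxE eqxx/= eq_sym ij !mulr0.
Qed.

Lemma sdot_delta (a : R) i : sdot S (a *: delta_mx ord0 i) (a *: delta_mx ord0 i) = a ^+ 2 * S i i.
Proof.
rewrite /sdot dot_delta -scalemxAl mxE mulrA -expr2; congr (_ * _).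
by rewrite -rowE mxE.
Qed.

Lemma whess_uwave L x : L != 0 -> whess S (uwave L) x = hs L x.
Proof.
move=> L0; rewrite /whess /uwave big_cat/= big_seq1/= /sdot dot0l mulr0 add0r big_map -sumrN.
apply: eq_bigr => i _; rewrite /phase/= dot_delta addr0 -/(sdot S _ _) sdot_delta (mulrC L^-1).
by field.
Qed.

Lemma usq_ge0 L x : 0 <= usq L x. Proof. exact: dotxx_ge0. Qed.

Lemma usq_le L x : L != 0 -> usq L x <= 4 * d%:R * L ^+ 2.
Proof.
move=> L0; rewrite usqE//; apply: (@le_trans _ _ (\sum_(i < d) 4 * L ^+ 2)).
  apply: ler_sum => i _; have := cos_geN1 (x ord0 i / L); have := sqr_ge0 L.
  move: (cos _) (L ^+ 2) => c l; nra.
by rewrite sumr_const card_ord -[leLHS]mulr_natr mulrAC.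
Qed.

Lemma rs_lipschitz L x z : L != 0 -> enorm (rs L (x + z) - rs L x) <= enorm z.
Proof.
move=> L0; apply: enorm_le_coord => i; rewrite !mxE -mulrBr normrM.
apply: (@le_trans _ _ (`|2 * L| * `|z ord0 i / (2 * L)|)).
  rewrite ler_wpM2l//; apply: le_trans (sin_lipschitz _ _) _.
  by rewrite -mulrBl addrAC subrr add0r.
by rewrite -normrM mulrCA mulfV ?mulr1// mulf_neq0.
Qed.

Lemma sqrt_usq L x z : L != 0 -> `|enorm (rs L (x + z)) - enorm (rs L x)| <= enorm z.
Proof.
move=> L0; have h := rs_lipschitz x z L0; rewrite ler_norml; apply/andP; split.
  have := enormD (rs L (x + z)) (rs L x - rs L (x + z)); rewrite subrKC enormB; lra.
have := enormD (rs L x) (rs L (x + z) - rs L x); rewrite subrKC; lra.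
Qed.

Lemma usq_increment L x z : L != 0 ->
  `|usq L (x + z) - usq L x| <= enorm z * (2 * enorm (rs L x) + enorm z).
Proof.
move=> L0; rewrite /usq -!sqr_enorm subr_sqr normrM; apply: ler_pM => //.
  exact: sqrt_usq.
have := sqrt_usq x z L0; rewrite ler_norml => /andP[_ h].
rewrite ger0_norm ?addr_ge0 ?enorm_ge0//; lra.
Qed.

Lemma usq_second L x z : L != 0 ->
  `|usq L (x + z) + usq L (x - z) - 2 * usq L x| <= 2 * enorm z ^+ 2.
Proof.
move=> L0; rewrite !usqE// mulr_sumr -big_split -sumrB/= sqr_enorm mulr_sumr.
apply: le_trans (ler_norm_sum _ _ _) _; apply: ler_sum => i _.
have -> : (x + z) ord0 i / L = x ord0 i / L + z ord0 i / L by rewrite mxE mulrDl.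
have -> : (x - z) ord0 i / L = x ord0 i / L - z ord0 i / L by rewrite !mxE mulrBl.
set A := x ord0 i / L; set B := z ord0 i / L.
rewrite cosD cosB.
have -> : 2 * L ^+ 2 * (1 - (cos A * cos B - sin A * sin B)) +
  2 * L ^+ 2 * (1 - (cos A * cos B + sin A * sin B)) - 2 * (2 * L ^+ 2 * (1 - cos A)) =
  cos A * (4 * L ^+ 2 * (1 - cos B)) by ring.
have /andP[h1 h2] := cos_quadratic B; rewrite normrM.
have p0 : 0 <= 4 * L ^+ 2 * (1 - cos B) by apply: mulr_ge0 => //; rewrite mulr_ge0 ?sqr_ge0.
rewrite (ger0_norm p0); apply: (@le_trans _ _ (1 * (4 * L ^+ 2 * (1 - cos B)))).
  by rewrite ler_wpM2r// cos_max.
rewrite mul1r; apply: (@le_trans _ _ (4 * L ^+ 2 * (B ^+ 2 / 2))).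
  by rewrite ler_wpM2l// mulr_ge0// sqr_ge0.
by rewrite le_eqVlt; apply/orP; left; apply/eqP; rewrite /B; field.
Qed.

(** For |z| >= 1 the bound N on q0 suffices. For |z| < 1 the first-order Taylor terms at x + z and x
    - z combine into q1 times the second difference of [usq], which is at most 2 |z|^2. The
    remainders contain squares of first differences, of size |z| (2 |rs L x| + |z|); these need |rs
    L x| <= K, and beyond K all three values of q0 vanish. *)
Lemma second_difference (q0 q1 : R -> R) (M N B1 B2 K : R) L : L != 0 ->
  0 <= N -> 0 <= B1 -> 0 <= B2 -> 0 <= K ->
  (forall x, usq L x <= M) ->
  (forall v, 0 <= v <= M -> `|q0 v| <= N /\ `|q1 v| <= B1) ->
  (forall u v, 0 <= u <= M -> 0 <= v <= M -> `|q0 v - q0 u - q1 u * (v - u)| <= B2 * (v - u) ^+ 2) ->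
  (forall x z, K < enorm (rs L x) -> enorm z <= 1 -> q0 (usq L (x + z)) = 0) ->
  forall x z, `|q0 (usq L (x + z)) + q0 (usq L (x - z)) - 2 * q0 (usq L x)| <=
    (4 * N + (2 * B1 + 2 * B2 * (2 * K + 1) ^+ 2)) * Num.min 1 (enorm z ^+ 2).
Proof.
move=> L0 N0 B10 B20 K0 UM qb qt q00 x z.
have UM0 y : 0 <= usq L y <= M by rewrite usq_ge0 UM.
set C := 2 * B1 + _; have C0 : 0 <= C.
  by apply: addr_ge0; apply: mulr_ge0 => //; [exact: mulr_ge0|exact: sqr_ge0].
have [z1|z1] := leP 1 (enorm z ^+ 2).
  rewrite mulr1; apply: (@le_trans _ _ (4 * N)); last by rewrite lerDl.
  have [h1 _] := qb _ (UM0 (x + z)); have [h2 _] := qb _ (UM0 (x - z)); have [h3 _] := qb _ (UM0 x).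
  apply: le_trans (ler_normB _ _) _; rewrite normrM (ger0_norm (ler0n _ 2)).
  have := ler_normD (q0 (usq L (x + z))) (q0 (usq L (x - z))); lra.
have z1' : enorm z <= 1 by rewrite -ler_sqr ?nnegrE ?enorm_ge0// expr1n ltW.
have NC : C * enorm z ^+ 2 <= (4 * N + C) * enorm z ^+ 2.
  by rewrite ler_wpM2r ?sqr_ge0// lerDr mulr_ge0.
apply: le_trans NC.
have [xK|xK] := leP (enorm (rs L x)) K; last first.
  have h1 := q00 x z xK z1'; have h2 : q0 (usq L (x - z)) = 0 by apply: q00; rewrite ?enormN.
  have h3 : q0 (usq L x) = 0 by rewrite -(addr0 x); apply: q00; rewrite // /enorm dot0l sqrtr0.
  by rewrite h1 h2 h3 mulr0 addr0 subr0 normr0 mulr_ge0 ?sqr_ge0.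
have step y : enorm y = enorm z -> (usq L (x + y) - usq L x) ^+ 2 <= enorm z ^+ 2 * (2 * K + 1) ^+ 2.
  move=> yz; have := usq_increment x y L0; rewrite yz => h.
  rewrite -exprMn -(real_normK (num_real (_ - _))) ler_sqr ?nnegrE ?mulr_ge0 ?addr_ge0 ?enorm_ge0 ?mulr_ge0//.
  by apply: (le_trans h); rewrite ler_wpM2l ?enorm_ge0// lerD// ler_wpM2l.
have t1 := qt _ _ (UM0 x) (UM0 (x + z)); have t2 := qt _ _ (UM0 x) (UM0 (x - z)).
have s1 := step z erefl; have s2 := step (- z) (enormN z).
have [_ b1] := qb _ (UM0 x); have s3 := usq_second x z L0.
move: t1 t2 s1 s2 b1 s3; rewrite /C.
move: (usq L (x + z)) (usq L (x - z)) (usq L x) (enorm z ^+ 2) (sqr_ge0 (enorm z)) => up um u E E0.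
move=> t1 t2 s1 s2 b1 s3.
have -> : q0 up + q0 um - 2 * q0 u = (q0 up - q0 u - q1 u * (up - u)) +
  (q0 um - q0 u - q1 u * (um - u)) + q1 u * (up + um - 2 * u) by ring.
apply: le_trans (ler_normD _ _) _; have := ler_normD (q0 up - q0 u - q1 u * (up - u)) (q0 um - q0 u - q1 u * (um - u)).
have : `|q1 u * (up + um - 2 * u)| <= B1 * (2 * E) by rewrite normrM ler_pM.
have : B2 * (up - u) ^+ 2 <= B2 * (E * (2 * K + 1) ^+ 2) by rewrite ler_wpM2l.
have : B2 * (um - u) ^+ 2 <= B2 * (E * (2 * K + 1) ^+ 2) by rewrite ler_wpM2l.
lra.
Qed.

Definition ssum := \sum_i \sum_j `|S i j|.

Lemma ssum_ge0 : 0 <= ssum.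
Proof. by apply: sumr_ge0 => i _; apply: sumr_ge0. Qed.

Lemma sdot_bound x A : (forall i, `|x ord0 i| <= A) -> `|sdot S x x| <= A ^+ 2 * ssum.
Proof.
move=> xA; rewrite /sdot /dot /ssum; under eq_bigr do rewrite mxE mulr_sumr.
rewrite exchange_big/= mulr_sumr; apply: le_trans (ler_norm_sum _ _ _) _; apply: ler_sum => i _.
rewrite mulr_sumr; apply: le_trans (ler_norm_sum _ _ _) _; apply: ler_sum => j _.
have A0 : 0 <= A by apply: le_trans (xA i).
by rewrite mulrA normrM ler_wpM2r// normrM expr2 ler_pM.
Qed.

Lemma gr_bound L x i : L != 0 -> `|gr L x ord0 i| <= 2 * `|rs L x ord0 i|.
Proof.
move=> L0; rewrite !mxE normrN.
have -> : x ord0 i / L = (x ord0 i / (2 * L)) *+ 2 by rewrite mulr2n; field.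
rewrite sin_mulr2n.
set w := x ord0 i / (2 * L).
have -> : 2 * L * (cos w * sin w *+ 2) = 2 * (cos w * (2 * L * sin w)) by rewrite mulr2n; ring.
rewrite normrM (ger0_norm (ler0n _ 2)) ler_wpM2l// normrM.
by rewrite -[leRHS]mul1r ler_wpM2r// cos_max.
Qed.

Lemma gr_bound2 L x i : L != 0 -> `|gr L x ord0 i| <= `|2 * L|.
Proof.
move=> L0; rewrite mxE normrN normrM -[leRHS]mulr1 ler_wpM2l//; exact: sin_max.
Qed.

Lemma hs_bound L x : `|hs L x| <= 2 * ssum.
Proof.
rewrite /ssum mulr_sumr; apply: le_trans (ler_norm_sum _ _ _) _; apply: ler_sum => i _.
rewrite (bigD1 i)//= !normrM (ger0_norm (ler0n _ 2)) -mulrA ler_wpM2l//.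
apply: (@le_trans _ _ `|S i i|); first by rewrite -[leRHS]mul1r ler_wpM2r// cos_max.
by rewrite lerDl sumr_ge0.
Qed.

Lemma cvg_of_bound (f : nat -> R) (l C : R) : (forall n, `|l - f n| <= C / n.+1%:R) ->
  f n @[n --> \oo] --> l.
Proof.
move=> h; apply/cvgrPdist_le => e e0.
have c0 : C / n.+1%:R @[n --> \oo] --> (0 : R).
  rewrite -(mulr0 C); apply: cvgM; first exact: cvg_cst.
  exact: cvg_harmonic.
have /cvgrPdist_le/(_ _ e0) := c0; apply: filterS => n; rewrite sub0r normrN => hn.
by apply: le_trans (h n) _; apply: le_trans hn; exact: ler_norm.
Qed.

Lemma cvg_ord_sum n (f : 'I_n -> nat -> R) (l : 'I_n -> R) :
  (forall i, f i j @[j --> \oo] --> l i) -> \sum_i f i j @[j --> \oo] --> \sum_i l i.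
Proof.
move=> h; elim: (index_enum _) => [|i r ih].
  by rewrite big_nil; under eq_fun do rewrite big_nil; exact: cvg_cst.
by rewrite big_cons; under eq_fun do rewrite big_cons; exact: cvgD.
Qed.

End periodic_square.

(** * Passage from trigonometric sums to a bump *)

Section bump.
Local Open Scope ereal_scope.
Context {R : realType} {d : nat}.
Notation rV := 'rV[R]_d.
Context {dO : measure_display} {Omega : measurableType dO}.
Variables (P : probability Omega R) (X : R -> Omega -> 'rV[R]_d).
Hypothesis HX : levy_process P X.
Variables (b : rV) (S : 'M[R]_d) (m : {measure set rV -> \bar R}).
Hypotheses (Xsym : symmetric_process P X) (Ssym : S^T%R = S)
  (Spos : forall xi : rV, (0 <= dot xi (xi *m S))%R)
  (mfin : \int[m]_z (Num.min 1 (enorm z ^+ 2)%R)%:E < +oo)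
  (charE : forall t (xi : rV), (0 <= t)%R ->
      let re := levy_exponent_re S m xi in
      let im := levy_exponent_im b m xi in
      (\int[P]_w cos (dot xi (X t w)) = expR (t * re) * cos (t * im))%R /\
      (\int[P]_w sin (dot xi (X t w)) = expR (t * re) * sin (t * im))%R).

(** Dynkin's formula for f, where h stands for sum_ij S_ij d_i d_j f. Keeping h as a separate
    function avoids differentiating the limits. *)
Definition gen (f h : rV -> R) := dyn P X f (fun x => jump m f x + 2^-1 * h x)%R.

Let cap (z : rV) : R := (Num.min 1 (enorm z ^+ 2))%R.

Let diff (f : rV -> R) x z : R := (2^-1 * (f (x + z) + f (x - z)) - f x)%R.

Let measurable_diff f x : measurable_fun setT f -> measurable_fun setT (diff f x).
Proof.
move=> mf; apply: measurable_funB => //; apply: measurable_funM => //.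
apply: measurable_funD; apply: (measurableT_comp mf).
  by apply: measurable_funD_rV.
by apply: measurable_funB_rV.
Qed.

Let diff_le f C : (forall x z, `|f (x + z) + f (x - z) - 2 * f x| <= C * cap z)%R ->
  forall x z, (`|diff f x z| <= C * cap z)%R.
Proof.
move=> h x z; have := h x z.
have -> : (diff f x z = 2^-1 * (f (x + z) + f (x - z) - 2 * f x))%R by rewrite /diff; field.
rewrite normrM ger0_norm ?invr_ge0//; have := normr_ge0 (f (x + z) + f (x - z) - 2 * f x)%R; lra.
Qed.

Let integrable_diff (f : rV -> R) (C : R) (x : rV) : measurable_fun setT f ->
  (forall x z, `|f (x + z) + f (x - z) - 2 * f x| <= C * cap z)%R ->
  m.-integrable setT (EFin \o diff f x).
Proof.
move=> mf h; apply: (integrable_small mfin (C := C)); first exact: measurable_diff.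
exact: diff_le.
Qed.

Let integrable_cap C : m.-integrable setT (fun z => (C * cap z)%:E).
Proof.
apply: (@integrable_small _ _ _ mfin (fun z => C * cap z)%R (`|C|)%R).
  apply: measurable_funM => //; apply: measurable_minr => //.
  by apply: measurable_funX; exact: measurable_enorm.
move=> z; rewrite normrM ler_wpM2l// ger0_norm// /cap le_min ler01/=; exact: sqr_ge0.
Qed.

(** The common bound C min(1, |z|^2) on second differences is integrable for the Levy measure: it
    bounds the jump parts uniformly and lets them converge. *)
Lemma gen_lim (f_ h_ : nat -> rV -> R) f h (N C H : R) :
  (forall n, gen (f_ n) (h_ n)) -> (forall n x, (`|f_ n x| <= N)%R) ->
  (forall n x z, `|f_ n (x + z) + f_ n (x - z) - 2 * f_ n x| <= C * cap z)%R ->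
  (forall n x, (`|h_ n x| <= H)%R) ->
  (forall x, f_ n x @[n --> \oo] --> f x) -> (forall x, h_ n x @[n --> \oo] --> h x) ->
  gen f h.
Proof.
move=> G fN fC hH cf ch.
have mf n : measurable_fun setT (f_ n) by case: (G n) => -[].
pose I := (\int[m]_z (C * cap z))%R.
have jI n x : (`|jump m (f_ n) x| <= I)%R.
  have iD := integrable_diff x (mf n) (fC n).
  apply: (le_trans (le_normr_Rintegral measurableT iD)).
  apply: le_Rintegral => //.
  - exact: (integrable_norm iD).
  - exact: integrable_cap.
  - by move=> z _; exact: (diff_le (fC n)).
have I0 : (0 <= I)%R by apply: le_trans (jI 0%N 0%R).
have N0 : (0 <= N)%R by apply: le_trans (fN 0%N 0%R).
have H0 : (0 <= H)%R by apply: le_trans (hH 0%N 0%R).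
apply: (dyn_lim HX (N := N + (I + H)) G) => //.
- by move=> n x; apply: le_trans (fN n x) _; rewrite lerDl addr_ge0.
- move=> n x; apply: le_trans (ler_normD _ _) _; apply: (@le_trans _ _ (I + H)%R); last by rewrite lerDr.
  apply: lerD => //; rewrite normrM ger0_norm ?invr_ge0//; have := hH n x; lra.
- move=> x; apply: cvgD; last by apply: cvgM; [exact: cvg_cst|exact: ch].
  have dc z : diff (f_ n) x z @[n --> \oo] --> diff f x z.
    apply: cvgB; last exact: cf.
    apply: cvgM; first exact: cvg_cst.
    by apply: cvgD; exact: cf.
  have bd : forall z, (`|diff f x z| <= C * cap z)%R.
    move=> z; rewrite -lee_fin; apply: (@lee_of_cvg _ (fun n => (`|diff (f_ n) x z|)%:E)).
      by apply: cvg_EFin; [exact: nearW|apply: cvg_norm; exact: dc].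
    by move=> n; rewrite lee_fin; exact: (diff_le (fC n)).
  have mdf : measurable_fun setT (diff f x).
    apply: (measurable_fun_cvg (h := fun n => diff (f_ n) x)) => //.
    by move=> n; exact: measurable_diff.
  have iD : m.-integrable setT (EFin \o diff f x) by apply: (integrable_small mfin mdf bd).
  have : \int[m]_z (diff (f_ n) x z)%:E @[n --> \oo] --> \int[m]_z (diff f x z)%:E.
    apply: (@dominated_cvg _ _ _ _ _ _ _ _ (fun z => (C * cap z)%:E)) => //.
    + by move=> n; apply/measurable_EFinP; exact: measurable_diff.
    + by move=> z _; apply: cvg_EFin; [exact: nearW|exact: dc].
    + by move=> n z _; rewrite lee_fin; exact: (diff_le (fC n)).
  have iDf : \int[m]_z (diff f x z)%:E \is a fin_num := integrable_fin_num measurableT iD.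
  rewrite -(fineK iDf) => /fine_cvg; exact.
Qed.

Let gen_wave (s : seq (@wave R d)) : gen (wval s) (whess S s).
Proof.
have := @dyn_wval _ _ _ _ _ _ HX b S m Xsym Spos mfin charE s; congr dyn.
by apply/funext => x; rewrite (wgenE S mfin).
Qed.

Section fixed_scale.
Variables (rho : R) (k : nat) (L : R).
Hypotheses (rho0 : (0 < rho)%R) (k1 : (1 < k)%N) (L0 : (0 < L)%R)
  (Lk : (4 * d%:R * L ^+ 2 = rho * k%:R)%R).

Definition cut_hess (x : rV) : R :=
  (cut2 rho (usq L x) * sdot S (gr L x) (gr L x) + cut1 rho (usq L x) * hs S L x)%R.

(** By [Lk] the maximum 4 d L^2 of [usq] is rho k, so its values stay in the interval where the
    cutoff polynomials converge boundedly. *)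
Lemma gen_cut : gen (fun x => cut0 rho (usq L x)) cut_hess.
Proof.
have Ln0 : (L != 0)%R by rewrite gt_eqF.
have [q [N hq]] := cutoff_polynomials rho0 k1.
have UM (x : rV) : (0 <= usq L x <= rho * k%:R)%R by rewrite usq_ge0/= -Lk; exact: usq_le.
have [u hu] : exists u, forall n, [/\ wval (u n) =1 (fun x => (q n).[usq L x])%R &
    forall x, whess S (u n) x = ((deriv (deriv (q n))).[usq L x] * sdot S (gr L x) (gr L x) +
      (deriv (q n)).[usq L x] * hs S L x)%R].
  have /all_sig[u hu] n := cid (@wpoly_ex _ _ S Ssym (uwave L) (q n)).
  exists u => n; split => x; have [h1 _ h3] := hu n x.
    by rewrite h1 wval_uwave.
  by rewrite h3 wval_uwave// wgrad_uwave// whess_uwave.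
have z0 : (0 <= (0 : R) <= rho * k%:R)%R by rewrite lexx mulr_ge0// ltW.
have N0 : (0 <= N)%R by have [h _ _ _] := hq 0%R z0; have [+ _ _] := h 0%N; exact: le_trans.
(* K bounds |rs L x| for all x, so at a fixed scale the Taylor bound serves everywhere. *)
pose K := Num.sqrt (rho * k%:R).
apply: (@gen_lim (fun n => wval (u n)) (fun n => whess S (u n)) _ _ N
  (4 * N + (2 * N + 2 * N * (2 * K + 1) ^+ 2)) (N * ((2 * L) ^+ 2 * ssum S) + N * (2 * ssum S)))%R.
- by move=> n; exact: gen_wave.
- move=> n x; have [h _] := hu n; rewrite h.
  by have [+ _ _ _] := hq _ (UM x) => /(_ n)[].
- move=> n x z; have [h _] := hu n; rewrite !h.
  apply: (@second_difference _ _ (horner (q n)) (horner (deriv (q n))) (rho * k%:R)%R N N N K L) => //.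
  + exact: sqrtr_ge0.
  + by move=> y; case/andP: (UM y).
  + by move=> v vM; have [+ _ _ _] := hq _ vM => /(_ n)[].
  + apply: poly_taylor => v vM.
    by have [+ _ _ _] := hq _ vM => /(_ n)[].
  + move=> y w; rewrite ltNge => /negP[]; rewrite /enorm -/(usq L y) ler_sqrt ?mulr_ge0 ?(ltW rho0)//.
    by case/andP: (UM y).
- move=> n x; have [_ h] := hu n; rewrite h.
  have [+ _ _ _] := hq _ (UM x) => /(_ n)[_ h1 h2].
  apply: le_trans (ler_normD _ _) _; rewrite !normrM; apply: lerD; apply: ler_pM => //.
    apply: sdot_bound => i; apply: le_trans (gr_bound2 _ _ _) _ => //.
    by rewrite ger0_norm// mulr_ge0// ltW.
  exact: hs_bound.
- move=> x; have -> : (fun n => wval (u n) x) = (fun n => (q n).[usq L x])%R.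
    by apply/funext => n; have [h _] := hu n; exact: h.
  by have [_ + _ _] := hq _ (UM x).
- move=> x; have -> : (fun n => whess S (u n) x) = (fun n =>
      (deriv (deriv (q n))).[usq L x] * sdot S (gr L x) (gr L x) + (deriv (q n)).[usq L x] * hs S L x)%R.
    by apply/funext => n; have [_ h] := hu n; exact: h.
  have [_ _ h1 h2] := hq _ (UM x).
  by apply: cvgD; apply: cvgM => //; exact: cvg_cst.
Qed.
End fixed_scale.

Definition rbump (rho : R) (x : rV) : R := cut0 rho (dot x x).
Definition rbump_hess (rho : R) (x : rV) : R := (cut2 rho (dot x x) * sdot S (- (2 *: x)) (- (2 *: x)) +
  cut1 rho (dot x x) * \sum_i 2 * S i i)%R.

Lemma gen_bump (rho : R) : (0 < d)%N -> (0 < rho)%R -> gen (rbump rho) (rbump_hess rho).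
Proof.
move=> d0 rho0.
have dp : (0 < d%:R :> R)%R by rewrite ltr0n.
(* Solves 4 d L^2 = rho k for k = j + 2, the shift ensuring k > 1. All approximation errors below
   are of order 1 / L^2, hence of order 1 / j. *)
pose Lsq (j : nat) : R := (rho * j.+2%:R / (4 * d%:R))%R.
have Lsq0 j : (0 < Lsq j)%R by rewrite divr_gt0 ?mulr_gt0.
pose L j := Num.sqrt (Lsq j).
have L0 j : (0 < L j)%R by rewrite sqrtr_gt0.
have Ln0 j : (L j != 0)%R by rewrite gt_eqF.
have L2 j : (L j ^+ 2 = Lsq j)%R by rewrite sqr_sqrtr// ltW.
have Lk j : (4 * d%:R * L j ^+ 2 = rho * j.+2%:R)%R.
  by rewrite L2 /Lsq; field; rewrite gt_eqF.
pose E : R := (d%:R / rho)%R.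
have E0 : (0 <= E)%R by rewrite divr_ge0 ?ltW.
have LE j : ((L j ^+ 2)^-1 <= 4 * E / j.+1%:R)%R.
  rewrite L2 /Lsq; have -> : ((rho * j.+2%:R / (4 * d%:R))^-1 = 4 * E / j.+2%:R)%R.
    by rewrite /E; field; rewrite pnatr_eq0 !gt_eqF.
  apply: ler_wpM2l; first by rewrite mulr_ge0.
  by rewrite lef_pV2 ?posrE ?ltr0n// ler_nat.
have cs (v : R) : (2 * L j * sin (v / (2 * L j)))%R @[j --> \oo] --> v.
  apply: (@cvg_of_bound _ _ _ (`|v| ^+ 3 * E)%R) => j; rewrite distrC.
  have -> : (2 * L j * sin (v / (2 * L j)) - v = 2 * L j * (sin (v / (2 * L j)) - v / (2 * L j)))%R.
    by rewrite mulrBr; congr (_ - _)%R; field.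
  have l0 : (0 <= 2 * L j)%R by rewrite mulr_ge0// ltW.
  rewrite normrM (ger0_norm l0); apply: (@le_trans _ _ (2 * L j * `|v / (2 * L j)| ^+ 3)%R).
    by rewrite ler_wpM2l// sin_cubic.
  rewrite normrM normfV (ger0_norm l0).
  have -> : (2 * L j * (`|v| / (2 * L j)) ^+ 3 = `|v| ^+ 3 / 4 * (L j ^+ 2)^-1)%R by field.
  have := ler_wpM2l (x := (`|v| ^+ 3 / 4)%R) _ (LE j); rewrite divr_ge0 ?exprn_ge0// => /(_ isT) h.
  by apply: (le_trans h); move: (j.+1%:R^-1)%R => N; rewrite le_eqVlt; apply/orP; left; apply/eqP; field.
have cc (v : R) : cos (v / L j)%R @[j --> \oo] --> (1%R : R).
  apply: (@cvg_of_bound _ _ _ (v ^+ 2 / 2 * (4 * E))%R) => j.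
  have /andP[h1 h2] := cos_quadratic (v / L j); rewrite ger0_norm//; apply: (le_trans h2).
  have -> : ((v / L j) ^+ 2 / 2 = v ^+ 2 / 2 * (L j ^+ 2)^-1)%R by field.
  by rewrite -[leRHS]mulrA ler_wpM2l// divr_ge0// sqr_ge0.
have crs (x : rV) i : rs (L j) x ord0 i @[j --> \oo] --> x ord0 i.
  by under eq_fun do rewrite mxE; exact: cs.
have cU (x : rV) : usq (L j) x @[j --> \oo] --> dot x x.
  by apply: cvg_ord_sum => i; apply: cvgM; exact: crs.
have cgr (x : rV) i : gr (L j) x ord0 i @[j --> \oo] --> (- (2 *: x))%R ord0 i.
  rewrite !mxE; under eq_fun do rewrite mxE; apply: cvgN.
  have -> : (fun j => 2 * L j * sin (x ord0 i / L j))%R =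
      (fun j => 2 * (L j * sin (x ord0 i / L j)))%R by apply/funext => j; rewrite mulrA.
  apply: cvgM; first exact: cvg_cst.
  have := cs (2 * x ord0 i)%R.
  have -> : (fun j => 2 * L j * sin (2 * x ord0 i / (2 * L j)))%R =
      (fun j => 2 * (L j * sin (x ord0 i / L j)))%R.
    by apply/funext => j; rewrite -mulrA; congr (_ * (_ * sin _))%R; field.
  move=> /(cvgM (cvg_cst (2^-1%R : R))); rewrite mulrA mulVf// mul1r.
  have -> : (fun j => L j * sin (x ord0 i / L j))%R = (fun j => 2^-1 * (2 * (L j * sin (x ord0 i / L j))))%R.
    by apply/funext => j; rewrite [RHS]mulrA mulVf// mul1r.
  exact.
have cS (x : rV) : sdot S (gr (L j) x) (gr (L j) x) @[j --> \oo] --> sdot S (- (2 *: x))%R (- (2 *: x))%R.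
  apply: cvg_ord_sum => i; apply: cvgM; first exact: cgr.
  rewrite mxE; under eq_fun do rewrite mxE.
  by apply: cvg_ord_sum => l; apply: cvgM; [exact: cgr|exact: cvg_cst].
have chs (x : rV) : hs S (L j) x @[j --> \oo] --> (\sum_i 2 * S i i)%R.
  apply: cvg_ord_sum => i; apply: cvgM; last exact: cvg_cst.
  by rewrite -[X in _ --> X]mulr1; apply: cvgM; [exact: cvg_cst|exact: cc].
have c2 (u : nat -> R) l : u j @[j --> \oo] --> l -> cut2 rho (u j) @[j --> \oo] --> cut2 rho l.
  move=> ul; rewrite /cut2 maxr_absE; under eq_fun do rewrite maxr_absE.
  have h : (rho - u j)%R @[j --> \oo] --> (rho - l)%R by apply: cvgB => //; exact: cvg_cst.
  rewrite addr0 subr0; under eq_fun do rewrite addr0 subr0.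
  by apply: cvgM; [apply: cvgD => //; exact: cvg_norm|exact: cvg_cst].
have c1 (u : nat -> R) l : u j @[j --> \oo] --> l -> cut1 rho (u j) @[j --> \oo] --> cut1 rho l.
  move=> /c2 h; apply: cvgN; apply: cvgM; last exact: cvg_cst.
  by rewrite expr2; under eq_fun do rewrite expr2; exact: cvgM.
have c0 (u : nat -> R) l : u j @[j --> \oo] --> l -> cut0 rho (u j) @[j --> \oo] --> cut0 rho l.
  move=> /c2 h; apply: cvgM; last exact: cvg_cst.
  rewrite !exprS expr0 mulr1; under eq_fun do rewrite !exprS expr0 mulr1.
  by apply: cvgM => //; exact: cvgM.
have cutb v : (0 <= v)%R -> (0 <= Num.max (rho - v) 0 <= rho)%R.
  by move=> v0; rewrite le_max lexx orbT ge_max gerBl v0 ltW.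
have b0 v : (0 <= v)%R -> (`|cut0 rho v| <= rho ^+ 3)%R.
  move=> /cutb/andP[h1 h2]; rewrite /cut0 ger0_norm ?divr_ge0 ?exprn_ge0//.
  have h3 : (Num.max (rho - v) 0 ^+ 3 <= rho ^+ 3)%R by apply: lerXn2r => //; rewrite nnegrE ltW.
  have : (0 <= rho ^+ 3)%R by rewrite exprn_ge0// ltW.
  have : (0 <= Num.max (rho - v) 0 ^+ 3)%R by rewrite exprn_ge0.
  lra.
have b1 v : (0 <= v)%R -> (`|cut1 rho v| <= rho ^+ 2)%R.
  move=> /cutb/andP[h1 h2]; rewrite /cut1 normrN ger0_norm ?divr_ge0 ?exprn_ge0//.
  have h3 : (Num.max (rho - v) 0 ^+ 2 <= rho ^+ 2)%R by apply: lerXn2r => //; rewrite nnegrE ltW.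
  have : (0 <= Num.max (rho - v) 0 ^+ 2)%R by rewrite exprn_ge0.
  lra.
(* From beyond this radius a move of length at most 1 does not reach the support of the cutoff,
   because [rs] is 1-Lipschitz. Unlike the radius at a fixed scale, it is independent of L. *)
pose K := (Num.sqrt rho + 1)%R.
have K0 : (0 <= K)%R by rewrite addr_ge0// sqrtr_ge0.
apply: (@gen_lim (fun j x => cut0 rho (usq (L j) x)) (fun j => cut_hess rho (L j)) _ _ (rho ^+ 3)
  (4 * rho ^+ 3 + (2 * rho ^+ 2 + 2 * rho * (2 * K + 1) ^+ 2))
  (rho * ((2 * Num.sqrt rho) ^+ 2 * ssum S) + rho ^+ 2 * (2 * ssum S)))%R.
- by move=> j; exact: (@gen_cut rho j.+2 (L j)).
- by move=> j x; apply: b0; exact: usq_ge0.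
- move=> j x z; apply: (@second_difference _ _ (cut0 rho) (cut1 rho) (rho * j.+2%:R)%R _ _ _ K (L j)) => //.
  + by rewrite exprn_ge0// ltW.
  + by rewrite exprn_ge0// ltW.
  + exact: ltW.
  + by move=> y; rewrite -Lk; exact: usq_le.
  + by move=> v /andP[v0 _]; split; [exact: b0|exact: b1].
  + move=> u v /andP[u0 _] /andP[v0 _]; exact: (cut_taylor rho0).
  + move=> y w Ky w1; rewrite /cut0 max_r ?expr0n/= ?mul0r// subr_le0 ltW//.
    have := sqrt_usq y w (Ln0 j); rewrite ler_norml => /andP[h _].
    have h2 : (Num.sqrt rho < enorm (rs (L j) (y + w)))%R by move: Ky; rewrite /K; lra.
    rewrite /usq -sqr_enorm -(sqr_sqrtr (ltW rho0)) ltr_sqr ?nnegrE ?sqrtr_ge0 ?enorm_ge0//.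
- move=> j x; have U0 := usq_ge0 (L j) x.
  apply: le_trans (ler_normD _ _) _; apply: lerD; last first.
    by rewrite normrM; apply: ler_pM => //; [exact: b1|exact: hs_bound].
  have [Ur|Ur] := leP (usq (L j) x) rho; last first.
    rewrite /cut2 max_r ?subr_le0 ?(ltW Ur)// mul0r normr0.
    by rewrite !mulr_ge0 ?(ltW rho0) ?sqr_ge0 ?ssum_ge0.
  rewrite normrM; apply: ler_pM => //.
    by have /andP[h1 h2] := cutb _ U0; rewrite /cut2 ger0_norm.
  apply: sdot_bound => i; apply: le_trans (gr_bound _ _ (Ln0 j)) _.
  rewrite ler_wpM2l//; apply: le_trans (coord_le_enorm _ _) _.
  by rewrite /enorm ler_sqrt// ltW.
- by move=> x; apply: c0; exact: cU.
- move=> x; apply: cvgD; apply: cvgM.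
  + by apply: c2; exact: cU.
  + exact: cS.
  + by apply: c1; exact: cU.
  + exact: chs.
Qed.

End bump.

(** * The comparison function kappa *)

Section volumes.
Context {R : realType} {d : nat}.
Notation rV := 'rV[R]_d.
Notation lam := (lebesgue_rV R d).

Definition cball (x : rV) (r : R) : set rV := [set y | enorm (y - x) <= r].

Lemma measurable_enormB (x : rV) : measurable_fun setT (fun y : rV => enorm (y - x)).
Proof.
apply: (measurableT_comp measurable_enorm); exact: measurable_funB_rV.
Qed.

Lemma measurable_enorm_le (f : rV -> R) r : measurable_fun setT f -> measurable [set y | f y <= r].
Proof.
by move=> mf; rewrite -[X in measurable X]setTI; apply: (measurable_fun_le measurableT mf (measurable_cst r)).
Qed.

Lemma measurable_enorm_gt (f : rV -> R) r : measurable_fun setT f -> measurable [set y | r < f y].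
Proof.
move=> mf; rewrite (_ : [set y | r < f y] = ~` [set y | f y <= r]).
  by apply: measurableC; exact: measurable_enorm_le.
by apply/seteqP; split => y /=; rewrite ltNge => /negP.
Qed.

Lemma measurable_cball x r : measurable (cball x r).
Proof. by apply: measurable_enorm_le; exact: measurable_enormB. Qed.

Definition box (x : rV) (r : R) : set rV := [set y | forall i, `[x ord0 i - r, x ord0 i + r]%classic (y ord0 i)].

Lemma volume_box x r : 0 <= r -> lam (box x r) = ((2 * r) ^+ d)%:E.
Proof.
move=> r0; have := @lebesgue_rV_box R d (fun i => `[x ord0 i - r, x ord0 i + r]%classic).
move=> /(_ (fun i => measurable_itv _)) E; rewrite /box E.
transitivity (\prod_(i < d) (2 * r)%:E)%E; last first.
  by rewrite prodEFin prodr_const card_ord.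
apply: eq_bigr => i _; rewrite lebesgue_measure_itv/= lte_fin.
have [->|r1] := eqVneq r 0; first by rewrite subr0 addr0 ltxx mulr0.
have rp : 0 < r by rewrite lt_neqAle eq_sym r1.
have -> : x ord0 i - r < x ord0 i + r by lra.
by rewrite -EFinD; congr EFin; ring.
Qed.

Lemma measurable_box x r : measurable (box x r).
Proof.
rewrite (_ : box x r = \bigcap_(i in [set: 'I_d])
    ((fun y : rV => y ord0 i) @^-1` `[x ord0 i - r, x ord0 i + r]%classic)); last first.
  by apply/seteqP; split => [y yA i _|y yA i]; exact: yA.
apply: fin_bigcap_measurable; first exact: finite_finset.
by move=> i _; rewrite -[X in measurable X]setTI; exact: measurable_coord.
Qed.

Lemma volume_le x r : 0 <= r -> (lam (cball x r) <= ((2 * r) ^+ d)%:E)%E.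
Proof.
move=> r0; rewrite -(volume_box x r0); apply: le_measure; rewrite ?inE.
- exact: measurable_cball.
- exact: measurable_box.
- move=> y /= yr i; have := le_trans (coord_le_enorm (y - x) i) yr.
  by rewrite !mxE ler_norml /= in_itv/= => /andP[h1 h2]; apply/andP; split; lra.
Qed.

Lemma volume_ge x r : 0 <= r -> (((2 * (r / d%:R)) ^+ d)%:E <= lam (cball x r))%E.
Proof.
move=> r0; have rd : 0 <= r / d%:R by rewrite divr_ge0.
rewrite -(volume_box x rd); apply: le_measure; rewrite ?inE.
- exact: measurable_box.
- exact: measurable_cball.
- move=> y /= yr; rewrite /cball/=; apply: le_trans (enorm_le_sum _) _.
  apply: (@le_trans _ _ (\sum_(i < d) r / d%:R)).
    apply: ler_sum => i _; have := yr i; rewrite /= in_itv/= => /andP[h1 h2].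
    by rewrite !mxE ler_norml; apply/andP; split; lra.
  rewrite sumr_const card_ord -[leLHS]mulr_natr; have [->|d0] := eqVneq (d%:R : R) 0.
    by rewrite mulr0.
  by rewrite divfK.
Qed.
End volumes.

Section jump_profile.
Local Open Scope ereal_scope.
Context {R : realType} {d : nat}.
Notation rV := 'rV[R]_d.
Notation lam := (lebesgue_rV R d).
Hypothesis d0 : (0 < d)%N.
Context {dO : measure_display} {Omega : measurableType dO}.
Variables (P : probability Omega R) (X : R -> Omega -> 'rV[R]_d).
Hypothesis HX : levy_process P X.
Variable nu : rV -> R.
Hypothesis HA : assumption_A1 P X nu.
Implicit Types x y z : rV.

Definition kappa (x : rV) : R := if (enorm x <= 1)%R then 1%R else nu x.

Let e1 : rV := delta_mx ord0 (Ordinal d0).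

Let enorm_e1 : (enorm e1 = 1)%R.
Proof.
rewrite /enorm /dot (bigD1 (Ordinal d0))//= mxE !eqxx mulr1 big1 ?addr0 ?sqrtr1//.
by move=> j /negPf ji; rewrite mxE eqxx/= ji mul0r.
Qed.

Let enorm_neq0 x : (0 < enorm x)%R -> x != 0%R.
Proof. by apply: contraTneq => ->; rewrite /enorm dot0l sqrtr0 ltxx. Qed.

Lemma nu_pos x : (0 < enorm x)%R -> (0 < nu x)%R.
Proof. by move=> /enorm_neq0; exact: (A1_pos HA). Qed.

Lemma kappa_in x : (enorm x <= 1)%R -> kappa x = 1%R.
Proof. by rewrite /kappa => ->. Qed.

Lemma kappa_pos x : (0 < kappa x)%R.
Proof.
rewrite /kappa; case: ifPn => // /negP/negP; rewrite -ltNge => x1.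
by apply: nu_pos; exact: lt_trans x1.
Qed.

Lemma measurable_kappa : measurable_fun setT kappa.
Proof.
apply: measurable_fun_ifT => //; last exact: (A1_measurable HA).
apply: measurable_fun_ler => //; exact: measurable_enorm.
Qed.

Lemma potential_kappa : potential kappa.
Proof. by split; [exact: measurable_kappa|move=> x; exact: ltW (kappa_pos x)]. Qed.

Lemma kappa_bounded : exists2 K : R, (1 <= K)%R & forall x, (kappa x <= K)%R.
Proof.
have [C C1 h] := A1_decay HA; have n1 : (0 < nu e1)%R by apply: nu_pos; rewrite enorm_e1.
exists (1 + C * nu e1)%R; first by rewrite lerDl mulr_ge0 ?ltW// (lt_le_trans ltr01 C1).
move=> x; rewrite /kappa; case: ifPn => [_|/negP/negP].
  by rewrite lerDl mulr_ge0 ?ltW// (lt_le_trans ltr01 C1).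
rewrite -ltNge => x1; apply: (@le_trans _ _ (C * nu e1)%R); last by rewrite lerDr.
by apply: h; rewrite enorm_e1 (ltW x1) andbT invf_le1// ler1n.
Qed.

(** Condition (A1)(1) at radius 1/4, made symmetric in x and y. This radius still covers balls of
    radius 1/4 about points of norm above 1/2. *)
Let A1loc : exists2 C : R, (1 <= C)%R & forall x y,
  (4^-1 <= enorm x)%R -> (4^-1 <= enorm y)%R -> (`|enorm x - enorm y| <= 1)%R ->
  (nu y <= C * nu x)%R.
Proof.
have r4 : (0 < (4^-1 : R) <= 2^-1)%R by rewrite invr_gt0 ltr0n/= lef_pV2 ?posrE ?ltr0n// ler_nat.
have [C C1 h] := A1_local HA r4; exists C => // x y x4 y4; rewrite ler_norml => /andP[l1 l2].
have [xy|xy] := leP (enorm y) (enorm x).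
  have /andP[+ _] := h x y (introT andP (conj y4 xy)) (ltac:(lra)).
  by rewrite -ler_pdivlMl ?invr_gt0 ?(lt_le_trans ltr01)// invrK.
by have /andP[_] := h y x (introT andP (conj x4 (ltW xy))) (ltac:(lra)).
Qed.

(* The comparison only involves the norms, so that it also applies to [x] and [- x]. *)
Lemma kappa_local : exists2 C : R, (1 <= C)%R & forall x y,
  (`|enorm x - enorm y| <= 2^-1)%R -> (kappa y <= C * kappa x)%R.
Proof.
have [C C1 h] := A1loc; have n1 : (0 < nu e1)%R by apply: nu_pos; rewrite enorm_e1.
have C0 : (0 < C)%R by exact: lt_le_trans C1.
pose D := (C + C * nu e1 + C / nu e1)%R.
have p1 : (0 < C * nu e1)%R by rewrite mulr_gt0.
have p2 : (0 < C / nu e1)%R by rewrite divr_gt0.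
exists D; first by rewrite /D; lra.
move=> x y; rewrite ler_norml => /andP[l1 l2]; rewrite /kappa.
have half : (4^-1 <= (1 : R))%R by rewrite invf_le1// ler1n.
case: ifPn => [y1|/negP/negP]; [|rewrite -ltNge => y1]; (case: ifPn => [x1|/negP/negP]; [|rewrite -ltNge => x1]).
- by rewrite mulr1 /D; lra.
- have h1 : (nu e1 <= C * nu x)%R.
    by apply: h; rewrite ?enorm_e1//; [lra|rewrite ler_norml; apply/andP; split; lra].
  have : (1 <= C / nu e1 * nu x)%R by rewrite mulrAC ler_pdivlMr// mul1r.
  have : (0 < nu x)%R by apply: nu_pos; exact: lt_trans x1.
  rewrite /D; move: (C / nu e1)%R p2 (C * nu e1)%R p1 (nu x) => a a0 b b0 v; nra.
- have h1 : (nu y <= C * nu e1)%R.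
    by apply: h; rewrite ?enorm_e1//; [lra|rewrite ler_norml; apply/andP; split; lra].
  by rewrite mulr1 /D; lra.
- have nx : (0 < nu x)%R by apply: nu_pos; exact: lt_trans x1.
  have h1 : (nu y <= C * nu x)%R.
    by apply: h; [lra|lra|rewrite ler_norml; apply/andP; split; lra].
  apply: (le_trans h1); rewrite ler_wpM2r ?(ltW nx)// /D; lra.
Qed.

Lemma nu_kappa : exists2 C : R, (1 <= C)%R & forall y, (4^-1 <= enorm y)%R ->
  (nu y <= C * kappa y)%R /\ (kappa y <= C * nu y)%R.
Proof.
have [C C1 h] := A1loc; have n1 : (0 < nu e1)%R by apply: nu_pos; rewrite enorm_e1.
have C0 : (0 < C)%R by exact: lt_le_trans C1.
have p1 : (0 < C * nu e1)%R by rewrite mulr_gt0.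
have p2 : (0 < C / nu e1)%R by rewrite divr_gt0.
pose D := (1 + C * nu e1 + C / nu e1)%R.
exists D; first by rewrite /D; lra.
move=> y y4; have ny : (0 < nu y)%R by apply: nu_pos; lra.
have D1 : (1 <= D)%R by rewrite /D; lra.
rewrite /kappa; case: ifPn => [y1|_]; last by split; rewrite ler_peMl// ltW.
have [h1 h2] : (nu y <= C * nu e1)%R /\ (nu e1 <= C * nu y)%R.
  by split; apply: h => //; rewrite ?enorm_e1; try lra; rewrite ler_norml; apply/andP; split; lra.
rewrite mulr1; split; first by rewrite /D; lra.
have : (1 <= C / nu e1 * nu y)%R by rewrite mulrAC ler_pdivlMr// mul1r.
rewrite /D; move: (C / nu e1)%R p2 (C * nu e1)%R p1 (nu y) ny => a a0 b b0 v v0; nra.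
Qed.

Lemma levy_data : exists (m : {measure set rV -> \bar R}) (b : rV) (S : 'M[R]_d),
  [/\ S^T%R = S, (forall xi : rV, (0 <= dot xi (xi *m S))%R),
    \int[m]_z (Num.min 1 (enorm z ^+ 2)%R)%:E < +oo,
    (forall t (xi : rV), (0 <= t)%R ->
      let re := levy_exponent_re S m xi in
      let im := levy_exponent_im b m xi in
      (\int[P]_w cos (dot xi (X t w)) = expR (t * re) * cos (t * im))%R /\
      (\int[P]_w sin (dot xi (X t w)) = expR (t * re) * sin (t * im))%R) &
    forall A, measurable A -> m A = \int[lam]_(x in A) (nu x)%:E].
Proof.
have [m [b [S [[h1 h2] _ h3 h4]]] h5] := A1_density HA.
by exists m, b, S; split.
Qed.

(** On this set min(1, |z|^2) is at least 1/4, and its integral against the Levy measure is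
    finite. *)
Lemma nu_tail : exists2 C : R, (0 <= C)%R &
  \int[lam]_(x in [set x | (2^-1 < enorm x)%R]) (nu x)%:E <= C%:E.
Proof.
have [m [b [S [_ _ mfin _ mE]]]] := levy_data.
have mT : measurable [set x : rV | (2^-1 < enorm x)%R].
  by apply: measurable_enorm_gt; exact: measurable_enorm.
have mmin : measurable_fun setT (fun z : rV => (Num.min 1 (enorm z ^+ 2))%R%:E).
  by apply/measurable_EFinP; apply: measurable_minr => //; apply: measurable_funX; exact: measurable_enorm.
have min0 (z : rV) : 0 <= (Num.min 1 (enorm z ^+ 2))%R%:E by rewrite lee_fin le_min ler01 sqr_ge0.
have fi : \int[m]_z (Num.min 1 (enorm z ^+ 2)%R)%:E \is a fin_num.
  by rewrite ge0_fin_numE//; apply: integral_ge0 => z _; exact: min0.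
exists (4 * fine (\int[m]_z (Num.min 1 (enorm z ^+ 2)%R)%:E))%R.
  by rewrite mulr_ge0// fine_ge0// integral_ge0.
rewrite -mE// EFinM fineK// -ge0_integralZl_EFin//.
rewrite -[X in m X]setIT -integral_indic//; apply: ge0_le_integral => //.
- by apply/measurable_EFinP; exact: measurable_indic.
- by apply: emeasurable_funM => //; exact: measurable_cst.
- move=> z _; rewrite -EFinM lee_fin indicE; case: (boolP (z \in _)) => [|_]; last first.
    by rewrite mulr_ge0// le_min ler01 sqr_ge0.
  rewrite inE/= => z2; have : (4^-1 <= Num.min 1 (enorm z ^+ 2) :> R)%R.
    rewrite le_min invf_le1 ?ler1n//=; have : ((2^-1) ^+ 2 <= enorm z ^+ 2 :> R)%R.
      by rewrite ler_sqr ?nnegrE ?enorm_ge0 ?invr_ge0// ltW.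
    by apply: le_trans; rewrite le_eqVlt; apply/orP; left; apply/eqP; field.
  by rewrite /=; lra.
Qed.

(** If |y| <= 1/2 then kappa(x - y) is comparable to kappa(x), if |x - y| <= 1/2 then kappa(y) is,
    and the other factor is bounded. On the rest kappa is comparable to nu: for |x| >= 1 this is
    (A1)(3), and for |x| < 1, where kappa(x) = 1, one factor is bounded and the other integrated by
    [nu_tail]. *)
Lemma kappa_convolution : exists2 C : R, (1 <= C)%R & forall x,
  \int[lam]_y (kappa (x - y) * kappa y)%R%:E <= (C * kappa x)%:E.
Proof.
have [K K1 kK] := kappa_bounded; have [C C1 kloc] := kappa_local.
have [N N1 nk] := nu_kappa; have [T T0 tail] := nu_tail; have [C3 C31 conv] := A1_convolution HA.
pose v : R := ((2 * 2^-1) ^+ d)%R.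
have v0 : (0 <= v)%R by rewrite exprn_ge0// mulr_ge0// invr_ge0.
have K0 : (0 <= K)%R by lra. have C0 : (0 <= C)%R by lra. have N0 : (0 <= N)%R by lra.
pose Q := (N * N * (C3 * N + N * K * T))%R.
have Q0 : (0 <= Q)%R by rewrite !(mulr_ge0, addr_ge0)//; lra.
exists (1 + (K * C * v + K * C * v + Q))%R.
  by rewrite lerDl; apply: addr_ge0 => //; rewrite addr_ge0 ?mulr_ge0.
move=> x; have kx := kappa_pos x.
pose A := cball (0%R : rV) 2^-1; pose B := cball x 2^-1.
pose D := [set z : rV | (2^-1 < enorm (z - x))%R /\ (2^-1 < enorm (z - 0))%R].
have mD : measurable D.
  by apply: measurableI; apply: measurable_enorm_gt; exact: measurable_enormB.
have mA : measurable A by exact: measurable_cball.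
have mB : measurable B by exact: measurable_cball.
have mshift (f : rV -> R) : measurable_fun setT f -> measurable_fun setT (fun y => f (x - y)%R).
  by move=> mf; apply: (measurableT_comp mf); exact: measurable_funB_rV.
have mnu := A1_measurable HA.
have tri (y : rV) : (`|enorm (x - y) - enorm x| <= enorm y)%R.
  rewrite ler_norml; apply/andP; split.
    by have := enormD (x - y) y; rewrite subrK; lra.
  by have := enormD x (- y); rewrite enormN; lra.
have tri2 (y : rV) : (`|enorm x - enorm y| <= enorm (y - x))%R.
  rewrite ler_norml; apply/andP; split.
    by have := enormD (y - x) x; rewrite subrK; lra.
  by have := enormD (x - y) y; rewrite subrK enormB; lra.
pose c : R := (K * C * kappa x)%R.
have c0 : (0 <= c)%R by rewrite !mulr_ge0// ltW.
pose f1 y : \bar R := c%:E * (\1_A y)%:E.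
pose f2 y : \bar R := c%:E * (\1_B y)%:E.
pose f3 y : \bar R := ((fun y => (N * N)%:E * (nu (x - y) * nu (y - 0))%:E) \_ D) y.
have n0 y : D y -> (0 <= nu (x - y) * nu (y - 0))%R.
  move=> [h1 h2]; apply: mulr_ge0; apply: ltW; apply: nu_pos.
    by rewrite enormB; apply: lt_trans h1; rewrite invr_gt0.
  by apply: lt_trans h2; rewrite invr_gt0.
have f10 y : 0 <= f1 y by rewrite mule_ge0// lee_fin.
have f20 y : 0 <= f2 y by rewrite mule_ge0// lee_fin.
have f30 y : 0 <= f3 y.
  rewrite /f3 patchE; case: ifPn => // /set_mem Dy; apply: mule_ge0; rewrite lee_fin.
    exact: mulr_ge0.
  exact: n0.
have mf1 : measurable_fun setT f1.
  by apply: emeasurable_funM => //; apply/measurable_EFinP; exact: measurable_indic.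
have mf2 : measurable_fun setT f2.
  by apply: emeasurable_funM => //; apply/measurable_EFinP; exact: measurable_indic.
have mn : measurable_fun setT (fun y => (nu (x - y) * nu (y - 0))%:E).
  apply/measurable_EFinP; apply: measurable_funM; first exact: mshift.
  by apply: (measurableT_comp mnu); exact: measurable_funB_rV.
have mf3 : measurable_fun setT f3.
  apply/(measurable_restrictT _ mD); apply: measurable_funTS.
  by apply: emeasurable_funM => //; exact: measurable_cst.
apply: (@le_trans _ _ (\int[lam]_y (f1 y + f2 y + f3 y))).
  apply: ge0_le_integral => //.
  - by move=> y _; rewrite lee_fin mulr_ge0// ltW// kappa_pos.
  - apply/measurable_EFinP; apply: measurable_funM; last exact: measurable_kappa.
    exact: (mshift _ measurable_kappa).
  - by apply: emeasurable_funD => //; exact: emeasurable_funD.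
  - move=> y _; have k1 := kappa_pos (x - y)%R; have k2 := kappa_pos y.
    have [yA|yA] := leP (enorm (y - 0)%R) (2^-1)%R.
      have : (kappa (x - y) <= C * kappa x)%R.
        by apply: kloc; rewrite distrC; apply: le_trans (tri y) _; rewrite -[y]subr0.
      move=> h; apply: (@le_trans _ _ (f1 y)); last by rewrite -addeA leeDl// adde_ge0.
      rewrite /f1 indicE mem_set// mule1 lee_fin /c; have := kK y => h2.
      by rewrite -mulrA mulrC ler_pM// ltW.
    have [yB|yB] := leP (enorm (y - x)%R) (2^-1)%R.
      have : (kappa y <= C * kappa x)%R by apply: kloc; apply: le_trans (tri2 y) _.
      move=> h; apply: (@le_trans _ _ (f2 y)); last by rewrite addeAC leeDr// adde_ge0.
      rewrite /f2 indicE mem_set// mule1 lee_fin /c; have := kK (x - y)%R => h2.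
      by rewrite -mulrA ler_pM// ltW.
    apply: (@le_trans _ _ (f3 y)); last by rewrite leeDr// adde_ge0.
    rewrite /f3 patchE mem_set// -EFinM lee_fin -mulrACA.
    have q4 : (4^-1 <= 2^-1 :> R)%R by rewrite lef_pV2 ?posrE ?ltr0n// ler_nat.
    have g1 : (4^-1 <= enorm (x - y))%R by rewrite enormB (le_trans q4)// ltW.
    have g2 : (4^-1 <= enorm y)%R by move: yA; rewrite subr0 => yA; rewrite (le_trans q4)// ltW.
    have [_ h1] := nk _ g1; have [_ h2] := nk _ g2.
    by rewrite subr0 ler_pM// ltW.
rewrite ge0_integralD//; last 2 first.
- by move=> y _; rewrite adde_ge0.
- exact: emeasurable_funD.
rewrite ge0_integralD// mulrDl mul1r.
have cA (E : set rV) z : E = cball z 2^-1 -> \int[lam]_y (c%:E * (\1_E y)%:E) <= (K * C * v * kappa x)%:E.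
  move=> ->; rewrite ge0_integralZl_EFin//; last first.
    by apply/measurable_EFinP; apply: measurable_indic; exact: measurable_cball.
  rewrite integral_indic//; last exact: measurable_cball.
  have -> : (K * C * v * kappa x = c * v)%R by rewrite /c; ring.
  rewrite setIT (EFinM c v); apply: lee_wpmul2l; first by rewrite lee_fin.
  by apply: volume_le; rewrite invr_ge0.
have c3 : \int[lam]_y f3 y <= (Q * kappa x)%:E.
  have n0E y : D y -> 0 <= (nu (x - y) * nu (y - 0))%:E by move=> Dy; rewrite lee_fin; exact: n0.
  have NN0 : (0 <= N * N)%R by rewrite mulr_ge0.
  rewrite -integral_mkcond (ge0_integralZl_EFin lam mD n0E (measurable_funTS mn) NN0).
  have -> : (Q * kappa x = (N * N) * ((C3 * N + N * K * T) * kappa x))%R by rewrite /Q mulrA.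
  rewrite (EFinM (N * N)%R); apply: lee_wpmul2l; first by rewrite lee_fin.
  have [x1|x1] := leP 1%R (enorm x).
    apply: (@le_trans _ _ (C3 * nu (x - 0))%:E).
      have := conv x 0%R; rewrite sub0r enormN => /(_ x1); apply: le_trans.
      by rewrite le_eqVlt; apply/orP; left; apply/eqP.
    rewrite subr0 lee_fin.
    have x4 : (4^-1 <= enorm x)%R by apply: le_trans x1; rewrite invf_le1// ler1n.
    have [h _] := nk x x4.
    rewrite mulrDl -!mulrA; apply: (@le_trans _ _ (C3 * (N * kappa x))%R).
      by rewrite ler_wpM2l//; lra.
    by rewrite lerDl !mulr_ge0// ltW.
  apply: (@le_trans _ _ (\int[lam]_(y in D) ((N * K)%:E * (nu y)%:E))).
    apply: ge0_le_integral => //.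
    - exact: measurable_funTS.
    - by apply: measurable_funTS; apply: emeasurable_funM => //; exact/measurable_EFinP.
    - move=> y [h1 h2]; rewrite -EFinM lee_fin subr0 ler_wpM2r//.
        by apply/ltW/nu_pos; rewrite -[y]subr0 (lt_trans _ h2)// invr_gt0.
      have g1 : (4^-1 <= enorm (x - y))%R.
        by rewrite enormB (le_trans _ (ltW h1))// lef_pV2 ?posrE ?ltr0n// ler_nat.
      have [h3 _] := nk _ g1.
      by apply: (@le_trans _ _ (N * kappa (x - y))%R); last by rewrite ler_wpM2l.
  have nuE y : D y -> 0 <= (nu y)%:E.
    by move=> [_ h2]; rewrite lee_fin ltW// nu_pos// -[y]subr0 (lt_trans _ h2)// invr_gt0.
  have mnuE : measurable_fun D (fun y => (nu y)%:E) by apply: measurable_funTS; exact/measurable_EFinP.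
  have NK0 : (0 <= N * K)%R by rewrite mulr_ge0.
  rewrite (ge0_integralZl_EFin lam mD nuE mnuE NK0).
  have -> : (kappa x = 1)%R by rewrite /kappa (ltW x1).
  rewrite mulr1; apply: (@le_trans _ _ (N * K * T)%:E); last first.
    by rewrite lee_fin lerDr mulr_ge0//; lra.
  rewrite (EFinM (N * K)%R T); apply: lee_wpmul2l; first by rewrite lee_fin.
  apply: le_trans tail; apply: ge0_subset_integral => //.
  - by apply: measurable_enorm_gt; exact: measurable_enorm.
  - by apply: measurable_funTS; exact/measurable_EFinP.
  - by move=> y /= h2; rewrite lee_fin ltW// nu_pos// (lt_trans _ h2)// invr_gt0.
  - by move=> y [_]; rewrite subr0.
apply: (@le_trans _ _ ((K * C * v * kappa x)%:E + (K * C * v * kappa x)%:E + (Q * kappa x)%:E)).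
  by apply: leeD => //; apply: leeD; [exact: (cA A 0%R)|exact: (cA B x)].
by rewrite -!EFinD lee_fin -!mulrDl lerDr ltW.
Qed.

End jump_profile.

(** * The generator applied to the bump *)

Section bump_generator.
Local Open Scope ereal_scope.
Context {R : realType} {d : nat}.
Notation rV := 'rV[R]_d.
Notation lam := (lebesgue_rV R d).
Hypothesis d0 : (0 < d)%N.
Context {dO : measure_display} {Omega : measurableType dO}.
Variables (P : probability Omega R) (X : R -> Omega -> 'rV[R]_d).
Hypothesis HX : levy_process P X.
Variable nu : rV -> R.
Hypothesis HA : assumption_A1 P X nu.
Notation kappa := (kappa nu).
Implicit Types x y z : rV.

(** Its square root 1/4 is the radius of the support of the bump, so that jumps into the support
    from outside B(0, 1/2) have length above 1/4. *)
Let rho : R := (16^-1)%R.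
Let chi : rV -> R := rbump rho.

Let rho0 : (0 < rho)%R. Proof. by rewrite invr_gt0. Qed.

Let chi_bound x : (0 <= chi x <= 1)%R.
Proof.
rewrite /chi /rbump /cut0; set M := Num.max _ _.
have M0 : (0 <= M)%R by rewrite /M le_max lexx orbT.
have M1 : (M <= 1)%R.
  by rewrite /M ge_max ler01 andbT; have := dotxx_ge0 x; rewrite /rho; lra.
have : (M ^+ 3 <= 1)%R by rewrite exprn_ile1.
have : (0 <= M ^+ 3)%R by rewrite exprn_ge0.
by move=> h1 h2; apply/andP; split; lra.
Qed.

Let far x : (4^-1 <= enorm x)%R -> (rho <= dot x x)%R.
Proof.
move=> x4; rewrite -sqr_enorm; have : ((4^-1) ^+ 2 <= enorm x ^+ 2 :> R)%R.
  by rewrite ler_sqr ?nnegrE ?enorm_ge0 ?invr_ge0.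
by apply: le_trans; rewrite /rho le_eqVlt; apply/orP; left; apply/eqP; field.
Qed.

Let chi_far x : (4^-1 <= enorm x)%R -> chi x = 0%R.
Proof. by move=> /far h; rewrite /chi /rbump /cut0 max_r ?subr_le0// expr0n/= mul0r. Qed.

Let hess_far S x : (4^-1 <= enorm x)%R -> rbump_hess S rho x = 0%R.
Proof.
move=> /far h; rewrite /rbump_hess /cut1 /cut2 max_r ?subr_le0// expr0n/= !mul0r oppr0 mul0r.
by rewrite addr0.
Qed.

(** The value of the bump at |x| = 1/8, where rho - |x|^2 = 1/16 - 1/64. *)
Let c0 : R := ((3 / 64) ^+ 3 / 6)%R.
Let c00 : (0 < c0)%R. Proof. by rewrite divr_gt0// exprn_gt0// divr_gt0. Qed.

Let chi_near x : (enorm x <= 8^-1)%R -> (c0 <= chi x)%R.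
Proof.
move=> x8; rewrite /chi /rbump /cut0 /c0 ler_wpM2r ?invr_ge0//.
have h : (dot x x <= 64^-1)%R.
  rewrite -sqr_enorm; have : (enorm x ^+ 2 <= (8^-1) ^+ 2 :> R)%R.
    by rewrite ler_sqr ?nnegrE ?enorm_ge0 ?invr_ge0.
  by move=> /le_trans; apply; rewrite le_eqVlt; apply/orP; left; apply/eqP; field.
have h2 : (3 / 64 <= Num.max (rho - dot x x) 0)%R.
  by rewrite le_max; apply/orP; left; rewrite /rho; lra.
by apply: lerXn2r => //; rewrite nnegrE ?le_max ?lexx ?orbT// divr_ge0.
Qed.

(** For |x| > 1/2 the bump and its second derivatives vanish at x, so F(x) is a pure jump term: the
    Levy measure of jumps from x into the support, weighted by the bump. It lies between multiples
    of the Levy measures of balls about x and -x, on which nu is comparable to kappa(x). For |x| <=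
    1/2 kappa is 1, and boundedness of F is enough. *)
Lemma dynkin_bump : exists (chi F : rV -> R) (c C : R),
  [/\ (0 < c)%R, (forall x, (0 <= chi x <= 1)%R),
    (forall x, (4^-1 <= enorm x)%R -> chi x = 0%R),
    (forall x, (enorm x <= 8^-1)%R -> (c <= chi x)%R) &
    [/\ dyn P X chi F, (forall x, (`|F x| <= C * kappa x)%R) &
      (forall x, (2^-1 < enorm x)%R -> (c * kappa x <= F x)%R)]].
Proof.
have [m [b [S [Ssym Spos mfin charE mE]]]] := levy_data HA.
have G := gen_bump HX (A1_symmetric HA) Ssym Spos mfin charE d0 rho0.
set F := (fun x => jump m (rbump rho) x + 2^-1 * rbump_hess S rho x)%R in G.
have [_ [_ [B FB]] _] := G; have [[mchi _] _ _] := G; rewrite -/chi in mchi.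
have [C C1 kloc] := kappa_local d0 HA; have [N N1 nk] := nu_kappa d0 HA.
have C0 : (0 < C)%R by lra. have N0 : (0 < N)%R by lra.
have mnu := A1_measurable HA.
pose v : R := ((2 * 4^-1) ^+ d)%R; pose w : R := ((2 * (8^-1 / d%:R)) ^+ d)%R.
have v0 : (0 <= v)%R by rewrite exprn_ge0// mulr_ge0// invr_ge0.
have w0 : (0 < w)%R by rewrite exprn_gt0// mulr_gt0// divr_gt0// ltr0n.
have shell x y : (2^-1 < enorm x)%R -> (`|enorm x - enorm y| <= 4^-1)%R ->
    [/\ (nu y <= N * C * kappa x)%R, (kappa x <= C * N * nu y)%R & (0 < nu y)%R].
  move=> x2 xy; move: (xy); rewrite ler_norml => /andP[l1 l2].
  have y4 : (4^-1 <= enorm y)%R by lra.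
  have xy2 : (`|enorm x - enorm y| <= 2^-1)%R by lra.
  have yx2 : (`|enorm y - enorm x| <= 2^-1)%R by rewrite distrC.
  have [h1 h2] := nk y y4; split.
  - by rewrite -mulrA; apply: (le_trans h1); rewrite ler_wpM2l ?(ltW N0)//; exact: kloc.
  - by rewrite -mulrA; apply: (le_trans (kloc _ _ yx2)); rewrite ler_wpM2l ?(ltW C0).
  - by apply: (nu_pos HA); lra.
(* The sign s accounts for the two terms x + z and x - z of the second difference. *)
have inshell x y (s : R) r : (r <= 4^-1)%R -> (s = 1 \/ s = -1)%R -> cball (s *: x)%R r y ->
    (`|enorm x - enorm y| <= 4^-1)%R.
  move=> r4 s1 yr; have nx : enorm (s *: x) = enorm x.
    by case: s1 => ->; rewrite ?scale1r// scaleN1r enormN.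
  rewrite -nx; apply: le_trans r4; apply: le_trans yr.
  rewrite ler_norml; apply/andP; split.
    by have := enormD (y - s *: x) (s *: x); rewrite subrK; lra.
  by have := enormD (s *: x - y) y; rewrite subrK enormB; lra.
have mball_le x s : (2^-1 < enorm x)%R -> (s = 1 \/ s = -1)%R ->
    m (cball (s *: x)%R 4^-1) <= (N * C * v * kappa x)%:E.
  move=> x2 s1; rewrite mE; last exact: measurable_cball.
  apply: (@le_trans _ _ (\int[lam]_(y in cball (s *: x)%R 4^-1) (N * C * kappa x)%:E)).
    apply: ge0_le_integral => //.
    - exact: measurable_cball.
    - by move=> y yb; have [_ _ /ltW] := shell x y x2 (inshell _ _ _ _ (lexx _) s1 yb).
    - by apply: measurable_funTS; exact/measurable_EFinP.
    - by move=> y yb; have [+ _ _] := shell x y x2 (inshell _ _ _ _ (lexx _) s1 yb); rewrite lee_fin.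
  rewrite integral_cst; last exact: measurable_cball.
  have -> : (N * C * v * kappa x = N * C * kappa x * v)%R by ring.
  rewrite (EFinM (N * C * kappa x)%R); apply: lee_wpmul2l.
    by rewrite lee_fin !mulr_ge0 ?ltW// (kappa_pos HA).
  by apply: volume_le; rewrite invr_ge0.
have mball_ge x : (2^-1 < enorm x)%R -> (w / (C * N) * kappa x)%:E <= m (cball x 8^-1).
  move=> x2; rewrite mE; last exact: measurable_cball.
  apply: (@le_trans _ _ (\int[lam]_(y in cball x 8^-1) ((C * N)^-1 * kappa x)%:E)).
    rewrite integral_cst; last exact: measurable_cball.
    have -> : (w / (C * N) * kappa x = (C * N)^-1 * kappa x * w)%R by ring.
    rewrite (EFinM ((C * N)^-1 * kappa x)%R); apply: lee_wpmul2l.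
      by rewrite lee_fin !mulr_ge0 ?invr_ge0 ?mulr_ge0 ?(ltW C0) ?(ltW N0)// ltW// (kappa_pos HA).
    by apply: volume_ge; rewrite invr_ge0.
  have r84 : (8^-1 <= (4^-1 : R))%R by rewrite lef_pV2 ?posrE ?ltr0n// ler_nat.
  have sh y : cball x 8^-1 y -> (`|enorm x - enorm y| <= 4^-1)%R.
    by move=> yb; apply: (inshell x y 1%R (8^-1)%R r84); [left|rewrite scale1r].
  have CN0 : (0 < C * N)%R by rewrite mulr_gt0.
  apply: ge0_le_integral => //.
  - exact: measurable_cball.
  - by move=> y yb; rewrite lee_fin mulr_ge0 ?invr_ge0 ?(ltW CN0)// ltW// (kappa_pos HA).
  - by apply: measurable_funTS; exact/measurable_EFinP.
  - by move=> y /sh yb; have [_ h _] := shell x y x2 yb; rewrite lee_fin ler_pdivrMl.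
have JE x : (2^-1 < enorm x)%R ->
    (F x)%:E = \int[m]_z (2^-1 * (chi (x + z) + chi (x - z)))%:E /\
    \int[m]_z (2^-1 * (chi (x + z) + chi (x - z)))%:E <= (N * C * v * kappa x + N * C * v * kappa x)%:E.
  move=> x2; have x4 : (4^-1 <= enorm x)%R.
    by apply: le_trans (ltW x2); rewrite lef_pV2 ?posrE ?ltr0n// ler_nat.
  pose B1 := cball (-1 *: x)%R 4^-1; pose B2 := cball (1 *: x)%R 4^-1.
  have mB1 : measurable B1 by exact: measurable_cball.
  have mB2 : measurable B2 by exact: measurable_cball.
  have mG : measurable_fun setT (fun z => (2^-1 * (chi (x + z) + chi (x - z)))%:E).
    apply/measurable_EFinP; apply: measurable_funM => //; apply: measurable_funD; apply: (measurableT_comp mchi).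
      exact: measurable_funD_rV.
    exact: measurable_funB_rV.
  have G0 z : 0 <= (2^-1 * (chi (x + z) + chi (x - z)))%:E.
    by rewrite lee_fin mulr_ge0 ?invr_ge0// addr_ge0//; have /andP[] := chi_bound (x + z)%R; have /andP[] := chi_bound (x - z)%R.
  have ub : \int[m]_z (2^-1 * (chi (x + z) + chi (x - z)))%:E <= (N * C * v * kappa x + N * C * v * kappa x)%:E.
    apply: (@le_trans _ _ (\int[m]_z ((\1_B1 z)%:E + (\1_B2 z)%:E))).
      apply: ge0_le_integral => //.
      - by apply: emeasurable_funD; apply/measurable_EFinP; exact: measurable_indic.
      - move=> z _; rewrite -EFinD lee_fin.
        have h1 : (chi (x + z) <= \1_B1 z)%R.
          rewrite indicE; case: (boolP (z \in B1)) => [_|/negP zB]; first by case/andP: (chi_bound (x + z)%R).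
          rewrite chi_far//; rewrite leNgt; apply/negP => h; apply: zB; rewrite inE /B1 /cball/= scaleN1r opprK.
          by rewrite addrC ltW.
        have h2 : (chi (x - z) <= \1_B2 z)%R.
          rewrite indicE; case: (boolP (z \in B2)) => [_|/negP zB]; first by case/andP: (chi_bound (x - z)%R).
          rewrite chi_far//; rewrite leNgt; apply/negP => h; apply: zB; rewrite inE /B2 /cball/= scale1r.
          by rewrite enormB ltW.
        have /andP[p1 _] := chi_bound (x + z)%R; have /andP[p2 _] := chi_bound (x - z)%R; lra.
    rewrite ge0_integralD//; last 2 first.
    - by apply/measurable_EFinP; exact: measurable_indic.
    - by apply/measurable_EFinP; exact: measurable_indic.
    by rewrite !integral_indic// !setIT EFinD; apply: leeD; apply: mball_le => //; [right|left].
  split => //; rewrite /F hess_far// mulr0 addr0 /jump -/chi.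
  under eq_Rintegral do rewrite (chi_far x4) subr0.
  rewrite /Rintegral fineK// ge0_fin_numE; last by apply: integral_ge0.
  by apply: le_lt_trans ub _; rewrite ltry.
exists chi, F, (Num.min c0 (2^-1 * c0 * (w / (C * N))))%R, (`|B| + 2 * (N * C * v))%R.
have Cv0 : (0 <= N * C * v)%R by rewrite !mulr_ge0 ?(ltW N0) ?(ltW C0).
have CN0 : (0 < C * N)%R by rewrite mulr_gt0.
have wc : (0 < 2^-1 * c0 * (w / (C * N)))%R by rewrite !mulr_gt0 ?invr_gt0// mulr_gt0.
split => //.
- by rewrite lt_min c00.
- by move=> x x8; apply: le_trans (chi_near x8); rewrite ge_min lexx.
split => //.
- move=> x; have [x2|x2] := leP (enorm x) (2^-1)%R.
    have -> : (kappa x = 1)%R.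
      by rewrite kappa_in// (le_trans x2)// invf_le1// ler1n.
    rewrite mulr1; apply: le_trans (FB x) _; apply: le_trans (ler_norm _) _; lra.
  have [E ub] := JE x x2.
  have F0 : (0 <= F x)%R.
    rewrite -lee_fin E; apply: integral_ge0 => z _; rewrite lee_fin mulr_ge0 ?invr_ge0// addr_ge0//.
      by case/andP: (chi_bound (x + z)%R).
    by case/andP: (chi_bound (x - z)%R).
  move: ub; rewrite -E lee_fin ger0_norm// => ub; apply: (le_trans ub).
  have := kappa_pos HA x; have := normr_ge0 B; move: (kappa x) (`|B|)%R (N * C * v)%R Cv0 => k b' c ? ? ?; nra.
- move=> x x2; have [E _] := JE x x2; rewrite -lee_fin E.
  have kx := kappa_pos HA x.
  apply: (@le_trans _ _ ((2^-1 * c0)%:E * (w / (C * N) * kappa x)%:E)).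
    by rewrite -EFinM lee_fin [leRHS]mulrA ler_wpM2r ?(ltW kx)// ge_min lexx orbT.
  apply: (@le_trans _ _ ((2^-1 * c0)%:E * m (cball x 8^-1))).
    by apply: lee_wpmul2l; [rewrite lee_fin mulr_ge0 ?invr_ge0// ltW|exact: mball_ge].
  have mb : measurable (cball x 8^-1) by exact: measurable_cball.
  rewrite -[X in m X]setIT -(integral_indic m measurableT mb).
  rewrite -ge0_integralZl_EFin//; last 2 first.
  - by apply/measurable_EFinP; exact: measurable_indic.
  - by rewrite mulr_ge0 ?invr_ge0// ltW.
  apply: ge0_le_integral => //.
  + by move=> z _; rewrite mule_ge0 ?lee_fin ?mulr_ge0 ?invr_ge0// ltW.
  + by apply: emeasurable_funM => //; apply/measurable_EFinP; exact: measurable_indic.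
  + apply/measurable_EFinP; apply: measurable_funM => //; apply: measurable_funD; apply: (measurableT_comp mchi).
      exact: measurable_funD_rV.
    exact: measurable_funB_rV.
  + move=> z _; rewrite -EFinM lee_fin -mulrA ler_wpM2l ?invr_ge0//.
    have /andP[p1 _] := chi_bound (x + z)%R; have /andP[p2 _] := chi_bound (x - z)%R.
    rewrite indicE; case: (boolP (z \in _)) => [|_]; last by rewrite mulr0 addr_ge0.
    rewrite inE /cball/= enormB => /chi_near; rewrite mulr1; lra.
Qed.

End bump_generator.

Lemma continuous_enorm (R : realType) d : continuous (@enorm R d).
Proof.
move=> x; apply: (@continuous_comp _ _ _ (fun y : 'rV[R]_d => dot y y) Num.sqrt); last exact: sqrt_continuous.
have h (r : seq 'I_d) : (fun y : 'rV[R]_d => \sum_(i <- r) y ord0 i * y ord0 i : R) y @[y --> x] -->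
    (\sum_(i <- r) x ord0 i * x ord0 i : R).
  elim: r => [|i r ih].
    rewrite (_ : (fun y : 'rV[R]_d => _) = cst (0 : R)); last by apply/funext => y; rewrite big_nil.
    by rewrite big_nil; apply: cst_continuous.
  rewrite big_cons; under eq_fun do rewrite big_cons.
  by apply: cvgD ih; apply: cvgM; exact: coord_continuous.
exact: h.
Qed.

(** * Small displacements in small time *)

Section path_tightness.
Local Open Scope ereal_scope.
Context {R : realType} {d : nat}.
Notation rV := 'rV[R]_d.
Context {dO : measure_display} {Omega : measurableType dO}.
Variables (P : probability Omega R) (X : R -> Omega -> 'rV[R]_d).
Hypothesis HX : levy_process P X.

Let good (eps : R) (n : nat) : set Omega :=
  [set w | forall q : rat, (0 <= (ratr q : R) < n.+1%:R^-1)%R -> (enorm (X (ratr q) w) <= eps)%R].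

Let measurable_good eps n : measurable (good eps n).
Proof.
pose r (k : nat) : R := ratr (odflt 0%R (unpickle k) : rat).
rewrite (_ : good eps n = \bigcap_(k in [set k | (0 <= r k < n.+1%:R^-1)%R]) [set w | (enorm (X (r k) w) <= eps)%R]); last first.
  apply/seteqP; split => w gw; first by move=> k /= rk; exact: gw.
  by move=> q q0; have := gw (pickle q); rewrite /= /r pickleK; exact.
apply: bigcap_measurableType => k /= /andP[r0 _].
rewrite -[X in measurable X]setTI.
exact: (levy_measurable HX r0 measurableT (measurable_enorm_le eps (@measurable_enorm R d))).
Qed.

Let good_path eps n w u : good eps n w -> (0 <= u < n.+1%:R^-1)%R -> (enorm (X u w) <= eps)%R.
Proof.
move=> gw /andP[u0 un].
have /choice[v hv] k : exists v : rat, (u < ratr v < Num.min (u + k.+1%:R^-1) n.+1%:R^-1)%R.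
  have uv : (u < Num.min (u + k.+1%:R^-1) n.+1%:R^-1)%R by rewrite lt_min ltrDl invr_gt0 ltr0n un.
  by have [q] := rat_in_itvoo uv; rewrite in_itv/=; exists q.
have vu : (ratr (v k) : R) @[k --> \oo] --> u.
  apply: (@cvg_of_bound _ _ _ 1%R) => k; have /andP[h1] := hv k; rewrite lt_min => /andP[h2 _].
  by rewrite mul1r distrC ger0_norm ?subr_ge0 ?(ltW h1)// lerBlDl ltW.
have rc := @right_cont_sample _ _ _ _ _ _ HX w u (fun k => ratr (v k)) u0 (fun k => proj1 (andP (hv k))) vu.
have ce : enorm (X (ratr (v k)) w) @[k --> \oo] --> enorm (X u w).
  by apply: (cvg_comp _ _ rc); exact: continuous_enorm.
rewrite -lee_fin; apply: (@lee_of_cvg _ (fun k => (enorm (X (ratr (v k)) w))%:E)).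
  by apply: cvg_EFin; [exact: nearW|].
move=> k; rewrite lee_fin; apply: gw => /=; have /andP[h1] := hv k; rewrite lt_min => /andP[_ h2].
by rewrite (le_trans u0 (ltW h1)).
Qed.

(** The events [good] test rational times of [0, 1 / (n + 1)[ only, which makes them measurable. By
    right continuity at 0 they increase to an event of probability one, so some n has probability at
    least 1/2; right continuity then covers the other times. *)
Lemma small_paths eps : (0 < eps)%R -> exists t0 E, [/\ (0 < t0)%R, measurable E, (2^-1)%:E <= P E &
  forall w u, E w -> (0 <= u <= t0)%R -> (enorm (X u w) <= eps)%R].
Proof.
move=> eps0.
have nd : nondecreasing_seq (good eps).
  move=> n k nk; apply/subsetPset => w gw q /= /andP[q0 qk]; apply: gw => /=; rewrite q0/=.
  by apply: (lt_le_trans qk); rewrite lef_pV2 ?posrE ?ltr0n// ler_nat.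
have mU : measurable (\bigcup_n good eps n) by apply: bigcup_measurable => k _; exact: measurable_good.
have cv : P (good eps n) @[n --> \oo] --> P (\bigcup_n good eps n).
  by apply: nondecreasing_cvg_mu => // k; exact: measurable_good.
have P1 : P (\bigcup_n good eps n) = 1.
  apply/eqP; rewrite eq_le probability_le1//=.
  rewrite -(levy_start HX); apply: le_measure; rewrite ?inE.
  - have := levy_measurable HX (lexx 0%R) measurableT (measurable_enorm_le 0%R (@measurable_enorm R d)).
    rewrite setTI.
    congr measurable; apply/seteqP; split => w /=.
      move=> h0; apply/rowP => i; rewrite mxE; apply/eqP; rewrite -normr_le0.
      exact: le_trans (coord_le_enorm _ _) h0.
    by move=> ->; rewrite /enorm dot0l sqrtr0.
  - exact: mU.
  - move=> w /= w0.
    have h := levy_rcont HX (w := w) (lexx 0%R); rewrite w0 in h.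
    have ce : enorm (X s w) @[s --> (0%R : R)^'+] --> enorm (0%R : rV).
      by apply: (cvg_comp _ _ h); exact: continuous_enorm.
    have /cvgrPdist_le/(_ _ eps0)/nbhs_ballP[e /= e0 he] := ce.
    have /cvgrPdist_lt/(_ _ e0)[n _ /(_ n (leqnn n)) ne] := @cvg_harmonic R.
    exists n => // q /= /andP[q0 qn].
    move: q0; rewrite le_eqVlt => /predU1P[<-|q0]; first by rewrite w0 /enorm dot0l sqrtr0 ltW.
    have E0 : enorm (0%R : rV) = 0%R by rewrite /enorm dot0l sqrtr0.
    have qe : ball (0%R : R) e (ratr q).
      rewrite /ball/= sub0r normrN (ger0_norm (ltW q0)); apply: (lt_trans qn).
      by move: ne; rewrite sub0r normrN; apply: le_lt_trans; exact: ler_norm.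
    have := he _ qe q0; rewrite E0 sub0r normrN; apply: le_trans; exact: ler_norm.
have : \forall n \near \oo, (2^-1)%:E <= P (good eps n).
  rewrite P1 in cv; have : nbhs (1 : \bar R) [set y | (2^-1)%:E < y].
    apply: open_nbhs_nbhs; split; first exact: open_ereal_gt_ereal.
    by rewrite /= lte_fin invf_lt1// ltr1n.
  by move=> /cv h; near=> n; apply: ltW; near: n; exact: h.
move=> [n _ /(_ n (leqnn n)) hn].
(* The event controls a half-open interval; n + 2 gives a closed one inside it. *)
exists (n.+2%:R^-1)%R, (good eps n); split => //.
- move=> w u gw /andP[u0 un]; apply: (good_path gw); rewrite u0/=.
  by apply: (le_lt_trans un); rewrite ltf_pV2 ?posrE ?ltr0n// ltr_nat.
Unshelve. all: by end_near. Qed.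

End path_tightness.

(** * Stability of kappa under the free semigroup *)

Section resolvent_stability.
Local Open Scope ereal_scope.
Context {R : realType} {d : nat}.
Notation rV := 'rV[R]_d.
Notation lam := (lebesgue_rV R d).
Notation mu := (@lebesgue_measure R).
Hypothesis d0 : (0 < d)%N.
Context {dO : measure_display} {Omega : measurableType dO}.
Variables (P : probability Omega R) (X : R -> Omega -> 'rV[R]_d).
Hypothesis HX : levy_process P X.
Variable nu : rV -> R.
Hypothesis HA : assumption_A1 P X nu.
Notation kappa := (kappa nu).
Local Opaque fk fk_weight.
Notation fk := (fk P X).
Notation Q := (fk (cst 0%R) (cst 0%R)).
Implicit Types x y : rV.

Let kE : rV -> \bar R := EFin \o kappa.
Let pk := potential_kappa HA.
Let mk : measurable_fun setT kE := measurable_potential pk.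
Let k0 y : 0 <= kE y := potential_ge0 y pk.
Let mQk (x : rV) (t : R) : measurable_fun `[0%R, t] (fun s : R => Q kE s x).
Proof. by apply: (measurable_fks_itv HX) => //; exact: potential0. Qed.

Let measurable_kX (x : rV) (s : R) : (0 <= s)%R -> measurable_fun setT (fun w => kE (x + X s w)%R).
Proof.
by move=> s0; apply/measurable_EFinP; apply: (measurable_fX HX) => //; exact: (measurable_kappa HA).
Qed.

(** With probability at least 1/2 the path has moved by at most 1/2, which changes kappa by a
    bounded factor. *)
Lemma kappa_lower : exists c t0 : R, [/\ (0 < c)%R, (0 < t0)%R &
  forall s x, (0 <= s <= t0)%R -> (c * kappa x)%:E <= Q kE s x].
Proof.
have h2 : (0 < (2^-1 : R))%R by rewrite invr_gt0.
have [t0 [E [t00 mE E2 hE]]] := small_paths HX h2.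
have [C C1 kloc] := kappa_local d0 HA; have C0 : (0 < C)%R by lra.
exists (2^-1 / C)%R, t0; split => //; first by rewrite divr_gt0.
move=> s x s0; have /andP[s00 _] := s0; rewrite fk00.
have kx := kappa_pos HA x.
have c0 : (0 <= kappa x / C)%R by rewrite divr_ge0 ?ltW.
apply: (@le_trans _ _ (\int[P]_w ((kappa x / C)%:E * (\1_E w)%:E))).
  rewrite ge0_integralZl_EFin//; last by apply/measurable_EFinP; exact: measurable_indic.
  rewrite integral_indic// setIT; have -> : (2^-1 / C * kappa x = kappa x / C * 2^-1)%R by ring.
  by rewrite EFinM; apply: lee_wpmul2l.
apply: ge0_le_integral => //.
- by move=> w _; rewrite mule_ge0// lee_fin.
- by apply: emeasurable_funM => //; apply/measurable_EFinP; exact: measurable_indic.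
- exact: measurable_kX.
- move=> w _; rewrite indicE; case: (boolP (w \in E)) => [|_]; last by rewrite mule0.
  rewrite inE => Ew; rewrite mule1 lee_fin ler_pdivrMr// mulrC; apply: kloc.
  have h := hE w s Ew s0; rewrite ler_norml; apply/andP; split.
    by have := enormD (x + X s w) (- X s w); rewrite addrK enormN; lra.
  by have := enormD x (X s w); lra.
Qed.

Let cv (f : rV -> \bar R) (x : rV) := \int[lam]_y ((kappa y)%:E * f (x - y)%R).

Let measurable_cv_integrand (f : rV -> \bar R) : measurable_fun setT f ->
  measurable_fun setT (fun z : rV * rV => (kappa z.2)%:E * f (z.1 - z.2)%R).
Proof.
move=> mf; apply: emeasurable_funM.
  by apply/measurable_EFinP; apply: (measurableT_comp (measurable_kappa HA)).
by apply: (measurableT_comp mf); exact: measurable_funB_rV.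
Qed.

Let measurable_cv_integrandx (f : rV -> \bar R) x : measurable_fun setT f ->
  measurable_fun setT (fun y => (kappa y)%:E * f (x - y)%R).
Proof. by move=> mf; apply: (measurableT_comp (measurable_cv_integrand mf) (pair1_measurable x)). Qed.

Let cv_integrand_ge0 (f : rV -> \bar R) (x y : rV) : (forall y, 0 <= f y) -> 0 <= (kappa y)%:E * f (x - y)%R.
Proof. by move=> f0; apply: mule_ge0 => //; rewrite lee_fin ltW// (kappa_pos HA). Qed.

Let measurable_cv (f : rV -> \bar R) : measurable_fun setT f -> (forall y, 0 <= f y) -> measurable_fun setT (cv f).
Proof.
move=> mf f0; apply: (measurable_fun_fubini_tonelli_F _ (measurable_cv_integrand mf)) => z.
exact: cv_integrand_ge0.
Qed.

Let Q_cv (f : rV -> \bar R) t x : measurable_fun setT f -> (forall y, 0 <= f y) -> (0 <= t)%R ->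
  Q (cv f) t x = cv (Q f t) x.
Proof.
move=> mf f0 t0; rewrite fk00.
rewrite (@fubini_tonelli _ _ _ _ _ P lam (fun z : Omega * rV => (kappa z.2)%:E * f (x + X t z.1 - z.2)%R)).
- apply: eq_integral => y _ /=; rewrite fk00 -(ge0_integralZl_EFin P measurableT).
  + by apply: eq_integral => w _; rewrite addrAC.
  + by move=> w _.
  + exact: (@measurable_position_path _ _ _ _ _ _ HX _ Omega (cst (x - y)%R) (cst t) id
      (measurable_cst _) (measurable_cst _) (@measurable_id _ _ _) _ _ f mf (fun=> t0)).
  + exact: ltW (kappa_pos HA y).
- apply: emeasurable_funM.
    by apply/measurable_EFinP; apply: (measurableT_comp (measurable_kappa HA) measurable_snd).
  have -> : (fun z : Omega * rV => f (x + X t z.1 - z.2)%R) = (fun z : Omega * rV => f (x - z.2 + X t z.1)%R).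
    by apply/funext => z; rewrite addrAC.
  exact: (@measurable_position_path _ _ _ _ _ _ HX _ (Omega * rV)%type (fun z : Omega * rV => x - z.2)%R (cst t) fst
      (measurable_funB_rV (measurable_cst _) measurable_snd) (measurable_cst _) measurable_fst _ _ f mf (fun=> t0)).
- by move=> z; exact: cv_integrand_ge0.
Qed.

(** The convolution [g] of kappa with the bump is comparable to kappa, since the bump is supported
    near 0 and bounded below there. As Q_t commutes with convolution, the error |F| <= C kappa of
    Dynkin's formula becomes a multiple of kappa * kappa, absorbed by [kappa_convolution]. *)
Lemma bump_kappa : exists A B : R, [/\ (0 <= A)%R, (0 <= B)%R &
  forall t x, (0 <= t)%R -> Q kE t x <= (A * kappa x)%:E + B%:E * \int[mu]_(s in `[0%R, t]) Q kE s x].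
Proof.
have [chi [F [c [C [c0 chi01 chi_far chi_near [D FC _]]]]]] := dynkin_bump d0 HX HA.
have [[mchi _] bF dE] := D; have [mF _] := bF.
have [K K1 kconv] := kappa_convolution d0 HA.
have [L L1 kloc] := kappa_local d0 HA; have L0 : (0 < L)%R by lra.
have kp := kappa_pos HA.
have C0 : (0 <= C)%R.
  have h := le_trans (normr_ge0 _) (FC 0%R); move: h; rewrite pmulr_lge0//; exact: kp.
pose v : R := ((2 * 4^-1) ^+ d)%R; pose w : R := ((2 * (8^-1 / d%:R)) ^+ d)%R.
have v0 : (0 <= v)%R by rewrite exprn_ge0// mulr_ge0// invr_ge0.
have w0 : (0 < w)%R by rewrite exprn_gt0// mulr_gt0// divr_gt0// ltr0n.
have chi0 y : 0 <= (chi y)%:E by rewrite lee_fin; case/andP: (chi01 y).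
have mchiE : measurable_fun setT (EFin \o chi) by exact/measurable_EFinP.
have Qchi t x : (0 <= t)%R -> Q (EFin \o chi) t x <= (chi x)%:E + C%:E * \int[mu]_(s in `[0%R, t]) Q kE s x.
  move=> t0; rewrite fk00 -[X in X <= _]/(ex P X chi t x) dE//; apply: leeD => //.
  have mi : measurable (`[0%R, t]%classic : set R) by exact: measurable_itv.
  rewrite -(ge0_integralZl_EFin mu mi (fun s _ => fk_ge0 P X _ _ s x k0) (@mQk x t) C0).
  apply: (@le_trans _ _ (\int[mu]_(s in `[0%R, t]) `|ex P X F s x|)).
    apply: le_trans (lee_abs _) _; apply: le_abse_integral => //.
    exact: measurable_ex.
  apply: ge0_le_integral => //.
  - by apply: measurableT_comp => //; exact: (measurable_ex HX).
  - by apply: emeasurable_funM; [exact: measurable_cst|exact: mQk].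
  - move=> s; rewrite /= in_itv/= => /andP[s0 _].
    rewrite -(@fkZl _ _ _ _ _ _ HX _ _ kE s x C potential0 potential0 s0 mk k0 C0) fk00.
    apply: (le_trans (le_abse_integral _ _ _)) => //.
      by apply/measurable_EFinP; exact: (measurable_fX HX).
    apply: ge0_le_integral => //.
    + by apply: measurableT_comp => //; apply/measurable_EFinP; exact: (measurable_fX HX).
    + apply: emeasurable_funM => //.
      exact: measurable_kX.
    + by move=> w' _; rewrite -EFinM lee_fin; exact: FC.
pose g := cv (EFin \o chi).
have mgx x : measurable_fun setT (fun y => (kappa y)%:E * (chi (x - y))%:E).
  exact: measurable_cv_integrandx mchiE.
have nb x y r : (r <= 2^-1)%R -> cball x r y -> (`|enorm x - enorm y| <= 2^-1)%R.
  move=> r2 yr; apply: le_trans r2; apply: le_trans yr; rewrite ler_norml; apply/andP; split.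
    by have := enormD (y - x) x; rewrite subrK; lra.
  by have := enormD (x - y) y; rewrite subrK enormB; lra.
have gub x : g x <= (L * v * kappa x)%:E.
  have mb : measurable (cball x 4^-1) by exact: measurable_cball.
  apply: (@le_trans _ _ (\int[lam]_y ((L * kappa x)%:E * (\1_(cball x 4^-1) y)%:E))).
    apply: ge0_le_integral => //.
    - by move=> y _; apply: mule_ge0; rewrite lee_fin ?(ltW (kp y))//; case/andP: (chi01 (x - y)%R).
    - exact: mgx.
    - by apply: emeasurable_funM => //; apply/measurable_EFinP; exact: measurable_indic.
    - move=> y _; rewrite -!EFinM lee_fin indicE; case: (boolP (y \in _)) => [|/negP yb].
        rewrite inE => yb; have /andP[h1 h2] := chi01 (x - y)%R.
        rewrite mulr1; apply: (@le_trans _ _ (kappa y * 1)%R); first by rewrite ler_wpM2l// ltW.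
        rewrite mulr1; apply: kloc; apply: nb yb.
        by rewrite lef_pV2 ?posrE ?ltr0n// ler_nat.
      rewrite chi_far ?mulr0// leNgt; apply/negP => h; apply: yb; rewrite inE /cball/=.
      by rewrite enormB ltW.
  have Lk0 : (0 <= L * kappa x)%R by rewrite mulr_ge0 ?ltW.
  rewrite ge0_integralZl_EFin//; last by apply/measurable_EFinP; exact: measurable_indic.
  rewrite integral_indic// setIT mulrAC (EFinM (L * kappa x)%R v); apply: lee_wpmul2l => //.
  by apply: volume_le; rewrite invr_ge0.
have glb x : (c / L * w * kappa x)%:E <= g x.
  have mb : measurable (cball x 8^-1) by exact: measurable_cball.
  have cLk0 : (0 <= c / L * kappa x)%R by rewrite mulr_ge0 ?divr_ge0 ?ltW.
  apply: (@le_trans _ _ (\int[lam]_y ((c / L * kappa x)%:E * (\1_(cball x 8^-1) y)%:E))).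
    rewrite ge0_integralZl_EFin//; last by apply/measurable_EFinP; exact: measurable_indic.
    rewrite integral_indic// setIT mulrAC (EFinM (c / L * kappa x)%R w); apply: lee_wpmul2l => //.
    by apply: volume_ge; rewrite invr_ge0.
  apply: ge0_le_integral => //.
  - by move=> y _; apply: mule_ge0; rewrite lee_fin.
  - by apply: emeasurable_funM => //; apply/measurable_EFinP; exact: measurable_indic.
  - exact: mgx.
  - move=> y _; rewrite -!EFinM lee_fin indicE; case: (boolP (y \in _)) => [|_]; last first.
      by rewrite mulr0 mulr_ge0 ?(ltW (kp y))//; case/andP: (chi01 (x - y)%R).
    rewrite inE => yb; rewrite mulr1.
    have h1 : (kappa x / L <= kappa y)%R.
      rewrite ler_pdivrMr// mulrC; apply: kloc; rewrite distrC; apply: nb yb.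
      by rewrite lef_pV2 ?posrE ?ltr0n// ler_nat.
    have h2 : (c <= chi (x - y))%R by apply: chi_near; rewrite enormB.
    have -> : (c / L * kappa x = kappa x / L * c)%R by ring.
    by apply: ler_pM => //; rewrite ?(ltW c0)// divr_ge0 ?(ltW (kp x))// ltW.
pose c' : R := (c / L * w)%R; have c'0 : (0 < c')%R by rewrite mulr_gt0 ?divr_gt0.
have [K0 C0'] : (0 <= K)%R /\ (0 <= C * K)%R by split; rewrite ?mulr_ge0//; lra.
exists (L * v / c')%R, (C * K / c')%R; split.
- by apply: divr_ge0; rewrite ?(ltW c'0)// mulr_ge0 ?(ltW L0).
- by apply: divr_ge0; rewrite ?(ltW c'0)// mulr_ge0.
move=> t x t0.
have mi : measurable (`[0%R, t]%classic : set R) by exact: measurable_itv.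
have mg : measurable_fun setT g by exact: measurable_cv.
have g0 y : 0 <= g y by apply: integral_ge0 => z _; exact: cv_integrand_ge0.
have h1 : c'%:E * Q kE t x <= Q g t x.
  rewrite -(@fkZl _ _ _ _ _ _ HX _ _ kE t x c' potential0 potential0 t0 mk k0 (ltW c'0)).
  apply: (@fk_le _ _ _ _ _ _ HX _ _ _ _ _ _ potential0 potential0 t0) => //.
  - by apply: emeasurable_funM.
  - by move=> y; apply: mule_ge0 => //; rewrite lee_fin ltW.
pose h (z : R * rV) := Q kE (Num.max z.1 0)%R (x - z.2)%R.
have mh : measurable_fun setT h.
  apply: (@measurable_fk _ _ _ _ _ _ HX _ _ kE _ (R * rV)%type (fun z : R * rV => x - z.2)%R (fun z => Num.max z.1 0)%R) => //.
  - by apply: measurable_funB_rV => //; exact: measurable_snd.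
  - by apply: measurable_maxr => //; exact: measurable_fst.
  - by move=> z; rewrite le_max lexx orbT.
have h00 z : 0 <= h z by exact: fk_ge0.
have h2 : cv (fun y => \int[mu]_(s in `[0%R, t]) Q kE s y) x = \int[mu]_(s in `[0%R, t]) Q (cv kE) s x.
  transitivity (\int[lam]_y \int[mu]_(s in `[0%R, t]) ((kappa y)%:E * h (s, y))).
    apply: eq_integral => y _.
    rewrite -[LHS](ge0_integralZl_EFin mu mi (fun s _ => fk_ge0 P X _ _ s (x - y)%R k0) (@mQk (x - y)%R t) (ltW (kp y))).
    by apply: eq_integral => s; rewrite inE/= in_itv/= => /andP[s0 _]; rewrite /h /= max_l.
  rewrite (@fubini_itv _ _ _ lam (fun z => (kappa z.2)%:E * h z)).
  - apply: eq_integral => s; rewrite inE/= in_itv/= => /andP[s0 _]; rewrite [RHS](Q_cv x mk k0 s0).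
    by apply: eq_integral => y _; rewrite /h/= max_l.
  - by apply: emeasurable_funM => //; apply/measurable_EFinP; apply: (measurableT_comp (measurable_kappa HA) measurable_snd).
  - by move=> z; apply: mule_ge0; [exact: k0|exact: h00].
have h3 : \int[mu]_(s in `[0%R, t]) Q (cv kE) s x <= K%:E * \int[mu]_(s in `[0%R, t]) Q kE s x.
  rewrite -(ge0_integralZl_EFin mu mi (fun s _ => fk_ge0 P X _ _ s x k0) (@mQk x t) K0).
  have mcv : measurable_fun setT (cv kE) by exact: measurable_cv.
  have cv0 y : 0 <= cv kE y by apply: integral_ge0 => z _; exact: cv_integrand_ge0.
  apply: ge0_le_integral; [exact: mi| | | |].
  - by move=> s _; exact: fk_ge0.
  - by apply: (measurable_fks_itv HX); [exact: potential0|exact: potential0|exact: mcv|exact: cv0].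
  - by apply: emeasurable_funM; [exact: measurable_cst|exact: mQk].
  - move=> s; rewrite /= in_itv/= => /andP[s0 _].
    rewrite -(@fkZl _ _ _ _ _ _ HX _ _ kE s x K potential0 potential0 s0 mk k0 K0).
    apply: (@fk_le _ _ _ _ _ _ HX _ _ _ _ _ _ potential0 potential0 s0 mcv _ cv0).
    + by apply: emeasurable_funM; [exact: measurable_cst|exact: mk].
    + move=> y; rewrite -EFinM; apply: le_trans (kconv y).
      by rewrite le_eqVlt; apply/orP; left; apply/eqP; apply: eq_integral => z _; rewrite /kE/= -EFinM mulrC.
have h4 : Q g t x <= g x + (C * K)%:E * \int[mu]_(s in `[0%R, t]) Q kE s x.
  rewrite (Q_cv x mchiE chi0 t0).
  have mI : measurable_fun setT (fun y => \int[mu]_(s in `[0%R, t]) Q kE s (x - y)%R).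
    have := measurable_integral_itv (h := fun z : rV * R => h (z.2, z.1)) (measurableT_comp mh (@measurable_swap _ _ rV R)) (fun z => h00 _).
    move=> /(fun m => measurableT_comp m (pair1_measurable t)).
    apply: eq_measurable_fun => y _ /=; apply: eq_integral => s.
    by rewrite inE/= in_itv/= => /andP[s0 _]; rewrite /h /= max_l.
  have I0 y : 0 <= \int[mu]_(s in `[0%R, t]) Q kE s y by apply: integral_ge0 => s _; exact: fk_ge0.
  apply: (@le_trans _ _ (\int[lam]_y ((kappa y)%:E * (chi (x - y))%:E +
      C%:E * ((kappa y)%:E * \int[mu]_(s in `[0%R, t]) Q kE s (x - y)%R)))).
    apply: ge0_le_integral; [exact: measurableT| | | |].
    - by move=> y _; apply: mule_ge0; [exact: k0|exact: fk_ge0].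
    - by apply: measurable_cv_integrandx; exact: (measurable_fkx HX potential0 potential0 mchiE chi0 t0).
    - apply: emeasurable_funD; first exact: mgx.
      by apply: emeasurable_funM; [exact: measurable_cst|apply: emeasurable_funM; [exact: mk|exact: mI]].
    - move=> y _; rewrite muleCA -ge0_muleDr.
      + by apply: lee_wpmul2l; [exact: k0|exact: Qchi].
      + exact: chi0.
      + by apply: mule_ge0; [rewrite lee_fin|exact: I0].
  have mkI : measurable_fun setT (fun y => (kappa y)%:E * \int[mu]_(s in `[0%R, t]) Q kE s (x - y)%R).
    by apply: emeasurable_funM; [exact: mk|exact: mI].
  have kI0 y : 0 <= (kappa y)%:E * \int[mu]_(s in `[0%R, t]) Q kE s (x - y)%R.
    by apply: mule_ge0; [exact: k0|exact: I0].
  rewrite ge0_integralD; [|exact: measurableT| | | |].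
  - rewrite (ge0_integralZl_EFin lam measurableT (fun y _ => kI0 y) mkI C0).
    apply: leeD; first exact: lexx.
    by rewrite EFinM -muleA; apply: lee_wpmul2l; [rewrite lee_fin|by apply: le_trans h3; rewrite -h2].
  - by move=> y _; apply: mule_ge0; [exact: k0|exact: chi0].
  - exact: mgx.
  - by move=> y _; apply: mule_ge0; [rewrite lee_fin|exact: kI0].
  - by apply: emeasurable_funM; [exact: measurable_cst|exact: mkI].
have h5 : c'%:E * Q kE t x <= (L * v * kappa x)%:E + (C * K)%:E * \int[mu]_(s in `[0%R, t]) Q kE s x.
  by apply: (le_trans h1); apply: (le_trans h4); apply: leeD.
have := lee_wpmul2l (_ : 0 <= (c'^-1)%:E) h5; rewrite lee_fin invr_ge0 (ltW c'0) => /(_ isT).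
rewrite muleA -EFinM mulVf ?(gt_eqF c'0)// mul1e => /le_trans; apply.
rewrite ge0_muleDr; [|by rewrite lee_fin !mulr_ge0// ltW|by rewrite mule_ge0// integral_ge0// => s _; exact: fk_ge0].
rewrite muleA -!EFinM le_eqVlt; apply/orP; left; apply/eqP; congr (_ + _); last by rewrite mulrC.
by congr (_%:E); ring.
Qed.

End resolvent_stability.

Section kappa_stability.
Local Open Scope ereal_scope.
Context {R : realType} {d : nat}.
Notation rV := 'rV[R]_d.
Hypothesis d0 : (0 < d)%N.
Context {dO : measure_display} {Omega : measurableType dO}.
Variables (P : probability Omega R) (X : R -> Omega -> 'rV[R]_d).
Hypothesis HX : levy_process P X.
Variable nu : rV -> R.
Hypothesis HA : assumption_A1 P X nu.
Notation kappa := (kappa nu).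
Local Opaque fk fk_weight.
Notation fk := (fk P X).
Notation Q := (fk (cst 0%R) (cst 0%R)).
Implicit Types x y : rV.

Let kE : rV -> \bar R := EFin \o kappa.
Let pk := potential_kappa HA.
Let mk : measurable_fun setT kE := measurable_potential pk.
Let k0 y : 0 <= kE y := potential_ge0 y pk.

(** Gronwall's argument by iteration, with t1 chosen so that B t1 <= 1/2: a bound 2 A kappa + b on
    Q_s kappa improves to 2 A kappa + b / 2, and the iteration starts from the supremum of kappa. *)
Let kappa_upper : exists A t1 : R, [/\ (0 <= A)%R, (0 < t1)%R &
  forall s x, (0 <= s <= t1)%R -> Q kE s x <= (A * kappa x)%:E].
Proof.
have [A [B [A0 B0 AB]]] := bump_kappa d0 HX HA.
have [K K1 kK] := kappa_bounded d0 HA.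
have B1 : (0 < B + 1)%R by lra.
pose t1 : R := (2^-1 / (B + 1))%R.
have Bt : (B * t1 <= 2^-1)%R.
  by rewrite /t1 mulrCA ger_pMr// ler_pdivrMr// mul1r lerDl.
exists (2 * A)%R, t1; split; first by rewrite mulr_ge0.
  by rewrite divr_gt0.
suff H n s x : (0 <= s <= t1)%R -> Q kE s x <= (2 * A * kappa x + K / 2 ^+ n)%:E.
  move=> s x st; apply: (@gee_of_cvg _ (fun n => (2 * A * kappa x + K / 2 ^+ n)%:E)); last by move=> n; exact: H.
  apply: cvg_EFin; first exact: nearW.
  rewrite -[X in _ --> X]addr0; apply: cvgD; first exact: cvg_cst.
  rewrite -(mulr0 K); apply: cvgM; first exact: cvg_cst.
  by under eq_fun do rewrite -exprVn; apply: cvg_expr; rewrite ger0_norm ?invf_lt1 ?ltr1n.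
elim: n s x => [|n ih] s x /andP[s0 st].
  have kp := kappa_pos HA x; have K0 : (0 <= K)%R by lra.
  apply: (@le_trans _ _ K%:E).
    have := @fk_cst_le _ _ _ _ _ _ HX _ _ K kE s x potential0 potential0 s0 mk k0 K0.
    rewrite [fk _ _ (cst 1) _ _]fk00 integral_probability_cst mule1; apply => y.
    by rewrite lee_fin; exact: kK.
  by rewrite lee_fin expr0 divr1 lerDr !mulr_ge0// ltW.
set b : R := (K / 2 ^+ n)%R in ih *.
apply: (le_trans (AB s x s0)).
have kp := kappa_pos HA x.
have b0 : (0 <= b)%R by rewrite divr_ge0 ?exprn_ge0//; lra.
have a0 : (0 <= 2 * A * kappa x + b)%R by rewrite addr_ge0// !mulr_ge0// ltW.
apply: (@le_trans _ _ ((A * kappa x)%:E + B%:E * ((2 * A * kappa x + b) * s)%:E)).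
  apply: leeD; first exact: lexx.
  apply: lee_wpmul2l; first by rewrite lee_fin.
  rewrite -(integral_itv_cst _ s0); apply: ge0_le_integral; [exact: measurable_itv| | |exact: measurable_cst|].
  - by move=> u _; exact: fk_ge0.
  - by apply: (measurable_fks_itv HX); [exact: potential0|exact: potential0|exact: mk|exact: k0].
  - move=> u; rewrite /= in_itv/= => /andP[u0 us]; apply: ih.
    by rewrite u0 (le_trans us st).
rewrite -EFinM -EFinD lee_fin.
have -> : (K / 2 ^+ n.+1 = 2^-1 * b)%R by rewrite /b exprS invfM mulrCA.
have h : (B * s <= 2^-1)%R by apply: le_trans Bt; rewrite ler_wpM2l.
have h2 : (B * s * (2 * A * kappa x + b) <= 2^-1 * (2 * A * kappa x + b))%R by rewrite ler_wpM2r.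
move: h2; rewrite mulrDr; move: (kappa x) => k; lra.
Qed.

Let kappa_short : exists be t1 : R, [/\ (1 <= be)%R, (0 < t1)%R &
  forall s x, (0 <= s <= t1)%R -> (be^-1 * kappa x)%:E <= Q kE s x <= (be * kappa x)%:E].
Proof.
have [A [t1 [A0 t10 hA]]] := kappa_upper.
have [c [t2 [c0 t20 hc]]] := kappa_lower d0 HX HA.
pose be : R := (1 + A + c^-1)%R.
have c1 : (0 < c^-1)%R by rewrite invr_gt0.
have be0 : (0 < be)%R by rewrite /be; lra.
exists be, (Num.min t1 t2); split.
- by rewrite /be; lra.
- by rewrite lt_min t10 t20.
- move=> s x /andP[s0]; rewrite le_min => /andP[s1 s2].
  have kp := kappa_pos HA x; apply/andP; split.
  + apply: (@le_trans _ _ (c * kappa x)%:E); last by apply: hc; rewrite s0.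
    rewrite lee_fin ler_wpM2r ?(ltW kp)// -[leRHS]invrK lef_pV2 ?posrE// /be; lra.
  + apply: (@le_trans _ _ (A * kappa x)%:E); first by apply: hA; rewrite s0.
    rewrite lee_fin ler_wpM2r ?(ltW kp)// /be; lra.
Qed.

Lemma kappa_stable t : exists2 be : R, (1 <= be)%R &
  forall s x, (0 <= s <= t)%R -> (be^-1 * kappa x)%:E <= Q kE s x <= (be * kappa x)%:E.
Proof.
have [be [t1 [be1 t10 short]]] := kappa_short; have be0 : (0 < be)%R by lra.
suff H n : forall s x, (0 <= s <= t1 *+ n.+1)%R ->
    ((be ^+ n.+1)^-1 * kappa x)%:E <= Q kE s x <= (be ^+ n.+1 * kappa x)%:E.
  exists (be ^+ (Num.bound (t / t1)).+1)%R; first exact: exprn_ege1.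
  move=> s x /andP[s0 st]; apply: H; rewrite s0/=; apply: (le_trans st).
  have [t0|t0] := leP 0%R t; last first.
    by apply: (le_trans (ltW t0)); rewrite mulrn_wge0// ltW.
  have := archi_boundP (divr_ge0 t0 (ltW t10)); rewrite ltr_pdivrMr// => h.
  by rewrite mulrS -mulr_natl; lra.
elim: n => [|n ih] s x; first by rewrite expr1 mulr1n; exact: short.
move=> /andP[s0 st].
have [s1|s1] := leP s t1.
  have s01 : (0 <= s <= t1 *+ n.+1)%R.
    by rewrite s0/= mulrS; apply: (le_trans s1); rewrite lerDl mulrn_wge0// ltW.
  have kp := ltW (kappa_pos HA x).
  have /andP[h1 h2] := ih s x s01; apply/andP; split.
    apply: le_trans h1; rewrite lee_fin ler_wpM2r// lef_pV2 ?posrE ?exprn_gt0//.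
    by rewrite (exprS _ n.+1) ler_peMl// exprn_ge0// ltW.
  apply: (le_trans h2); rewrite lee_fin ler_wpM2r//.
  by rewrite (exprS _ n.+1) ler_peMl// exprn_ge0// ltW.
have r0 : (0 <= s - t1)%R by rewrite subr_ge0 ltW.
have rn : (0 <= s - t1 <= t1 *+ n.+1)%R by rewrite r0/= lerBlDl -mulrS.
have t1t : (0 <= t1 <= t1)%R by rewrite lexx ltW.
have -> : s = (t1 + (s - t1))%R by rewrite addrCA subrr addr0.
rewrite (@fk_semigroup _ _ _ _ _ _ HX _ _ kE t1 (s - t1)%R x potential0 potential0 mk k0 (ltW t10) r0).
have mQ : measurable_fun setT (Q kE (s - t1)%R) by exact: (measurable_fkx HX potential0 potential0 mk k0 r0).
have /andP[l1 u1] := short t1 x t1t.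
have Z c : (0 <= c)%R -> c%:E * Q kE t1 x = Q (fun y => c%:E * kE y) t1 x.
  by move=> c0; rewrite (@fkZl _ _ _ _ _ _ HX _ _ kE t1 x c potential0 potential0 (ltW t10) mk k0 c0).
have ben : (0 < be ^+ n.+1)%R by rewrite exprn_gt0.
have mZ c : measurable_fun setT (fun y => c%:E * kE y).
  by apply: emeasurable_funM; [exact: measurable_cst|exact: mk].
apply/andP; split.
- apply: (@le_trans _ _ (((be ^+ n.+1)^-1)%:E * Q kE t1 x)).
    apply: (@le_trans _ _ (((be ^+ n.+1)^-1)%:E * (be^-1 * kappa x)%:E)).
      by rewrite -EFinM lee_fin mulrA -invfM -exprSr.
    by apply: lee_wpmul2l => //; rewrite lee_fin invr_ge0 ltW.
  rewrite Z ?invr_ge0 ?(ltW ben)//.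
  apply: (@fk_le _ _ _ _ _ _ HX _ _ _ _ _ _ potential0 potential0 (ltW t10) (mZ _) mQ).
    by move=> y; apply: mule_ge0; [rewrite lee_fin invr_ge0 ltW|exact: k0].
  by move=> y; have /andP[h _] := ih (s - t1)%R y rn; rewrite -EFinM.
- apply: (@le_trans _ _ ((be ^+ n.+1)%:E * Q kE t1 x)).
    rewrite Z ?(ltW ben)//.
    apply: (@fk_le _ _ _ _ _ _ HX _ _ _ _ _ _ potential0 potential0 (ltW t10) mQ (mZ _)).
      by move=> y; exact: fk_ge0.
    by move=> y; have /andP[_ h] := ih (s - t1)%R y rn; rewrite -EFinM.
  apply: (@le_trans _ _ ((be ^+ n.+1)%:E * (be * kappa x)%:E)).
    by apply: lee_wpmul2l => //; rewrite lee_fin ltW.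
  by rewrite -EFinM lee_fin (exprS _ n.+1) le_eqVlt; apply/orP; left; apply/eqP; ring.
Qed.

End kappa_stability.

(** * Upper bound on the ground state, lower bound on the potential *)

Section ground_state.
Local Open Scope ereal_scope.
Context {R : realType} {d : nat}.
Notation rV := 'rV[R]_d.
Notation lam := (lebesgue_rV R d).
Notation mu := (@lebesgue_measure R).
Context {dO : measure_display} {Omega : measurableType dO}.
Variables (P : probability Omega R) (X : R -> Omega -> 'rV[R]_d).
Hypothesis HX : levy_process P X.
Local Opaque fk fk_weight.
Notation fk := (fk P X).
Notation path_of := (path_of X).
Implicit Types (x y : rV) (w : Omega).

Lemma path_locally_bounded w (u : R) : (0 <= u)%R -> exists M : R,
  \forall v \near u, (0 <= v)%R -> (enorm (X v w) <= M)%R.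
Proof.
move=> u0.
have near_enorm (F : set_system R) (FF : Filter F) (l : rV) : X s w @[s --> F] --> l ->
    \forall s \near F, (enorm (X s w) <= enorm l + 1)%R.
  move=> Xl; have ce : enorm (X s w) @[s --> F] --> enorm l.
    by apply: (cvg_comp _ _ Xl); exact: continuous_enorm.
  have /cvgrPdist_le/(_ _ ltr01) := ce; apply: filterS => s.
  by rewrite ler_norml => /andP[h _]; lra.
have hr : nbhs u [set v | (u < v)%R -> (enorm (X v w) <= enorm (X u w) + 1)%R].
  exact: near_enorm (levy_rcont HX (w := w) u0).
have [M hl] : exists M : R, nbhs u [set v | (0 <= v < u)%R -> (enorm (X v w) <= M)%R].
  move: u0; rewrite le_eqVlt => /predU1P[<-|u0].
    by exists 0%R; exists 1%R => //= v _ /andP[v0]; rewrite ltNge v0.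
  have [l /near_enorm h] := levy_llim HX w u0.
  exists (enorm l + 1)%R; have : nbhs u [set v | (v < u)%R -> (enorm (X v w) <= enorm l + 1)%R] := h.
  by apply: filterS => v h2 /andP[_]; exact: h2.
exists (Num.max (enorm (X u w) + 1) M)%R; near=> v => v0; rewrite le_max.
have h1 : (u < v)%R -> (enorm (X v w) <= enorm (X u w) + 1)%R by near: v; exact: hr.
have h2 : (0 <= v < u)%R -> (enorm (X v w) <= M)%R by near: v; exact: hl.
have [vu|uv|->] := ltgtP v u.
- by rewrite h2 ?orbT// v0.
- by rewrite h1.
- by rewrite lerDl ler01.
Unshelve. all: by end_near. Qed.

(** Right limits and left limits bound the path near each time, and compactness of [0, t] makes the
    bound uniform. *)
Lemma path_bounded w (t : R) : exists M : R, forall u, (0 <= u <= t)%R -> (enorm (X u w) <= M)%R.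
Proof.
have /compact_near_coveringP/(_ nat \oo (fun n u => (0 <= u)%R -> (enorm (X u w) <= n%:R)%R)) := @segment_compact R 0%R t.
move=> /(_ _)[].
  move=> u; rewrite /= in_itv/= => /andP[u0 _].
  have [M hM] := path_locally_bounded w u0.
  exists ([set v | (0 <= v)%R -> (enorm (X v w) <= M)%R], [set n | (Num.bound `|M|%R <= n)%N]) => /=.
    by split => //; exact: nbhs_infty_ge.
  move=> [v n] /= [h Mn] v0; apply: (le_trans (h v0)); apply: (le_trans (ler_norm _)).
  apply: (le_trans (ltW (archi_boundP (normr_ge0 M)))).
  by rewrite ler_nat.
move=> n _ /(_ n (leqnn n)) h; exists n%:R => u u0; apply: h => /=.
  by rewrite in_itv.
by case/andP: u0.
Qed.

Lemma measurable_path_potential (W : rV -> R) x (t : R) : potential W ->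
  measurable_fun setT (fun w => \int[mu]_(u in `[0%R, t]) (W (x + X u w)%R)%:E).
Proof.
move=> pW; under eq_fun do rewrite (eq_potential_path HX).
apply: (@measurable_path_integral _ _ W _ Omega (cst x) (cst t) (fun z => regularize (sample X z.1) z.2)) => //.
exact: (measurable_Xr HX).
Qed.

(** Khasminskii's lemma gives even a finite exponential moment. *)
Lemma small_occupation_finite (W : rV -> R) x (t : R) : potential W -> small_occupation P X W ->
  (0 <= t)%R -> {ae P, forall w, \int[mu]_(u in `[0%R, t]) (W (x + X u w)%R)%:E < +oo}.
Proof.
move=> pW sW t0; have [C C1 hC] := khasminskii HX pW sW t0.
have h := hC t x; rewrite t0 lexx fkE in h; have {}h := h isT.
have mI := measurable_path_potential x t pW.
have E w : fk_weight (cst 0%R) W x t (path_of w) * cst 1 (x + X t w)%R = expeR (\int[mu]_(u in `[0%R, t]) (W (x + X u w)%R)%:E).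
  by rewrite mule1 fk_weightE integral0 oppe0 expeR0 mul1e.
have ig : P.-integrable setT (fun w => expeR (\int[mu]_(u in `[0%R, t]) (W (x + X u w)%R)%:E)).
  apply/integrableP; split; first exact: (measurableT_comp (@measurable_expeR R)).
  apply: le_lt_trans (ltry C); apply: le_trans h; rewrite le_eqVlt; apply/orP; left; apply/eqP.
  by apply: eq_integral => w _; rewrite E gee0_abs// expeR_ge0.
have := integrable_ae measurableT ig; apply: filterS => w /(_ I).
by case: (\int[mu]_(u in _) _) => //= r _; exact: ltry.
Qed.

(** Up to time t a path stays in some ball, where W coincides with its cut-off [Wn n]; countably
    many exceptional events are discarded. *)
Lemma kato_loc_finite (W : rV -> R) x (t : R) : potential W -> kato_loc P X W ->
  (0 <= t)%R -> {ae P, forall w, \int[mu]_(u in `[0%R, t]) (W (x + X u w)%R)%:E < +oo}.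
Proof.
move=> pW [mW kW] t0; have [_ W0] := pW.
pose Wn (n : nat) y : R := (W y * \1_(eball (0%R : rV) n.+1%:R) y)%R.
have pWn n : potential (Wn n).
  have [mk _] := kW 0%R n.+1%:R (ltr0Sn _ _); split; first exact: mk.
  by move=> y; rewrite mulr_ge0// indicE ler0n.
have h n : {ae P, forall w, \int[mu]_(u in `[0%R, t]) (Wn n (x + X u w)%R)%:E < +oo}.
  apply: small_occupation_finite => //; apply: (kato_small HX) => //.
  exact: (kW 0%R n.+1%:R (ltr0Sn _ _)).
have := ae_foralln h; apply: filterS => w hw.
have [M hM] := path_bounded w t.
pose n := Num.bound (enorm x + `|M|)%R; apply: le_lt_trans (hw n).
rewrite le_eqVlt; apply/orP; left; apply/eqP; apply: eq_integral => u.
rewrite inE/= in_itv/= => ut; rewrite /Wn indicE mem_set ?mulr1// /eball/= subr0.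
have := archi_boundP (addr_ge0 (enorm_ge0 x) (normr_ge0 M)); rewrite -/n => hn.
apply: (le_lt_trans (enormD _ _)); rewrite -natr1.
have := hM u ut; have := ler_norm M; move: hn; move: (enorm x) `|M|%R (enorm (X u w)) => p q r; lra.
Qed.

Section feynman_kac.
Variable V : rV -> R.
Hypothesis HV : kato_potential P X V.

Lemma potential_pos : potential (V^\+)%R.
Proof.
have [mV _ _] := HV; split; first exact: measurable_funrpos.
by move=> x; exact: funrpos_ge0.
Qed.

Lemma potential_neg : potential (V^\-)%R.
Proof.
have [mV _ _] := HV; split; first exact: measurable_funrneg.
by move=> x; exact: funrneg_ge0.
Qed.

Lemma neg_small : small_occupation P X (V^\-)%R.
Proof. by apply: (kato_small HX potential_neg); case: HV. Qed.

Lemma path_integralE x w (t : R) : \int[mu]_(s in `[0%R, t]) (V (x + X s w)%R)%:E =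
  \int[mu]_(s in `[0%R, t]) (V^\+ (x + X s w))%R%:E - \int[mu]_(s in `[0%R, t]) (V^\- (x + X s w))%R%:E.
Proof.
by rewrite integralE; congr (_ - _); apply: eq_integral => s _; rewrite ?funeposE ?funenegE ?funrposE ?funrnegE EFin_max.
Qed.

Lemma measurable_feynman_kac_integrand (h : rV -> R) x (t : R) : measurable_fun setT h -> (0 <= t)%R ->
  measurable_fun setT (fun w => expeR (- \int[mu]_(s in `[0%R, t]) (V (x + X s w)%R)%:E) * (h (x + X t w)%R)%:E).
Proof.
move=> mh t0; have pp := potential_pos; have pn := potential_neg; apply: emeasurable_funM.
  apply: (measurableT_comp (@measurable_expeR R)); apply: measurableT_comp => //.
  by under eq_fun do rewrite path_integralE; apply: emeasurable_funB; exact: measurable_path_potential.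
by apply/measurable_EFinP; exact: (measurable_fX HX).
Qed.

(** The definition integrates V itself along the path. The exponential splits into the two factors
    of [fk_weight] because the integral of V_- is almost surely finite. *)
Lemma feynman_kacE (f : rV -> R) (t : R) x : potential f -> (0 <= t)%R ->
  feynman_kac P X V t f x = fk (V^\+)%R (V^\-)%R (EFin \o f) t x.
Proof.
move=> pf t0; have mf := measurable_potential pf.
have pp := potential_pos; have pn := potential_neg.
rewrite fkE /feynman_kac; apply: ae_eq_integral => //.
- by apply: measurable_feynman_kac_integrand => //; case: pf.
- exact: (@measurable_fk_integrand _ _ _ _ _ _ HX _ _ _ _ _ (cst x) (cst t) id).
- have := small_occupation_finite x potential_neg neg_small t0; apply: filterS => w hw _.
  congr (_ * _); rewrite path_integralE fk_weightE -expeRD; congr expeR.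
  by rewrite fin_num_oppeB// ge0_fin_numE ?path_integral_ge0.
Qed.

End feynman_kac.

(** For t > 0 the law of x + X_t has a density, so it does not charge Lebesgue null sets. *)
Lemma fk_ae_eq p (a b : rV -> R) (f g : rV -> \bar R) (t : R) x :
  is_transition_density P X p -> potential a -> potential b ->
  measurable_fun setT f -> measurable_fun setT g -> (0 < t)%R ->
  {ae lam, forall y, f y = g y} -> fk a b f t x = fk a b g t x.
Proof.
move=> hp pa pb mf mg t0 [N [mN N0 hN]]; have [mp p0 pE] := hp t t0.
rewrite !fkE; apply: ae_eq_integral => //.
- exact: (@measurable_fk_integrand _ _ _ _ _ _ HX _ _ _ _ _ (cst x) (cst t) id _ _ mf _ _ _ (fun=> ltW t0)).
- exact: (@measurable_fk_integrand _ _ _ _ _ _ HX _ _ _ _ _ (cst x) (cst t) id _ _ mg _ _ _ (fun=> ltW t0)).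
- exists [set w | N (x + X t w)%R]; split.
  + rewrite -[X in measurable X]setTI.
    exact: (@measurable_position_path _ _ _ _ _ _ HX _ Omega (cst x) (cst t) id (measurable_cst _) (measurable_cst _) (@measurable_id _ _ _) _ _ id (@measurable_id _ _ _) (fun=> ltW t0)).
  + rewrite -[LHS]/(law_from P X x t N) pE// null_set_integral//.
    by apply: measurable_funTS; apply: (measurableT_comp mp); exact: measurable_funB_rV.
  + move=> w /= h; apply: hN => /= fg; apply: h => _.
    by rewrite fg.
Qed.

Lemma cvg_small_path_integral (W : rV -> R) x w (t : R) (e : nat -> R) : potential W ->
  (0 < t)%R -> \int[mu]_(u in `[0%R, t]) (W (x + X u w)%R)%:E < +oo ->
  (forall n, 0 <= e n <= t)%R -> e n @[n --> \oo] --> (0%R : R) ->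
  \int[mu]_(u in `[0%R, e n]) (W (x + X u w)%R)%:E @[n --> \oo] --> (0%R : \bar R).
Proof.
move=> pW t0 Woo et e0; have [mW W0] := pW.
pose h u := W (x + regularize (sample X w) u)%R.
have mh : measurable_fun setT h by exact: measurable_potential_path.
have h0 u : (0 <= h u)%R by exact: W0.
have ih : mu.-integrable `[0%R, t] (EFin \o h).
  apply/integrableP; split; first by apply: measurable_funTS; exact/measurable_EFinP.
  apply: le_lt_trans Woo; rewrite (eq_potential_path HX) le_eqVlt; apply/orP; left; apply/eqP.
  by apply: eq_integral => u _; rewrite gee0_abs// lee_fin.
have := parameterized_integral_cvg_left t0 ih; move=> /(cvg_comp _ _ e0) c.
have E n : \int[mu]_(u in `[0%R, e n]) (W (x + X u w)%R)%:E = (parameterized_integral mu 0%R (e n) h)%:E.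
  rewrite (eq_potential_path HX) /parameterized_integral /Rintegral fineK//.
  rewrite ge0_fin_numE ?integral_ge0//.
    apply: le_lt_trans Woo; rewrite (eq_potential_path HX); apply: ge0_subset_integral => //.
    - by apply: measurable_funTS; exact/measurable_EFinP.
    - by move=> u _; rewrite lee_fin.
    - by move=> u; rewrite /= !in_itv/= => /andP[-> /le_trans]; apply; case/andP: (et n).
  by move=> u _; rewrite lee_fin.
under eq_fun do rewrite E.
by apply: cvg_EFin; [exact: nearW|exact: c].
Qed.

Lemma start_ae : {ae P, forall w, X 0%R w = 0%R}.
Proof.
have m0 : measurable [set w | X 0%R w = 0%R].
  rewrite (_ : [set w | _] = setT `&` X 0%R @^-1` [set y | (enorm y <= 0)%R]).
    exact: (levy_measurable HX (lexx _) measurableT (measurable_enorm_le 0%R (@measurable_enorm R d))).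
  rewrite setTI; apply/seteqP; split => w /=.
    by move=> ->; rewrite /enorm dot0l sqrtr0.
  move=> h0; apply/rowP => i; rewrite mxE; apply/eqP; rewrite -normr_le0.
  exact: le_trans (coord_le_enorm _ _) h0.
exists (~` [set w | X 0%R w = 0%R]); split => //; first exact: measurableC.
by rewrite probability_setC// (levy_start HX) subee.
Qed.

Lemma fk_time0 (a b : rV -> R) (f : rV -> \bar R) x : potential a -> potential b ->
  measurable_fun setT f -> fk a b f 0%R x = f x.
Proof.
move=> pa pb mf; rewrite fkE -[RHS](integral_probability_cst P).
apply: ae_eq_integral => //.
- exact: (@measurable_fk_integrand _ _ _ _ _ _ HX _ _ _ _ _ (cst x) (cst 0%R) id _ _ mf _ _ _ (fun=> lexx _)).
- have := start_ae; apply: filterS => w w0 _.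
  by rewrite w0 addr0 fk_weightE set_itv1 !integral_set1 oppe0 expeR0 !mul1e.
Qed.

(** As the time tends to 0 the weight tends to 1 and the position to x along almost every path. The
    gain up to the fixed time t, integrable by Khasminskii's lemma, dominates. *)
Lemma fk_cvg0 (a b u : rV -> R) (N t : R) (e : nat -> R) x : potential a -> kato_loc P X a ->
  potential b -> small_occupation P X b -> potential u -> (forall y, (u y <= N)%R) ->
  continuous u -> (0 < t)%R -> (forall n, 0 < e n <= t)%R -> e n @[n --> \oo] --> (0%R : R) ->
  fk a b (EFin \o u) (e n) x @[n --> \oo] --> (u x)%:E.
Proof.
move=> pa ka pb sb pu uN cu t0 et e0.
have mu' := measurable_potential pu; have [_ u0] := pu.
have et' n : (0 <= e n <= t)%R by case/andP: (et n) => /ltW -> ->.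
have N0 : (0 <= N)%R by exact: le_trans (u0 0%R) (uN 0%R).
rewrite -(integral_probability_cst P (u x)%:E).
have [C C1 hC] := khasminskii HX pb sb (ltW t0).
have mw : measurable_fun setT (fun w => fk_weight (cst 0%R) b x t (path_of w) * N%:E).
  by apply: (@measurable_fk_integrand _ _ _ _ _ _ HX (cst 0%R) b (cst N%:E) _ _ (cst x) (cst t) id) => //= _; exact: ltW.
have := @dominated_convergence _ _ _ P setT measurableT
  (fun n w => fk_weight a b x (e n) (path_of w) * (EFin \o u) (x + X (e n) w)%R)
  (cst (u x)%:E) (fun w => fk_weight (cst 0%R) b x t (path_of w) * N%:E).
case => //.
- move=> n; have h := et' n.
  by apply: (@measurable_fk_integrand _ _ _ _ _ _ HX a b (EFin \o u) _ _ (cst x) (cst (e n)) id) => //= _; case/andP: h.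
- have h1 := kato_loc_finite x pa ka (ltW t0).
  have h2 := small_occupation_finite x pb sb (ltW t0).
  have h3 := start_ae.
  move: h1 h2 h3; apply: filterS3 => w aw bw w0 _.
  have c1 := cvg_small_path_integral pa t0 aw et' e0.
  have c2 := cvg_small_path_integral pb t0 bw et' e0.
  have c3 : (EFin \o u) (x + X (e n) w)%R @[n --> \oo] --> (u x)%:E.
    apply: cvg_EFin; first exact: nearW.
    apply: (cvg_comp (fun n => x + X (e n) w)%R u); last exact: cu.
    suff : (x + X (e n) w)%R @[n --> \oo] --> (x + X 0%R w)%R by rewrite w0 addr0.
    apply: cvgD; first exact: cvg_cst.
    exact: (@right_cont_sample _ _ _ _ _ _ HX w 0%R e (lexx _) (fun n => proj1 (andP (et n))) e0).
  have cw : fk_weight a b x (e n) (path_of w) @[n --> \oo] --> expeR (0 : \bar R) * expeR (0 : \bar R).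
    under eq_fun do rewrite fk_weightE; apply: cvgeM; first by rewrite expeR0.
      by rewrite -{1}oppe0; apply: cvg_expeR; apply: cvgeN.
    exact: cvg_expeR.
  rewrite expeR0 mule1 in cw.
  suff : fk_weight a b x (e n) (path_of w) * (EFin \o u) (x + X (e n) w)%R @[n --> \oo] --> 1 * (u x)%:E.
    by rewrite mul1e.
  exact: cvgeM.
- apply/integrableP; split => //.
  apply: (@le_lt_trans _ _ (N%:E * C%:E)); last by rewrite -EFinM ltry.
  apply: (@le_trans _ _ (fk (cst 0%R) b (fun y => N%:E * cst 1 y) t x)).
    rewrite fkE le_eqVlt; apply/orP; left; apply/eqP; apply: eq_integral => w _.
    by rewrite mule1 gee0_abs// mule_ge0 ?fk_weight_ge0// lee_fin.
  rewrite (@fkZl _ _ _ _ _ _ HX (cst 0%R) b (cst 1) t x N potential0 pb (ltW t0) (measurable_cst _) (fun=> lee01) N0).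
  by apply: lee_wpmul2l; rewrite ?lee_fin//; apply: hC; rewrite lexx ltW.
- apply: nearW => w n _; rewrite gee0_abs; last by rewrite mule_ge0 ?fk_weight_ge0// lee_fin.
  apply: lee_pmul; rewrite ?fk_weight_ge0 ?lee_fin//.
  have h := fk_weight_le HX x (e n) w pa pb potential0 pb (fun y => proj2 pa y) (fun y => lexx _).
  apply: (le_trans h); rewrite !fk_weightE !integral0 oppe0 expeR0 !mul1e lee_expeR.
  rewrite !(eq_potential_path HX); apply: ge0_subset_integral => //.
  + apply: measurable_funTS; apply/measurable_EFinP; apply: measurable_potential_path; exact: (proj1 pb).
  + by move=> v _; rewrite lee_fin; exact: (proj2 pb).
  + by move=> v; rewrite /= !in_itv/= => /andP[-> /le_trans]; apply; case/andP: (et n).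
Qed.

(** The eigen equation is given almost everywhere only. Applying T_e to it at time t - e ignores the
    null set, so T_t u = e^(- l (t - e)) T_e u at every point; then e tends to 0, using continuity
    of u. *)
Lemma eigen_everywhere p (a b u : rV -> R) (N l : R) :
  is_transition_density P X p -> potential a -> kato_loc P X a ->
  potential b -> small_occupation P X b -> potential u -> (forall y, (u y <= N)%R) ->
  continuous u ->
  (forall t, (0 < t)%R -> {ae lam, forall x, fk a b (EFin \o u) t x = (expR (- l * t) * u x)%:E}) ->
  forall t x, (0 <= t)%R -> fk a b (EFin \o u) t x = (expR (- l * t) * u x)%:E.
Proof.
move=> hp pa ka pb sb pu uN cu ae_eigen t x.
have mu' := measurable_potential pu; have [_ u0] := pu.
have u0E y : 0 <= (EFin \o u) y by rewrite lee_fin.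
rewrite le_eqVlt => /predU1P[<-|t0].
  by rewrite fk_time0// mulr0 expR0 mul1r.
(* The denominator n + 2 keeps [e n] strictly below t, so both pieces of time are positive. *)
pose e (n : nat) : R := (t / n.+2%:R)%R.
have e_gt0 n : (0 < e n)%R by rewrite divr_gt0.
have e_lt n : (e n < t)%R by rewrite ltr_pdivrMr// ltr_pMr// ltr1n.
have e0 : e n @[n --> \oo] --> (0%R : R).
  apply: (@cvg_of_bound _ _ _ t) => n; rewrite sub0r normrN ger0_norm ?(ltW (e_gt0 n))//.
  by rewrite ler_wpM2l ?(ltW t0)// lef_pV2 ?posrE ?ltr0n// ler_nat.
have E n : fk a b (EFin \o u) t x = (expR (- l * (t - e n)))%:E * fk a b (EFin \o u) (e n) x.
  have r0 : (0 < t - e n)%R by rewrite subr_gt0.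
  have -> : t = (e n + (t - e n))%R by rewrite addrCA subrr addr0.
  rewrite (@fk_semigroup _ _ _ _ _ _ HX a b _ (e n) (t - e n)%R x pa pb mu' u0E (ltW (e_gt0 n)) (ltW r0)).
  rewrite addrCA subrr addr0 -(@fkZl _ _ _ _ _ _ HX a b _ (e n) x _ pa pb (ltW (e_gt0 n)) mu' u0E (expR_ge0 _)).
  apply: (@fk_ae_eq p a b _ _ (e n) x hp pa pb).
  - exact: (measurable_fkx HX pa pb mu' u0E (ltW r0)).
  - by apply: emeasurable_funM.
  - exact: e_gt0.
  - by have := ae_eigen _ r0; apply: filterS => y ->.
have c : (expR (- l * (t - e n)))%:E * fk a b (EFin \o u) (e n) x @[n --> \oo] --> (expR (- l * t))%:E * (u x)%:E.
  apply: cvgeM => //.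
  - apply: cvg_EFin; first exact: nearW.
    apply: (cvg_comp (fun n => - l * (t - e n))%R expR); last exact: continuous_expR.
    apply: cvgM; first exact: cvg_cst.
    by rewrite -[X in _ --> X]subr0; apply: cvgB => //; exact: cvg_cst.
  - apply: (@fk_cvg0 _ _ _ N t) => // n; first by rewrite e_gt0 ltW.
have := c; under eq_fun do rewrite -E.
by move=> /(cvg_unique _ (@cvg_cst _ _ _ _ _)) ->.
Qed.

End ground_state.

(** * Perturbation by potentials of vanishing occupation *)

Section perturbation.
Local Open Scope ereal_scope.
Context {R : realType} {d : nat}.
Notation rV := 'rV[R]_d.
Notation mu := (@lebesgue_measure R).
Context {dO : measure_display} {Omega : measurableType dO}.
Variables (P : probability Omega R) (X : R -> Omega -> 'rV[R]_d).
Hypothesis HX : levy_process P X.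
Local Opaque fk fk_weight.
Notation fk := (fk P X).
Notation path_of := (path_of X).
Notation Q := (fk (cst 0%R) (cst 0%R)).
Notation occupation := (occupation P X).
Implicit Types (x y : rV) (w : Omega) (a b W : rV -> R).

(** The Kato condition without absolute values. Having every eps, and not just 1/2, makes the class
    stable under sums. *)
Definition vanishing_occupation W := forall eps : R, (0 < eps)%R ->
  exists2 t0 : R, (0 < t0)%R & forall x, occupation W t0 x <= eps%:E.

Lemma kato_vanishing W : potential W -> kato P X W -> vanishing_occupation W.
Proof.
move=> pW [_] c eps eps0; have [_ W0] := pW; move: c.
move=> /fine_cvgP[fin /cvgrPdist_lt/(_ _ eps0)] h.
pose S (t : R) := ereal_sup (range (fun x : rV =>
  \int[P]_w \int[mu]_(s in `[0%R, t]) `|W (x + X s w)%R|%:E)).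
near ((0:R)%R^'+) => t; exists t; first by near: t; exact: nbhs_right_gt.
have tf : S t \is a fin_num by near: t.
have h0 : (`|0 - fine (S t)| < eps)%R by near: t.
rewrite sub0r normrN in h0 => x; rewrite (occupationE HX)//.
apply: (@le_trans _ _ (S t)).
  apply: ereal_sup_ubound; exists x; first exact: I.
  by apply: eq_integral => w _; apply: eq_integral => s _; rewrite ger0_norm.
rewrite -(fineK tf) lee_fin; apply: ltW; apply: le_lt_trans h0.
exact: ler_norm.
Unshelve. all: by end_near. Qed.

Lemma vanishing_small W : vanishing_occupation W -> small_occupation P X W.
Proof. by move=> h; apply: h; rewrite invr_gt0. Qed.

Let mocc W x (t : R) : potential W -> measurable_fun `[0%R, t] (fun s : R => Q (EFin \o W) s x).
Proof.
move=> pW; apply: (measurable_fks_itv HX); [exact: potential0|exact: potential0|exact: measurable_potential|].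
by move=> y; exact: potential_ge0.
Qed.

Lemma occupation_time_le W x (s t : R) : potential W -> (s <= t)%R ->
  occupation W s x <= occupation W t x.
Proof.
move=> pW st; apply: ge0_subset_integral; [exact: measurable_itv|exact: measurable_itv|exact: mocc| |].
- by move=> u _; apply: fk_ge0 => y; exact: potential_ge0.
- by move=> u; rewrite /= !in_itv/= => /andP[-> /le_trans]; apply.
Qed.

Lemma occupationD a W x (t : R) : potential a -> potential W ->
  occupation (a \+ W)%R t x = occupation a t x + occupation W t x.
Proof.
move=> pa pW; rewrite /occupation -ge0_integralD; [|exact: measurable_itv| |exact: mocc| |exact: mocc].
- apply: eq_integral => s; rewrite inE/= in_itv/= => /andP[s0 _].
  rewrite -(@fkD _ _ _ _ _ _ HX _ _ (EFin \o a) (EFin \o W) s x potential0 potential0 s0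
    (measurable_potential pa) (measurable_potential pW) (fun y => potential_ge0 y pa) (fun y => potential_ge0 y pW)).
  by apply: eq_fk => y.
- by move=> s _; apply: fk_ge0 => y; exact: potential_ge0.
- by move=> s _; apply: fk_ge0 => y; exact: potential_ge0.
Qed.

Lemma vanishing_le W W' : potential W -> potential W' -> (forall y, W y <= W' y)%R ->
  vanishing_occupation W' -> vanishing_occupation W.
Proof.
move=> pW pW' WW' h eps /h[t0 t00 ht]; exists t0; first exact: t00.
move=> x; apply: le_trans (ht x); exact: (occupation_le HX).
Qed.

Lemma vanishingD a W : potential a -> potential W -> vanishing_occupation a ->
  vanishing_occupation W -> vanishing_occupation (a \+ W)%R.
Proof.
move=> pa pW ha hW eps eps0; have e2 : (0 < eps / 2)%R by rewrite divr_gt0.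
have [t1 t10 h1] := ha _ e2; have [t2 t20 h2] := hW _ e2.
exists (Num.min t1 t2); first by rewrite lt_min t10.
move=> x; rewrite occupationD//; have -> : eps = (eps / 2 + eps / 2)%R by lra.
rewrite EFinD; apply: leeD.
- by apply: le_trans (h1 x); apply: occupation_time_le => //; rewrite ge_min lexx.
- by apply: le_trans (h2 x); apply: occupation_time_le => //; rewrite ge_min lexx orbT.
Qed.

Lemma vanishing_cst (N : R) : (0 <= N)%R -> vanishing_occupation (cst N).
Proof.
move=> N0 eps eps0; exists (eps / (N + 1))%R; first by rewrite divr_gt0//; lra.
move=> x; have t0 : (0 <= eps / (N + 1))%R by rewrite divr_ge0//; lra.
rewrite /occupation (_ : \int[mu]_(s in _) _ = \int[mu]_(s in `[0%R, (eps / (N + 1))%R]) N%:E).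
  rewrite integral_itv_cst// lee_fin mulrCA ger_pMr// ler_pdivrMr; lra.
by apply: eq_integral => s _; rewrite fk00 -[RHS](integral_probability_cst P).
Qed.

Lemma path_integralD a b x w (t : R) : potential a -> potential b ->
  \int[mu]_(u in `[0%R, t]) ((a \+ b)%R (x + X u w)%R)%:E =
  \int[mu]_(u in `[0%R, t]) (a (x + X u w)%R)%:E + \int[mu]_(u in `[0%R, t]) (b (x + X u w)%R)%:E.
Proof.
move=> [ma a0] [mb b0]; rewrite !(eq_potential_path HX) -ge0_integralD//.
- by move=> u _; rewrite lee_fin.
- by apply: measurable_funTS; apply/measurable_EFinP; exact: measurable_potential_path.
- by move=> u _; rewrite lee_fin.
- by apply: measurable_funTS; apply/measurable_EFinP; exact: measurable_potential_path.
Qed.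

Lemma path_integral_time_le W x w (s t : R) : potential W -> (s <= t)%R ->
  \int[mu]_(u in `[0%R, s]) (W (x + X u w)%R)%:E <= \int[mu]_(u in `[0%R, t]) (W (x + X u w)%R)%:E.
Proof.
move=> [mW W0] st; rewrite !(eq_potential_path HX); apply: ge0_subset_integral => //.
- by apply: measurable_funTS; apply/measurable_EFinP; exact: measurable_potential_path.
- by move=> u _; rewrite lee_fin.
- by move=> u; rewrite /= !in_itv/= => /andP[-> /le_trans]; apply.
Qed.

Lemma expeR_mul_le (M : R) (A B B' : \bar R) : 0 <= A -> 0 <= B -> 0 <= B' ->
  M%:E + B <= A + B' -> expeR (- A) * expeR B <= (expR (- M))%:E * expeR B'.
Proof.
move: A B B' => [p| |] [q| |] [r| |] //= p0 q0 r0 h; rewrite ?mul0e ?mule0 ?gt0_mulye ?gt0_muley ?lte_fin ?expR_gt0 ?leey//.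
- by rewrite -!EFinM lee_fin -!expRD ler_expR; move: h; rewrite -!EFinD lee_fin; lra.
Qed.

(** A potential a - b that exceeds M up to the correction W is traded for the constant rate M and
    the gain W, path by path. *)
Lemma fk_compare a b W (M : R) (f : rV -> \bar R) (t : R) x : potential a -> potential b ->
  potential W -> (0 <= M)%R -> (forall y, M + b y <= a y + W y)%R ->
  measurable_fun setT f -> (forall y, 0 <= f y) -> (0 <= t)%R ->
  fk a b f t x <= (expR (- (M * t)))%:E * fk (cst 0%R) W f t x.
Proof.
move=> pa pb pW M0 h mf f0 t0; have pM : potential (cst M : rV -> R) by split.
rewrite -(@fkZl _ _ _ _ _ _ HX _ _ f t x _ potential0 pW t0 mf f0 (expR_ge0 _)) !fkE.
have mcf : measurable_fun setT (fun y => (expR (- (M * t)))%:E * f y).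
  by apply: emeasurable_funM; [exact: measurable_cst|exact: mf].
apply: ge0_le_integral => //.
- by move=> w _; apply: mule_ge0; [exact: fk_weight_ge0|exact: f0].
- by apply: (@measurable_fk_integrand _ _ _ _ _ _ HX a b f _ _ (cst x) (cst t) id).
- by apply: (@measurable_fk_integrand _ _ _ _ _ _ HX (cst 0%R) W (fun y => (expR (- (M * t)))%:E * f y) _ _ (cst x) (cst t) id).
- move=> w _; rewrite muleCA muleA; apply: lee_wpmul2r; first exact: f0.
  rewrite !fk_weightE integral0 oppe0 expeR0 mul1e.
  apply: expeR_mul_le; try by apply: integral_ge0 => u _; rewrite lee_fin; case: pa pb pW => _ a0 [_ b0] [_ W0].
  have := path_integral_le HX x w t (potentialD pM pb) (potentialD pa pW) h.
  by rewrite !path_integralD// integral_itv_cst.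
Qed.

(** Along a path the left side is at most e^(int b) times int W, and r <= e^r bounds this by e^(int
    (b + W)), to which Khasminskii's lemma applies. *)
Lemma occupation_weighted a b W (t : R) : potential a -> potential b -> potential W ->
  vanishing_occupation b -> vanishing_occupation W -> (0 <= t)%R ->
  exists2 C : R, (0 < C)%R & forall x, \int[mu]_(s in `[0%R, t]) fk a b (EFin \o W) s x <= C%:E.
Proof.
move=> pa pb pW vb vW t0.
have pbW := potentialD pb pW.
have [C C1 hC] := khasminskii HX pbW (vanishing_small (vanishingD pb pW vb vW)) t0.
exists C => [|x]; first by lra.
have m2 : measurable_fun setT (fun z : R * rV => (EFin \o W) z.2).
  by apply: (measurableT_comp (measurable_potential pW)).
rewrite (@fk_time_integral _ _ _ _ _ _ HX _ _ (fun=> EFin \o W) t x pa pb m2 (fun _ y => potential_ge0 y pW)).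
have /hC : (0 <= t <= t)%R by rewrite t0 lexx.
move=> /(_ x); apply: le_trans; rewrite fkE.
have mpos : measurable_fun setT (fun s : R => Num.max s 0%R) by apply: measurable_maxr.
have mw w : measurable_fun `[0%R, t] (fun s : R => fk_weight a b x s (path_of w) * (EFin \o W) (x + X s w)%R).
  have m0 (s : R) : (0 <= Num.max s 0)%R by rewrite le_max lexx orbT.
  have := @measurable_fk_integrand _ _ _ _ _ _ HX a b (EFin \o W) _ R (cst x) (fun s => Num.max s 0)%R (cst w)
    pa pb (measurable_potential pW) (measurable_cst _) mpos (measurable_cst _) m0.
  move=> /(measurable_funTS (D := `[0%R, t]%classic)); apply: eq_measurable_fun => s.
  by rewrite inE/= in_itv/= => /andP[s0 _]; rewrite max_l.
have mX w : measurable_fun `[0%R, t] (fun s : R => (W (x + X s w)%R)%:E).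
  have := measurable_funTS (D := `[0%R, t]%classic) (measurableT_comp (@EFin_measurable R setT) (measurable_potential_path X x w (proj1 pW))).
  apply: eq_measurable_fun => s; rewrite inE/= in_itv/= => /andP[s0 _].
  by rewrite regularizeE//; exact: (right_cont_sample HX).
apply: ge0_le_integral => //.
- move=> w _; apply: integral_ge0 => s _; apply: mule_ge0; first exact: fk_weight_ge0.
  exact: potential_ge0.
- have m3 : measurable_fun setT (fun z : R * Omega => (fk_weight a b x (Num.max z.1 0)%R (path_of z.2) * (EFin \o W) (x + X (Num.max z.1 0)%R z.2)%R)).
    apply: (@measurable_fk_integrand _ _ _ _ _ _ HX a b (EFin \o W) _ (R * Omega)%type (cst x) (fun z => Num.max z.1 0)%R snd) => //.
    - exact: measurable_potential.
    - exact: (measurableT_comp mpos measurable_fst).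
    - by move=> z; rewrite le_max lexx orbT.
  have m4 : measurable_fun setT (fun z : R * Omega => \int[mu]_(u in `[0%R, z.1])
      (fk_weight a b x (Num.max u 0)%R (path_of z.2) * (EFin \o W) (x + X (Num.max u 0)%R z.2)%R)).
    apply: (measurable_integral_itv (h := fun z : Omega * R => fk_weight a b x (Num.max z.2 0)%R (path_of z.1) *
      (EFin \o W) (x + X (Num.max z.2 0)%R z.1)%R)).
      exact: (measurableT_comp m3 (@measurable_swap _ _ Omega R)).
    by move=> z; apply: mule_ge0; [exact: fk_weight_ge0|exact: potential_ge0].
  have := measurableT_comp m4 (pair1_measurable t).
  apply: eq_measurable_fun => w _ /=; apply: eq_integral => s.
  by rewrite inE/= in_itv/= => /andP[s0 _]; rewrite max_l.
- by apply: (@measurable_fk_integrand _ _ _ _ _ _ HX (cst 0%R) (b \+ W)%R (cst 1) _ _ (cst x) (cst t) id).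
- move=> w _; rewrite mule1 fk_weightE integral0 oppe0 expeR0 mul1e path_integralD// expeRD.
  apply: (@le_trans _ _ (\int[mu]_(s in `[0%R, t]) (expeR (\int[mu]_(u in `[0%R, t]) (b (x + X u w)%R)%:E) * (W (x + X s w)%R)%:E))).
    apply: ge0_le_integral; [exact: measurable_itv| |exact: mw| |].
    + by move=> s _; apply: mule_ge0; [exact: fk_weight_ge0|exact: potential_ge0].
    + by apply: emeasurable_funM; [exact: measurable_cst|exact: mX].
    + move=> s; rewrite /= in_itv/= => /andP[s0 st]; apply: lee_wpmul2r; first exact: (potential_ge0 _ pW).
      rewrite fk_weightE -[leRHS]mul1e; apply: lee_pmul; rewrite ?expeR_ge0//.
        rewrite -expeR0 lee_expeR leeNl oppe0; apply: integral_ge0 => u _; rewrite lee_fin; exact: (proj2 pa).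
      by rewrite lee_expeR; exact: path_integral_time_le.
  rewrite ge0_integralZl//; last by rewrite expeR_ge0.
    apply: lee_wpmul2l; first exact: expeR_ge0.
    case: (\int[mu]_(s in _) _) => [r| |] //=.
    by rewrite lee_fin; apply: le_trans (expR_ge1Dx r); rewrite lerDr.
    exact: mX.
  by move=> s _; exact: (potential_ge0 _ pW).
Qed.

End perturbation.

Lemma enormZ (R : realType) d (a : R) (x : 'rV[R]_d) : enorm (a *: x) = `|a| * enorm x.
Proof. by rewrite /enorm dotZl dotZr mulrA -expr2 sqrtrM ?sqr_ge0// sqrtr_sqr. Qed.

Section kappa_perturbation.
Local Open Scope ereal_scope.
Context {R : realType} {d : nat}.
Notation rV := 'rV[R]_d.
Notation mu := (@lebesgue_measure R).
Hypothesis d0 : (0 < d)%N.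
Context {dO : measure_display} {Omega : measurableType dO}.
Variables (P : probability Omega R) (X : R -> Omega -> 'rV[R]_d).
Hypothesis HX : levy_process P X.
Variable nu : rV -> R.
Hypothesis HA : assumption_A1 P X nu.
Notation kappa := (kappa nu).
Local Opaque fk fk_weight.
Notation fk := (fk P X).
Notation Q := (fk (cst 0%R) (cst 0%R)).
Implicit Types (x y : rV) (w : Omega) (a b : rV -> R).

Let kE : rV -> \bar R := EFin \o kappa.
Let pk := potential_kappa HA.
Let mk : measurable_fun setT kE := measurable_potential pk.
Let k0 y : 0 <= kE y := potential_ge0 y pk.

(** The decay condition (A1)(2) compares y with one fixed point of norm max(r, 1). *)
Lemma kappa_ball (r : R) : exists2 c : R, (0 < c)%R & forall y, (enorm y <= r)%R -> (c <= kappa y)%R.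
Proof.
have [C C1 h] := A1_decay HA; have C0 : (0 < C)%R by lra.
pose x0 : rV := ((Num.max r 1) *: delta_mx ord0 (Ordinal d0))%R.
have x0E : enorm x0 = Num.max r 1%R.
  rewrite /x0 enormZ (_ : enorm (delta_mx _ _) = 1%R).
    by rewrite mulr1 ger0_norm// le_max ler01 orbT.
  by rewrite /enorm /dot (bigD1 (Ordinal d0))//= mxE !eqxx mulr1 big1 ?addr0 ?sqrtr1// => i /negPf ne; rewrite mxE eqxx ne mul0r.
have n0 : (0 < nu x0)%R by apply: (nu_pos HA); rewrite x0E lt_max ltr01 orbT.
exists (Num.min 1 (nu x0 / C))%R; first by rewrite lt_min ltr01 divr_gt0.
move=> y yr; rewrite /kappa; case: ifPn => [_|]; first by rewrite ge_min lexx.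
rewrite -ltNge => y1; rewrite ge_min ler_pdivrMr// mulrC h ?orbT// x0E le_max yr andbT.
by apply: ltW; apply: lt_trans y1; rewrite invf_lt1// ltr1n.
Qed.

Section gain.
Variables (W : rV -> R) (r t : R).
Hypothesis (pW : potential W) (vW : vanishing_occupation P X W).
Hypothesis Wr : forall y, (0 < W y)%R -> (enorm y <= r)%R.
Hypothesis t0 : (0 <= t)%R.

(** Domination for the free semigroup with u = kappa, which is nearly invariant by [kappa_stable]
    and bounded below on the ball containing {W > 0}. *)
Lemma occupation_le_kappa : exists2 C : R, (0 <= C)%R &
  forall x, occupation P X W t x <= (C * kappa x)%:E.
Proof.
have [be be1 st] := kappa_stable d0 HX HA t; have be0 : (0 < be)%R by lra.
have [c c0 hc] := kappa_ball r.
have [B B0 hB] := occupation_weighted HX potential0 potential0 pW (vanishing_cst P X (lexx 0%R)) vW t0.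
exists (B * be / (be^-1 * c))%R.
  by rewrite divr_ge0 ?mulr_ge0 ?invr_ge0 ?(ltW be0) ?(ltW B0) ?(ltW c0).
move=> x; apply: (@domination _ _ _ _ _ _ HX (cst 0%R) (cst 0%R) W kappa be^-1 be c B t x) => //.
- by rewrite invr_gt0.
- by move=> s y s0; have /andP[] := st s y s0.
- by move=> y; have /andP[] := st t y (introT andP (conj t0 (lexx t))).
- by move=> y /Wr; exact: hc.
Qed.

(** In Duhamel's formula the evolved f is at most K times a Khasminskii constant; what remains is
    the occupation time of W, already below a multiple of kappa. A gain supported in a ball
    therefore costs only an additive kappa. *)
Lemma gain_le : exists2 C : R, (0 <= C)%R & forall (f : rV -> \bar R) (K s : R) x,
  measurable_fun setT f -> (forall y, 0 <= f y) -> (0 <= K)%R -> (forall y, f y <= K%:E) ->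
  (0 <= s <= t)%R -> fk (cst 0%R) W f s x <= Q f s x + (C * K * kappa x)%:E.
Proof.
have [C1 C10 hC1] := occupation_le_kappa.
have [C2 C21 hC2] := khasminskii HX pW (vanishing_small vW) t0.
have C20 : (0 <= C2)%R by lra.
exists (C2 * C1)%R => [|f K s x mf f0 K0 fK /andP[s0 st]]; first by rewrite mulr_ge0.
apply: (@lee_of_cvg _ (fun n => fk (cst 0%R) (truncation W n) f s x)).
  exact: (cvg_fk_truncation_potential HX).
move=> n; have pT := potential_truncation n pW.
rewrite (duhamel_gain HX x pT (truncation_bound W n) mf f0 s0); apply: leeD; first exact: lexx.
have KC0 : (0 <= K * C2)%R by rewrite mulr_ge0.
have mW := measurable_potential pW.
apply: (@le_trans _ _ ((K * C2)%:E * occupation P X W s x)).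
  have mQW : measurable_fun `[0%R, s] (fun r0 : R => Q (EFin \o W) r0 x).
    by apply: (measurable_fks_itv HX); [exact: potential0|exact: potential0|exact: mW|move=> y; exact: potential_ge0].
  rewrite /occupation -(ge0_integralZl_EFin mu _ _ mQW KC0); last 2 first.
  - exact: measurable_itv.
  - by move=> q _; apply: fk_ge0 => y; exact: potential_ge0.
  apply: ge0_le_integral; [exact: measurable_itv| | | |].
  - move=> q _; apply: fk_ge0 => y; apply: mule_ge0; first exact: (potential_ge0 y pT).
    by apply: fk_ge0.
  - apply: (measurable_fk_mid_itv HX (F := EFin \o truncation W n)) => //.
    + exact: measurable_potential.
    + by move=> y; exact: (potential_ge0 y pT).
  - by apply: emeasurable_funM; [exact: measurable_cst|exact: mQW].
  - move=> q; rewrite /= in_itv/= => /andP[q0 qs].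
    have sq0 : (0 <= s - q)%R by rewrite subr_ge0.
    rewrite -(@fkZl _ _ _ _ _ _ HX _ _ (EFin \o W) q x _ potential0 potential0 q0 mW (fun y => potential_ge0 y pW) KC0).
    apply: (@fk_le _ _ _ _ _ _ HX _ _ _ _ _ _ potential0 potential0 q0).
    + apply: emeasurable_funM; first exact: measurable_potential.
      exact: (measurable_fkx HX potential0 pT mf f0 sq0).
    + by apply: emeasurable_funM; [exact: measurable_cst|exact: mW].
    + move=> y; apply: mule_ge0; first exact: (potential_ge0 y pT).
      exact: fk_ge0.
    + move=> y; rewrite muleC; apply: lee_pmul; rewrite ?fk_ge0//; first exact: (potential_ge0 y pT).
        apply: (le_trans (@fk_cst_le _ _ _ _ _ _ HX _ _ K f _ y potential0 pT sq0 mf f0 K0 fK)).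
        rewrite EFinM; apply: lee_wpmul2l; first by rewrite lee_fin.
        apply: (@le_trans _ _ (fk (cst 0%R) W (cst 1) (s - q)%R y)); last first.
          by apply: hC2; rewrite sq0/=; apply: le_trans st; rewrite gerBl.
        rewrite !fkE; apply: ge0_le_integral => //.
        * by move=> w _; rewrite mule1 fk_weight_ge0.
        * by apply: (@measurable_fk_integrand _ _ _ _ _ _ HX (cst 0%R) (truncation W n) (cst 1) _ _ (cst y) (cst (s - q)%R) id).
        * by apply: (@measurable_fk_integrand _ _ _ _ _ _ HX (cst 0%R) W (cst 1) _ _ (cst y) (cst (s - q)%R) id).
        * move=> w _; rewrite !mule1; apply: (fk_weight_le HX) => //.
          by move=> z; exact: truncation_le.
      by rewrite lee_fin truncation_le.
have -> : (C2 * C1 * K * kappa x = K * C2 * (C1 * kappa x))%R by ring.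
rewrite (EFinM (K * C2)%R); apply: lee_wpmul2l; first by rewrite lee_fin.
apply: le_trans (hC1 x); exact: occupation_time_le.
Qed.

End gain.

(** The least W >= 0 with M + b <= a + W, as [fk_compare] requires; if a - b is confining, W
    vanishes outside a ball. *)
Definition shortfall a b (M : R) (y : rV) : R := (Num.max (M + b y - a y) 0)%R.

Lemma potential_shortfall a b (M : R) : potential a -> potential b -> potential (shortfall a b M).
Proof.
move=> [ma _] [mb _]; split; last by move=> y; rewrite le_max lexx orbT.
by apply: measurable_maxr => //; apply: measurable_funB => //; apply: measurable_funD.
Qed.

(* The eigen equation gives u <= e^(l - M) Q u + C kappa. For M large,
   e^(l - M) Q kappa <= kappa / 2, and iterating removes the first term. *)
Lemma ground_le_kappa a b (u : rV -> R) (N l : R) : potential a -> potential b ->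
  vanishing_occupation P X b -> potential u -> (forall y, u y <= N)%R ->
  (forall M : R, exists r : R, forall y, (r < enorm y)%R -> (M <= a y - b y)%R) ->
  (forall x, (expR (- l) * u x)%:E <= fk a b (EFin \o u) 1%R x) ->
  exists2 C : R, (0 < C)%R & forall x, (u x <= C * kappa x)%R.
Proof.
move=> pa pb vb pu uN conf eig; have [mu' u0] := pu.
have N0 : (0 <= N)%R by exact: le_trans (u0 0%R) (uN 0%R).
have [be be1 st] := kappa_stable d0 HX HA 1%R; have be0 : (0 < be)%R by lra.
(* Makes e^(l - M) at most 1 / (2 be), where be bounds Q_1 kappa / kappa. *)
pose M : R := (`|l| + ln (2 * be))%R.
have ln0 : (0 <= ln (2 * be))%R by rewrite ln_ge0//; lra.
have M0 : (0 <= M)%R by rewrite addr_ge0.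
pose de : R := expR (l - M)%R.
have deb : (de <= (2 * be)^-1)%R.
  rewrite -[leRHS]lnK ?posrE ?invr_gt0 ?mulr_gt0// /de ler_expR lnV ?posrE ?mulr_gt0//.
  by rewrite /M; have := ler_norm l; lra.
have de0 : (0 < de)%R := expR_gt0 _.
have de2 : (de <= 2^-1)%R.
  by apply: (le_trans deb); rewrite lef_pV2 ?posrE ?mulr_gt0//; lra.
have dbe : (de * be <= 2^-1)%R.
  apply: (@le_trans _ _ ((2 * be)^-1 * be)%R); first by rewrite ler_wpM2r// ltW.
  by rewrite invfM mulfVK ?gt_eqF.
have [r hr] := conf M.
pose W := shortfall a b M; have pW : potential W := potential_shortfall M pa pb.
have vW : vanishing_occupation P X W.
  apply: (vanishing_le HX pW (potentialD (a := cst M) _ pb)); first by split.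
    move=> y; have a0 := proj2 pa y; have b0 := proj2 pb y.
    by rewrite /W /shortfall ge_max/=; apply/andP; split; lra.
  by apply: (vanishingD HX _ pb _ vb); [split|exact: vanishing_cst].
have Wr y : (0 < W y)%R -> (enorm y <= r)%R.
  by rewrite /W /shortfall lt_max ltxx orbF => h; rewrite leNgt; apply/negP => /hr; lra.
have [C1 C10 hC1] := gain_le pW vW Wr ler01.
pose C : R := (de * (C1 * N))%R; have C0 : (0 <= C)%R by rewrite !mulr_ge0 ?(ltW de0).
have uE0 y : 0 <= (EFin \o u) y := potential_ge0 y pu.
have muE := measurable_potential pu.
have one1 : (0 <= (1 : R) <= 1)%R by rewrite ler01 lexx.
have step x : (u x)%:E <= de%:E * Q (EFin \o u) 1%R x + (C * kappa x)%:E.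
  have h1 := eig x.
  have MW y : (M + b y <= a y + W y)%R.
    have : (M + b y - a y <= W y)%R by rewrite /W /shortfall le_max lexx.
    lra.
  have h2 := fk_compare HX x pa pb pW M0 MW muE uE0 ler01.
  have uNE y : (EFin \o u) y <= N%:E by rewrite lee_fin.
  have h3 := hC1 (EFin \o u) N 1%R x muE uE0 N0 uNE one1.
  have eM0 : 0 <= (expR (- (M * 1)))%:E by rewrite lee_fin expR_ge0.
  have := le_trans h1 (le_trans h2 (lee_wpmul2l eM0 h3)).
  move=> /(lee_wpmul2l (_ : 0 <= (expR l)%:E)); rewrite lee_fin expR_ge0 => /(_ isT).
  rewrite -EFinM mulrA -expRD subrr expR0 mul1r muleA -EFinM -expRD mulr1 => h4.
  apply: (le_trans h4); rewrite ge0_muleDr; last 2 first.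
  - exact: fk_ge0.
  - by rewrite lee_fin !mulr_ge0// ltW// (kappa_pos HA).
  apply: leeD; first exact: lexx.
  by rewrite -EFinM lee_fin /C /de !mulrA.
(* The coefficient 2 C reproduces itself, since half of it plus C is 2 C again, while the additive
   error is halved. *)
suff H n x : (u x <= 2 * C * kappa x + N / 2 ^+ n)%R.
  exists (2 * C + 1)%R => [|x]; first by lra.
  apply: (@le_trans _ _ (2 * C * kappa x)%R); last first.
    by rewrite ler_wpM2r ?(ltW (kappa_pos HA x))//; lra.
  rewrite -lee_fin; apply: (@gee_of_cvg _ (fun n => (2 * C * kappa x + N / 2 ^+ n)%:E)); last by move=> n; rewrite lee_fin.
  apply: cvg_EFin; first exact: nearW.
  rewrite -[X in _ --> X]addr0; apply: cvgD; first exact: cvg_cst.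
  rewrite -(mulr0 N); apply: cvgM; first exact: cvg_cst.
  by under eq_fun do rewrite -exprVn; apply: cvg_expr; rewrite ger0_norm ?invf_lt1 ?ltr1n.
elim: n x => [|n ih] x.
  have kp := kappa_pos HA x.
  by rewrite expr0 divr1; apply: (le_trans (uN x)); rewrite lerDr !mulr_ge0// ltW.
set e : R := (N / 2 ^+ n)%R in ih.
have e0 : (0 <= e)%R by rewrite divr_ge0 ?exprn_ge0.
have -> : (N / 2 ^+ n.+1 = 2^-1 * e)%R by rewrite /e exprS invfM mulrCA.
have kp := kappa_pos HA x.
have C20 : (0 <= 2 * C)%R by rewrite mulr_ge0.
have mC : measurable_fun setT (fun y => (2 * C)%:E * kE y).
  by apply: emeasurable_funM; [exact: measurable_cst|exact: mk].
have Ck0 y : 0 <= (2 * C)%:E * kE y by apply: mule_ge0; [rewrite lee_fin|exact: k0].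
have hQ : Q (EFin \o u) 1%R x <= (2 * C * (be * kappa x) + e)%:E.
  apply: (@le_trans _ _ (Q (fun y => (2 * C)%:E * kE y + cst e%:E y) 1%R x)).
    apply: (@fk_le _ _ _ _ _ _ HX _ _ _ _ _ _ potential0 potential0 ler01 muE _ uE0).
      by apply: emeasurable_funD => //; exact: measurable_cst.
    by move=> y; rewrite /= -EFinM -EFinD lee_fin; exact: ih.
  have eE0 y : 0 <= cst e%:E y by rewrite lee_fin.
  rewrite (@fkD _ _ _ _ _ _ HX _ _ _ _ 1%R x potential0 potential0 ler01 mC (measurable_cst _) Ck0 eE0).
  rewrite (@fkZl _ _ _ _ _ _ HX _ _ kE 1%R x _ potential0 potential0 ler01 mk k0 C20) EFinD; apply: leeD.
    rewrite (EFinM (2 * C)); apply: lee_wpmul2l; first by rewrite lee_fin.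
    by have /andP[] := st 1%R x one1.
  by rewrite fk00 integral_probability_cst.
have := le_trans (step x) (leeD (lee_wpmul2l (_ : 0 <= de%:E) hQ) (lexx _)).
rewrite lee_fin (ltW de0) => /(_ isT); rewrite -EFinM -EFinD lee_fin => h.
apply: (le_trans h).
have h1 : (de * e <= 2^-1 * e)%R by rewrite ler_wpM2r.
have h2 : (de * be * (2 * C * kappa x) <= 2^-1 * (2 * C * kappa x))%R.
  by rewrite ler_wpM2r// !mulr_ge0// ltW.
have -> : (de * (2 * C * (be * kappa x) + e) = de * be * (2 * C * kappa x) + de * e)%R by ring.
by move: h1 h2; move: (kappa x) => k; lra.
Qed.

End kappa_perturbation.

Lemma continuous_measurable_rV (R : realType) d (f : 'rV[R]_d -> R) :
  continuous f -> measurable_fun setT f.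
Proof.
move=> cf; apply: (measurability _ (RGenOpens.measurableE R)) => _ [_ [a [b ->]] <-].
rewrite setTI; suff : (<<s @open 'rV[R]_d >>) (f @^-1` `]a, b[) by rewrite -measurable_rV_borel.
apply: sub_sigma_algebra; apply: open_comp; first by move=> x _; exact: cf.
exact: (@interval_open R (BRight a) (BLeft b)).
Qed.

Section eball.
Context {R : realType} {d : nat}.
Notation rV := 'rV[R]_d.

Lemma measurable_eball (x : rV) r : measurable (eball x r).
Proof.
rewrite (_ : eball x r = ~` [set y | r <= enorm (y - x)]).
  apply: measurableC; rewrite (_ : [set y | _] = [set y | - enorm (y - x) <= - r]).
    by apply: measurable_enorm_le; apply: measurableT_comp => //; exact: measurable_enormB.
  by apply/seteqP; split => y /=; rewrite lerN2.
by apply/seteqP; split => y /=; rewrite /eball/= ltNge => /negP.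
Qed.

End eball.

(** * Lower bound on the potential from GSD or IUC *)

Section potential_lower_bound.
Local Open Scope ereal_scope.
Context {R : realType} {d : nat}.
Notation rV := 'rV[R]_d.
Notation lam := (lebesgue_rV R d).
Hypothesis d0 : (0 < d)%N.
Context {dO : measure_display} {Omega : measurableType dO}.
Variables (P : probability Omega R) (X : R -> Omega -> 'rV[R]_d).
Hypothesis HX : levy_process P X.
Variable nu : rV -> R.
Hypothesis HA : assumption_A1 P X nu.
Variable p : R -> rV -> \bar R.
Hypothesis Hp : is_transition_density P X p.
Variable V : rV -> R.
Hypothesis HV : confining_kato_potential P X V.
Variables (la : nat -> R) (phi : nat -> rV -> R).
Hypothesis Hphi : feynman_kac_eigenbasis P X V la phi.
Notation kappa := (kappa nu).
Local Opaque fk fk_weight.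
Notation fk := (fk P X).
Notation phi0 := (phi 0%N).
Notation T := (fk (V^\+)%R (V^\-)%R).
Implicit Types (x y : rV) (w : Omega).

Let KV : kato_potential P X V. Proof. by case: HV. Qed.
Let pp : potential (V^\+)%R := potential_pos KV.
Let pn : potential (V^\-)%R := potential_neg KV.

Lemma neg_vanishing : vanishing_occupation P X (V^\-)%R.
Proof. by apply: (kato_vanishing HX pn); case: KV. Qed.

Lemma ground_potential : potential phi0.
Proof.
split; first by apply: continuous_measurable_rV; exact: (eigen_continuous Hphi).
by move=> x; apply: ltW; exact: (ground_state_gt0 Hphi).
Qed.

Lemma confining (M : R) : exists r : R, forall y, (r < enorm y)%R -> (M <= V y)%R.
Proof. by have [_ /cvgryPge/(_ M)] := HV. Qed.

Lemma posBneg y : (V^\+ y - V^\- y)%R = V y.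
Proof. by have := congr1 (fun f => f y) (funrposBneg V). Qed.

Lemma ground_eigen (t : R) x : (0 <= t)%R ->
  T (EFin \o phi0) t x = (expR (- la 0%N * t) * phi0 x)%:E.
Proof.
move=> t0; have [N hN] := eigen_bounded Hphi 0%N.
apply: (@eigen_everywhere _ _ _ _ _ _ HX p _ _ phi0 N (la 0%N) Hp pp _ pn _ ground_potential) => //.
- by case: KV.
- exact: (vanishing_small neg_vanishing).
- by move=> y; apply: le_trans (hN y); exact: ler_norm.
- exact: (eigen_continuous Hphi).
- move=> s s0; have := eigen_eq Hphi 0%N s0; apply: filterS => y <-.
  by rewrite (feynman_kacE HX KV _ ground_potential (ltW s0)).
Qed.

Lemma ground_upper : exists2 C : R, (0 < C)%R & forall x, (phi0 x <= C * kappa x)%R.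
Proof.
have [N hN] := eigen_bounded Hphi 0%N.
apply: (@ground_le_kappa _ _ d0 _ _ _ _ HX nu HA (V^\+)%R (V^\-)%R phi0 N (la 0%N) pp pn neg_vanishing ground_potential).
- by move=> y; apply: le_trans (hN y); exact: ler_norm.
- by move=> M; have [r hr] := confining M; exists r => y /hr; rewrite posBneg.
- by move=> x; rewrite ground_eigen// mulr1.
Qed.

Let pball x (eps : R) : potential (\1_(eball x eps) : rV -> R).
Proof.
split; first by apply: measurable_indic; exact: measurable_eball.
by move=> y; rewrite indicE ler0n.
Qed.

(** From a start within eps / 2 of x, moves of length at most eps / 4 stay in the ball. The start y
    is not fixed at the centre because IUC controls almost every point only. *)
Lemma survival (eps : R) : (0 < eps)%R -> exists2 t0 : R, (0 < t0)%R &
  forall t x y S, (0 <= t <= t0)%R -> (enorm (y - x) <= eps / 2)%R -> (0 <= S)%R ->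
  (forall z, eball x eps z -> (V z <= S)%R) ->
  (2^-1 * expR (- (S * t)))%:E <= T (EFin \o \1_(eball x eps)) t y.
Proof.
move=> eps0; have e4 : (0 < eps / 4)%R by rewrite divr_gt0.
have [t0 [E [t00 mE E2 hE]]] := small_paths HX e4; exists t0 => // t x y S tt yx S0 VS.
have /andP[tp tt0] := tt.
have ib w s : E w -> (0 <= s <= t)%R -> eball x eps (y + X s w)%R.
  move=> Ew /andP[s0 st]; have h := hE w s Ew; rewrite s0 (le_trans st tt0) in h.
  have {}h := h isT; rewrite /eball/=.
  have -> : (y + X s w - x = (y - x) + X s w)%R by rewrite addrAC.
  by apply: (le_lt_trans (enormD _ _)); lra.
have c0 : (0 <= expR (- (S * t)))%R by exact: expR_ge0.
apply: (@le_trans _ _ (\int[P]_w ((expR (- (S * t)))%:E * (\1_E w)%:E))).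
  rewrite (ge0_integralZl_EFin P measurableT (fun w _ => _ : 0 <= (\1_E w)%:E) _ c0); last 2 first.
  - by move=> w _; rewrite lee_fin indicE ler0n.
  - by apply/measurable_EFinP; exact: measurable_indic.
  rewrite integral_indic// setIT mulrC EFinM; apply: lee_wpmul2l => //.
rewrite fkE; apply: ge0_le_integral => //.
- by apply: emeasurable_funM => //; apply/measurable_EFinP; exact: measurable_indic.
- have [m1 _] := pball x eps.
  by apply: (@measurable_fk_integrand _ _ _ _ _ _ HX (V^\+)%R (V^\-)%R _ _ _ (cst y) (cst t) id) => //; exact/measurable_EFinP.
- move=> w _; rewrite indicE; case: (boolP (w \in E)) => [|_]; last first.
    by rewrite mule0 mule_ge0 ?fk_weight_ge0// (potential_ge0 _ (pball x eps)).
  rewrite inE => Ew; rewrite mule1 /= indicE mem_set ?mule1; last by apply: ib; rewrite ?tp ?lexx.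
  rewrite fk_weightE -[leLHS]mule1; apply: lee_pmul; rewrite ?lee_fin ?expeR_ge0//.
    rewrite -[leLHS]/(expeR (- (S * t)%:E)) lee_expeR leeN2 -(integral_itv_cst S tp) (eq_potential_path HX).
    apply: ge0_le_integral; [exact: measurable_itv| | |exact: measurable_cst|].
    - by move=> s _; rewrite lee_fin; exact: (proj2 pp).
    - apply: measurable_funTS; apply/measurable_EFinP; apply: measurable_potential_path; exact: (proj1 pp).
    - move=> s; rewrite /= in_itv/= => st; have /andP[s0 _] := st.
      rewrite regularizeE//; last exact: (right_cont_sample HX).
      by rewrite lee_fin /funrpos ge_max S0 andbT; apply: VS; exact: ib.
  by rewrite -expeR0 lee_expeR; apply: integral_ge0 => s _; rewrite lee_fin; exact: (proj2 pn).
Qed.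

(** Under GSD take y = x. Under IUC test with the indicator of the ball divided by phi_0, whose norm
    in L^2(phi_0^2 dx) is the square root of the volume: this bounds T_t of the indicator by a
    multiple of phi_0 off a null set, which cannot contain the ball of radius eps / 2. As eps <= 1,
    kappa at such a point y is comparable to kappa at x. *)
Lemma survival_le_kappa (t eps : R) : GSD P X V phi0 \/ IUC P X V (la 0%N) phi0 ->
  (0 < t)%R -> (0 < eps <= 1)%R -> exists2 C : R, (0 < C)%R &
  forall x, exists2 y, (enorm (y - x) <= eps / 2)%R &
    T (EFin \o \1_(eball x eps)) t y <= (C * kappa x)%:E.
Proof.
move=> H t0 /andP[e0 e1]; have [C1 C10 hC1] := ground_upper.
have p1 : potential (cst 1%R : rV -> R) by split.
case: H => [/(_ t t0)[C2 C20 hC2]|/(_ t t0)[C2 hC2]].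
  exists (C2 * C1)%R => [|x]; first by rewrite mulr_gt0.
  exists x; first by rewrite subrr /enorm dot0l sqrtr0 divr_ge0// ltW.
  apply: (@le_trans _ _ (T (EFin \o cst 1%R) t x)).
    apply: (@fk_le _ _ _ _ _ _ HX _ _ _ _ _ _ pp pn (ltW t0)).
    - exact: (measurable_potential (pball x eps)).
    - exact: measurable_potential.
    - by move=> y; exact: (potential_ge0 _ (pball x eps)).
    - by move=> y; rewrite lee_fin indicE; case: (_ \in _).
  rewrite -(feynman_kacE HX KV _ p1 (ltW t0)); apply: (le_trans (hC2 x)).
  by rewrite lee_fin -mulrA ler_wpM2l// ltW.
have [L L1 hL] := kappa_local d0 HA; have L0 : (0 < L)%R by lra.
pose v : R := ((2 * eps) ^+ d)%R.
have v0 : (0 <= v)%R by rewrite exprn_ge0// mulr_ge0// ltW.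
pose K : R := (`|C2| * v `^ 2^-1 + 1)%R.
have K0 : (0 < K)%R by rewrite ltr_wpDl// mulr_ge0// powR_ge0.
exists (K * expR (- la 0%N * t) * (C1 * L))%R => [|x]; first by rewrite !mulr_gt0// expR_gt0.
have php z := ground_state_gt0 Hphi z.
pose f y : R := (\1_(eball x eps) y / phi0 y)%R.
have mf : measurable_fun setT f.
  apply: measurable_funM; first by case: (pball x eps).
  apply: continuous_measurable_rV => z; have pz : (phi0 z != 0)%R by rewrite gt_eqF.
  exact: (cvgV pz (eigen_continuous Hphi (n := 0%N) (x := z))).
have If : \int[lam]_y (f y ^+ 2 * phi0 y ^+ 2)%:E <= v%:E.
  rewrite (_ : \int[lam]_y _ = \int[lam]_y (\1_(eball x eps) y)%:E); last first.
    apply: eq_integral => y _; rewrite /f exprMn -mulrA -exprMn mulVf ?gt_eqF ?(php y)//.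
    by rewrite expr1n mulr1 indicE; case: (_ \in _); rewrite ?expr1n ?expr0n.
  rewrite integral_indic ?setIT; [|exact: measurableT|exact: measurable_eball].
  apply: le_trans (volume_le x (ltW e0)); apply: le_measure; rewrite ?inE.
  - exact: measurable_eball.
  - exact: measurable_cball.
  - by move=> y; rewrite /eball /cball/= => /ltW.
have If0 : 0 <= \int[lam]_y (f y ^+ 2 * phi0 y ^+ 2)%:E.
  by apply: integral_ge0 => y _; rewrite lee_fin mulr_ge0 ?sqr_ge0.
have Ifoo : \int[lam]_y (f y ^+ 2 * phi0 y ^+ 2)%:E < +oo by apply: le_lt_trans If (ltry v).
have := hC2 f mf Ifoo; set g := intrinsic_semigroup _ _ _ _ _ _ _ => gC.
have {gC} gK : 'N[lam]_+oo[g] <= K%:E.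
  apply: (le_trans gC); rewrite /K; move: If If0 Ifoo; move: (\int[lam]_y _) => [r| |]//= rv r0 _.
  rewrite -EFinM lee_fin; apply: ler_wpDr; first exact: ler01.
  apply: (@le_trans _ _ (`|C2| * r `^ 2^-1)%R); first by rewrite ler_wpM2r ?powR_ge0// ler_norm.
  by rewrite ler_wpM2l//; apply: ge0_ler_powR; rewrite ?nnegrE ?invr_ge0.
have e20 : (0 <= eps / 2)%R by rewrite divr_ge0// ltW.
have vol : 0 < lam (cball x (eps / 2)).
  apply: lt_le_trans (volume_ge x e20); rewrite lte_fin exprn_gt0// mulr_gt0//.
  by rewrite divr_gt0 ?ltr0n// divr_gt0.
(* The norm of index +oo is the essential supremum only on a space of positive measure. *)
have lam0 : 0 < lam setT.
  by apply: (lt_le_trans vol); apply: le_measure; rewrite ?inE//; exact: measurable_cball.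
have aeg : {ae lam, forall y, `|g y| <= K%:E}.
  by apply/ess_sup_inf.ess_supP; move: gK; rewrite unlock lam0.
have [y yb gy] : exists2 y, cball x (eps / 2) y & `|g y| <= K%:E.
  apply: contrapT => no; have [N [mN N0 hN]] := aeg.
  have : lam (cball x (eps / 2)) <= lam N.
    apply: le_measure; rewrite ?inE//; first exact: measurable_cball.
    by move=> y yb; apply: hN => /= gy; apply: no; exists y.
  by rewrite N0 leNgt vol.
exists y => //.
have Eg : g y = (expR (la 0%N * t) / phi0 y)%:E * T (EFin \o \1_(eball x eps)) t y.
  rewrite /g /intrinsic_semigroup -(feynman_kacE HX KV _ (pball x eps) (ltW t0)); congr (_ * _).
  congr feynman_kac; apply/funext => z; rewrite /f mulrC divfK ?gt_eqF ?(php z)//.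
have Tb0 : 0 <= T (EFin \o \1_(eball x eps)) t y by apply: fk_ge0 => z; exact: (potential_ge0 _ (pball x eps)).
have q0 : (0 < expR (la 0%N * t) / phi0 y)%R by rewrite divr_gt0 ?expR_gt0.
rewrite gee0_abs in gy; last by rewrite Eg mule_ge0// lee_fin ltW.
rewrite Eg in gy.
have := lee_wpmul2l (_ : 0 <= ((expR (la 0%N * t) / phi0 y)^-1)%:E) gy.
rewrite lee_fin invr_ge0 (ltW q0) => /(_ isT).
rewrite muleA -EFinM mulVf ?gt_eqF// mul1e => /le_trans; apply.
rewrite -EFinM lee_fin.
have -> : ((expR (la 0%N * t) / phi0 y)^-1 * K = K * expR (- la 0%N * t) * phi0 y)%R.
  by rewrite invf_div mulNr expRN; ring.
rewrite -[leRHS]mulrA ler_wpM2l ?mulr_ge0 ?expR_ge0 ?(ltW K0)//.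
apply: (le_trans (hC1 y)); rewrite -mulrA ler_wpM2l ?(ltW C10)//; apply: hL.
have h1 := enormD (y - x)%R x; have h2 := enormD (x - y)%R y.
rewrite subrK in h1; rewrite subrK enormB in h2.
by rewrite ler_norml; apply/andP; split; move: yb; rewrite /cball/=; lra.
Qed.

(** With S the supremum of V over the ball, survival gives S t >= |log nu| - c, hence S t >= |log
    nu| / 2 once |log nu| >= 2 c. The factor K comes from the freedom to take t small. *)
Lemma potential_lower (eps K : R) : GSD P X V phi0 \/ IUC P X V (la 0%N) phi0 ->
  (0 < eps <= 1)%R -> (0 < K)%R -> exists r : R, forall x, (r < enorm x)%R ->
  (K * `|ln (nu x)|)%:E <= sup_ball V eps x.
Proof.
move=> H e01 K0; have /andP[e0 e1] := e01.
have [t0 t00 hs] := survival e0.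
(* The bound 1 / (2 K) turns S t >= |log nu| / 2 into S >= K |log nu|. *)
pose t := Num.min t0 (2 * K)^-1%R.
have K2 : (0 < (2 * K)^-1)%R by rewrite invr_gt0 mulr_gt0.
have tp : (0 < t)%R by rewrite lt_min t00.
have tK : (t <= (2 * K)^-1)%R by rewrite ge_min lexx orbT.
have tt : (0 <= t <= t0)%R by rewrite (ltW tp) ge_min lexx.
have [C C0 hC] := survival_le_kappa H tp e01.
have [B B1 hB] := kappa_bounded d0 HA.
pose c : R := (`|ln C| + ln 2)%R.
have c0 : (0 <= c)%R by rewrite addr_ge0// ln_ge0// ler1n.
have B0 : (0 <= ln B)%R by rewrite ln_ge0.
pose L : R := (2 * c + ln B)%R; have L0 : (0 <= L)%R by rewrite /L; lra.
have [r hr] := confining (K * L)%R.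
exists (Num.max r 1)%R => x; rewrite gt_max => /andP[rx x1].
have Vx := hr x rx; have KL0 : (0 <= K * L)%R by rewrite mulr_ge0// ltW.
have xx : eball x eps x by rewrite /eball/= subrr /enorm dot0l sqrtr0.
have supV z : eball x eps z -> (V z)%:E <= sup_ball V eps x by move=> xz; apply: ereal_sup_ubound; exists z.
have nuE : kappa x = nu x by rewrite /kappa leNgt x1.
have nu0 : (0 < nu x)%R by rewrite -nuE; exact: (kappa_pos HA).
case ES : (sup_ball V eps x) => [S| |]; last 2 first.
- by rewrite leey.
- by have := supV x xx; rewrite ES.
have VS z : eball x eps z -> (V z <= S)%R by move=> /supV; rewrite ES lee_fin.
have SL : (K * L <= S)%R by apply: le_trans Vx (VS x xx).
have S0 : (0 <= S)%R by exact: le_trans SL.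
have [y yx Ty] := hC x.
have := le_trans (hs t x y S tt yx S0 VS) Ty; rewrite lee_fin nuE => h.
have {}h : (- (S * t) - ln 2 <= ln C + ln (nu x))%R.
  have := h; rewrite -ler_ln ?posrE ?mulr_gt0 ?invr_gt0 ?expR_gt0//.
  have -> : ln (2^-1 * expR (- (S * t)))%R = (- ln 2 - S * t)%R.
    by rewrite lnM ?posrE ?invr_gt0 ?expR_gt0// lnV ?posrE// expRK.
  by rewrite (lnM (x := C)) ?posrE//; lra.
rewrite lee_fin.
(* Below the threshold L the confinement of V suffices. Above it the logarithm is negative, because
   L is at least ln B and kappa is at most B. *)
have [small|big] := leP `|ln (nu x)|%R L.
  by apply: le_trans SL; rewrite ler_wpM2l// ltW.
have neg : (ln (nu x) <= 0)%R.
  rewrite leNgt; apply/negP => pos; move: big; rewrite gtr0_norm// ltNge => /negP; apply.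
  apply: (@le_trans _ _ (ln B)); last by rewrite /L; lra.
  by rewrite ler_ln ?posrE//; [rewrite -nuE; exact: hB|lra].
rewrite ler0_norm// in big *.
have Cn := ler_norm (ln C).
have St : (2^-1 * (- ln (nu x)) <= S * t)%R by move: h big; rewrite /L /c; lra.
have St2 : (S * t <= S * (2 * K)^-1)%R by rewrite ler_wpM2l.
have := le_trans St St2; rewrite invfM mulrCA ler_pM2l ?invr_gt0//.
by rewrite ler_pdivlMr// mulrC.
Qed.

End potential_lower_bound.

(** * Fast growing potentials *)

(** Jensen's inequality for the uniform law on [0, s]: integrate the tangent inequality e^(-f) >=
    e^(-m) (1 + m - f), where m is the mean of f. An infinite mean makes the left side 0. *)
Lemma exp_mean_le (R : realType) (f : R -> R) (s : R) : (0 < s)%R ->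
  measurable_fun setT f -> (forall u, (0 <= f u)%R) ->
  (expeR (- \int[@lebesgue_measure R]_(u in `[0%R, s]) (f u / s)%:E) <=
   \int[@lebesgue_measure R]_(u in `[0%R, s]) (expR (- f u) / s)%:E)%E.
Proof.
move=> s0 mf f0; set mu := (@lebesgue_measure R).
have m1 : measurable_fun (`[0%R, s]%classic : set R) (fun u => (f u / s)%:E).
  by apply: measurable_funTS; apply/measurable_EFinP; apply: measurable_funM.
have mexp : measurable_fun setT (fun u => expR (- f u)).
  by apply: (measurableT_comp (@measurable_expR R)); apply: measurableT_comp.
have m2 : measurable_fun (`[0%R, s]%classic : set R) (fun u => (expR (- f u) / s)%:E).
  by apply: measurable_funTS; apply/measurable_EFinP; apply: measurable_funM.
have J0 : (0 <= \int[mu]_(u in `[0%R, s]) (expR (- f u) / s)%:E)%E.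
  by apply: integral_ge0 => u _; rewrite lee_fin divr_ge0 ?expR_ge0// ltW.
have I0 : (0 <= \int[mu]_(u in `[0%R, s]) (f u / s)%:E)%E.
  by apply: integral_ge0 => u _; rewrite lee_fin divr_ge0// ltW.
case EI : (\int[mu]_(u in `[0%R, s]) (f u / s)%:E)%E I0 => [m| |]//= m0; rewrite lee_fin in m0.
have mi : measurable (`[0%R, s]%classic : set R) by exact: measurable_itv.
have em0 : (0 <= expR (- m))%R := expR_ge0 _.
have h : (((expR (- m) * (1 + m) / s) * s)%:E <=
    \int[mu]_(u in `[0%R, s]) ((expR (- f u) / s)%:E + (expR (- m))%:E * (f u / s)%:E))%E.
  rewrite -(integral_itv_cst _ (ltW s0)); apply: ge0_le_integral => //.
  - by move=> u _; rewrite lee_fin divr_ge0 ?(ltW s0)// mulr_ge0// addr_ge0.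
  - by apply: emeasurable_funD => //; apply: emeasurable_funM.
  - move=> u _; rewrite -EFinM -EFinD lee_fin mulrA -mulrDl ler_pM2r ?invr_gt0//.
    have -> : expR (- f u) = (expR (- m) * expR (m - f u))%R by rewrite -expRD addrA addNr add0r.
    by rewrite -mulrDr ler_wpM2l//; have := expR_ge1Dx (m - f u)%R; lra.
move: h; rewrite ge0_integralD//; last 3 first.
- by move=> u _; rewrite lee_fin divr_ge0 ?expR_ge0// ltW.
- by move=> u _; rewrite mule_ge0// lee_fin ?divr_ge0// ltW.
- by apply: emeasurable_funM.
have f0E u : `[0%R, s]%classic u -> (0 <= (f u / s)%:E)%E by rewrite lee_fin divr_ge0// ltW.
rewrite (ge0_integralZl_EFin mu mi f0E m1 em0) EI.
move: J0; case: (\int[mu]_(u in `[0%R, s]) _)%E => [j| |]//=; rewrite ?leey// => j0.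
rewrite divfK ?gt_eqF// -EFinM -EFinD !lee_fin; lra.
Qed.

Section survival_upper_bound.
Local Open Scope ereal_scope.
Context {R : realType} {d : nat}.
Notation rV := 'rV[R]_d.
Notation mu := (@lebesgue_measure R).
Hypothesis d0 : (0 < d)%N.
Context {dO : measure_display} {Omega : measurableType dO}.
Variables (P : probability Omega R) (X : R -> Omega -> 'rV[R]_d).
Hypothesis HX : levy_process P X.
Variable nu : rV -> R.
Hypothesis HA : assumption_A1 P X nu.
Notation kappa := (kappa nu).
Local Opaque fk fk_weight.
Notation fk := (fk P X).
Notation path_of := (path_of X).
Implicit Types (x y : rV) (w : Omega).

Let kE : rV -> \bar R := EFin \o kappa.
Let pk := potential_kappa HA.
Let mk : measurable_fun setT kE := measurable_potential pk.
Let k0 y : 0 <= kE y := potential_ge0 y pk.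

Variables a b : rV -> R.
Hypothesis (pa : potential a) (pb : potential b) (vb : vanishing_occupation P X b).
Hypothesis grow : forall K : R, exists r : R, forall y, (r < enorm y)%R ->
  (K * (1 + `|ln (nu y)|) <= a y - b y)%R.

Lemma fk_le_gain (f : rV -> \bar R) (t : R) x : measurable_fun setT f -> (forall y, 0 <= f y) ->
  (0 <= t)%R -> fk a b f t x <= fk (cst 0%R) b f t x.
Proof.
move=> mf f0 t0; rewrite !fkE; apply: ge0_le_integral => //.
- by move=> w _; rewrite mule_ge0// fk_weight_ge0.
- by apply: (@measurable_fk_integrand _ _ _ _ _ _ HX a b f _ _ (cst x) (cst t) id).
- by apply: (@measurable_fk_integrand _ _ _ _ _ _ HX (cst 0%R) b f _ _ (cst x) (cst t) id).
- move=> w _; apply: lee_wpmul2r => //; apply: (fk_weight_le HX) => //.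
  by move=> y; exact: (proj2 pa).
Qed.

Lemma fk_mass_bounded (t : R) : (0 <= t)%R -> exists2 C : R, (1 <= C)%R &
  forall s x, (0 <= s <= t)%R -> fk a b (cst 1) s x <= C%:E.
Proof.
move=> t0; have [C C1 hC] := khasminskii HX pb (vanishing_small vb) t0; exists C; first exact: C1.
move=> s x st; apply: le_trans (hC s x st); apply: fk_le_gain; [exact: measurable_cst|by move=> y; exact: lee01|by case/andP: st].
Qed.

(* Outside a ball the potential exceeds f / s, f = ln (K0 / kappa), and by Jensen's
   inequality exp (- s^(-1) \int f) is at most the time average of kappa / K0. *)
Lemma mass_le_kappa (s : R) : (0 < s)%R -> exists2 C : R, (0 < C)%R &
  forall x, fk a b (cst 1) s x <= (C * kappa x)%:E.
Proof.
move=> s0; have s0' := ltW s0.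
have [K0 K01 kK] := kappa_bounded d0 HA; have K00 : (0 < K0)%R by lra.
have kp := kappa_pos HA.
have lK0 : (0 <= ln K0)%R by rewrite ln_ge0.
pose f y : R := (ln K0 - ln (kappa y))%R.
have f0 y : (0 <= f y)%R by rewrite subr_ge0 ler_ln ?posrE.
have fe y : expR (- f y) = (kappa y / K0)%R.
  by rewrite /f opprB expRD expRN !lnK ?posrE.
have mf : measurable_fun setT f.
  apply: measurable_funB => //; apply: (measurableT_comp (@measurable_ln R)).
  exact: (measurable_kappa HA).
(* The amount by which a - b falls short of f / s. The growth condition confines it to a ball, where
   f is bounded, so that W is at most a constant plus b. *)
pose W y : R := (Num.max (f y / s + b y - a y) 0)%R.
have [mb b0] := pb; have [ma a0] := pa.
have pW : potential W.
  split; last by move=> y; rewrite le_max lexx orbT.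
  by apply: measurable_maxr => //; apply: measurable_funB => //; apply: measurable_funD => //; apply: measurable_funM.
have [r hr] := grow (s^-1 * (1 + ln K0))%R.
pose r1 : R := Num.max r 1%R.
have Wr y : (0 < W y)%R -> (enorm y <= r1)%R.
  rewrite /W lt_max ltxx orbF => h; rewrite leNgt gt_max; apply/negP => /andP[/hr h2 y1].
  have : (f y / s <= s^-1 * (1 + ln K0) * (1 + `|ln (nu y)|))%R.
    have -> : f y = (ln K0 - ln (nu y))%R by rewrite /f /kappa leNgt y1.
    rewrite mulrC -mulrA ler_wpM2l ?invr_ge0//.
    have := ler_norm (- ln (nu y))%R; rewrite normrN => h3.
    have : (0 <= ln K0 * `|ln (nu y)|)%R by rewrite mulr_ge0.
    by move: h3; move: `|ln (nu y)|%R (ln K0) => p q; rewrite mulrDl !mulrDr; lra.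
  by move: h h2; lra.
have [c c0 hc] := kappa_ball d0 HA r1.
pose N : R := ((ln K0 + `|ln c|) / s)%R.
have N0 : (0 <= N)%R by rewrite divr_ge0// addr_ge0.
have WN y : (W y <= (cst N \+ b) y)%R.
  have [W0|W0] := leP (W y) 0%R; first by apply: (le_trans W0); rewrite addr_ge0.
  have yr := Wr y W0; rewrite /W ge_max/= [X in _ && X]addr_ge0// andbT.
  have : (f y / s <= N)%R.
    rewrite ler_wpM2r ?invr_ge0// /f lerD2l.
    have : (ln c <= ln (kappa y))%R by rewrite ler_ln ?posrE//; exact: hc.
    by have := ler_norm (- ln c)%R; rewrite normrN; lra.
  by have := a0 y; lra.
have vW : vanishing_occupation P X W.
  apply: (vanishing_le HX pW (potentialD (a := cst N) _ pb) WN); first by split.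
  by apply: (vanishingD HX _ pb _ vb); [split|exact: vanishing_cst].
have [C1 C10 hC1] := gain_le d0 HX HA pW vW Wr s0'.
have [C2 C21 hC2] := khasminskii HX pW (vanishing_small vW) s0'.
have [be be1 st] := kappa_stable d0 HX HA s.
have C20 : (0 < C2)%R by lra.
pose e : R := (K0^-1 / s)%R; have e0 : (0 < e)%R by rewrite !divr_gt0 ?invr_gt0.
pose C : R := (C2 * e * (be + C1 * K0) * s)%R.
have C0 : (0 < C)%R.
  have h : (0 <= C1 * K0)%R by rewrite mulr_ge0// ltW.
  have h1 : (0 < be + C1 * K0)%R by lra.
  by apply: mulr_gt0 => //; apply: mulr_gt0 => //; apply: mulr_gt0.
exists C => // x.
pose F : rV -> \bar R := fun y => (e * kappa y)%:E.
have mek : measurable_fun setT (fun y => e * kappa y)%R.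
  by apply: measurable_funM => //; exact: (measurable_kappa HA).
have mF : measurable_fun setT F by exact/measurable_EFinP.
have F0 y : 0 <= F y by rewrite lee_fin mulr_ge0 ?(ltW e0)// ltW.
(* Up to the factor e^(int W), the weight is at most e^(- int f / s), to which Jensen's inequality
   applies. The factor e^(int W) is then cut at time u, which gives a Duhamel integrand with kappa
   inserted at u. *)
have path w : fk_weight a b x s (path_of w) * cst 1 (x + X s w)%R <=
    \int[mu]_(u in `[0%R, s]) duhamel_integrand X (cst 0%R) W (cst 0%R) W F (cst 1) s x u w.
  have -> : \int[mu]_(u in `[0%R, s]) duhamel_integrand X (cst 0%R) W (cst 0%R) W F (cst 1) s x u w =
      expeR (\int[mu]_(u in `[0%R, s]) (W (x + X u w)%R)%:E) * \int[mu]_(u in `[0%R, s]) F (x + X u w)%R.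
    rewrite -ge0_integralZl//; last 2 first.
    - have := measurable_funTS (D := `[0%R, s]%classic) (measurableT_comp (@EFin_measurable R setT) (measurable_potential_path X x w mek)).
      apply: eq_measurable_fun => u; rewrite inE/= in_itv/= => /andP[u0 _].
      by rewrite regularizeE//; exact: (right_cont_sample HX).
    - exact: expeR_ge0.
    apply: eq_integral => u; rewrite inE/= in_itv/= => /andP[u0 us].
    rewrite /duhamel_integrand mule1 muleAC; congr (_ * _).
    have su0 : (0 <= s - u)%R by rewrite subr_ge0.
    rewrite -(fk_weightD HX x w potential0 pW u0 su0) addrCA subrr addr0.
    by rewrite fk_weightE integral0 oppe0 expeR0 mul1e.
  rewrite mule1 fk_weightE.
  (* A bounded path meets only values of kappa above a positive constant, so the integral of f along
     it is finite and the exponents can be compared. *)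
  have [M hM] := path_bounded HX w s.
  have [c' c'0 hc'] := kappa_ball d0 HA (enorm x + M)%R.
  have fin : \int[mu]_(u in `[0%R, s]) (f (x + X u w)%R / s)%:E < +oo.
    apply: le_lt_trans (ltry (((ln K0 - ln c') / s) * s)); rewrite -(integral_itv_cst _ s0').
    have mfp : measurable_fun setT (fun u => f (x + regularize (sample X w) u)%R) by exact: measurable_potential_path.
    rewrite (@eq_potential_path _ _ _ _ _ _ HX (fun y => f y / s)%R).
    apply: ge0_le_integral; [exact: measurable_itv| | |exact: measurable_cst|].
    - by move=> u _; rewrite lee_fin divr_ge0.
    - by apply: measurable_funTS; apply/measurable_EFinP; apply: measurable_funM.
    - move=> u; rewrite /= in_itv/= => us; have /andP[u0 _] := us.
      rewrite regularizeE//; last exact: (right_cont_sample HX).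
      rewrite lee_fin ler_wpM2r ?invr_ge0// /f lerB// ler_ln ?posrE//; apply: hc'.
      by apply: (le_trans (enormD _ _)); rewrite lerD2l; exact: hM.
  have pfs : potential (fun y => f y / s)%R.
    by split; [apply: measurable_funM|move=> y; rewrite divr_ge0].
  have ge0p V : potential V -> 0 <= \int[mu]_(u in `[0%R, s]) (V (x + X u w)%R)%:E.
    by move=> pV; apply: integral_ge0 => u _; rewrite lee_fin; exact: (proj2 pV).
  have fnum : \int[mu]_(u in `[0%R, s]) (f (x + X u w)%R / s)%:E \is a fin_num.
    by rewrite ge0_fin_numE// (ge0p _ pfs).
  have := @expeR_mul_le R (fine (\int[mu]_(u in `[0%R, s]) (f (x + X u w)%R / s)%:E)) _ _ _ (ge0p _ pa) (ge0p _ pb) (ge0p _ pW).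
  rewrite fineK// => /(_ _)/le_trans; apply.
    have fbW y : (((fun y => f y / s) \+ b) y <= (a \+ W) y)%R.
      have : (f y / s + b y - a y <= W y)%R by rewrite /W le_max lexx.
      by rewrite /=; lra.
    have := path_integral_le HX x w s (potentialD pfs pb) (potentialD pa pW) fbW.
    by rewrite !(path_integralD HX).
  rewrite muleC; apply: lee_wpmul2l; first exact: expeR_ge0.
  have -> : (expR (- fine (\int[mu]_(u in `[0%R, s]) (f (x + X u w)%R / s)%:E)))%:E =
    expeR (- \int[mu]_(u in `[0%R, s]) (f (x + X u w)%R / s)%:E) by rewrite -{2}(fineK fnum).
  rewrite (@eq_potential_path _ _ _ _ _ _ HX (fun y => f y / s)%R).
  apply: (le_trans (exp_mean_le s0 (measurable_potential_path X x w mf) _)); first by move=> u; exact: f0.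
  rewrite le_eqVlt; apply/orP; left; apply/eqP; apply: eq_integral => u; rewrite inE/= in_itv/= => /andP[u0 _].
  rewrite regularizeE//; last exact: (right_cont_sample HX).
  rewrite /F fe -[sample X w u]/(X u w); congr (_%:E); rewrite /e; ring.
rewrite fkE.
apply: (@le_trans _ _ (\int[P]_w \int[mu]_(u in `[0%R, s]) duhamel_integrand X (cst 0%R) W (cst 0%R) W F (cst 1) s x u w)).
  apply: ge0_le_integral => //.
  - by move=> w _; rewrite mule1 fk_weight_ge0.
  - by apply: (@measurable_fk_integrand _ _ _ _ _ _ HX a b (cst 1) _ _ (cst x) (cst s) id).
  - have mD := measurable_duhamel_integrand HX x potential0 pW potential0 pW mF (measurable_cst (1 : \bar R)) s0'.
    have mI := measurable_integral_itv (measurableT_comp mD (@measurable_swap _ _ Omega R)).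
    have := measurableT_comp (mI (fun z => duhamel_integrand_ge0 X _ _ _ _ s x _ _ F0 (fun=> lee01))) (pair1_measurable s).
    apply: eq_measurable_fun => w _ /=; apply: eq_integral => u; rewrite inE/= in_itv/= => us.
    by rewrite clampE.
rewrite (integral_duhamel HX x potential0 pW potential0 pW mF (measurable_cst _) F0 (fun=> lee01) s0').
rewrite /C -mulrA (mulrC s) mulrA -(integral_itv_cst _ s0').
have m1 : measurable_fun [set: rV] (cst (1 : \bar R)) by exact: measurable_cst.
have C2e0 : (0 <= C2 * e)%R by rewrite mulr_ge0 ?(ltW C20) ?(ltW e0).
have mCk : measurable_fun setT (fun y => (C2 * e)%:E * kE y).
  by apply: emeasurable_funM; [exact: measurable_cst|exact: mk].
apply: ge0_le_integral; [exact: measurable_itv| | |exact: measurable_cst|].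
- by move=> u _; apply: fk_ge0 => y; apply: mule_ge0; [exact: F0|exact: fk_ge0].
- by apply: (measurable_fk_mid_itv HX (F := F)) => //.
- move=> u; rewrite /= in_itv/= => us; have /andP[u0 us'] := us.
  have su0 : (0 <= s - u)%R by rewrite subr_ge0.
  (* After time u the mass is at most C2; before it, [gain_le] and [kappa_stable] keep the evolved
     kappa below a multiple of kappa. *)
  apply: (@le_trans _ _ (fk (cst 0%R) W (fun y => (C2 * e)%:E * kE y) u x)).
    apply: (@fk_le _ _ _ _ _ _ HX _ _ _ _ _ _ potential0 pW u0 _ mCk).
    + by apply: emeasurable_funM => //; exact: (measurable_fkx HX potential0 pW m1 (fun=> lee01) su0).
    + by move=> y; apply: mule_ge0; [exact: F0|exact: fk_ge0].
    + move=> y; have -> : (C2 * e)%:E * kE y = F y * C2%:E.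
        by rewrite /F /kE /= -!EFinM; congr (_%:E); ring.
      by apply: lee_wpmul2l; [exact: F0|apply: hC2; rewrite su0 gerBl].
  rewrite (@fkZl _ _ _ _ _ _ HX _ _ kE u x _ potential0 pW u0 mk k0 C2e0).
  have -> : (C2 * e * (be + C1 * K0) * kappa x = C2 * e * (be * kappa x + C1 * K0 * kappa x))%R by ring.
  rewrite (EFinM (C2 * e)%R); apply: lee_wpmul2l; first by rewrite lee_fin.
  have kK' y : kE y <= K0%:E by rewrite lee_fin.
  apply: (le_trans (hC1 kE K0 u x mk k0 (ltW K00) kK' us)); rewrite EFinD; apply: leeD; last exact: lexx.
  by have /andP[] := st u x us.
Qed.

(** Write 2 s = u + s + (s - u): the last period costs a bounded factor, the middle one yields
    kappa, and the first one evolves it. *)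
Lemma mass_le_evolved_kappa (s : R) : (0 < s)%R -> exists2 C : R, (0 < C)%R &
  forall u x, (0 <= u <= s)%R -> fk a b (cst 1) (s + s)%R x <= C%:E * fk a b kE u x.
Proof.
move=> s0; have s0' := ltW s0.
have [C1 C10 hC1] := mass_le_kappa s0; have [C2 C21 hC2] := fk_mass_bounded s0'.
have C20 : (0 <= C2)%R by lra.
exists (C2 * C1)%R => [|u x us]; first by rewrite mulr_gt0//; lra.
have /andP[u0 us'] := us.
have m1 : measurable_fun [set: rV] (cst (1 : \bar R)) by exact: measurable_cst.
have su0 : (0 <= s - u)%R by rewrite subr_ge0.
have ssu0 : (0 <= s + (s - u))%R by rewrite addr_ge0.
have -> : (s + s = u + (s + (s - u)))%R by lra.
rewrite (@fk_semigroup _ _ _ _ _ _ HX a b (cst 1) u (s + (s - u))%R x pa pb m1 (fun=> lee01) u0 ssu0).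
have C0 : (0 <= C2 * C1)%R by rewrite mulr_ge0// ltW.
rewrite -(@fkZl _ _ _ _ _ _ HX a b kE u x _ pa pb u0 mk k0 C0).
apply: (@fk_le _ _ _ _ _ _ HX a b _ _ _ _ pa pb u0).
- exact: (measurable_fkx HX pa pb m1 (fun=> lee01) ssu0).
- by apply: emeasurable_funM; [exact: measurable_cst|exact: mk].
- by move=> y; exact: fk_ge0.
- move=> y; rewrite (@fk_semigroup _ _ _ _ _ _ HX a b (cst 1) s (s - u)%R y pa pb m1 (fun=> lee01) s0' su0).
  have mf := measurable_fkx HX pa pb m1 (fun=> lee01) su0.
  apply: (@le_trans _ _ (C2%:E * fk a b (cst 1) s y)).
    apply: (@fk_cst_le _ _ _ _ _ _ HX a b C2 _ s y pa pb s0' mf _ C20).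
      by move=> z; exact: fk_ge0.
    by move=> z; apply: hC2; rewrite su0 gerBl.
  by rewrite EFinM -muleA; apply: lee_wpmul2l; [rewrite lee_fin|exact: hC1].
Qed.

End survival_upper_bound.

(** * Dynkin's formula for the killed semigroup *)

Section killed_dynkin_formula.
Local Open Scope ereal_scope.
Context {R : realType} {d : nat}.
Notation rV := 'rV[R]_d.
Notation mu := (@lebesgue_measure R).
Context {dO : measure_display} {Omega : measurableType dO}.
Variables (P : probability Omega R) (X : R -> Omega -> 'rV[R]_d).
Hypothesis HX : levy_process P X.
Local Opaque fk fk_weight.
Notation fk := (fk P X).
Notation Q := (fk (cst 0%R) (cst 0%R)).
Implicit Types (x y : rV) (w : Omega) (a b c chi F h : rV -> R) (f g : rV -> \bar R) (s t r q : R).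

(** A Duhamel formula integrated over [0, t]: after interchanging the times, the inner integral is
    the full time integral restarted at r. The term A is left abstract so that formulas for gain and
    for loss are both covered. *)
Lemma time_duhamel a1 b1 a2 b2 c g (A : R -> \bar R) t x :
  potential a1 -> potential b1 -> potential a2 -> potential b2 -> potential c ->
  measurable_fun setT g -> (forall y, 0 <= g y) ->
  measurable_fun `[0%R, t] A -> (forall s, (0 <= s <= t)%R -> 0 <= A s) ->
  (forall s, (0 <= s <= t)%R -> fk a2 b2 g s x = A s + \int[mu]_(r in `[0%R, s])
     fk a1 b1 (fun y => (c y)%:E * fk a2 b2 g (s - r)%R y) r x) ->
  \int[mu]_(s in `[0%R, t]) fk a2 b2 g s x = \int[mu]_(s in `[0%R, t]) A s +
  \int[mu]_(r in `[0%R, t]) fk a1 b1 (fun y => (c y)%:E * \int[mu]_(q in `[0%R, (t - r)%R]) fk a2 b2 g q y) r x.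
Proof.
move=> pa1 pb1 pa2 pb2 pc mg g0 mA A0 eqA; have mc := measurable_potential pc.
have c0 y : 0 <= (EFin \o c) y := potential_ge0 y pc.
pose H (z : R * R) := fk a1 b1 (fun y => (EFin \o c) y * fk a2 b2 g (Num.max (z.2 - z.1) 0)%R y) (Num.max z.1 0)%R x.
have mH : measurable_fun setT H.
  have m := @measurable_fk_mid _ _ _ _ _ _ HX a1 b1 a2 b2 (EFin \o c) g x pa1 pb1 pa2 pb2 mc mg c0 g0.
  apply: (measurableT_comp m (g := fun z : R * R => (z.1, (z.2 - z.1)%R))).
  apply: measurable_fun_pair; first exact: measurable_fst.
  by apply: measurable_funB; [exact: measurable_snd|exact: measurable_fst].
have H0 z : 0 <= H z by apply: fk_ge0 => y; apply: mule_ge0; [exact: c0|exact: fk_ge0].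
have HE s r : (0 <= r)%R -> (r <= s)%R -> H (r, s) = fk a1 b1 (fun y => (c y)%:E * fk a2 b2 g (s - r)%R y) r x.
  by move=> r0 rs; rewrite /H/= (max_l r0) max_l// subr_ge0.
have mi s : measurable (`[0%R, s]%classic : set R) by exact: measurable_itv.
have mHs : measurable_fun `[0%R, t] (fun s => \int[mu]_(r in `[0%R, s]) H (r, s)).
  have := measurable_integral_itv (measurableT_comp mH (@measurable_swap _ _ R R)) (fun z => H0 _).
  move=> /measurableT_comp/(_ (measurable_fun_pair (@measurable_id _ R setT) (@measurable_id _ R setT))).
  by move=> m; exact: measurable_funTS m.
transitivity (\int[mu]_(s in `[0%R, t]) (A s + \int[mu]_(r in `[0%R, s]) H (r, s))).
  apply: eq_integral => s; rewrite inE/= in_itv/= => st; rewrite (eqA s st); apply: (congr2 adde (erefl _)).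
  by apply: eq_integral => r; rewrite inE/= in_itv/= => /andP[r0 rs]; rewrite HE.
rewrite ge0_integralD; [|exact: mi| |exact: mA| |exact: mHs]; last 2 first.
- by move=> s; rewrite /= in_itv/=; exact: A0.
- by move=> s _; apply: integral_ge0 => r _; exact: H0.
apply: (congr2 adde (erefl _)); rewrite (ge0_integral_triangle t mH H0).
apply: eq_integral => r; rewrite inE/= in_itv/= => /andP[r0 rt].
pose g' (z : R * rV) := (c z.2)%:E * fk a2 b2 g (Num.max z.1 0)%R z.2.
have mg' : measurable_fun setT g'.
  apply: emeasurable_funM; first exact: (measurableT_comp mc measurable_snd).
  apply: (@measurable_fk _ _ _ _ _ _ HX a2 b2 g _ (R * rV)%type snd (fun z => Num.max z.1 0)%R) => //.
    by apply: measurable_maxr => //; exact: measurable_fst.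
  by move=> z; rewrite le_max lexx orbT.
have g'0 z : 0 <= g' z by apply: mule_ge0; [exact: c0|exact: fk_ge0].
transitivity (\int[mu]_(q in `[0%R, (t - r)%R]) fk a1 b1 (fun y => g' (q, y)) r x).
  apply: eq_integral => q; rewrite inE/= in_itv/= => /andP[q0 _].
  have rq : (r <= r + q)%R by rewrite lerDl.
  have rqE : (r + q - r = q)%R by rewrite addrAC subrr add0r.
  by rewrite (HE _ _ r0 rq); apply: eq_fk => y; rewrite rqE /g' /= (max_l q0).
rewrite -(fk_integral HX (t - r)%R x pa1 pb1 mg' g'0 r0); apply: eq_fk => y.
transitivity (\int[mu]_(q in `[0%R, (t - r)%R]) ((c y)%:E * fk a2 b2 g q y)).
  by apply: eq_integral => q; rewrite inE/= in_itv/= => /andP[q0 _]; rewrite /g' /= max_l.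
have mq : measurable_fun `[0%R, (t - r)%R] (fun q => fk a2 b2 g q y) by exact: measurable_fks_itv.
by rewrite (ge0_integralZl_EFin mu (mi _) (fun q _ => fk_ge0 P X _ _ q y g0) mq (proj2 pc y)).
Qed.

Lemma measurable_time_duhamel a1 b1 a2 b2 c g t x :
  potential a1 -> potential b1 -> potential a2 -> potential b2 -> potential c ->
  measurable_fun setT g -> (forall y, 0 <= g y) ->
  measurable_fun `[0%R, t] (fun r =>
    fk a1 b1 (fun y => (c y)%:E * \int[mu]_(q in `[0%R, (t - r)%R]) fk a2 b2 g q y) r x).
Proof.
move=> pa1 pb1 pa2 pb2 pc mg g0.
have m3 : measurable_fun setT (fun z : R * (R * rV) => fk a2 b2 g (Num.max z.1 0)%R z.2.2).
  apply: (@measurable_fk _ _ _ _ _ _ HX _ _ g _ (R * (R * rV))%type (fun z => z.2.2) (fun z => Num.max z.1 0)%R) => //.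
  - by apply: (measurableT_comp measurable_snd measurable_snd).
  - by apply: measurable_maxr => //; exact: measurable_fst.
  - by move=> z; rewrite le_max lexx orbT.
have m4 : measurable_fun setT (fun z : R * (R * rV) => \int[mu]_(q in `[0%R, z.1]) fk a2 b2 g (Num.max q 0)%R z.2.2).
  apply: (measurable_integral_itv (h := fun z : (R * rV) * R => fk a2 b2 g (Num.max z.2 0)%R z.1.2)).
    exact: (measurableT_comp m3 (@measurable_swap _ _ (R * rV)%type R)).
  by move=> z; exact: fk_ge0.
have m5 : measurable_fun setT (fun z : R * rV => (c z.2)%:E * \int[mu]_(q in `[0%R, (t - z.1)%R]) fk a2 b2 g (Num.max q 0)%R z.2).
  apply: emeasurable_funM; first exact: (measurableT_comp (measurable_potential pc) measurable_snd).
  apply: (measurableT_comp m4 (g := fun z : R * rV => ((t - z.1)%R, z))).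
  apply: measurable_fun_pair => //; apply: measurable_funB => //; exact: measurable_fst.
have m6 := @measurable_fk_param _ _ _ _ _ _ HX a1 b1 _ R _ (fun r => Num.max r 0)%R x pa1 pb1 m5.
have h1 (z : R * rV) : 0 <= (c z.2)%:E * \int[mu]_(q in `[0%R, (t - z.1)%R]) fk a2 b2 g (Num.max q 0%R) z.2.
  by apply: mule_ge0; [rewrite lee_fin; exact: (proj2 pc)|apply: integral_ge0 => q _; exact: fk_ge0].
have h2 : measurable_fun setT (fun q : R => Num.max q 0%R) by apply: measurable_maxr.
have h3 (z : R) : (0 <= Num.max z 0)%R by rewrite le_max lexx orbT.
have := measurable_funTS (D := `[0%R, t]%classic) (m6 h1 h2 h3).
apply: eq_measurable_fun => r; rewrite inE/= in_itv/= => /andP[r0 _]; rewrite (max_l r0).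
apply: eq_fk => y; apply: (congr2 mule (erefl _)).
by apply: eq_integral => q; rewrite inE/= in_itv/= => /andP[q0 _]; rewrite max_l.
Qed.

Definition path_integrable a := forall t x, (0 <= t)%R ->
  {ae P, forall w, \int[mu]_(u in `[0%R, t]) (a (x + X u w)%R)%:E < +oo}.

Lemma fk_cancel a b f t x : potential a -> potential b -> path_integrable b ->
  measurable_fun setT f -> (0 <= t)%R -> fk (a \+ b)%R b f t x = fk a (cst 0%R) f t x.
Proof.
move=> pa pb bfin mf t0; rewrite !fkE; apply: ae_eq_integral => //.
- by apply: (@measurable_fk_integrand _ _ _ _ _ _ HX (a \+ b)%R b f _ _ (cst x) (cst t) id) => //; exact: potentialD.
- by apply: (@measurable_fk_integrand _ _ _ _ _ _ HX a (cst 0%R) f _ _ (cst x) (cst t) id).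
- have := bfin t x t0; apply: filterS => w fin _; congr (_ * _).
  rewrite (fk_weight_addl HX b x t w pa pb) !fk_weightE integral0 expeR0 mule1 -muleA -expeRD subee ?expeR0 ?mule1//.
  by rewrite ge0_fin_numE//; apply: integral_ge0 => u _; rewrite lee_fin; exact: (proj2 pb).
Qed.

Lemma duhamel_gain_ae a b f t x : potential a -> potential b -> path_integrable b ->
  measurable_fun setT f -> (forall y, 0 <= f y) -> (0 <= t)%R ->
  fk a b f t x = fk a (cst 0%R) f t x + \int[mu]_(r in `[0%R, t])
    fk a (cst 0%R) (fun y => (b y)%:E * fk a b f (t - r)%R y) r x.
Proof.
move=> pa pb bfin mf f0 t0.
rewrite (@duhamel _ _ _ _ _ _ HX a b b f t x pa pb pb mf f0 t0 (bfin t x t0)) (@fk_cancel a b f t x pa pb bfin mf t0).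
apply: (congr2 adde (erefl _)); apply: eq_integral => r; rewrite inE/= in_itv/= => /andP[r0 rt].
apply: (fk_cancel _ pa pb bfin _ r0); apply: emeasurable_funM; first exact: measurable_potential.
by apply: (measurable_fkx HX pa pb mf f0); rewrite subr_ge0.
Qed.

Lemma duhamel_loss a f t x : potential a -> path_integrable a ->
  measurable_fun setT f -> (forall y, 0 <= f y) -> (0 <= t)%R ->
  Q f t x = fk a (cst 0%R) f t x + \int[mu]_(r in `[0%R, t])
    fk a (cst 0%R) (fun y => (a y)%:E * Q f (t - r)%R y) r x.
Proof.
move=> pa afin mf f0 t0.
have E : (cst 0%R \+ a = a)%R by apply/funext => y /=; rewrite add0r.
have := @duhamel _ _ _ _ _ _ HX (cst 0%R) (cst 0%R) a f t x potential0 potential0 pa mf f0 t0 (afin t x t0).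
by rewrite E.
Qed.

Section killed.
Variables a : rV -> R.
Hypothesis (pa : potential a) (afin : path_integrable a).
Notation Ta := (fk a (cst 0%R)).

Let mTa g t x : measurable_fun setT g -> (forall y, 0 <= g y) ->
  measurable_fun `[0%R, t] (fun s => Ta g s x).
Proof. by move=> mg g0; apply: (measurable_fks_itv HX). Qed.

Let time_loss g t x : measurable_fun setT g -> (forall y, 0 <= g y) ->
  \int[mu]_(s in `[0%R, t]) Q g s x = \int[mu]_(s in `[0%R, t]) Ta g s x +
  \int[mu]_(r in `[0%R, t]) Ta (fun y => (a y)%:E * \int[mu]_(q in `[0%R, (t - r)%R]) Q g q y) r x.
Proof.
move=> mg g0; apply: time_duhamel => //.
- exact: mTa.
- by move=> s _; exact: fk_ge0.
- by move=> s /andP[s0 _]; exact: duhamel_loss.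
Qed.

(** Formally chi(x) + int Ta_s F ds = Ta_t chi + int Ta_s (a chi) ds, and chi(x) >= 0 is dropped.
    Since F may change sign, h is added so that only nonnegative functions are integrated; the
    formula follows from the free one by expanding each free term in killed ones. *)
Lemma killed_dynkin chi F h t x : dyn P X chi F -> potential chi -> potential h -> bounded_mf h ->
  (forall y, (0 <= F y + h y)%R) -> (0 <= t)%R ->
  \int[mu]_(s in `[0%R, t]) Ta (EFin \o (F \+ h)%R) s x <=
  Ta (EFin \o chi) t x + \int[mu]_(s in `[0%R, t]) Ta (EFin \o h) s x +
  \int[mu]_(s in `[0%R, t]) Ta (fun y => (a y)%:E * (chi y)%:E) s x.
Proof.
move=> [bchi bF dE] pchi ph bh Fh0 t0.
have bFh := bounded_mfD bF bh.
have pFh : potential (F \+ h)%R by split; [case: bFh|exact: Fh0].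
have mFh := measurable_potential pFh; have mh := measurable_potential ph; have mchi := measurable_potential pchi.
have Fh0E y : 0 <= (EFin \o (F \+ h)%R) y := potential_ge0 y pFh.
have h0E y : 0 <= (EFin \o h) y := potential_ge0 y ph.
have chi0E y : 0 <= (EFin \o chi) y := potential_ge0 y pchi.
have a0E y : 0 <= (a y)%:E := potential_ge0 y pa.
have maE : measurable_fun setT (EFin \o a) := measurable_potential pa.
have dynF s y : (0 <= s)%R -> (chi y)%:E + \int[mu]_(q in `[0%R, s]) Q (EFin \o (F \+ h)%R) q y =
    Q (EFin \o chi) s y + \int[mu]_(q in `[0%R, s]) Q (EFin \o h) q y.
  move=> s0; rewrite [Q (EFin \o chi) s y]fk00 -[X in _ = X + _]/(ex P X chi s y) (dE s y s0) -addeA; apply: (congr2 adde (erefl _)).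
  rewrite -integralD; [|exact: measurable_itv|exact: (integrable_ex HX)|]; last first.
    apply: eq_integrable (integrable_ex HX y bh s0); first exact: measurable_itv.
    by move=> q _; rewrite fk00.
  apply: eq_integral => q; rewrite inE/= in_itv/= => /andP[q0 _].
  by rewrite !fk00 -[LHS]/(ex P X (F \+ h)%R q y) (exD HX).
have mI g s0 : measurable_fun setT g -> (forall y, 0 <= g y) ->
    measurable_fun setT (fun y => \int[mu]_(q in `[0%R, s0]) Q g q y).
  move=> mg g0.
  have m : measurable_fun setT (fun z : rV * R => Q g (Num.max z.2 0)%R z.1).
    apply: (@measurable_fk _ _ _ _ _ _ HX _ _ g _ (rV * R)%type fst (fun z => Num.max z.2 0)%R) => //.
      by apply: measurable_maxr => //; exact: measurable_snd.
    by move=> z; rewrite le_max lexx orbT.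
  have := measurableT_comp (measurable_integral_itv m (fun z => fk_ge0 P X _ _ _ _ g0)) (pair1_measurable s0).
  apply: eq_measurable_fun => y _ /=; apply: eq_integral => q; rewrite inE/= in_itv/= => /andP[q0 _].
  by rewrite max_l.
have I0 g s0 y : (forall y, 0 <= g y) -> 0 <= \int[mu]_(q in `[0%R, s0]) Q g q y.
  by move=> g0; apply: integral_ge0 => q _; exact: fk_ge0.
have mi : measurable (`[0%R, t]%classic : set R) by exact: measurable_itv.
pose J g := \int[mu]_(r in `[0%R, t]) Ta (fun y => (a y)%:E * \int[mu]_(q in `[0%R, (t - r)%R]) Q g q y) r x.
pose J1 := \int[mu]_(r in `[0%R, t]) Ta (fun y => (a y)%:E * Q (EFin \o chi) (t - r)%R y) r x.
have J0 g : (forall y, 0 <= g y) -> 0 <= J g.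
  move=> g0; apply: integral_ge0 => r _; apply: fk_ge0 => y; apply: mule_ge0; first exact: a0E.
  exact: I0.
(* The free Dynkin formula on the remaining time t - r, started where the path is killed and
   integrated against the killing rate. *)
have E4 : \int[mu]_(s in `[0%R, t]) Ta (fun y => (a y)%:E * (chi y)%:E) s x + J (EFin \o (F \+ h)%R) = J1 + J (EFin \o h).
  have mJ g : measurable_fun setT g -> (forall y, 0 <= g y) ->
      measurable_fun `[0%R, t] (fun r => Ta (fun y => (a y)%:E * \int[mu]_(q in `[0%R, (t - r)%R]) Q g q y) r x).
    by move=> mg g0; apply: measurable_time_duhamel.
  have ach0 y : 0 <= (a y)%:E * (chi y)%:E by apply: mule_ge0; [exact: a0E|exact: chi0E].
  have mach : measurable_fun setT (fun y => (a y)%:E * (chi y)%:E) by exact: emeasurable_funM.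
  have aI0 g r y : (forall y, 0 <= g y) -> 0 <= (a y)%:E * \int[mu]_(q in `[0%R, (t - r)%R]) Q g q y.
    by move=> g0; apply: mule_ge0; [exact: a0E|exact: I0].
  have maI g r : measurable_fun setT g -> (forall y, 0 <= g y) ->
      measurable_fun setT (fun y => (a y)%:E * \int[mu]_(q in `[0%R, (t - r)%R]) Q g q y).
    by move=> mg g0; apply: emeasurable_funM; [exact: maE|exact: mI].
  have aQ0 r y : 0 <= (a y)%:E * Q (EFin \o chi) (t - r)%R y by apply: mule_ge0; [exact: a0E|exact: fk_ge0].
  have mJ1 : measurable_fun `[0%R, t] (fun r => Ta (fun y => (a y)%:E * Q (EFin \o chi) (t - r)%R y) r x).
    by apply: (measurable_fk_mid_itv HX (F := EFin \o a)).
  rewrite /J /J1.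
  rewrite -(ge0_integralD mu mi (fun r _ => fk_ge0 P X _ _ _ _ ach0) (@mTa _ t x mach ach0)
    (fun r _ => fk_ge0 P X _ _ _ _ (fun y => aI0 _ r y Fh0E)) (mJ _ mFh Fh0E)).
  rewrite -(ge0_integralD mu mi (fun r _ => fk_ge0 P X _ _ _ _ (fun y => aQ0 r y)) mJ1
    (fun r _ => fk_ge0 P X _ _ _ _ (fun y => aI0 _ r y h0E)) (mJ _ mh h0E)).
  apply: eq_integral => r; rewrite inE/= in_itv/= => /andP[r0 rt].
  have tr0 : (0 <= t - r)%R by rewrite subr_ge0.
  have maQ : measurable_fun setT (fun y => (a y)%:E * Q (EFin \o chi) (t - r)%R y).
    by apply: emeasurable_funM; [exact: maE|exact: (measurable_fkx HX potential0 potential0 mchi chi0E tr0)].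
  rewrite -(@fkD _ _ _ _ _ _ HX a (cst 0%R) _ _ r x pa potential0 r0 mach (maI _ r mFh Fh0E) ach0 (fun y => aI0 _ r y Fh0E)).
  rewrite -(@fkD _ _ _ _ _ _ HX a (cst 0%R) _ _ r x pa potential0 r0 maQ (maI _ r mh h0E) (aQ0 r) (fun y => aI0 _ r y h0E)).
  apply: eq_fk => y; rewrite -ge0_muleDr; [|exact: chi0E|exact: I0].
  by rewrite -ge0_muleDr; [rewrite (dynF _ _ tr0)|exact: fk_ge0|exact: I0].
have E1 : Q (EFin \o chi) t x = Ta (EFin \o chi) t x + J1 by exact: duhamel_loss.
have E2 := time_loss t x mFh Fh0E; have E3 := time_loss t x mh h0E.
rewrite -/(J _) in E2; rewrite -/(J _) in E3.
have E5 := dynF t x t0; rewrite E1 E2 E3 in E5.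
(* This term is part of a free time integral of a bounded function, hence finite and open to
   cancellation in the last step. *)
have Jfin : J (EFin \o (F \+ h)%R) \is a fin_num.
  rewrite (ge0_fin_numE (J0 _ Fh0E)).
  have [_ [N FN]] := bFh.
  apply: (@le_lt_trans _ _ (\int[mu]_(s in `[0%R, t]) Q (EFin \o (F \+ h)%R) s x)).
    rewrite E2; apply: leeDr; apply: integral_ge0 => s _; exact: fk_ge0.
  apply: le_lt_trans (ltry (N * t)); rewrite -(integral_itv_cst N t0).
  apply: ge0_le_integral; [exact: mi| | |exact: measurable_cst|].
  - by move=> s _; exact: fk_ge0.
  - by apply: (measurable_fks_itv HX); [exact: potential0|exact: potential0|exact: mFh|exact: Fh0E].
  - move=> s; rewrite /= in_itv/= => /andP[s0 _]; rewrite fk00 -[leLHS]/(ex P X (F \+ h)%R s x).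
    have := @ex_abse_le _ _ _ _ P X HX (F \+ h)%R N s x (proj1 bFh) FN s0.
    exact: le_trans (lee_abs _).
have aux (K A B D J2 J3 J4 : \bar R) : D + J2 = J3 + J4 -> K = A + J3 + (B + J4) -> K <= A + B + D + J2.
  by move=> E ->; rewrite -[leRHS]addeA E addeACA.
rewrite -(leeD2rE _ _ Jfin).
set Ia := \int[mu]_(s in `[0%R, t]) Ta (EFin \o (F \+ h)%R) s x in E5 *.
apply: (@le_trans _ _ ((chi x)%:E + (Ia + J (EFin \o (F \+ h)%R)))); first by apply: leeDr; rewrite lee_fin; exact: (proj2 pchi).
apply: (aux _ _ _ _ _ J1 (J (EFin \o h))); [exact: E4|exact: E5].
Qed.

End killed.
End killed_dynkin_formula.

Lemma continuous_pos_ball (R : realType) d (u : 'rV[R]_d -> R) (r : R) :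
  continuous u -> (forall y, 0 < u y) ->
  exists2 c : R, 0 < c & forall y, enorm y <= r -> c <= u y.
Proof.
move=> cu u0.
have cpt : compact [set v : 'rV[R]_d | forall i, `[- r, r]%classic (v ord0 i)].
  exact: (@rV_compact _ _ (fun=> `[- r, r]%classic) (fun=> @segment_compact R (- r) r)).
have /compact_near_coveringP/(_ nat \oo (fun n y => n.+1%:R^-1 <= u y)) := cpt.
move=> /(_ _)[].
  move=> x _; have ux2 : 0 < u x / 2 by rewrite divr_gt0.
  have /cvgrPdist_lt/(_ _ ux2) hx := cu x.
  have /cvgrPdist_lt/(_ _ ux2) hn := @cvg_harmonic R.
  exists ([set y | `|u x - u y| < u x / 2], [set n | `|0 - n.+1%:R^-1| < u x / 2]); first by split.
  move=> [y n] /= [h1 h2]; move: h2; rewrite sub0r normrN ger0_norm ?invr_ge0// => h2.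
  apply: ltW; apply: (lt_trans h2); move: h1; rewrite ltr_norml => /andP[_].
  by rewrite ltrBlDl -ltrBlDr {1}[u x]splitr addrK.
move=> n _ /(_ n (leqnn n)) h; exists n.+1%:R^-1; first by rewrite invr_gt0.
move=> y yr; apply: h => i /=; rewrite in_itv/= -ler_norml.
exact: le_trans (coord_le_enorm _ _) yr.
Qed.

(** * Domination by the ground state *)

Section ground_state_domination.
Local Open Scope ereal_scope.
Context {R : realType} {d : nat}.
Notation rV := 'rV[R]_d.
Notation mu := (@lebesgue_measure R).
Hypothesis d0 : (0 < d)%N.
Context {dO : measure_display} {Omega : measurableType dO}.
Variables (P : probability Omega R) (X : R -> Omega -> 'rV[R]_d).
Hypothesis HX : levy_process P X.
Variable nu : rV -> R.
Hypothesis HA : assumption_A1 P X nu.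
Notation kappa := (kappa nu).
Local Opaque fk fk_weight.
Notation fk := (fk P X).
Implicit Types (x y : rV) (w : Omega).

Let kE : rV -> \bar R := EFin \o kappa.
Let pk := potential_kappa HA.
Let mk : measurable_fun setT kE := measurable_potential pk.
Let k0 y : 0 <= kE y := potential_ge0 y pk.

Variables (a b u : rV -> R) (l : R).
Hypothesis (pa : potential a) (pb : potential b) (vb : vanishing_occupation P X b).
Hypothesis afin : path_integrable P X a.
Hypothesis va : vanishing_occupation P X (fun y => a y * \1_(eball (0%R : rV) 1) y)%R.
Hypothesis (pu : potential u) (cu : continuous u) (upos : forall y, (0 < u y)%R).
Hypothesis eigen : forall t x, (0 <= t)%R -> fk a b (EFin \o u) t x = (expR (- l * t) * u x)%:E.
Hypothesis ubnd : exists N : R, forall x, (u x <= N)%R.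
Hypothesis grow : forall K : R, exists r : R, forall y, (r < enorm y)%R ->
  (K * (1 + `|ln (nu y)|) <= a y - b y)%R.
Hypothesis bball : exists r : R, forall y, (0 < b y)%R -> (enorm y <= r)%R.
Notation T := (fk a b).
Notation Ta := (fk a (cst 0%R)).

Let bfin : path_integrable P X b.
Proof. by move=> t x t0; exact: (small_occupation_finite HX x pb (vanishing_small vb) t0). Qed.

Let uE0 y : 0 <= (EFin \o u) y := potential_ge0 y pu.
Let muE : measurable_fun setT (EFin \o u) := measurable_potential pu.

Let expR_time (s t : R) : (0 <= s <= t)%R -> (expR (- (`|l| * t)) <= expR (- l * s) <= expR (`|l| * t))%R.
Proof.
move=> /andP[s0 st]; rewrite !ler_expR.
have h : (`|l * s| <= `|l| * t)%R by rewrite normrM (ger0_norm s0) ler_wpM2l.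
by move: h; rewrite ler_norml mulNr => /andP[]; lra.
Qed.

Lemma domination_ground (W : rV -> R) (r t : R) : potential W -> vanishing_occupation P X W ->
  (forall y, (0 < W y)%R -> (enorm y <= r)%R) -> (0 <= t)%R ->
  exists2 C : R, (0 <= C)%R & forall x, \int[mu]_(s in `[0%R, t]) T (EFin \o W) s x <= (C * u x)%:E.
Proof.
move=> pW vW Wr t0.
have [B B0 hB] := occupation_weighted HX pa pb pW vb vW t0.
have [c c0 hc] := continuous_pos_ball r cu upos.
pose al : R := expR (- (`|l| * t))%R; pose be : R := expR (`|l| * t)%R.
have al0 : (0 < al)%R := expR_gt0 _. have be0 : (0 < be)%R := expR_gt0 _.
exists (B * be / (al * c))%R.
  by rewrite divr_ge0 ?mulr_ge0 ?(ltW al0) ?(ltW be0) ?(ltW B0) ?(ltW c0).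
move=> x; apply: (@domination _ _ _ _ _ _ HX a b W u al be c B t x) => //.
- move=> s y st; rewrite eigen; last by case/andP: st.
  by rewrite lee_fin ler_wpM2r ?(ltW (upos y))//; have /andP[] := expR_time st.
- move=> y; rewrite eigen// lee_fin ler_wpM2r ?(ltW (upos y))//.
  by have /andP[] := expR_time (introT andP (conj t0 (lexx t))).
- by move=> y /Wr; exact: hc.
Qed.

Lemma killed_le (g : rV -> \bar R) (t : R) x : measurable_fun setT g -> (forall y, 0 <= g y) ->
  (0 <= t)%R -> Ta g t x <= T g t x.
Proof.
move=> mg g0 t0; rewrite !fkE; apply: ge0_le_integral => //.
- by move=> w _; rewrite mule_ge0// fk_weight_ge0.
- by apply: (@measurable_fk_integrand _ _ _ _ _ _ HX a (cst 0%R) g _ _ (cst x) (cst t) id).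
- by apply: (@measurable_fk_integrand _ _ _ _ _ _ HX a b g _ _ (cst x) (cst t) id).
- move=> w _; apply: lee_wpmul2r; first exact: g0.
  by apply: (fk_weight_le HX) => //; move=> y; exact: (proj2 pb).
Qed.

Let mT (g : rV -> \bar R) x (t : R) : measurable_fun setT g -> (forall y, 0 <= g y) ->
  measurable_fun `[0%R, t] (fun s : R => T g s x).
Proof. by move=> mg g0; apply: (measurable_fks_itv HX). Qed.

Let mTa (g : rV -> \bar R) x (t : R) : measurable_fun setT g -> (forall y, 0 <= g y) ->
  measurable_fun `[0%R, t] (fun s : R => Ta g s x).
Proof. by move=> mg g0; apply: (measurable_fks_itv HX). Qed.

Lemma killed_time_le (g : rV -> \bar R) (t : R) x : measurable_fun setT g -> (forall y, 0 <= g y) ->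
  \int[mu]_(s in `[0%R, t]) Ta g s x <= \int[mu]_(s in `[0%R, t]) T g s x.
Proof.
move=> mg g0; apply: ge0_le_integral; [exact: measurable_itv| |exact: mTa|exact: mT|].
- by move=> s _; exact: fk_ge0.
- by move=> s; rewrite /= in_itv/= => /andP[s0 _]; exact: killed_le.
Qed.

Lemma evolved_le_ground (g : rV -> R) (C s t : R) x : potential g -> (0 <= C)%R ->
  (forall y, g y <= C * u y)%R -> (0 <= s <= t)%R ->
  T (EFin \o g) s x <= (C * expR (`|l| * t) * u x)%:E.
Proof.
move=> pg C0 gC st; have /andP[s0 _] := st.
apply: (@le_trans _ _ (T (fun y => C%:E * (EFin \o u) y) s x)).
  apply: (@fk_le _ _ _ _ _ _ HX a b _ _ _ _ pa pb s0).
  - exact: measurable_potential.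
  - by apply: emeasurable_funM; [exact: measurable_cst|exact: muE].
  - by move=> y; exact: (potential_ge0 _ pg).
  - by move=> y; rewrite -EFinM lee_fin; exact: gC.
rewrite (@fkZl _ _ _ _ _ _ HX a b _ s x C pa pb s0 muE uE0 C0) eigen//.
rewrite -EFinM lee_fin -mulrA ler_wpM2l// ler_wpM2r ?(ltW (upos x))//.
by have /andP[] := expR_time st.
Qed.

(* Outside a ball kappa is dominated by F, the generator applied to the bump chi,
   and the killed Dynkin formula bounds the time integral of F by terms supported
   near the origin, where u is bounded below. *)
Lemma evolved_kappa_le_ground (s : R) : (0 < s)%R -> exists2 C : R, (0 <= C)%R &
  forall x, \int[mu]_(q in `[0%R, s]) T kE q x <= (C * u x)%:E.
Proof.
move=> s0; have s0' := ltW s0.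
have ss : (0 <= s <= s)%R by rewrite s0' lexx.
have [chi [F [c [C [c0 chi01 chi_far _ [D FC cF]]]]]] := dynkin_bump d0 HX HA.
have kp := kappa_pos HA.
have C0 : (0 <= C)%R.
  have h := le_trans (normr_ge0 _) (FC 0%R); move: h; rewrite pmulr_lge0//; exact: kp.
have [[mchi _] bF _] := D; have [mF _] := bF.
have pchi : potential chi by split => // y; case/andP: (chi01 y).
have [e e0 he] := continuous_pos_ball 1%R cu upos.
have h21 : (2^-1 <= 1 :> R)%R by rewrite invf_le1// ler1n.
have h41 : (4^-1 <= 1 :> R)%R by rewrite invf_le1// ler1n.
(* Within distance 1/2 of the origin kappa is 1 and F may be as low as - C; adding C + c gives F + h
   >= c kappa everywhere. *)
pose h y : R := ((C + c) * \1_(cball (0%R : rV) 2^-1) y)%R.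
have Cc0 : (0 <= C + c)%R by lra.
have mh : measurable_fun setT h.
  by apply: measurable_funM => //; apply: measurable_indic; exact: measurable_cball.
have ph : potential h by split => // y; rewrite mulr_ge0// indicE ler0n.
have bh : bounded_mf h.
  split => //; exists (C + c)%R => y; rewrite ger0_norm; last exact: (proj2 ph).
  by rewrite ler_piMr// indicE; case: (_ \in _).
have Fh y : (c * kappa y <= F y + h y)%R.
  rewrite /h indicE; have [y2|y2] := leP (enorm y) 2^-1%R.
    rewrite mem_set; last by rewrite /cball/= subr0.
    have ky : kappa y = 1%R by rewrite /kappa (le_trans y2 h21).
    have := FC y; rewrite ky !mulr1 ler_norml => /andP[]; lra.
  rewrite memNset; last by rewrite /cball/= subr0 leNgt y2.
  by rewrite mulr0 addr0; exact: cF.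
have Fh0 y : (0 <= F y + h y)%R.
  by apply: le_trans (Fh y); rewrite mulr_ge0 ?(ltW c0)// ltW.
have pFh : potential (F \+ h)%R by split; [exact: measurable_funD|exact: Fh0].
have mFh := measurable_potential pFh.
have Fh0E y : 0 <= (EFin \o (F \+ h)%R) y := potential_ge0 y pFh.
have ech y : (chi y <= e^-1 * u y)%R.
  have [y4|y4] := leP 4^-1%R (enorm y).
    by rewrite chi_far// mulr_ge0 ?invr_ge0 ?(ltW e0)// ltW.
  rewrite mulrC ler_pdivlMr//; apply: le_trans (he y _); last exact: (le_trans (ltW y4) h41).
  by rewrite ler_piMl ?(ltW e0)//; case/andP: (chi01 y).
have eh y : (h y <= (C + c) / e * u y)%R.
  rewrite /h -mulrA ler_wpM2l// indicE; case: (boolP (y \in _)) => [|_]; last first.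
    by rewrite mulr_ge0 ?invr_ge0 ?(ltW e0)// ltW.
  rewrite inE /cball/= subr0 => y2; rewrite mulrC ler_pdivlMr// mul1r.
  by apply: he; exact: le_trans h21.
(* The killing term of Dynkin's formula. It lives in the unit ball, where a has vanishing
   occupation, so domination applies to it. *)
pose ac y : R := (a y * chi y)%R.
have pac : potential ac.
  split; first by apply: measurable_funM => //; case: pa.
  by move=> y; rewrite mulr_ge0 ?(proj2 pa y) ?(proj2 pchi y).
have pa1 : potential (fun y => a y * \1_(eball (0%R : rV) 1) y)%R.
  split; last by move=> y; rewrite mulr_ge0 ?(proj2 pa y)// indicE ler0n.
  apply: measurable_funM; first by case: pa.
  by apply: measurable_indic; exact: measurable_eball.
have vac : vanishing_occupation P X ac.
  apply: (vanishing_le HX pac pa1 _ va) => y; apply: ler_wpM2l; first exact: (proj2 pa).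
  have [y4|y4] := leP 4^-1%R (enorm y); first by rewrite chi_far// indicE ler0n.
  rewrite indicE mem_set; first by case/andP: (chi01 y).
  by rewrite /eball/= subr0; apply: lt_le_trans y4 h41.
have acr y : (0 < ac y)%R -> (enorm y <= 1)%R.
  move=> acy; rewrite leNgt; apply/negP => y1; move: acy; rewrite /ac chi_far ?mulr0 ?ltxx//.
  exact: le_trans h41 (ltW y1).
have [C1 C10 hC1] := domination_ground pac vac acr s0'.
have [r hr] := bball; have [C2 C20 hC2] := domination_ground pb vb hr s0'.
have [C3 C31 hC3] := fk_mass_bounded HX pa pb vb s0'.
have C30 : (0 <= C3)%R by lra.
have [_ [N FN]] := bounded_mfD bF bh.
have N0 : (0 <= N)%R by apply: le_trans (FN 0%R).
pose E : R := expR (`|l| * s)%R; have E0 : (0 <= E)%R := expR_ge0 _.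
pose C4 : R := (e^-1 * E + (C + c) / e * E * s + C1)%R.
have e10 : (0 <= e^-1)%R by rewrite invr_ge0 ltW.
have Cce0 : (0 <= (C + c) / e)%R by rewrite divr_ge0// ltW.
have mh' := measurable_potential ph; have mchi' := measurable_potential pchi; have mac' := measurable_potential pac.
have mb' := measurable_potential pb.
have h0' y : 0 <= (EFin \o h) y := potential_ge0 y ph.
have chi0' y : 0 <= (EFin \o chi) y := potential_ge0 y pchi.
have ac0' y : 0 <= (EFin \o ac) y := potential_ge0 y pac.
have b0' y : 0 <= (EFin \o b) y := potential_ge0 y pb.
have mi t : measurable (`[0%R, t]%classic : set R) by exact: measurable_itv.
have Ia x : \int[mu]_(q in `[0%R, s]) Ta (EFin \o (F \+ h)%R) q x <= (C4 * u x)%:E.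
  apply: (le_trans (killed_dynkin HX pa afin x D pchi ph bh Fh0 s0')).
  have -> : (C4 * u x = e^-1 * E * u x + (C + c) / e * E * u x * s + C1 * u x)%R by rewrite /C4; ring.
  rewrite !EFinD; apply: leeD; [apply: leeD|].
  - apply: (le_trans (killed_le x mchi' chi0' s0')).
    exact: (evolved_le_ground x pchi e10 ech ss).
  - apply: (le_trans (killed_time_le s x mh' h0')).
    rewrite -(integral_itv_cst _ s0'); apply: ge0_le_integral; [exact: mi| |exact: mT|exact: measurable_cst|].
    + by move=> q _; exact: fk_ge0.
    + by move=> q; rewrite /= in_itv/= => qs; exact: (evolved_le_ground x ph Cce0 eh qs).
  - apply: le_trans (hC1 x); apply: le_trans (killed_time_le s x mac' ac0').
    rewrite le_eqVlt; apply/orP; left; apply/eqP; apply: eq_integral => q _; apply: eq_fk => y.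
    by rewrite /= EFinM.
pose D' : R := (N * C3 * s)%R; have D'0 : (0 <= D')%R by rewrite !mulr_ge0.
have m1 : measurable_fun [set: rV] (cst (1 : \bar R)) by exact: measurable_cst.
have inner t y : (0 <= t <= s)%R -> \int[mu]_(q in `[0%R, t]) T (EFin \o (F \+ h)%R) q y <= D'%:E.
  move=> /andP[t0 ts]; apply: (@le_trans _ _ (N * C3 * t)%:E); last first.
    by rewrite lee_fin ler_wpM2l// mulr_ge0.
  rewrite -(integral_itv_cst _ t0); apply: ge0_le_integral; [exact: mi| |exact: mT|exact: measurable_cst|].
  - by move=> q _; exact: fk_ge0.
  - move=> q; rewrite /= in_itv/= => /andP[q0 qt].
    have FhN z : (EFin \o (F \+ h)%R) z <= N%:E by rewrite lee_fin; exact: le_trans (ler_norm _) (FN z).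
    apply: (le_trans (@fk_cst_le _ _ _ _ _ _ HX a b N _ q y pa pb q0 mFh Fh0E N0 FhN)).
    by rewrite EFinM; apply: lee_wpmul2l; [rewrite lee_fin|apply: hC3; rewrite q0 (le_trans qt ts)].
(* The gain b is put back by Duhamel's formula. The restarted time integral is at most D', and the
   time integral of b, supported in a ball, is dominated by u. *)
have IT x : \int[mu]_(q in `[0%R, s]) T (EFin \o (F \+ h)%R) q x <= ((C4 + D' * C2) * u x)%:E.
  rewrite (time_duhamel HX (a1 := a) (b1 := cst 0%R) (c := b) (A := fun q => Ta (EFin \o (F \+ h)%R) q x) pa potential0 pa pb pb mFh Fh0E).
  - rewrite mulrDl EFinD; apply: leeD; first exact: Ia.
    have mTab : measurable_fun `[0%R, s] (fun q : R => Ta (EFin \o b) q x) by exact: mTa.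
    apply: (@le_trans _ _ (D'%:E * \int[mu]_(q in `[0%R, s]) Ta (EFin \o b) q x)).
      rewrite -(ge0_integralZl_EFin mu (mi s) (fun q _ => fk_ge0 P X _ _ q x b0') mTab D'0).
      apply: ge0_le_integral; [exact: mi| | | |].
      + move=> q _; apply: fk_ge0 => y; apply: mule_ge0; first exact: b0'.
        by apply: integral_ge0 => z _; exact: fk_ge0.
      + by apply: (measurable_time_duhamel HX).
      + by apply: emeasurable_funM; [exact: measurable_cst|exact: mTab].
      + move=> q; rewrite /= in_itv/= => /andP[q0 qs].
        have sq : (0 <= s - q <= s)%R by rewrite subr_ge0 qs gerBl.
        rewrite -(@fkZl _ _ _ _ _ _ HX a (cst 0%R) _ q x D' pa potential0 q0 mb' b0' D'0).
        apply: (@fk_le _ _ _ _ _ _ HX a (cst 0%R) _ _ _ _ pa potential0 q0).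
        * apply: emeasurable_funM; first exact: mb'.
          have m : measurable_fun setT (fun z : rV * R => T (EFin \o (F \+ h)%R) (Num.max z.2 0)%R z.1).
            apply: (@measurable_fk _ _ _ _ _ _ HX a b _ _ (rV * R)%type fst (fun z => Num.max z.2 0)%R) => //.
              by apply: measurable_maxr => //; exact: measurable_snd.
            by move=> z; rewrite le_max lexx orbT.
          have := measurableT_comp (measurable_integral_itv m (fun z => fk_ge0 P X _ _ _ _ Fh0E)) (pair1_measurable (s - q)%R).
          apply: eq_measurable_fun => y _; apply: eq_integral => z; rewrite inE/= in_itv/= => /andP[z0 _].
          by rewrite max_l.
        * by apply: emeasurable_funM; [exact: measurable_cst|exact: mb'].
        * move=> y; apply: mule_ge0; first exact: b0'.
          by apply: integral_ge0 => z _; exact: fk_ge0.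
        * move=> y; rewrite muleC; apply: lee_wpmul2r; first exact: b0'.
          exact: inner.
    rewrite -mulrA (EFinM D'); apply: lee_wpmul2l; first by rewrite lee_fin.
    exact: (le_trans (killed_time_le s x mb' b0') (hC2 x)).
  - exact: mTa.
  - by move=> q _; exact: fk_ge0.
  - by move=> q /andP[q0 _]; exact: (duhamel_gain_ae HX x pa pb bfin mFh Fh0E q0).
have C40 : (0 <= C4)%R.
  by apply: addr_ge0 => //; apply: addr_ge0; [|apply: mulr_ge0 => //]; apply: mulr_ge0.
have c10 : (0 <= c^-1)%R by rewrite invr_ge0 ltW.
exists (c^-1 * (C4 + D' * C2))%R => [|x]; first by rewrite mulr_ge0// addr_ge0// mulr_ge0.
apply: (@le_trans _ _ ((c^-1)%:E * \int[mu]_(q in `[0%R, s]) T (EFin \o (F \+ h)%R) q x)); last first.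
  by rewrite -mulrA (EFinM c^-1%R); apply: lee_wpmul2l; [rewrite lee_fin|exact: IT].
have mTF : measurable_fun `[0%R, s] (fun q : R => T (EFin \o (F \+ h)%R) q x) by exact: mT.
rewrite -(ge0_integralZl_EFin mu (mi s) (fun q _ => fk_ge0 P X _ _ q x Fh0E) mTF c10).
apply: ge0_le_integral; [exact: mi| |exact: mT| |].
- by move=> q _; exact: fk_ge0.
- by apply: emeasurable_funM; [exact: measurable_cst|exact: mTF].
- move=> q; rewrite /= in_itv/= => /andP[q0 _].
  rewrite -(@fkZl _ _ _ _ _ _ HX a b _ q x _ pa pb q0 mFh Fh0E c10).
  apply: (@fk_le _ _ _ _ _ _ HX a b _ _ _ _ pa pb q0 mk _ k0).
    by apply: emeasurable_funM; [exact: measurable_cst|exact: mFh].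
  by move=> y; rewrite -EFinM lee_fin mulrC ler_pdivlMr// mulrC.
Qed.

(** T_t 1 lies below C1 T_q kappa for every q in [0, t / 2]; averaging over q replaces the value at
    one time by the time integral that u dominates. *)
Lemma mass_le_ground (t : R) : (0 < t)%R -> exists2 C : R, (0 < C)%R &
  forall x, fk a b (cst 1) t x <= (C * u x)%:E.
Proof.
move=> t0; have s0 : (0 < t / 2)%R by rewrite divr_gt0.
have [C1 C10 hC1] := mass_le_evolved_kappa d0 HX HA pa pb vb grow s0.
have [C2 C20 hC2] := evolved_kappa_le_ground s0.
have [C3 C31 hC3] := fk_mass_bounded HX pa pb vb (ltW t0).
have ts : (t = t / 2 + t / 2)%R by lra.
exists (C1 * C2 / (t / 2) + 1)%R => [|x].
  by rewrite ltr_wpDl// divr_ge0 ?mulr_ge0// ltW.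
have mTx : measurable_fun `[0%R, (t / 2)%R] (fun q : R => T kE q x) by exact: mT.
have m0 : 0 <= T (cst 1) t x by apply: fk_ge0 => y; exact: lee01.
have := hC3 t x; rewrite lexx (ltW t0) => /(_ isT).
case ET : (T (cst 1) t x) m0 => [m| |]// m0 _; rewrite lee_fin.
rewrite lee_fin in m0.
have : (m * (t / 2))%:E <= C1%:E * \int[mu]_(q in `[0%R, (t / 2)%R]) T kE q x.
  have mi : measurable (`[0%R, (t / 2)%R]%classic : set R) by exact: measurable_itv.
  rewrite -(integral_itv_cst m (ltW s0)) -(ge0_integralZl_EFin mu mi (fun q _ => fk_ge0 P X _ _ q x k0) mTx (ltW C10)).
  apply: ge0_le_integral; [exact: mi| |exact: measurable_cst| |].
  - by move=> q _; rewrite lee_fin.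
  - by apply: emeasurable_funM; [exact: measurable_cst|exact: mTx].
  - move=> q; rewrite /= in_itv/= => qs; rewrite -ET {1}ts; exact: hC1.
move=> /le_trans/(_ (lee_wpmul2l _ (hC2 x))); rewrite lee_fin (ltW C10) => /(_ isT).
rewrite -EFinM lee_fin -ler_pdivlMr// => /le_trans; apply.
rewrite mulrDl mul1r; apply: ler_wpDr; first exact: (proj2 pu).
by rewrite le_eqVlt; apply/orP; left; apply/eqP; ring.
Qed.

End ground_state_domination.

(** * From ground state domination to ultracontractivity *)

Section ultracontractivity.
Local Open Scope ereal_scope.
Context {R : realType} {d : nat}.
Notation rV := 'rV[R]_d.
Notation lam := (lebesgue_rV R d).
Notation mu := (@lebesgue_measure R).
Context {dO : measure_display} {Omega : measurableType dO}.
Variables (P : probability Omega R) (X : R -> Omega -> 'rV[R]_d).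
Hypothesis HX : levy_process P X.
Local Opaque fk fk_weight.
Notation fk := (fk P X).
Notation path_of := (path_of X).
Notation Q := (fk (cst 0%R) (cst 0%R)).
Implicit Types (x y : rV) (w : Omega).

Lemma bounded_density_le p (M t : R) x (f : rV -> \bar R) : is_transition_density P X p ->
  (0 < t)%R -> (forall y, p t y <= M%:E) -> (0 <= M)%R ->
  measurable_fun setT f -> (forall y, 0 <= f y) ->
  Q f t x <= M%:E * \int[lam]_y f y.
Proof.
move=> hp t0 pM M0 mf f0; have [mp p0 pE] := hp t t0.
have mY : measurable_fun setT (fun w => x + X t w)%R.
  exact: (@measurable_position_path _ _ _ _ _ _ HX _ Omega (cst x) (cst t) id
    (measurable_cst _) (measurable_cst _) (@measurable_id _ _ _) _ _ id (@measurable_id _ _ _) (fun=> ltW t0)).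
pose mixin := isMeasurableFun.Build _ _ _ _ _ mY.
pose Y : {mfun Omega >-> rV} := HB.pack (fun w => x + X t w)%R mixin.
rewrite fk00 (_ : \int[P]_w f (x + X t w)%R = \int[pushforward P Y]_y f y); last first.
  by rewrite ge0_integral_pushforward//; exact: mY.
have -> : M%:E * \int[lam]_y f y = \int[mscale (NngNum M0) lam]_y f y by rewrite ge0_integral_mscale.
apply: ge0_le_measure_integral => // A mA; rewrite /mscale/=.
have -> : pushforward P Y A = law_from P X x t A by [].
rewrite pE//; apply: (@le_trans _ _ (\int[lam]_(y in A) M%:E)); last by rewrite integral_cst.
apply: ge0_le_integral => //.
- by apply: measurable_funTS; apply: (measurableT_comp mp); exact: measurable_funB_rV.
Qed.

Variables a b : rV -> R.
Hypothesis (pa : potential a) (pb : potential b) (vb : vanishing_occupation P X b).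

(* AM-GM: 2 e^B g <= theta e^(2B) + g^2 / theta, where B is the path integral of b. *)
Lemma fk_l2_bounded p (M s : R) : is_transition_density P X p -> (0 < s)%R ->
  (forall y, p s y <= M%:E) -> exists2 K : R, (0 < K)%R &
  forall (g : rV -> R) (th : R) x, potential g -> (0 < th)%R ->
    \int[lam]_y (g y ^+ 2)%:E <= (th ^+ 2)%:E -> fk a b (EFin \o g) s x <= (K * th)%:E.
Proof.
move=> hp s0 pM; have s0' := ltW s0.
have M0 : (0 <= M)%R.
  by have [_ p0 _] := hp s s0; rewrite -lee_fin; exact: le_trans (p0 0%R) (pM 0%R).
have pbb := potentialD pb pb.
have [C C1 hC] := khasminskii HX pbb (vanishing_small (vanishingD HX pb pb vb vb)) s0'.
exists ((C + M) / 2)%R => [|g th x pg th0 gth]; first by rewrite divr_gt0//; lra.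
have mg := measurable_potential pg; have [_ g0] := pg.
have g0E y : 0 <= (EFin \o g) y := potential_ge0 y pg.
apply: (@le_trans _ _ (fk (cst 0%R) b (EFin \o g) s x)); first by apply: (fk_le_gain HX).
have mg2 : measurable_fun setT (fun y => (g y ^+ 2)%:E).
  by apply/measurable_EFinP; apply: measurable_funX; case: pg.
have g20 y : 0 <= (g y ^+ 2)%:E by rewrite lee_fin sqr_ge0.
have th2 : (0 <= th / 2)%R by rewrite divr_ge0// ltW.
have th2' : (0 <= (2 * th)^-1)%R by rewrite invr_ge0 mulr_ge0// ltW.
have m1 : measurable_fun [set: rV] (cst (1 : \bar R)) by exact: measurable_cst.
apply: (@le_trans _ _ ((th / 2)%:E * fk (cst 0%R) (b \+ b)%R (cst 1) s x +
    ((2 * th)^-1)%:E * Q (fun y => (g y ^+ 2)%:E) s x)); last first.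
  have h1 : (th / 2)%:E * fk (cst 0%R) (b \+ b)%R (cst 1) s x <= (th / 2 * C)%:E.
    by rewrite (EFinM (th / 2)%R C); apply: lee_wpmul2l; [rewrite lee_fin|apply: hC; rewrite s0' lexx].
  have h2 : ((2 * th)^-1)%:E * Q (fun y => (g y ^+ 2)%:E) s x <= ((2 * th)^-1 * (M * th ^+ 2))%:E.
    rewrite (EFinM (2 * th)^-1%R (M * th ^+ 2)%R); apply: lee_wpmul2l; first by rewrite lee_fin.
    apply: (le_trans (bounded_density_le x hp s0 pM M0 mg2 g20)).
    by rewrite (EFinM M); apply: lee_wpmul2l; [rewrite lee_fin|].
  apply: (le_trans (leeD h1 h2)); rewrite -EFinD lee_fin le_eqVlt; apply/orP; left; apply/eqP.
  by field; rewrite gt_eqF.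
have mW : measurable_fun setT (fun w => fk_weight (cst 0%R) (b \+ b)%R x s (path_of w) * cst 1 (x + X s w)%R).
  by apply: (@measurable_fk_integrand _ _ _ _ _ _ HX (cst 0%R) (b \+ b)%R (cst 1) _ _ (cst x) (cst s) id).
have mG : measurable_fun setT (fun w => (g (x + X s w) ^+ 2)%R%:E).
  exact: (@measurable_position_path _ _ _ _ _ _ HX _ Omega (cst x) (cst s) id
    (measurable_cst _) (measurable_cst _) (@measurable_id _ _ _) _ _ _ mg2 (fun=> s0')).
have W0 w : 0 <= fk_weight (cst 0%R) (b \+ b)%R x s (path_of w) * cst 1 (x + X s w)%R.
  by rewrite mule1 fk_weight_ge0.
have G0 w : 0 <= (g (x + X s w) ^+ 2)%R%:E by rewrite lee_fin sqr_ge0.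
rewrite fk00 !fkE -(ge0_integralZl_EFin P measurableT (fun w _ => W0 w) mW th2).
rewrite -(ge0_integralZl_EFin P measurableT (fun w _ => G0 w) mG th2').
rewrite -(ge0_integralD P measurableT); last 4 first.
- by move=> w _; apply: mule_ge0; [rewrite lee_fin|exact: W0].
- by apply: emeasurable_funM; [exact: measurable_cst|exact: mW].
- by move=> w _; apply: mule_ge0; [rewrite lee_fin|exact: G0].
- by apply: emeasurable_funM; [exact: measurable_cst|exact: mG].
apply: ge0_le_integral => //.
- by move=> w _; apply: mule_ge0; [exact: fk_weight_ge0|exact: g0E].
- by apply: (@measurable_fk_integrand _ _ _ _ _ _ HX (cst 0%R) b (EFin \o g) _ _ (cst x) (cst s) id).
- apply: emeasurable_funD; first by apply: emeasurable_funM; [exact: measurable_cst|exact: mW].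
  by apply: emeasurable_funM; [exact: measurable_cst|exact: mG].
- move=> w _; rewrite mule1 !fk_weightE !integral0 oppe0 expeR0 !mul1e (path_integralD HX)//.
  have : 0 <= \int[mu]_(u in `[0%R, s]) (b (x + X u w)%R)%:E.
    by apply: integral_ge0 => u _; rewrite lee_fin; exact: (proj2 pb).
  rewrite -/(path_of w); case: (\int[mu]_(u in `[0%R, s]) _) => [B| |]// B0.
    rewrite /= -!EFinM -EFinD lee_fin expRD; set E := expR B; set G := g _.
    rewrite -subr_ge0 (_ : _ - _ = (th * E - G) ^+ 2 / (2 * th))%R.
      by rewrite divr_ge0 ?sqr_ge0// mulr_ge0// ltW.
    by field; rewrite gt_eqF.
  rewrite /= gt0_muley ?lte_fin ?divr_gt0// addye ?leey//.
Qed.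

End ultracontractivity.

Section intrinsic_ultracontractivity.
Local Open Scope ereal_scope.
Context {R : realType} {d : nat}.
Notation rV := 'rV[R]_d.
Notation lam := (lebesgue_rV R d).
Hypothesis d0 : (0 < d)%N.
Context {dO : measure_display} {Omega : measurableType dO}.
Variables (P : probability Omega R) (X : R -> Omega -> 'rV[R]_d).
Hypothesis HX : levy_process P X.
Variable nu : rV -> R.
Hypothesis HA : assumption_A1 P X nu.
Variable p : R -> rV -> \bar R.
Hypothesis Hp : is_transition_density P X p.
Variable V : rV -> R.
Hypothesis HV : confining_kato_potential P X V.
Variables (la : nat -> R) (phi : nat -> rV -> R).
Hypothesis Hphi : feynman_kac_eigenbasis P X V la phi.
Hypothesis grow : forall K : R, (0 < K)%R -> exists r : R, forall y, (r < enorm y)%R ->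
  (K * `|ln (nu y)| <= V y)%R.
Local Opaque fk fk_weight.
Notation fk := (fk P X).
Notation phi0 := (phi 0%N).
Notation T := (fk (V^\+)%R (V^\-)%R).
Implicit Types (x y : rV) (w : Omega).

Let KV : kato_potential P X V. Proof. by case: HV. Qed.
Let pp : potential (V^\+)%R := potential_pos KV.
Let pn : potential (V^\-)%R := potential_neg KV.
Let vn : vanishing_occupation P X (V^\-)%R := neg_vanishing HX HV.
Let pphi : potential phi0 := ground_potential Hphi.

Lemma mass_le_phi0 (t : R) : (0 < t)%R -> exists2 C : R, (0 < C)%R &
  forall x, T (cst 1) t x <= (C * phi0 x)%:E.
Proof.
have [_ _ [_ kloc]] := KV.
have pball : potential (fun y => V^\+ y * \1_(eball (0%R : rV) 1) y)%R.
  split; last by move=> y; rewrite mulr_ge0 ?(proj2 pp y)// indicE ler0n.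
  apply: measurable_funM; first by case: pp.
  by apply: measurable_indic; exact: measurable_eball.
apply: (mass_le_ground d0 HX HA pp pn vn _ _ pphi _ _ (l := la 0%N)).
- by move=> s x s0; apply: (kato_loc_finite HX x pp _ s0); case: KV.
- by apply: (kato_vanishing HX pball); apply: kloc; exact: ltr01.
- exact: (eigen_continuous Hphi).
- by move=> y; exact: (ground_state_gt0 Hphi).
- by move=> s x s0; exact: (ground_eigen HX Hp HV Hphi x s0).
(* The mean of the bounds (2 |K| + 1) |log nu| and 2 |K| produces the extra summand |K|, which
   matters where log nu is small. *)
- move=> K; have K0 : (0 < 2 * `|K| + 1)%R by rewrite ltr_wpDl// mulr_ge0.
  have [r1 hr1] := grow K0; have [r2 hr2] := confining HV (2 * `|K|)%R.
  exists (Num.max r1 r2) => y; rewrite gt_max => /andP[/hr1 h1 /hr2 h2]; rewrite posBneg.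
  apply: (@le_trans _ _ (`|K| * (1 + `|ln (nu y)|))%R); first by rewrite ler_wpM2r ?addr_ge0// ler_norm.
  by move: h1 h2 (normr_ge0 (ln (nu y))); move: `|ln (nu y)|%R `|K|%R => n k; nra.
(* Confinement makes V nonnegative outside a ball, so V_- is supported in it. *)
- have [r hr] := confining HV 0%R; exists r => y; rewrite leNgt => h; apply/negP => /hr.
  by move: h; rewrite /funrneg lt_max ltxx orbF oppr_gt0 ltNge => /negP.
Qed.

Lemma gsd_of_growth : GSD P X V phi0.
Proof.
move=> t t0; have [C C0 hC] := mass_le_phi0 t0; exists C => // x.
by rewrite (feynman_kacE HX KV _ _ (ltW t0)); [exact: hC|split].
Qed.

Lemma iuc_of_growth : (forall t, (0 < t)%R -> exists M : R, forall x, p t x <= M%:E) ->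
  IUC P X V (la 0%N) phi0.
Proof.
move=> pbnd t t0; have s0 : (0 < t / 2)%R by rewrite divr_gt0.
have s0' := ltW s0.
have [M hM] := pbnd _ s0; have [K K0 hK] := fk_l2_bounded HX pp pn vn Hp s0 hM.
have [C C0 hC] := mass_le_phi0 s0.
have php y := ground_state_gt0 Hphi y.
pose D : R := (expR (la 0%N * t) * (K * C))%R.
have D0 : (0 < D)%R by rewrite mulr_gt0 ?expR_gt0// mulr_gt0.
exists D => f mf Ifoo.
have I0 : 0 <= \int[lam]_y (f y ^+ 2 * phi0 y ^+ 2)%:E.
  by apply: integral_ge0 => y _; rewrite lee_fin mulr_ge0 ?sqr_ge0.
case EI : (\int[lam]_y (f y ^+ 2 * phi0 y ^+ 2)%:E) I0 Ifoo => [r| |]// r0 _; rewrite lee_fin in r0.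
pose g y : R := `|phi0 y * f y|%R.
have mh : measurable_fun setT (fun y => phi0 y * f y)%R.
  by apply: measurable_funM => //; case: pphi.
have pg : potential g by split => [|y]; [apply: measurableT_comp|exact: normr_ge0].
have key th x : (0 < th)%R -> (r <= th ^+ 2)%R ->
    `|intrinsic_semigroup P X V (la 0%N) phi0 t f x| <= (D * th)%:E.
  move=> th0 rth.
  have gth : \int[lam]_y (g y ^+ 2)%:E <= (th ^+ 2)%:E.
    rewrite (_ : \int[lam]_y _ = r%:E) ?lee_fin// -EI; apply: eq_integral => y _.
    by rewrite /g real_normK ?num_real// exprMn mulrC.
  have Tg : T (EFin \o g) t x <= (K * C * th * phi0 x)%:E.
    have -> : t = (t / 2 + t / 2)%R by lra.
    have mg := measurable_potential pg; have g0 y : 0 <= (EFin \o g) y := potential_ge0 y pg.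
    rewrite (@fk_semigroup _ _ _ _ _ _ HX _ _ (EFin \o g) (t / 2)%R (t / 2)%R x pp pn mg g0 s0' s0').
    have Kth0 : (0 <= K * th)%R by rewrite mulr_ge0// ltW.
    have mTg := measurable_fkx HX pp pn mg g0 s0'.
    apply: (le_trans (@fk_cst_le _ _ _ _ _ _ HX _ _ (K * th)%R _ (t / 2)%R x pp pn s0' mTg _ Kth0 _)).
    - by move=> y; exact: fk_ge0.
    - by move=> y; exact: hK.
    - rewrite (_ : K * C * th * phi0 x = K * th * (C * phi0 x))%R; last by ring.
      by rewrite (EFinM (K * th)%R); apply: lee_wpmul2l; [rewrite lee_fin|exact: hC].
  have hle : `|feynman_kac P X V t (fun y => phi0 y * f y)%R x| <= T (EFin \o g) t x.
    rewrite -(feynman_kacE HX KV _ pg (ltW t0)).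
    have mi := measurable_feynman_kac_integrand HX KV x mh (ltW t0).
    apply: (le_trans (le_abse_integral P measurableT mi)).
    rewrite le_eqVlt; apply/orP; left; apply/eqP; apply: eq_integral => w _.
    by rewrite abseM gee0_abs ?expeR_ge0.
  have q0 : (0 < expR (la 0%N * t) / phi0 x)%R by rewrite divr_gt0 ?expR_gt0.
  rewrite /intrinsic_semigroup abseM gee0_abs; last by rewrite lee_fin ltW.
  apply: (@le_trans _ _ ((expR (la 0%N * t) / phi0 x)%:E * (K * C * th * phi0 x)%:E)).
    by apply: lee_wpmul2l; [rewrite lee_fin ltW|exact: le_trans hle Tg].
  rewrite -EFinM lee_fin /D le_eqVlt; apply/orP; left; apply/eqP.
  by field; rewrite gt_eqF.
rewrite poweR_EFin powR12_sqrt//.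
apply/lee_addgt0Pr => e e0.
(* Slightly above the norm of f, so as to be positive even when this norm is 0; after multiplication
   by D the excess is exactly e. *)
pose th : R := (Num.sqrt r + e / D)%R.
have eD : (0 < e / D)%R by rewrite divr_gt0.
have th0 : (0 < th)%R by rewrite ltr_wpDl// sqrtr_ge0.
have rth : (r <= th ^+ 2)%R.
  rewrite -{1}(sqr_sqrtr r0) ler_sqr ?nnegrE ?sqrtr_ge0//; last exact: ltW.
  by rewrite lerDl ltW.
have E : D%:E * (Num.sqrt r)%:E + e%:E = (D * th)%:E.
  by rewrite -EFinM -EFinD; congr (_%:E); rewrite /th mulrDr mulrCA divff ?gt_eqF// mulr1.
rewrite E unlock; case: ifPn => _; last by rewrite lee_fin mulr_ge0// ltW.
by apply/ess_sup_inf.ess_supP; apply: nearW => x; exact: key.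
Qed.

End intrinsic_ultracontractivity.

(** * Ratios with logarithms, and the conclusion *)

Section logarithmic_ratios.
Local Open Scope ereal_scope.
Context {R : realType} {d : nat}.
Notation rV := 'rV[R]_d.
Implicit Types (x : rV) (n C : R) (L : \bar R).

(** Comparability with a real number rules out L = +oo, the value of [abs_log] where a density or
    probability is 0. *)
Lemma asymp_byP C n L : (0 < C)%R -> 0 <= L -> asymp_by C n%:E L ->
  exists l : R, [/\ L = l%:E, (0 <= l)%R, (l <= C * n)%R & (n <= C * l)%R].
Proof.
move=> C0 L0 /andP[h1 h2]; case: L L0 h1 h2 => [l| |]// l0 h1 h2.
  rewrite -EFinM lee_fin in h1; rewrite -EFinM lee_fin in h2.
  exists l; split; [by []|by rewrite lee_fin in l0| |exact: h2].
  by move: h1; rewrite mulrC ler_pdivrMr// mulrC.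
by move: h1; rewrite gt0_muley ?lte_fin ?invr_gt0// leye_eq.
Qed.

Lemma cvg_ratio (S L : rV -> \bar R) : (forall K : R, (0 < K)%R -> exists r : R,
    forall x, (r < enorm x)%R -> exists l : R, [/\ L x = l%:E, (0 <= l)%R, 0 < S x & (K * l)%:E <= S x]) ->
  (S x / L x) @[x --> infty_rV] --> +oo.
Proof.
move=> h; apply/cvgeyPge => A; pose K : R := Num.max A 1%R.
have K0 : (0 < K)%R by rewrite lt_max ltr01 orbT.
have [r hr] := h K K0; exists r => x /hr[l [-> l0 S0 KS]].
move: l0; rewrite le_eqVlt => /predU1P[l0|l0].
  (* The inverse of 0 is +oo, so a vanishing logarithm gives the ratio +oo provided that the
     numerator is positive. *)
  by rewrite -l0 /inve eqxx gt0_muley// leey.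
rewrite /inve gt_eqF// lee_pdivlMr// -EFinM; apply: le_trans KS.
by rewrite lee_fin ler_wpM2r ?(ltW l0)// le_max lexx.
Qed.

Lemma growth_of_ratio (V nu : rV -> R) (L : rV -> \bar R) C (r0 : R) : (0 < C)%R ->
  (forall M : R, exists r : R, forall y, (r < enorm y)%R -> (M <= V y)%R) ->
  (forall x, (r0 < enorm x)%R -> 0 <= L x /\ asymp_by C (`|ln (nu x)|)%:E (L x)) ->
  ((V x)%:E / L x) @[x --> infty_rV] --> +oo ->
  forall K : R, (0 < K)%R -> exists r : R, forall y, (r < enorm y)%R -> (K * `|ln (nu y)| <= V y)%R.
Proof.
move=> C0 conf hL /cvgeyPge lim K K0.
have [r1 hr1] := lim (K * C)%R; have [r2 hr2] := conf 0%R.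
exists (Num.max r0 (Num.max r1 r2)) => y; rewrite !gt_max => /andP[yr0 /andP[/hr1 h1 /hr2 h2]].
have [L0 Las] := hL y yr0; have [l [El l0 _ nl]] := asymp_byP C0 L0 Las.
apply: (@le_trans _ _ (K * (C * l))%R); first by rewrite ler_wpM2l// ltW.
(* If l = 0 the bound to be proved is 0 <= V, which holds far out by confinement. *)
move: l0; rewrite le_eqVlt => /predU1P[<-|l0]; first by rewrite !mulr0.
by move: h1; rewrite El /inve gt_eqF// lee_pdivlMr// -EFinM lee_fin mulrA.
Qed.

End logarithmic_ratios.

Theorem proposition2p4 (R : realType) (d : nat) (hd : (0 < d)%N)
  (dO : measure_display) (Omega : measurableType dO)
  (P : probability Omega R) (X : R -> Omega -> 'rV[R]_d)
  (nu : 'rV[R]_d -> R) (p : R -> 'rV[R]_d -> \bar R)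
  (hX : regular_jump_levy P X nu p)
  (V : 'rV[R]_d -> R) (hV : confining_kato_potential P X V)
  (lam : nat -> R) (phi : nat -> 'rV[R]_d -> R)
  (hphi : feynman_kac_eigenbasis P X V lam phi)
  (C17 C18 : R) (hC17 : 0 < C17) (hC18 : 0 < C18)
  (hnu : forall t : R, 0 < t -> exists2 r : R, 0 < r &
    forall x : 'rV[R]_d, r < enorm x ->
      asymp_by C17 (abs_log (nu x)%:E) (abs_log (p t x)) /\
      asymp_by C18 (abs_log (nu x)%:E)
        (abs_log (law_from P X x t (eball 0 1)))) :
  ((GSD P X V (phi 0%N) \/ IUC P X V (lam 0%N) (phi 0%N)) ->
    (forall t eps : R, 0 < t -> 0 < eps <= 1 ->
      ((sup_ball V eps x / abs_log (law_from P X x t (eball 0 1)))%E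
         @[x --> infty_rV] --> +oo%E) /\
      ((sup_ball V eps x / abs_log (p t x))%E
         @[x --> infty_rV] --> +oo%E)) /\
    ((exists R0 C14 : R, [/\ 1 < R0, 0 < C14 &
       forall x : 'rV[R]_d, R0 < enorm x ->
       forall y, eball x 1 y -> V y <= C14 * V x]) ->
     forall t : R, 0 < t ->
      (((V x)%:E / abs_log (law_from P X x t (eball 0 1)))%E
         @[x --> infty_rV] --> +oo%E) /\
      (((V x)%:E / abs_log (p t x))%E @[x --> infty_rV] --> +oo%E)))
  /\
  ((exists2 t : R, 0 < t &
      (((V x)%:E / abs_log (law_from P X x t (eball 0 1)))%E
         @[x --> infty_rV] --> +oo%E) \/
      (((V x)%:E / abs_log (p t x))%E @[x --> infty_rV] --> +oo%E)) ->
    GSD P X V (phi 0%N) /\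
    ((forall t : R, 0 < t -> exists M : R, forall x, (p t x <= M%:E)%E) ->
     IUC P X V (lam 0%N) (phi 0%N))).
Proof.
have HX := regular_levy hX; have HA := regular_A1 hX.
have [Hp _] := regular_A2 hX.
have lawE t x : (0%:E <= abs_log (law_from P X x t (eball 0 1)))%E by rewrite /abs_log abse_ge0.
have pE t x : (0%:E <= abs_log (p t x))%E by rewrite /abs_log abse_ge0.
have nuE x : (1 < enorm x) -> abs_log (nu x)%:E = (`|ln (nu x)|)%:E.
  move=> x1; rewrite /abs_log lne_EFin//.
  by apply: (nu_pos HA); exact: lt_trans x1.
have asy t : 0 < t -> exists r : R, forall x, r < enorm x ->
    asymp_by C17 (`|ln (nu x)|)%:E (abs_log (p t x)) /\
    asymp_by C18 (`|ln (nu x)|)%:E (abs_log (law_from P X x t (eball 0 1))).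
  move=> t0; have [r r0 hr] := hnu t t0; exists (Num.max r 1) => x.
  by rewrite gt_max => /andP[xr x1]; rewrite -(nuE x x1); exact: hr.
have ratio (S : 'rV[R]_d -> \bar R) C (L : 'rV[R]_d -> \bar R) (r0 : R) : 0 < C ->
    (forall x, (0 <= L x)%E) ->
    (forall x, r0 < enorm x -> asymp_by C (`|ln (nu x)|)%:E (L x)) ->
    (forall K : R, 0 < K -> exists r : R, forall x, r < enorm x -> ((K * `|ln (nu x)|)%:E <= S x)%E) ->
    (exists r : R, forall x, r < enorm x -> (0%:E < S x)%E) ->
    (S x / L x)%E @[x --> infty_rV] --> +oo%E.
  move=> C0 L0 Las hS [r2 hr2]; apply: cvg_ratio => K K0.
  have KC0 : 0 < K * C by rewrite mulr_gt0.
  have [r1 hr1] := hS _ KC0; exists (Num.max r0 (Num.max r1 r2)) => x.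
  rewrite !gt_max => /andP[x0 /andP[x1 x2]].
  have [l [El l0 lC _]] := asymp_byP C0 (L0 x) (Las x x0).
  exists l; split; [exact: El|exact: l0|exact: hr2|].
  apply: le_trans (hr1 x x1); by rewrite lee_fin -mulrA ler_wpM2l// ltW.
split.
  move=> H; split.
    move=> t eps t0 e01; have [r hr] := asy t t0; have /andP[e0 _] := e01.
    have low K : 0 < K -> exists r : R, forall x, r < enorm x -> ((K * `|ln (nu x)|)%:E <= sup_ball V eps x)%E.
      by move=> K0; exact: (potential_lower hd HX HA Hp hV hphi H e01 K0).
    have pos : exists r : R, forall x, r < enorm x -> (0 < sup_ball V eps x)%E.
      have [r1 hr1] := confining hV 1; exists r1 => x /hr1 h.
      apply: (@lt_le_trans _ _ (V x)%:E); first by rewrite lte_fin (lt_le_trans ltr01 h).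
      by apply: ereal_sup_ubound; exists x => //; rewrite /eball/= subrr /enorm dot0l sqrtr0.
    split.
    - by apply: (ratio _ C18 _ r) => // x /hr[].
    - by apply: (ratio _ C17 _ r) => // x /hr[].
  move=> [R0 [C14 [R01 C140 hC14]]] t t0; have [r hr] := asy t t0.
  have low K : 0 < K -> exists r : R, forall x, r < enorm x -> ((K * `|ln (nu x)|)%:E <= (V x)%:E)%E.
    move=> K0; have one : 0 < (1 : R) <= 1 by rewrite ltr01 lexx.
    have CK0 : 0 < C14 * K by rewrite mulr_gt0.
    (* Asking for the rate C14 K makes up for the factor C14 lost in replacing the supremum over the
       unit ball by V(x). *)
    have [r1 hr1] := potential_lower hd HX HA Hp hV hphi H one CK0.
    exists (Num.max r1 R0) => x; rewrite gt_max => /andP[/hr1 h xR].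
    have : (sup_ball V 1 x <= (C14 * V x)%:E)%E.
      by apply: ge_ereal_sup => _ [y yx <-]; rewrite lee_fin; exact: hC14 xR _ yx.
    by move=> /(le_trans h); rewrite !lee_fin -mulrA ler_pM2l.
  have pos : exists r : R, forall x, r < enorm x -> (0 < (V x)%:E)%E.
    by have [r1 hr1] := confining hV 1; exists r1 => x /hr1 h; rewrite lte_fin (lt_le_trans ltr01 h).
  split.
  - by apply: (ratio _ C18 _ r) => // x /hr[].
  - by apply: (ratio _ C17 _ r) => // x /hr[].
move=> [t t0 H]; have [r hr] := asy t t0.
have grow : forall K : R, 0 < K -> exists r : R, forall y, r < enorm y -> K * `|ln (nu y)| <= V y.
  case: H => lim.
  - apply: (@growth_of_ratio _ _ V nu (fun x => abs_log (law_from P X x t (eball 0 1))) C18 r) => //.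
      exact: (confining hV).
    by move=> x /hr[].
  - apply: (@growth_of_ratio _ _ V nu (fun x => abs_log (p t x)) C17 r) => //.
      exact: (confining hV).
    by move=> x /hr[].
split; first exact: (gsd_of_growth hd HX HA Hp hV hphi grow).
exact: (iuc_of_growth hd HX HA Hp hV hphi grow).
Qed.
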